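(* Let $n\ge1$ and $R>0$. Let $\phi:[R_0,\infty)\to(0,\infty)$ be a nonincreasing function for some $R_0\ge0$, and set $$\Phi(r):=\int_{R_0}^r\phi(s)\,ds .$$ Assume that $$\frac{\Phi(r)}{\ln r}\to\infty\qquad\text{as }r\to\infty.$$ Suppose $u\in L^1_{loc}(\mathbb C^n\setminus\overline{B_R})$ is complex-valued and satisfies $$\bar\partial u=Vu\quad\text{on }\mathbb C^n\setminus\overline{B_R}$$ in the sense of distributions, where $V\in L^\infty(\mathbb C^n\setminus\overline{B_R})$ is a $(0,1)$-form satisfying $$|V(z)|\le C_0\,\phi(|z|),\qquad |z|\gg1,$$ for some $C_0>0$. If $$|u(z)|\le e^{-C\Phi(|z|)},\qquad |z|\gg1,$$ for some $C>2C_0$, then $u$ vanishes identically.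
   Context: $B_R$ is the open ball of radius $R$ centered at $0$ in $\mathbb C^n$. For a measurable $(0,1)$-form $V=\sum_{j=1}^n V_j\,d\bar z_j$, $|V|=(\sum_j|V_j|^2)^{1/2}$ pointwise (inequalities on $|V|$ are understood almost everywhere), and $V\in L^\infty$ means $|V|$ is essentially bounded. The equation $\bar\partial u=Vu$ means $\partial u/\partial\bar z_j=V_ju$ for all $j=1,\dots,n$. ''$|z|\gg1$'' means for all $z$ with $|z|$ sufficiently large. Functions are identified with their continuous representatives whenever these exist, and pointwise statements refer to that representative. *)

(* Defs.v *)
From HB Require Import structures.
From mathcomp Require Import all_boot all_order all_algebra.
From mathcomp Require Import all_classical all_reals all_analysis.

Set Implicit Arguments.
Unset Strict Implicit.
Unset Printing Implicit Defensive.

Import Order.TTheory GRing.Theory Num.Theory.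
Import numFieldNormedType.Exports.
(* Required after [Num.Theory], so that [Re] and [Im] are the real-valued
   projections of [R[i]]. *)
From mathcomp Require Import complex.

Local Open Scope classical_set_scope.
Local Open Scope ring_scope.
Local Open Scope complex_scope.

(* The library only equips the alias [R[i]^o] with the topology of the modulus;
   with this instance ['rV[R[i]]_n] gets its usual topology as well. *)
HB.instance Definition _ (R : realType) := NormedModule.copy R[i] R[i]^o.

Section pushforward_sigma_finite.
Context d1 d2 (T1 : measurableType d1) (T2 : measurableType d2) (R : realType).
Variables (m : {sigma_finite_measure set T1 -> \bar R}).
Variables (f : T1 -> T2) (g : T2 -> T1).
Hypotheses (mf : measurable_fun setT f) (mg : measurable_fun setT g).
Hypothesis fK : cancel f g.

Lemma pushforward_semi_sigma_additive : semi_sigma_additive (pushforward m f).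
Proof.
move=> F mF tF mUF; rewrite /pushforward preimage_bigcup.
apply: measure_semi_sigma_additive.
- by move=> n; rewrite -[X in measurable X]setTI; exact: mf.
- apply/trivIsetP => /= i j _ _ ij; rewrite -preimage_setI.
  by move/trivIsetP : tF => /(_ _ _ _ _ ij) ->//; rewrite preimage_set0.
- by rewrite -preimage_bigcup -[X in measurable X]setTI; exact: mf.
Qed.

Lemma pushforward_sigma_finite : sigma_finite setT (pushforward m f).
Proof.
have [F UF mF] := sigma_finiteT m.
exists (fun i => g @^-1` F i); first by rewrite -preimage_bigcup -UF.
move=> i; have [mFi Fi] := mF i; split.
  by rewrite -[X in measurable X]setTI; exact: mg.
rewrite /pushforward -comp_preimage (_ : g \o f = id)//.
by apply/funext => x /=; rewrite fK.
Qed.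

End pushforward_sigma_finite.
Arguments pushforward_semi_sigma_additive {d1 d2 T1 T2 R} m {f} mf.
Arguments pushforward_sigma_finite {d1 d2 T1 T2 R} m {f g} mg fK.

(* The library's product measure. It is given a new name because, in the library,
   the structure of sigma-finite measure on [m1 \x m2] is not found by inference:
   it is shadowed by the one for subprobabilities. *)
Section sf_product.
Context d1 d2 (T1 : measurableType d1) (T2 : measurableType d2) (R : realType).
Variable m1 : {sigma_finite_measure set T1 -> \bar R}.
Variable m2 : {sigma_finite_measure set T2 -> \bar R}.

Definition sf_product : set (T1 * T2)%type -> \bar R := (m1 \x m2)%E.

HB.instance Definition _ := Measure.on sf_product.

Let sf_product_sigma_finite : sigma_finite setT sf_product.
Proof.
have /sigma_finiteP[F [TF ndF Foo]] := sigma_finiteT m1.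
have /sigma_finiteP[G [TG ndG Goo]] := sigma_finiteT m2.
exists (fun n => F n `*` G n).
  rewrite -setXTT TF TG predeqE => -[x y]; split.
    move=> [/= [n _ Fnx] [k _ Gky]]; exists (maxn n k) => //; split.
    - by move: x Fnx; exact/subsetPset/ndF/leq_maxl.
    - by move: y Gky; exact/subsetPset/ndG/leq_maxr.
  by move=> [n _ []/= ? ?]; split; exists n.
move=> k; have [? ?] := Foo k; have [? ?] := Goo k.
split; first exact: measurableX.
by rewrite /sf_product product_measure1E// lte_mul_pinfty// ge0_fin_numE.
Qed.

HB.instance Definition _ := Measure_isSigmaFinite.Build _ _ _ sf_product
  sf_product_sigma_finite.

End sf_product.

Section tuple_measure.
Context d (T : measurableType d) (R : realType).
Variable mu : {sigma_finite_measure set T -> \bar R}.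

Definition tcons n (p : T * n.-tuple T) : n.+1.-tuple T :=
  [tuple of p.1 :: p.2].

Definition tuncons n (t : n.+1.-tuple T) : T * n.-tuple T :=
  (thead t, [tuple of behead t]).

Lemma tconsK n : cancel (@tcons n) (@tuncons n).
Proof.
by case=> x t; rewrite /tuncons theadE; congr pair; exact: val_inj.
Qed.

Lemma measurable_tcons n : measurable_fun setT (@tcons n).
Proof. exact: measurable_cons. Qed.

Lemma measurable_tuncons n : measurable_fun setT (@tuncons n).
Proof.
apply/measurable_fun_pair; first exact: measurable_tnth.
exact: measurable_behead.
Qed.

Section cons_measure.
Variables (n : nat) (m : {sigma_finite_measure set (n.-tuple T) -> \bar R}).

Definition cons_measure : set (n.+1.-tuple T) -> \bar R :=
  pushforward (sf_product mu m) (@tcons n).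

Let cons_measure0 : cons_measure set0 = 0%E.
Proof. by rewrite /cons_measure /pushforward preimage_set0 measure0. Qed.

Let cons_measure_ge0 A : (0 <= cons_measure A)%E.
Proof. by rewrite /cons_measure /pushforward; exact: measure_ge0. Qed.

Let cons_measure_sigma_additive : semi_sigma_additive cons_measure.
Proof. exact: (pushforward_semi_sigma_additive (sf_product mu m) (@measurable_tcons n)). Qed.

HB.instance Definition _ := isMeasure.Build _ _ _ cons_measure
  cons_measure0 cons_measure_ge0 cons_measure_sigma_additive.

Let cons_measure_sigma_finite : sigma_finite setT cons_measure.
Proof. exact: (pushforward_sigma_finite (sf_product mu m) (@measurable_tuncons n) (@tconsK n)). Qed.

HB.instance Definition _ := Measure_isSigmaFinite.Build _ _ _ cons_measure
  cons_measure_sigma_finite.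

End cons_measure.

(* The [n]-fold product of [mu]. *)
Fixpoint tuple_measure n : {sigma_finite_measure set (n.-tuple T) -> \bar R} :=
  match n with
  | 0 => \d_([tuple] : 0.-tuple T)
  | n'.+1 => cons_measure (tuple_measure n')
  end.

End tuple_measure.

Section lebesgue_Cn.
Context (R : realType) (n : nat).
Local Notation RR := (measurableTypeR R * measurableTypeR R)%type.

Definition tuple_of_Cn (z : 'rV[R[i]]_n) : n.-tuple RR :=
  [tuple (Re (z 0 j), Im (z 0 j)) | j < n].

Definition Cn_of_tuple (t : n.-tuple RR) : 'rV[R[i]]_n :=
  \row_j ((tnth t j).1 +i* (tnth t j).2).

Lemma tuple_of_CnK : cancel tuple_of_Cn Cn_of_tuple.
Proof.
move=> z; apply/rowP => j; rewrite mxE tnth_mktuple /=.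
by case: (z 0 j).
Qed.

Lemma Cn_of_tupleK : cancel Cn_of_tuple tuple_of_Cn.
Proof.
move=> t; apply: eq_from_tnth => j; rewrite tnth_mktuple mxE /=.
by case: (tnth t j).
Qed.

(* The sigma-algebra of C^n is generated by the real and imaginary parts of the
   coordinates: these are the Borel sets. *)
HB.instance Definition _ := Measurable.copy 'rV[R[i]]_n
  (g_sigma_algebra_preimageType tuple_of_Cn).

Lemma measurable_tuple_of_Cn : measurable_fun setT tuple_of_Cn.
Proof. by move=> _ B mB; exists B. Qed.

Lemma measurable_Cn_of_tuple : measurable_fun setT Cn_of_tuple.
Proof.
move=> _ A [B mB <-]; rewrite !setTI -comp_preimage.
rewrite (_ : tuple_of_Cn \o Cn_of_tuple = id)//.
by apply/funext => t /=; rewrite Cn_of_tupleK.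
Qed.

Let lambda : {sigma_finite_measure set (n.-tuple RR) -> \bar R} :=
  tuple_measure (sf_product (@lebesgue_measure R) (@lebesgue_measure R)) n.

Definition lebesgue_Cn : set 'rV[R[i]]_n -> \bar R :=
  pushforward lambda Cn_of_tuple.

Let lebesgue_Cn0 : lebesgue_Cn set0 = 0%E.
Proof. by rewrite /lebesgue_Cn /pushforward preimage_set0 measure0. Qed.

Let lebesgue_Cn_ge0 A : (0 <= lebesgue_Cn A)%E.
Proof. by rewrite /lebesgue_Cn /pushforward; exact: measure_ge0. Qed.

Let lebesgue_Cn_sigma_additive : semi_sigma_additive lebesgue_Cn.
Proof. exact: (pushforward_semi_sigma_additive lambda measurable_Cn_of_tuple). Qed.

HB.instance Definition _ := isMeasure.Build _ _ _ lebesgue_Cn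
  lebesgue_Cn0 lebesgue_Cn_ge0 lebesgue_Cn_sigma_additive.

Let lebesgue_Cn_sigma_finite : sigma_finite setT lebesgue_Cn.
Proof.
exact: (pushforward_sigma_finite lambda measurable_tuple_of_Cn Cn_of_tupleK).
Qed.

HB.instance Definition _ := Measure_isSigmaFinite.Build _ _ _ lebesgue_Cn
  lebesgue_Cn_sigma_finite.

End lebesgue_Cn.
Arguments lebesgue_Cn {R n}.

Section dbar_equation.
Context {R : realType} {n : nat}.
Local Notation C := R[i].
Local Notation Cn := 'rV[R[i]]_n.
Local Notation mu := (@lebesgue_Cn R n).
Implicit Types (z v : Cn) (f u : Cn -> C) (D : set Cn).

(* [`|w|] has type [R[i]]; its real part is the modulus as an element of [R]. *)
Definition cmod (w : C) : R := Re `|w|.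

Definition enorm z : R := Num.sqrt (\sum_(j < n) cmod (z 0 j) ^+ 2).

(* C^n minus the closed ball of radius [r] centered at 0. *)
Definition exterior (r : R) : set Cn := [set z | r < enorm z].

Definition cmeasurable D f : Prop :=
  measurable_fun D (fun z => Re (f z)) /\ measurable_fun D (fun z => Im (f z)).

Definition cintegral D f : C :=
  (\int[mu]_(z in D) Re (f z)) +i* (\int[mu]_(z in D) Im (f z)).

Definition L1loc D u : Prop :=
  cmeasurable D u /\
  forall K, compact K -> K `<=` D -> (\int[mu]_(z in K) (cmod (u z))%:E < +oo)%E.

Definition Linfty D (V : Cn -> Cn) : Prop :=
  (forall j, cmeasurable D (fun z => V z 0 j)) /\
  exists M : R, {ae mu, forall z, D z -> enorm (V z) <= M}.

(* Derivatives along the real line [t |-> z + t v]; the directions [e_j] and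
   ['i e_j] give the partial derivatives in [x_j] and [y_j], where
   [z_j = x_j + 'i y_j]. *)
Definition rderivable f z v : Prop :=
  derivable (fun t : R => Re (f (z + t%:C *: v))) 0 1 /\
  derivable (fun t : R => Im (f (z + t%:C *: v))) 0 1.

Definition rderive v f z : C :=
  derive1 (fun t : R => Re (f (z + t%:C *: v))) 0 +i*
  derive1 (fun t : R => Im (f (z + t%:C *: v))) 0.

Definition ex (j : 'I_n) : Cn := delta_mx 0 j.
Definition ey (j : 'I_n) : Cn := 'i *: delta_mx 0 j.

Fixpoint Ck (k : nat) f : Prop :=
  continuous f /\
  match k with
  | 0 => True
  | k'.+1 => forall j v, v = ex j \/ v = ey j ->
      (forall z, rderivable f z v) /\ Ck k' (rderive v f)
  end.

Definition smooth f : Prop := forall k, Ck k f.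

Definition test_function D f : Prop :=
  let supp := closure [set z | f z != 0] in
  [/\ smooth f, compact supp & supp `<=` D].

Definition dbar (j : 'I_n) f z : C :=
  (rderive (ex j) f z + 'i * rderive (ey j) f z) / 2%:R.

(* du/d(zbar_j) = V_j u on [D] for all j, in the sense of distributions. *)
Definition weak_dbar_eq D u (V : Cn -> Cn) : Prop :=
  forall f, test_function D f -> forall j,
    - cintegral D (fun z => u z * dbar j f z) =
    cintegral D (fun z => V z 0 j * u z * f z).

End dbar_equation.

(* Main.v *)
(** Fubini and product test functions reduce the theorem to n = 1: for almost
    every value t of the other coordinates, the slice of u satisfies the
    mollified equation on |zeta| > D whenever D^2 + |t|^2 > r^2, and |z| >= |zeta|
    preserves the decay hypotheses.  For n = 1 put Lam_e = ln (|u|^2 + e) / 2.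
    The equation makes Lam_e subharmonic up to the divergence of a field of size
    2 |V|.  Testing against a logarithmic cutoff and comparing with a radial
    function whose gradient dominates 2 C0 phi forces, as |u| <= exp (- C Phi)
    with C > 2 C0 and Phi / ln -> oo, the integral of Lam_e over far rings to
    tend to -oo as e -> 0.  Bisection concentrates this on arbitrarily small
    sets; a local submean inequality then gives u = 0 on every disc seen from
    such a set and, going around the origin, outside a large disc.  Vanishing
    propagates inwards by a Carleman argument: weights z^N and the L^1 bound of
    the Cauchy transform on thin annuli. *)

Require Import Defs.
From HB Require Import structures.
From mathcomp Require Import all_boot all_order all_algebra.
From mathcomp Require Import all_classical all_reals all_analysis.
From mathcomp Require Import measurable_realfun ring lra zify.
Import Order.TTheory GRing.Theory Num.Theory.
Import numFieldNormedType.Exports.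

Set Implicit Arguments.
Unset Strict Implicit.
Unset Printing Implicit Defensive.

Local Open Scope classical_set_scope.
Local Open Scope ring_scope.

(** * Integration on the plane *)

(** The equation says that the dbar derivative of ln u is V, so the Laplacian of ln |u| is the
    divergence of a field of length 2 |V|: this is the origin of the constant in C > 2 C0. Two
    obstacles shape the proof. Since u may vanish, ln |u| is replaced by Lam_e, at the price of an
    error term carrying a factor e. Since u is only locally integrable and V only bounded, the
    inequality is proved for mollified functions and passed to the limit; mollification does not
    commute with multiplication by V, so u and h = 2 V u are carried along as separate functions,
    linked only by the mollified equation [moll_eq] and by pointwise bounds. For fixed e the
    integrand is Lipschitz in (u, h), so convergence in L^1 is enough. The growth of Phi / ln enters
    at a single place: the weight is piecewise linear in ln |z|, its long descent ending at ln |z| =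
    c has slope of order 1 / c, and this slope times the value of Phi at about e^c has to be
    unbounded. *)

Notation plane R := (measurableTypeR R * measurableTypeR R)%type.
Notation mplane := (measurable_fun [set: plane _]).
Notation "z :-: b" := (z.1 - b.1, z.2 - b.2)
  (at level 50, left associativity) : ring_scope.

Lemma ae_imply d (T : measurableType d) (R : realType)
    (m : {measure set T -> \bar R}) (P Q : T -> Prop) :
  (forall x, P x -> Q x) -> {ae m, forall x, P x} -> {ae m, forall x, Q x}.
Proof.
move=> PQ; apply: filterS => //; exact: (ae_filter_ringOfSetsType m).
Qed.

Section plane.
Context {R : realType}.
Local Notation mu := (@lebesgue_measure R).

Local Notation RR := (plane R).

Definition mu2 : {sigma_finite_measure set RR -> \bar R} :=
  sf_product (@lebesgue_measure R) (@lebesgue_measure R).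

Lemma integral_xy (f : RR -> \bar R) : measurable_fun setT f ->
  (forall z, 0 <= f z)%E ->
  (\int[mu2]_z f z = \int[mu]_x \int[mu]_y f (x, y))%E.
Proof. by move=> mf f0; exact: (fubini_tonelli1 (m1 := mu) (m2 := mu)). Qed.

Lemma integral_yx (f : RR -> \bar R) : measurable_fun setT f ->
  (forall z, 0 <= f z)%E ->
  (\int[mu2]_z f z = \int[mu]_y \int[mu]_x f (x, y))%E.
Proof. by move=> mf f0; exact: (fubini_tonelli2 (m1 := mu) (m2 := mu)). Qed.

Lemma integrable_yx (f : RR -> \bar R) : mu2.-integrable setT f ->
  (\int[mu2]_z f z = \int[mu]_y \int[mu]_x f (x, y))%E.
Proof. by move=> fi; rewrite -(integral21_prod_meas1 (m1 := mu) (m2 := mu)). Qed.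

Lemma integrable_xy (f : RR -> \bar R) : mu2.-integrable setT f ->
  (\int[mu2]_z f z = \int[mu]_x \int[mu]_y f (x, y))%E.
Proof. by move=> fi; rewrite -(integral12_prod_meas1 (m1 := mu) (m2 := mu)). Qed.

Lemma measurable_int_y (f : RR -> \bar R) : measurable_fun setT f ->
  (forall z, 0 <= f z)%E ->
  measurable_fun [set: measurableTypeR R] (fun x => \int[mu]_y f (x, y))%E.
Proof. exact: (@measurable_fun_fubini_tonelli_F _ _ _ _ _ mu f). Qed.

Lemma measurable_int_x (f : RR -> \bar R) : measurable_fun setT f ->
  (forall z, 0 <= f z)%E ->
  measurable_fun [set: measurableTypeR R] (fun y => \int[mu]_x f (x, y))%E.
Proof. exact: (@measurable_fun_fubini_tonelli_G _ _ _ _ _ mu f). Qed.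

(** Second countability: an open set is a countable union of squares with rational centres and
    half-sides 1 / (k + 1), and squares are products of intervals. *)
Lemma open_measurable2 (A : set (R * R)%type) : open A -> measurable (A : set RR).
Proof.
move=> oA.
pose B (p q : R) (k : nat) : set (R * R)%type :=
  `](p - k.+1%:R^-1), (p + k.+1%:R^-1)[ `*` `](q - k.+1%:R^-1), (q + k.+1%:R^-1)[.
(* Squares that stick out of [A] are replaced by the empty set, so that the union runs over all
   rational centres. *)
pose C p q k : set (R * R)%type%type := if `[< B p q k `<=` A >] then B p q k else set0.
have -> : A = \bigcup_k \bigcup_(p : rat) \bigcup_(q : rat) C (ratr p) (ratr q) k.
  apply/seteqP; split => [z Az|z [k _ [p _ [q _]]]]; last first.
    by rewrite /C; case: asboolP => // BA /BA.
  have /nbhs_ballP[e /= e0 zeA] : nbhs z A by apply: open_nbhs_nbhs; split.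
  have [k ke] : exists k : nat, k.+1%:R^-1 < e / 2 :> R.
    have e20 : 0 < e / 2 by rewrite divr_gt0.
    by have [k _ hk] := near_infty_natSinv_lt (PosNum e20); exists k; apply: hk => /=.
  have k0 : 0 < k.+1%:R^-1 :> R by rewrite invr_gt0.
  pose d : R := k.+1%:R^-1.
  have d0 : 0 < d by []. have de : d < e / 2 by [].
  have itv0 (x : R) : x - d < x + d by move: (d) d0 => ?; lra.
  have [p] := rat_in_itvoo (itv0 z.1).
  rewrite in_itv/= => /andP[p1 p2].
  have [q] := rat_in_itvoo (itv0 z.2).
  rewrite in_itv/= => /andP[q1 q2].
  exists k => //; exists p => //; exists q => //.
  rewrite /C; case: asboolP => [_|].
    by split; rewrite /= in_itv/= -/d; move: (d) d0 p1 p2 q1 q2 => ? *; lra.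
  apply: contra_notP => _ w -[/=]; rewrite !in_itv/= -/d => /andP[a1 a2] /andP[b1 b2].
  by apply: zeA; split; rewrite /= /ball/= ltr_norml; move: (d) d0 de p1 p2 q1 q2 a1 a2 b1 b2 => ? *; lra.
apply: bigcup_measurable => k _; apply: bigcupT_measurable_rat => p.
apply: bigcupT_measurable_rat => q; rewrite /C; case: asboolP => // _.
by apply: measurableX.
Qed.

Lemma continuous_measurable2 (f : R * R -> R) : continuous f ->
  mplane f.
Proof.
move=> /continuousP cf; apply: (measurability _ (RGenOpens.measurableE R)).
move=> _ [_ [a [b ->] <-]]; rewrite setTI; apply: open_measurable2.
exact/cf/interval_open.
Qed.

Definition cbox (L : R) : set (R * R)%type%type := [set z | `|z.1| <= L /\ `|z.2| <= L].

Lemma cboxE L : cbox L = `[- L, L] `*` `[- L, L].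
Proof. by apply/seteqP; split=> -[x y] /=; rewrite /cbox/= !in_itv/= !ler_norml. Qed.

Lemma measurable_cbox L : measurable (cbox L : set RR).
Proof. by rewrite cboxE; exact: measurableX. Qed.

Lemma compact_cbox L : compact (cbox L).
Proof. by rewrite cboxE; apply: compact_setX; exact: segment_compact. Qed.

Lemma mu2_cbox_lty L : (mu2 (cbox L) < +oo)%E.
Proof.
have -> : mu2 (cbox L) = (mu [set` `[- L, L]%R] * mu [set` `[- L, L]%R])%E.
  by rewrite cboxE; exact: product_measure1E.
by rewrite !lebesgue_measure_itv/=; case: ifP => _; rewrite ?mul0e ?ltry.
Qed.

Lemma cbox_sub L L' : L <= L' -> cbox L `<=` cbox L'.
Proof. by move=> LL' z [? ?]; split; apply: le_trans LL'. Qed.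

Lemma integrable_bbox (f : R * R -> R) (L M : R) : mplane f ->
  (forall z, `|f z| <= M) -> (forall z, ~ cbox L z -> f z = 0) ->
  mu2.-integrable setT (EFin \o f).
Proof.
move=> mf fM f0.
rewrite (_ : EFin \o f = (EFin \o f) \_ (cbox L)); last first.
  apply/funext => z; rewrite patchE; case: ifPn => //.
  by rewrite notin_setE => /f0 /= ->.
apply/(integrable_mkcond _ (measurable_cbox L)).
apply: measurable_bounded_integrable; first exact: measurable_cbox.
- exact: mu2_cbox_lty.
- exact: measurable_funTS.
- by exists M; split; rewrite ?num_real// => x Mx y _ /=; rewrite (le_trans (fM y))// ltW.
Qed.

Lemma Cc_bounded (f : R * R -> R) (L : R) : continuous f ->
  (forall z, ~ cbox L z -> f z = 0) -> exists2 M, 0 <= M & forall z, `|f z| <= M.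
Proof.
move=> cf f0.
have /compact_bounded[M [Mr hM]] : compact (f @` cbox L).
  apply: continuous_compact; last exact: compact_cbox.
  exact: continuous_subspaceT.
exists (`|M| + 1); first by rewrite addr_ge0.
move=> z; have [bz|/f0 ->] := pselect (cbox L z).
  by apply: hM; [rewrite ltr_pwDr// ler_norm|exists z].
by rewrite normr0 addr_ge0.
Qed.

Lemma Cc_integrable (f : R * R -> R) (L : R) : continuous f ->
  (forall z, ~ cbox L z -> f z = 0) -> mu2.-integrable setT (EFin \o f).
Proof.
move=> cf f0; have [M _ fM] := Cc_bounded cf f0.
by apply: (integrable_bbox _ fM f0); exact: continuous_measurable2.
Qed.

Lemma integral_deriv0 (f f' : R -> R) (L : R) :
  (forall x, is_derive x (1 : R) f (f' x)) -> continuous f' ->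
  (forall x, L < `|x| -> f x = 0) -> (forall x, L < `|x| -> f' x = 0) ->
  (\int[mu]_x (f' x)%:E = 0)%E.
Proof.
move=> df cf' f0 f'0.
(* Strictly larger than [L], because [f] is only known to vanish where L < |x|: both end points of
   [-K, K] must qualify. *)
pose K : R := `|L| + 1.
have LK : L < K by rewrite /K ltr_pwDr// ler_norm.
have K0 : 0 < K by rewrite /K ltr_wpDl.
have -> : (\int[mu]_x (f' x)%:E = \int[mu]_(x in [set` `[- K, K]%R]) (f' x)%:E)%E.
  rewrite [RHS]integral_mkcond; apply: eq_integral => x _.
  rewrite patchE; case: ifPn => //; rewrite notin_setE/= in_itv/= => xK.
  rewrite f'0//; rewrite ltNge; apply/negP => xL; apply: xK.
  by rewrite -ler_norml (le_trans xL)// ltW.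
rewrite (@continuous_FTC2 _ _ f).
- by rewrite !f0 ?sube0// ?normrN ger0_norm// ltW.
- lra.
- exact: continuous_subspaceT.
- split.
  + by move=> x _; have [] := df x.
  + apply: cvg_at_right_filter; apply: differentiable_continuous.
    by apply/derivable1_diffP; have [] := df (- K).
  + apply: cvg_at_left_filter; apply: differentiable_continuous.
    by apply/derivable1_diffP; have [] := df K.
- by move=> x _; rewrite derive1E; have [_ ->] := df x.
Qed.

(** Partial derivatives as relations between a function and its derivative: the rules of calculus
    then build the derivative by composing proofs, and continuity of the derivative is asked for
    separately where it matters. *)
Definition D1 (f g : R * R -> R) :=
  forall x y, is_derive x (1 : R) (fun s => f (s, y)) (g (x, y)).
Definition D2 (f g : R * R -> R) :=
  forall x y, is_derive y (1 : R) (fun s => f (x, s)) (g (x, y)).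

Lemma continuous_sec1 (f : R * R -> R) y : continuous f ->
  continuous (fun s => f (s, y)).
Proof.
move=> cf x; apply: (@continuous_comp _ _ _ (fun s => (s, y)) f).
  by apply: (@cvg_pair _ _ _ _ (nbhs x) (nbhs y)); [exact: cvg_id|exact: cvg_cst].
exact: cf.
Qed.

Lemma continuous_sec2 (f : R * R -> R) x : continuous f ->
  continuous (fun s => f (x, s)).
Proof.
move=> cf y; apply: (@continuous_comp _ _ _ (fun s => (x, s)) f).
  by apply: (@cvg_pair _ _ _ _ (nbhs x) (nbhs y)); [exact: cvg_cst|exact: cvg_id].
exact: cf.
Qed.

(** Fubini reduces this to the fundamental theorem of calculus on each horizontal line; with
    [int_D2] it is the divergence theorem for compactly supported fields. *)
Lemma int_D1 (f g : R * R -> R) L : D1 f g -> continuous g ->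
  (forall z, ~ cbox L z -> f z = 0) -> (forall z, ~ cbox L z -> g z = 0) ->
  \int[mu2]_z g z = 0.
Proof.
move=> fg cg f0 g0; rewrite /Rintegral integrable_yx; last exact: Cc_integrable g0.
rewrite integral0_eq// => y _.
apply: (@integral_deriv0 (fun x => f (x, y)) _ L) => //.
- exact: continuous_sec1.
- by move=> x Lx; apply: f0 => -[/=]; rewrite leNgt Lx.
- by move=> x Lx; apply: g0 => -[/=]; rewrite leNgt Lx.
Qed.

Lemma int_D2 (f g : R * R -> R) L : D2 f g -> continuous g ->
  (forall z, ~ cbox L z -> f z = 0) -> (forall z, ~ cbox L z -> g z = 0) ->
  \int[mu2]_z g z = 0.
Proof.
move=> fg cg f0 g0; rewrite /Rintegral integrable_xy; last exact: Cc_integrable g0.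
rewrite integral0_eq// => x _.
apply: (@integral_deriv0 (fun y => f (x, y)) _ L) => //.
- exact: continuous_sec2.
- by move=> y Lx; apply: f0 => -[/=]; rewrite (leNgt `|y|) Lx.
- by move=> y Lx; apply: g0 => -[/=]; rewrite (leNgt `|y|) Lx.
Qed.

End plane.

(** * Translations and their continuity in L^1 of the line *)

Section shift.
Context {R : realType}.
Local Notation mu := (@lebesgue_measure R).
Local Notation RR := (plane R).

Definition shiftR (h : R) : measurableTypeR R -> measurableTypeR R :=
  fun x => (x : R) + h.

Lemma measurable_shift (h : R) : measurable_fun setT (shiftR h).
Proof.
apply: (@continuous_measurable_fun R (fun x => x + h)) => x.
by apply: cvgD; [exact: cvg_id|exact: cvg_cst].
Qed.

Lemma lebesgue_measure_shift (h : R) (A : set (measurableTypeR R)) :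
  measurable A -> pushforward mu (shiftR h) A = mu A.
Proof.
move=> mA; apply/esym/lebesgue_measure_unique => //=.
  exact: measurable_shift.
move=> mh _ [[a b]] _ <-; rewrite /pushforward/=.
rewrite (_ : _ @^-1` _ = [set` `]a - h, b - h]]); last first.
  by apply/seteqP; split=> x /=; rewrite !in_itv/= ltrBlDr lerBrDr.
rewrite !lebesgue_measure_itv/= !lte_fin ltrD2r.
by case: ifP => // _; rewrite -!EFinB; congr EFin; ring.
Qed.

Lemma ge0_integral_shift (f : R -> \bar R) (h : R) :
  measurable_fun [set: measurableTypeR R] f -> (forall x, 0 <= f x)%E ->
  (\int[mu]_x f (x + h)%R = \int[mu]_x f x)%E.
Proof.
move=> mf f0.
have := @ge0_integral_pushforward _ _ _ _ R _ (measurable_shift h) mu setT f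
  measurableT mf (fun y _ => f0 y).
rewrite preimage_setT => <-.
by apply: eq_measure_integral => //= [|_ A mA _];
  [exact: measurable_shift|exact: lebesgue_measure_shift].
Qed.

Lemma measurable_shift2 (h : R * R) :
  mplane (fun z => (z.1 + h.1, z.2 + h.2) : RR).
Proof.
apply/measurable_fun_pairP; split.
  exact: (measurableT_comp (measurable_shift h.1) measurable_fst).
exact: (measurableT_comp (measurable_shift h.2) measurable_snd).
Qed.

Lemma ge0_integral_shift2 (f : R * R -> \bar R) (h : R * R) :
  mplane f -> (forall x, 0 <= f x)%E ->
  (\int[mu2]_z f (z.1 + h.1, z.2 + h.2)%R = \int[mu2]_z f z)%E.
Proof.
move=> mf f0.
have mfh : mplane (fun z => f (z.1 + h.1, z.2 + h.2)%R).
  exact: (measurableT_comp mf (measurable_shift2 h)).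
rewrite (integral_xy mfh (fun z => f0 _)) (integral_xy mf f0).
rewrite -[RHS](ge0_integral_shift h.1 (measurable_int_y mf f0)); last first.
  by move=> x; exact: integral_ge0.
apply: eq_integral => x _.
rewrite -[RHS](@ge0_integral_shift (fun y => f (x + h.1, y)%R) h.2)//.
exact: (measurableT_comp mf (pair1_measurable _)).
Qed.

(** Convergence to 0 for extended reals, without asking for finiteness beforehand: the L^1 moduli of
    continuity below are integrals that could be infinite. *)
Definition small (u : nat -> \bar R) :=
  forall e : R, 0 < e -> exists N, forall n, (N <= n)%N -> (u n <= e%:E)%E.

Lemma cvg_small (u : nat -> \bar R) : (u n @[n --> \oo] --> 0)%E -> small u.
Proof.
move=> u0 e e0.
have /u0 : nbhs 0%E [set x : \bar R | (x < e%:E)%E].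
  by apply: open_nbhs_nbhs; split; [exact: open_ereal_lt_ereal|rewrite /= lte_fin].
by move=> [N _ hN]; exists N => n Nn; apply: ltW; exact: hN.
Qed.

Definition omega1 (f : R -> R) (h : R) : \bar R :=
  (\int[mu]_x `|f (x + h) - f x|%:E)%E.

(** Stated with sequences because dominated convergence is applied to it. *)
Definition transl_cont (f : R -> R) := forall h : nat -> R,
  h n @[n --> \oo] --> (0 : R) -> small (fun n => omega1 f (h n)).

(** The usual argument with three terms: the two outer ones are equal by translation invariance. *)
Lemma transl_cont_approx (f : R -> R) :
  measurable_fun [set: measurableTypeR R] f ->
  (forall e, 0 < e -> exists g, [/\ measurable_fun [set: measurableTypeR R] g,
     transl_cont g & (\int[mu]_x `|f x - g x|%:E <= e%:E)%E]) ->
  transl_cont f.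
Proof.
move=> mf happ h h0 e e0.
have e30 : 0 < e / 3 by rewrite divr_gt0.
have [g [mg tg fg]] := happ _ e30.
have [N hN] := tg h h0 _ e30; exists N => n /hN gn.
have mfg : measurable_fun [set: measurableTypeR R] (fun x => `|f x - g x|%:E).
  by apply/measurable_EFinP/measurableT_comp => //; exact: measurable_funB.
have mgh (k : R -> R) : measurable_fun [set: measurableTypeR R] k ->
    measurable_fun [set: measurableTypeR R] (fun x => k (x + h n)).
  by move=> mk; exact: (measurableT_comp mk (measurable_shift (h n))).
have mgg : measurable_fun [set: measurableTypeR R] (fun x => `|g (x + h n) - g x|%:E).
  by apply/measurable_EFinP/measurableT_comp => //; apply: measurable_funB => //; exact: mgh.
have fg' : (\int[mu]_x `|f (x + h n) - g (x + h n)|%:E <= (e / 3)%:E)%E.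
  by rewrite (@ge0_integral_shift (fun x => `|f x - g x|%:E)%E).
have mfg' : measurable_fun [set: measurableTypeR R] (fun x => `|f (x + h n) - g (x + h n)|%:E).
  by apply/measurable_EFinP/measurableT_comp => //; apply: measurable_funB => //; exact: mgh.
apply: (@le_trans _ _ (\int[mu]_x (`|f (x + h n) - g (x + h n)|%:E +
   (`|g (x + h n) - g x|%:E + `|f x - g x|%:E)))%E).
  apply: ge0_le_integral => //.
  - apply/measurable_EFinP/measurableT_comp => //.
    by apply: measurable_funB => //; exact: mgh.
  - by apply: emeasurable_funD => //; exact: emeasurable_funD.
  - move=> x _; rewrite -!EFinD lee_fin.
    have := ler_normD (f (x + h n) - g (x + h n)) (g (x + h n) - g x + (g x - f x)).
    have := ler_normD (g (x + h n) - g x) (g x - f x).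
    rewrite (distrC (f x)) !addrA !subrK => ? ?; lra.
rewrite ge0_integralD//; last 2 first.
- by move=> x _; rewrite adde_ge0.
- exact: emeasurable_funD.
rewrite ge0_integralD//.
rewrite [e in leRHS](_ : _ = e / 3 + (e / 3 + e / 3)); last by field.
by rewrite !EFinD; apply: leeD => //; exact: leeD.
Qed.

Lemma transl_cont_Cc (g : R -> R) (K : R) : continuous g ->
  (forall x, K < `|x| -> g x = 0) -> transl_cont g.
Proof.
move=> cg g0 h h0; apply: cvg_small.
have [M M0 gM] : exists2 M, 0 <= M & forall x, `|g x| <= M.
  have /compact_bounded[M [Mr hM]] : compact (g @` `[- K, K]).
    apply: continuous_compact; last exact: segment_compact.
    exact: continuous_subspaceT.
  exists (`|M| + 1); first by rewrite addr_ge0.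
  move=> z; have [/g0 ->|zK] := ltP K `|z|; first by rewrite normr0 addr_ge0.
  apply: hM; first by rewrite ltr_pwDr// ler_norm.
  by exists z => //=; rewrite in_itv/= -ler_norml.
have [B B0 hB] : exists2 B : R, 0 <= B & forall n, `|h n| <= B.
  have /cvg_seq_bounded [B [_ hB]] : cvgn h by apply/cvg_ex; exists (0 : R).
  exists (`|B| + 1); first by rewrite addr_ge0.
  by move=> n; apply: (hB (`|B| + 1)); rewrite ?ltr_pwDr// ler_norm.
have mg := continuous_measurable_fun cg.
have mD n : measurable_fun [set: measurableTypeR R] (fun x => `|g (x + h n) - g x|%:E).
  apply/measurable_EFinP/measurableT_comp => //; apply: measurable_funB => //.
  exact: (measurableT_comp mg (measurable_shift (h n))).
(* The dominating function: the sequence [h] is bounded by [B], so all translates of [g] live on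
   [-(K + B), K + B]. *)
pose G (x : R) : R := (M + M) * \1_([set` `[- (K + B), K + B]]) x.
have [] := @dominated_convergence _ _ _ mu setT measurableT
  (fun n x => `|g (x + h n) - g x|%:E) (cst 0)%E (EFin \o G) mD
  (measurable_cst _).
- apply: aeW => x _; apply: cvg_EFin; first by near=> n.
  rewrite [X in X @ _ --> _](_ : _ = fun n => `|g (x + h n) - g x|)//.
  rewrite -(normr0 R) -(subrr (g x)); apply: cvg_norm; apply: cvgB; last exact: cvg_cst.
  apply: continuous_cvg; first exact: cg.
  by rewrite -[X in _ --> X]addr0; apply: cvgD => //; exact: cvg_cst.
- rewrite (_ : EFin \o G = fun x => (M + M)%:E * (\1_([set` `[- (K + B), K + B]]) x)%:E)%E//.
  apply: integrableZl => //.
  exact: integrable_indic_itv.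
- apply: aeW => x n _; rewrite /G lee_fin normr_id indicE.
  case: (boolP (_ \in _)) => [_|]; first by rewrite mulr1 (le_trans (ler_normB _ _))// lerD.
  rewrite notin_setE/= in_itv/= -ler_norml => /negP; rewrite -ltNge => xK.
  rewrite !g0 ?subrr ?normr0 ?mulr0//; first by rewrite (le_lt_trans _ xK)// lerDl.
  have := ler_normB (x + h n) (h n); rewrite addrK => ?; have := hB n => ?; lra.
- by move=> _ _; rewrite integral0.
Unshelve. all: by end_near. Qed.

End shift.

(** * Continuity of translations in L^1 of the plane *)

Section L1.
Context {R : realType}.
Local Notation mu := (@lebesgue_measure R).
Local Notation RR := (plane R).

Lemma small_cvg (u : nat -> \bar R) : (forall n, 0 <= u n)%E -> small u ->
  (u n @[n --> \oo] --> 0)%E.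
Proof.
move=> u0 su; apply/fine_cvgP; split.
  have [N hN] := su 1 ltr01; exists N => // n /= /hN un.
  by rewrite ge0_fin_numE// (le_lt_trans un)// ltry.
apply/cvgrPdist_le => e e0; have [N hN] := su e e0; exists N => // n /= /hN un.
have un_fin : u n \is a fin_num by rewrite ge0_fin_numE// (le_lt_trans un)// ltry.
by rewrite sub0r normrN ger0_norm ?fine_ge0// -lee_fin fineK.
Qed.

Lemma integrable_tail (f : R -> R) (e : R) : mu.-integrable setT (EFin \o f) ->
  0 < e -> exists N : nat,
  (\int[mu]_x `|f x - f x * \1_([set` `[- N%:R, N%:R]%R]) x|%:E <= e%:E)%E.
Proof.
move=> fi e0; pose g (n : nat) (x : R) : R := f x - f x * \1_([set` `[- n%:R, n%:R]%R]) x.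
have mf : measurable_fun setT f by move/integrableP: fi => [/measurable_EFinP].
have mg n : measurable_fun setT (fun x => (`|g n x|)%:E).
  apply/measurable_EFinP/measurableT_comp => //; apply: measurable_funB => //.
  by apply: measurable_funM.
suff : ([sequence (\int[mu]_x `|g n x|%:E)%E]_n @ \oo --> (0 : \bar R)%E).
  by move/cvg_small => /(_ e e0)[N hN]; exists N; exact: hN.
have [] := @dominated_convergence _ _ _ mu setT measurableT
  (fun n x => `|g n x|%:E) (cst 0)%E (fun x => `|f x|%:E) mg
  (measurable_cst _).
  - apply: aeW => x _; apply: cvg_near_cst.
    exists (Num.truncn `|x|).+1 => // n /= xn; rewrite /g indicE mem_set ?mulr1 ?subrr ?normr0//=.
    rewrite in_itv/= -ler_norml ltW// (lt_le_trans (truncnS_gt _))// ler_nat.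
    by [].
  - exact: (integrable_norm fi).
  - apply: aeW => x n _; rewrite lee_fin normr_id /g indicE.
    by case: (_ \in _); rewrite ?mulr1 ?mulr0 ?subr0 ?subrr ?normr0.
  - by rewrite integral0.
Qed.

Lemma continuous_cutoff (N : R) :
  exists chi : R -> R, [/\ continuous chi, forall x, 0 <= chi x <= 1,
    forall x, `|x| <= N -> chi x = 1 & forall x, N + 1 < `|x| -> chi x = 0].
Proof.
exists (fun x => Num.max 0 (Num.min 1 (N + 1 - `|x|))); split.
- move=> x.
  have c1 : {for x, continuous (fun y : R => N + 1 - `|y|)}.
    by apply: cvgB; [exact: cvg_cst|exact: norm_continuous].
  have c2 : {for x, continuous ((fun=> 1 : R) \min (fun y : R => N + 1 - `|y|))}.
    by apply: continuous_min => //; exact: cvg_cst.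
  have : {for x, continuous ((fun=> 0 : R) \max
      ((fun=> 1 : R) \min (fun y : R => N + 1 - `|y|)))}.
    by apply: continuous_max => //; exact: cvg_cst.
  exact.
- by move=> x; rewrite /Num.max /Num.min; case: ifPn; case: ifPn; lra.
- by move=> x ?; rewrite /Num.max /Num.min; case: ifPn; case: ifPn; lra.
- by move=> x ?; rewrite /Num.max /Num.min; case: ifPn; case: ifPn; lra.
Qed.

(** By density of continuous functions with compact support: truncate [f] to a bounded interval,
    approximate there by a continuous function, and multiply by a continuous cutoff. *)
Lemma transl_cont_integrable (f : R -> R) : mu.-integrable setT (EFin \o f) ->
  transl_cont f.
Proof.
move=> fi; have mf : measurable_fun setT f by move/integrableP: fi => [/measurable_EFinP].
apply: transl_cont_approx => // e e0.
have e20 : 0 < e / 2 by rewrite divr_gt0.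
have [N hN] := integrable_tail fi e20.
pose I : set R := [set` `[- N%:R, N%:R]%R].
(* One unit longer than [I] on each side: the ramp of the cutoff lies inside the set on which the
   approximation is controlled. *)
pose E : set R := [set` `[- (N%:R + 1), N%:R + 1]%R].
pose f1 (x : R) : R := f x * \1_I x.
have mf1 : measurable_fun setT f1.
  rewrite /f1; apply: measurable_funM => //; apply: measurable_indic.
  exact: measurable_itv.
have mE : measurable E by exact: measurable_itv.
have f1i : mu.-integrable E (EFin \o f1).
  apply: (@integrableS _ _ _ mu setT) => //.
  apply: le_integrable fi => //; first exact/measurable_EFinP.
  move=> x _; rewrite lee_fin /f1 indicE.
  by case: (_ \in _); rewrite ?mulr1 ?mulr0 ?normr0.
have Efin : (mu E < +oo)%E.
  by rewrite /E lebesgue_measure_itv/=; case: ifP; rewrite ?ltry.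
have [g_ [cg gi /cvg_small/(_ _ e20)[n hn]]] :=
  approximation_continuous_integrable mE Efin f1i.
have {}hn := hn n (leqnn n).
have [chi [cchi chi01 chi1 chi0]] := continuous_cutoff (N%:R : R).
pose G x := g_ n x * chi x.
have cG : continuous G by move=> x; apply: cvgM; [exact: cg|exact: cchi].
have mG : measurable_fun setT G by exact: continuous_measurable_fun.
exists G; split => //.
  by apply: (@transl_cont_Cc _ _ (N%:R + 1)) => // x xN; rewrite /G chi0// mulr0.
have m1 (a b : R -> R) : measurable_fun setT a -> measurable_fun setT b ->
    measurable_fun [set: measurableTypeR R] (fun x => `|a x - b x|%:E).
  by move=> ma mb; apply/measurable_EFinP/measurableT_comp => //; exact: measurable_funB.
apply: (@le_trans _ _ (\int[mu]_x (`|f x - f1 x|%:E + `|f1 x - G x|%:E))%E).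
  apply: ge0_le_integral => //; first exact: m1.
  - by apply: emeasurable_funD; exact: m1.
  - by move=> x _; rewrite -EFinD lee_fin; have := ler_normD (f x - f1 x) (f1 x - G x); rewrite addrA subrK.
rewrite ge0_integralD//; [|exact: m1..].
rewrite [e in leRHS](_ : _ = e / 2 + e / 2); last by field.
rewrite EFinD; apply: leeD => //; apply: le_trans hn.
rewrite [leRHS]integral_mkcond; apply: ge0_le_integral => //; first exact: m1.
  apply/(measurable_restrictT _ mE)/measurable_funTS; apply: m1 => //.
  exact: continuous_measurable_fun.
move=> x _; rewrite patchE; case: ifPn => [xE|].
  rewrite lee_fin /f1 indicE; have [xI|xI] := boolP (x \in I).
    rewrite /G chi1 ?mulr1// ler_norml.
    by move: xI; rewrite inE /= ?in_itv.
  rewrite mulr0 !sub0r !normrN /G normrM ler_piMr// ger0_norm.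
    by have /andP[] := chi01 x.
  by have /andP[] := chi01 x.
rewrite notin_setE /E/= in_itv/= -ler_norml => /negP; rewrite -ltNge => xN.
rewrite /G chi0// mulr0 subr0 /f1 indicE memNset ?mulr0 ?normr0//=.
move=> xI; have : - N%:R <= x <= N%:R by move: xI; rewrite /I /= ?in_itv.
by rewrite -ler_norml => /(lt_le_trans xN); lra.
Qed.

Definition omega2 (f : R * R -> R) (h : R * R) : \bar R :=
  (\int[mu2]_z `|f (z.1 + h.1, z.2 + h.2) - f z|%:E)%E.

Lemma measurable_pt2 (f : R * R -> R) (h : R * R) : mplane f ->
  mplane (fun z : RR => f ((z.1 : R) + h.1, (z.2 : R) + h.2)).
Proof. by move=> mf; exact: (measurableT_comp mf (measurable_shift2 h)). Qed.

Lemma measurable_diff2 (f g : R * R -> R) : mplane f ->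
  mplane g -> mplane (fun z => `|f z - g z|%:E).
Proof.
by move=> mf mg; apply/measurable_EFinP/measurableT_comp => //; exact: measurable_funB.
Qed.

(** Almost every horizontal slice of [f] is integrable and is covered by the one-dimensional result;
    dominated convergence in the other variable concludes. *)
Lemma omega2_seq1 (f : R * R -> R) (h : nat -> R) :
  mu2.-integrable setT (EFin \o f) -> h n @[n --> \oo] --> (0 : R) ->
  small (fun n => omega2 f (h n, 0)).
Proof.
move=> fi h0.
have mf : mplane f by move/integrableP: fi => [/measurable_EFinP].
have mD n : mplane (fun z => `|f (z.1 + h n, z.2 + 0) - f z|%:E).
  by apply: measurable_diff2 => //; exact: (measurable_pt2 (h n, 0)).
have mabs : mplane (fun z => `|f z|%:E).
  exact/measurable_EFinP/measurableT_comp.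
pose F (n : nat) (y : R) : \bar R := (\int[mu]_x `|f (x + h n, y + 0) - f (x, y)|%:E)%E.
pose A (y : R) : \bar R := (\int[mu]_x `|f (x, y)|%:E)%E.
have mF n : measurable_fun [set: measurableTypeR R] (F n).
  exact: (measurable_int_x (mD n)).
have mA : measurable_fun [set: measurableTypeR R] A by exact: (measurable_int_x mabs).
have mfy y : measurable_fun [set: measurableTypeR R] (fun x => f (x, y)).
  exact: (measurableT_comp mf (pair2_measurable _)).
have F0 n y : (0 <= F n y)%E by exact: integral_ge0.
have A0 y : (0 <= A y)%E by exact: integral_ge0.
(* Translation invariance bounds the modulus of a slice by twice its norm, which is the dominating
   function. *)
have FA n y : (F n y <= A y + A y)%E.
  rewrite {1}/A -(@ge0_integral_shift _ (fun x => `|f (x, y)|%:E)%E (h n))//; last first.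
    exact/measurable_EFinP/measurableT_comp.
  rewrite /A -ge0_integralD//; last 2 first.
  - apply/measurable_EFinP/measurableT_comp => //.
    exact: (measurableT_comp (mfy y) (measurable_shift (h n))).
  - exact/measurable_EFinP/measurableT_comp.
  apply: ge0_le_integral => //.
  - apply/measurable_EFinP/measurableT_comp => //; apply: measurable_funB => //.
    rewrite addr0; exact: (measurableT_comp (mfy y) (measurable_shift (h n))).
  - apply: emeasurable_funD; apply/measurable_EFinP/measurableT_comp => //.
    exact: (measurableT_comp (mfy y) (measurable_shift (h n))).
  - by move=> x _; rewrite addr0 -EFinD lee_fin ler_normB.
have omegaE n : omega2 f (h n, 0) = (\int[mu]_y F n y)%E.
  by rewrite /omega2 (integral_yx (mD n)).
have Ai : mu.-integrable setT (fun y => A y + A y)%E.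
  suff Ai : mu.-integrable setT A by exact: integrableD.
  apply/integrableP; split => //.
  under eq_integral do rewrite gee0_abs//.
  rewrite /A -(integral_yx mabs)//.
  by move/integrableP: fi => [].
under eq_fun do rewrite omegaE.
apply: cvg_small.
have [] := @dominated_convergence _ _ _ mu setT measurableT F (cst 0)%E
   (fun y => A y + A y)%E mF (measurable_cst _).
- have : {ae mu, forall y, mu.-integrable setT (fun x => (f (x, y))%:E)}.
    exact: (ae_integrable2 (m1 := mu) (m2 := mu) fi).
  apply: ae_imply => y fyi _; apply: small_cvg => //.
  have := transl_cont_integrable fyi h0; congr small; apply/funext => n.
  by rewrite /omega1 /F; apply: eq_integral => x _; rewrite addr0.
- exact: Ai.
- by apply: aeW => y n _; rewrite gee0_abs.
- by rewrite integral0.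
Qed.

Lemma ge0_integral_swap (f : R * R -> \bar R) : mplane f ->
  (forall z, 0 <= f z)%E ->
  (\int[mu2]_z f (z.2, z.1) = \int[mu2]_z f z)%E.
Proof.
move=> mf f0; rewrite (integral_yx mf f0) integral_xy//.
exact: (measurableT_comp mf (@measurable_swap _ _ (measurableTypeR R) (measurableTypeR R))).
Qed.

Lemma omega2_seq2 (f : R * R -> R) (h : nat -> R) :
  mu2.-integrable setT (EFin \o f) -> h n @[n --> \oo] --> (0 : R) ->
  small (fun n => omega2 f (0, h n)).
Proof.
move=> fi h0; pose f' (z : R * R) := f (z.2, z.1).
have mf : mplane f by move/integrableP: fi => [/measurable_EFinP].
have mf' : mplane f'.
  exact: (measurableT_comp mf (@measurable_swap _ _ (measurableTypeR R) (measurableTypeR R))).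
have f'i : mu2.-integrable setT (EFin \o f').
  apply/integrableP; split; first exact/measurable_EFinP.
  move/integrableP: fi => [_]; rewrite -ge0_integral_swap//.
  by apply: measurableT_comp => //; exact/measurable_EFinP.
have := omega2_seq1 f'i h0.
suff -> : (fun n => omega2 f' (h n, 0)) = (fun n => omega2 f (0, h n)) by [].
apply/funext => n; rewrite /omega2/= -[RHS]ge0_integral_swap//.
by apply: measurable_diff2 => //; exact: (measurable_pt2 (0, h n)).
Qed.

Lemma omega2_triangle (f : R * R -> R) (a b : R) : mplane f ->
  (omega2 f (a, b) <= omega2 f (a, 0)%R + omega2 f (0, b)%R)%E.
Proof.
move=> mf; rewrite /omega2/=.
have m1 : mplane (fun z => `|f (z.1 + a, z.2 + 0) - f z|%:E).
  by apply: measurable_diff2 => //; exact: (measurable_pt2 (a, 0)).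
have m2 : mplane (fun z => `|f (z.1 + 0, z.2 + b) - f z|%:E).
  by apply: measurable_diff2 => //; exact: (measurable_pt2 (0, b)).
rewrite -(ge0_integral_shift2 (0, b) m1)//=.
have m3 : mplane
    (fun z => `|f (z.1 + 0 + a, z.2 + b + 0) - f (z.1 + 0, z.2 + b)|%:E).
  exact: (measurableT_comp m1 (measurable_shift2 (0, b))).
rewrite -ge0_integralD//; apply: ge0_le_integral => //.
- by apply: measurable_diff2 => //; exact: (measurable_pt2 (a, b)).
- exact: emeasurable_funD.
- move=> z _; rewrite -EFinD lee_fin !addr0.
  have := ler_normD (f (z.1 + a, z.2 + b) - f (z.1, z.2 + b)) (f (z.1, z.2 + b) - f z).
  by rewrite addrA subrK.
Qed.

(** A failure would produce sequences of translations tending to 0 in each coordinate, against the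
    two sequential statements combined by [omega2_triangle]. *)
Lemma omega2_small (f : R * R -> R) (e : R) : mu2.-integrable setT (EFin \o f) ->
  0 < e -> exists2 d, 0 < d & forall h, `|h.1| <= d -> `|h.2| <= d ->
  (omega2 f h <= e%:E)%E.
Proof.
move=> fi e0; apply: contrapT => nd.
have mf : mplane f by move/integrableP: fi => [/measurable_EFinP].
have H n : exists h : R * R, [/\ `|h.1| <= n.+1%:R^-1,
    `|h.2| <= n.+1%:R^-1 & (e%:E < omega2 f h)%E].
  apply: contrapT => nh; apply: nd; exists n.+1%:R^-1 => // h h1 h2.
  by rewrite leNgt; apply/negP => h3; apply: nh; exists h.
pose h n := projT1 (cid (H n)).
have hP n : [/\ `|(h n).1| <= n.+1%:R^-1, `|(h n).2| <= n.+1%:R^-1 &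
  (e%:E < omega2 f (h n))%E] := projT2 (cid (H n)).
have h0 (g : nat -> R) : (forall n, `|g n| <= n.+1%:R^-1) -> g n @[n --> \oo] --> (0 : R).
  move=> gn; apply/norm_cvg0P.
  apply: (@squeeze_cvgr _ _ _ _ (cst 0) (fun n => n.+1%:R^-1)).
  - by apply: nearW => n; rewrite normr_ge0 gn.
  - exact: cvg_cst.
  - exact: cvg_harmonic.
have e20 : 0 < e / 2 by rewrite divr_gt0.
have [N1 hN1] := omega2_seq1 fi (h0 (fun n => (h n).1) (fun n => let: And3 a _ _ := hP n in a)) e20.
have [N2 hN2] := omega2_seq2 fi (h0 (fun n => (h n).2) (fun n => let: And3 _ a _ := hP n in a)) e20.
have [_ _] := hP (maxn N1 N2); rewrite ltNge => /negP; apply.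
rewrite [h _]surjective_pairing (le_trans (omega2_triangle _ _ mf))//.
rewrite [e in leRHS](_ : _ = e / 2 + e / 2); last by field.
rewrite EFinD; apply: leeD; [apply: hN1; exact: leq_maxl|apply: hN2; exact: leq_maxr].
Qed.

Lemma measurable_sub2 : measurable_fun [set: RR * RR]
  (fun p : RR * RR => ((p.2.1 : R) - p.1.1, (p.2.2 : R) - p.1.2) : RR).
Proof.
have mfst : mplane (fst : RR -> R) by exact: measurable_fst.
have msnd : mplane (snd : RR -> R) by exact: measurable_snd.
apply/measurable_fun_pairP; split.
- apply: measurable_funB; [exact: (measurableT_comp mfst measurable_snd)|
    exact: (measurableT_comp mfst measurable_fst)].
- apply: measurable_funB; [exact: (measurableT_comp msnd measurable_snd)|
    exact: (measurableT_comp msnd measurable_fst)].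
Qed.

(** Substitute z = b + h and apply Tonelli: the L^1 error of averaging against [K] is the
    [K]-average of the moduli of continuity of [f]. *)
Lemma approx_identity (f : R * R -> R) (K : R * R -> R) :
  mplane f -> mplane K -> (forall z, 0 <= K z) ->
  (\int[mu2]_b \int[mu2]_z (`|f z - f b| * K (z :-: b)%R)%:E =
   \int[mu2]_h ((K h)%:E * omega2 f h))%E.
Proof.
move=> mf mK K0.
pose F (p : RR * RR) : \bar R := (`|f (p.1.1 + p.2.1, p.1.2 + p.2.2) - f p.1| * K p.2)%:E.
have madd : measurable_fun [set: RR * RR]
    (fun p : RR * RR => ((p.1.1 : R) + p.2.1, (p.1.2 : R) + p.2.2) : RR).
  have mfst : mplane (fst : RR -> R) by exact: measurable_fst.
  have msnd : mplane (snd : RR -> R) by exact: measurable_snd.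
  apply/measurable_fun_pairP; split.
  - apply: measurable_funD; [exact: (measurableT_comp mfst measurable_fst)|
      exact: (measurableT_comp mfst measurable_snd)].
  - apply: measurable_funD; [exact: (measurableT_comp msnd measurable_fst)|
      exact: (measurableT_comp msnd measurable_snd)].
have mF : measurable_fun [set: RR * RR] F.
  apply/measurable_EFinP; apply: measurable_funM; last first.
    exact: (measurableT_comp mK measurable_snd).
  apply: measurableT_comp => //; apply: measurable_funB.
    exact: (measurableT_comp mf madd).
  exact: (measurableT_comp mf measurable_fst).
have F0 p : (0 <= F p)%E by rewrite lee_fin mulr_ge0.
transitivity (\int[mu2]_b \int[mu2]_h F (b, h))%E.
  apply: eq_integral => b _.
  rewrite -(ge0_integral_shift2 b).
  - apply: eq_integral => h _; rewrite /F/=; congr (`|f (_, _) - _| * K _)%:E.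
    + by rewrite addrC. + by rewrite addrC.
    + by rewrite !addrK -surjective_pairing.
  - apply/measurable_EFinP; apply: measurable_funM.
      apply: measurableT_comp => //; exact: measurable_funB.
    exact: (measurableT_comp mK (measurable_shift2 (- b.1, - b.2))).
  - by move=> z; rewrite lee_fin mulr_ge0.
rewrite (fubini_tonelli (m1 := mu2) (m2 := mu2) F mF F0)/=; apply: eq_integral => h _.
rewrite /omega2 -ge0_integralZl//.
- by apply: eq_integral => b _; rewrite /F/= EFinM muleC.
- by apply: measurable_diff2 => //; exact: measurable_pt2.
- by rewrite lee_fin.
Qed.

End L1.

(** * Derivatives and mollifiers *)

Section real_derivatives.
Context {R : realType}.
Implicit Types f g : R -> R.

Definition der f x l := is_derive x (1 : R) f l.

Lemma derD f g x a b : der f x a -> der g x b -> der (fun y => f y + g y) x (a + b).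
Proof. by rewrite /der => ? ?; exact: is_deriveD. Qed.

Lemma derB f g x a b : der f x a -> der g x b -> der (fun y => f y - g y) x (a - b).
Proof. by rewrite /der => ? ?; exact: is_deriveB. Qed.

Lemma derN f x a : der f x a -> der (fun y => - f y) x (- a).
Proof. by rewrite /der => ?; exact: is_deriveN. Qed.

Lemma derM f g x a b : der f x a -> der g x b ->
  der (fun y => f y * g y) x (a * g x + f x * b).
Proof.
rewrite /der => fa gb; have := is_deriveM fa gb; rewrite /GRing.scale/= => h.
by apply: (is_derive_eq h); rewrite addrC mulrC (mulrC a) mulrC.
Qed.

Lemma derV f x a : f x != 0 -> der f x a -> der (fun y => (f y)^-1) x (- a / f x ^+ 2).
Proof.
rewrite /der => f0 fa; have := is_deriveV f0 fa; rewrite /GRing.scale/= => h.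
by apply: (is_derive_eq h); rewrite !mulNr mulrC.
Qed.

Lemma der_comp f g x a b : der f (g x) a -> der g x b -> der (fun y => f (g y)) x (a * b).
Proof. by rewrite /der => ? ?; exact: is_derive1_comp. Qed.

Lemma der_id x : der id x 1.
Proof. by rewrite /der; exact: is_derive_id. Qed.

Lemma der_cst (c : R) x : der (fun=> c) x 0.
Proof. by rewrite /der; exact: is_derive_cst. Qed.

Lemma der_eq f x a b : der f x a -> a = b -> der f x b.
Proof. by move=> ? <-. Qed.

Lemma der_near f g x a : (\near x, f x = g x) -> der f x a -> der g x a.
Proof. exact: near_eq_is_derive. Qed.

Lemma der_ext f g x a : (forall x, f x = g x) -> der f x a -> der g x a.
Proof. by move=> /funext ->. Qed.

Lemma der_uniq f x a b : der f x a -> der f x b -> a = b.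
Proof. by move=> [_ <-] [_ <-]. Qed.

Lemma der_support (eta eta' : R -> R) d : (forall x, d < `|x| -> eta x = 0) ->
  (forall x, der eta x (eta' x)) -> forall x, d < `|x| -> eta' x = 0.
Proof.
move=> e0 de x dx; apply: der_uniq (de x) _.
apply: (der_near (f := fun=> 0)); last exact: der_cst.
near=> y; apply/esym/e0; near: y.
have cn : {for x, continuous (fun y : R => `|y|)} by exact: norm_continuous.
by apply: (cvgr_gt _ cn).
Unshelve. all: by end_near. Qed.


Lemma der_continuous f x a : der f x a -> {for x, continuous f}.
Proof.
by move=> [df _]; apply: differentiable_continuous; exact/derivable1_diffP.
Qed.

(** A quadratic remainder replaces any limit argument where no differentiation rule applies: at
    gluing points of piecewise functions, and for integrals depending on a parameter. *)
Lemma der_quad f x l (C d : R) : 0 < d ->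
  (forall h, `|h| < d -> `|f (x + h) - f x - h * l| <= C * h ^+ 2) -> der f x l.
Proof.
move=> d0 hC.
have D : h^-1 *: (f (h + x) - f x) @[h --> (0:R)^'] --> l.
  apply/cvgrPdist_le => e e0.
  have C1 : 0 < `|C| + 1 by rewrite ltr_wpDl.
  near=> h.
  have h0 : h != 0 by near: h; exact: nbhs_dnbhs_neq.
  have hh0 : 0 < `|h| by rewrite normr_gt0.
  have hd : `|h| < d by near: h; apply: dnbhs0_lt.
  have he : `|h| <= e / (`|C| + 1) by near: h; apply: dnbhs0_le; rewrite divr_gt0.
  rewrite distrC /GRing.scale/= addrC (addrC h).
  have -> : - l + h^-1 * (f (x + h) - f x) = h^-1 * (f (x + h) - f x - h * l).
    by field.
  rewrite normrM normfV ler_pdivrMl//.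
  have := hC h hd => /le_trans; apply.
  rewrite -(real_normK (num_real h)) expr2.
  apply: (@le_trans _ _ ((`|C| + 1) * (`|h| * `|h|))).
    by rewrite ler_wpM2r ?mulr_ge0// (le_trans (ler_norm _))// lerDl.
  by rewrite mulrCA ler_wpM2l// mulrC -ler_pdivlMr.
apply: DeriveDef; first by apply/cvg_ex; exists l; under eq_fun do rewrite /GRing.scale/= mulr1.
rewrite -derive1E /derive1; exact/cvg_lim.
Unshelve. all: by end_near. Qed.

Lemma der_lip f f' (B : R) x y : (forall z, der f z (f' z)) ->
  (forall z, `|f' z| <= B) -> `|f x - f y| <= B * `|x - y|.
Proof.
move=> ff' f'B; wlog xy : x y / y <= x.
  by move=> H; case: (leP y x) => [/H//|/ltW /H]; rewrite distrC (distrC y).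
have [||c _ ->] := @MVT_segment R f f' y x xy.
- by move=> z _; exact: ff'.
- by apply: continuous_subspaceT => z; exact: der_continuous.
- by rewrite normrM ler_wpM2r.
Qed.

(** The mean value theorem applied to f(z) - z f'(x), then the Lipschitz bound on f'; this gives the
    constant B, which suffices for [der_quad]. *)
Lemma der_taylor f f' f'' (B : R) x h : (forall z, der f z (f' z)) ->
  (forall z, der f' z (f'' z)) -> (forall z, `|f'' z| <= B) ->
  `|f (x + h) - f x - h * f' x| <= B * h ^+ 2.
Proof.
move=> ff' f'f'' f''B.
have B0 : 0 <= B by apply: le_trans (f''B 0).
pose g z := f z - z * f' x.
have dg z : der g z (f' z - f' x).
  have := derB (ff' z) (derM (der_id z) (der_cst (f' x) z)).
  by move/der_eq; apply; rewrite mul1r mulr0 addr0.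
have main a b : a <= b -> (forall z, a <= z <= b -> `|z - x| <= `|h|) -> `|b - a| = `|h| ->
    `|g b - g a| <= B * h ^+ 2.
  move=> ab hz bah.
  have [||c] := @MVT_segment R g (fun z => f' z - f' x) a b ab.
  - by move=> z _; exact: dg.
  - by apply: continuous_subspaceT => z; exact: der_continuous.
  - rewrite in_itv/= => cab ->; rewrite normrM bah -(real_normK (num_real h)) expr2 mulrA.
    rewrite ler_wpM2r//; apply: le_trans (der_lip _ _ f'f'' f''B) _.
    by rewrite ler_wpM2l// hz.
have E : f (x + h) - f x - h * f' x = g (x + h) - g x by rewrite /g; ring.
rewrite E; have [h0|h0] := leP 0 h.
  apply: main; first lra; last by congr (`| _ |); lra.
  by move=> z ?; rewrite !ger0_norm; lra.
rewrite distrC; apply: main; first lra; last by rewrite -normrN; congr (`| _ |); lra.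
by move=> z ?; rewrite !ler0_norm; lra.
Qed.

Fixpoint dk (k : nat) f : Prop := match k with
  | 0 => True
  | k'.+1 => exists2 f', (forall x, der f x (f' x)) & dk k' f'
  end.

Definition smooth1 f := forall k, dk k f.

Lemma dkW k f : dk k.+1 f -> dk k f.
Proof.
elim: k f => // k IH f [f' ff' dkf']; exists f' => //; exact: IH.
Qed.

Lemma dkD k f g : dk k f -> dk k g -> dk k (fun x => f x + g x).
Proof.
elim: k f g => // k IH f g [f' ff' df'] [g' gg' dg'].
by exists (fun x => f' x + g' x); [move=> x; exact: derD|exact: IH].
Qed.

Lemma dkM k f g : dk k f -> dk k g -> dk k (fun x => f x * g x).
Proof.
elim: k f g => // k IH f g df dg.
have [dfW dgW] := (dkW df, dkW dg).
move: df dg => [f' ff' df'] [g' gg' dg'].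
exists (fun x => f' x * g x + f x * g' x); first by move=> x; exact: derM.
by apply: dkD; exact: IH.
Qed.

Lemma dk_cst k (c : R) : dk k (fun=> c).
Proof. by elim: k c => // k IH c; exists (fun=> 0) => // x; exact: der_cst. Qed.

Lemma dk_affine k f (a b : R) : dk k f -> dk k (fun x => f (a * x + b)).
Proof.
elim: k f => // k IH f [f' ff' df'].
exists (fun x => f' (a * x + b) * a).
  move=> x; apply: (@der_comp f (fun x => a * x + b)) => //.
  have := derD (derM (der_cst a x) (der_id x)) (der_cst b x).
  by move/der_eq; apply; rewrite mul0r add0r mulr1 addr0.
by apply: dkM; [exact: IH|exact: dk_cst].
Qed.

Lemma smooth1_der f : smooth1 f -> exists2 f', (forall x, der f x (f' x)) & smooth1 f'.
Proof.
move=> sf; have [f' ff' _] := sf 1%N; exists f' => // k.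
have [g fg dg] := sf k.+1; suff -> : f' = g by [].
by apply/funext => x; exact: (der_uniq (ff' x) (fg x)).
Qed.

(** The classical functions p(1/x) exp(-1/x), taken for all polynomials at once because this family
    is closed under differentiation: smoothness follows by induction. *)
Definition flat (p : {poly R}) (x : R) : R :=
  if 0 < x then p.[x^-1] * expR (- x^-1) else 0.

(** With y = 1 / x >= 1 the polynomial is at most a multiple of y^n, while exp y >= y^(n+2) /
    (n+2)!; the two spare powers of y give the factor x^2. *)
Lemma flat_bound (p : {poly R}) : exists C : R, forall x, x <= 1 -> `|flat p x| <= C * x ^+ 2.
Proof.
pose n := size p; pose S : R := \sum_(i < n) `|p`_i|.
have S0 : 0 <= S by exact: sumr_ge0.
exists (S * (n.+2)`!%:R) => x x1; rewrite /flat; case: ltP => [x0|_]; last first.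
  by rewrite normr0; apply: mulr_ge0; [exact: mulr_ge0|exact: sqr_ge0].
pose y := x^-1; have y1 : 1 <= y by rewrite /y invf_ge1.
have y0 : 0 < y by lra.
have xy : x = y^-1 by rewrite /y invrK.
rewrite -/y normrM (ger0_norm (expR_ge0 _)) expRN; clearbody y.
have py : `|p.[y]| <= S * y ^+ n.
  rewrite horner_coef (le_trans (ler_norm_sum _ _ _))// /S mulr_suml ler_sum// => i _.
  rewrite normrM ler_wpM2l// ger0_norm; last by rewrite exprn_ge0// ltW.
  by apply: ler_weXn2l => //; exact: ltnW.
have ey : y ^+ n.+2 / (n.+2)`!%:R <= expR y.
  by apply: le_trans (expR_ge1Dxn n.+1 (ltW y0)); rewrite lerDr.
have f0 : 0 < (n.+2)`!%:R :> R by rewrite ltr0n fact_gt0.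
rewrite ler_pdivrMr ?expR_gt0// xy.
apply: (le_trans py); rewrite -mulrA -mulrA ler_wpM2l//.
rewrite exprVn.
apply: (@le_trans _ _ ((n.+2)`!%:R / y ^+ 2 * (y ^+ n.+2 / (n.+2)`!%:R))).
  rewrite -[n.+2]addn2 exprD le_eqVlt; apply/orP; left; apply/eqP; field.
  by rewrite !gt_eqF// ltr0n fact_gt0.
by rewrite ler_wpM2l// divr_ge0// ?ltW// exprn_gt0.
Qed.

(** Away from 0 this is the chain rule; at 0 the quadratic bound [flat_bound] gives derivative 0. *)
Lemma der_flat (p : {poly R}) x : der (flat p) x (flat ((p - p^`()) * 'X^2) x).
Proof.
have [x0|x0|<-] := ltgtP 0 x.
- apply: (@der_near (fun x => p.[x^-1] * expR (- x^-1))).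
    near=> y; rewrite /flat ifT//; near: y; exact: lt_nbhsr.
  have xn0 : x != 0 by rewrite gt_eqF.
  have dV := derV (f := id) xn0 (der_id x).
  have dp := der_comp (f := horner p) (g := fun x => x^-1) (is_derive_poly p x^-1) dV.
  have de := der_comp (f := expR) (g := fun x => - x^-1) (is_derive_expR _) (derN dV).
  apply: (der_eq (derM dp de)).
  by rewrite /flat x0 !hornerE /=; field.
- rewrite /flat ltNge (ltW x0)/=; apply: (@der_near (fun=> 0)); last exact: der_cst.
  near=> y; rewrite /flat ltNge ltW//=; near: y; exact: lt_nbhsl.
- have [C hC] := flat_bound p.
  have f0 q : flat q 0 = 0 by rewrite /flat ltxx.
  rewrite f0; apply: (@der_quad _ _ _ C 1) => // h h1.
  by rewrite add0r f0 mulr0 !subr0 hC// (le_trans (ler_norm _))// ltW.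
Unshelve. all: by end_near. Qed.

Lemma smooth1_flat (p : {poly R}) : smooth1 (flat p).
Proof.
move=> k; elim: k p => // k IH p; exists (flat ((p - p^`()) * 'X^2)) => //.
by move=> x; exact: der_flat.
Qed.

End real_derivatives.

(** * Bump functions and mollification *)

Section mollifiers.
Context {R : realType}.
Local Notation mu := (@lebesgue_measure R).
Local Notation RR := (plane R).

Definition kernel1 (a : R -> R) :=
  smooth1 a /\ exists L, forall x, L < `|x| -> a x = 0.

Lemma smooth1_continuous (a : R -> R) : smooth1 a -> continuous a.
Proof. by move=> /(_ 1%N)[a' aa' _] x; exact: der_continuous (aa' x). Qed.

Lemma continuous1_bounded (f : R -> R) (L : R) : continuous f ->
  (forall x, L < `|x| -> f x = 0) -> exists2 B, 0 <= B & forall x, `|f x| <= B.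
Proof.
move=> cf f0.
have /compact_bounded[M [Mr hM]] : compact (f @` `[- L, L]).
  apply: continuous_compact; last exact: segment_compact.
  exact: continuous_subspaceT.
exists (`|M| + 1); first by rewrite addr_ge0.
move=> z; have [/f0 ->|zL] := ltP L `|z|; first by rewrite normr0 addr_ge0.
apply: hM; first by rewrite ltr_pwDr// ler_norm.
by exists z => //=; rewrite in_itv/= -ler_norml.
Qed.

Lemma kernel1_bounded (a : R -> R) : kernel1 a ->
  exists2 B, 0 <= B & forall x, `|a x| <= B.
Proof.
move=> [sa [L aL]]; apply: (continuous1_bounded _ aL); exact: smooth1_continuous.
Qed.

Lemma kernel1_der (a : R -> R) : kernel1 a ->
  exists2 a', (forall x, der a x (a' x)) & kernel1 a'.
Proof.
move=> [sa [L aL]]; have [a' aa' sa'] := smooth1_der sa.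
exists a' => //; split => //; exists L => x Lx.
apply: (der_uniq (aa' x)); apply: (@der_near _ (fun=> 0)); last exact: der_cst.
near=> y; apply/esym/aL; near: y.
by have /cvgr_gt/(_ L Lx) := @norm_continuous _ _ x.
Unshelve. all: by end_near. Qed.

Lemma integrable_bounded1 (f : R -> R) (L B : R) :
  measurable_fun [set: measurableTypeR R] f -> (forall x, `|f x| <= B) ->
  (forall x, L < `|x| -> f x = 0) -> mu.-integrable setT (EFin \o f).
Proof.
move=> mf fB f0.
rewrite (_ : EFin \o f = (EFin \o f) \_ [set` `[- L, L]]); last first.
  apply/funext => z; rewrite patchE; case: ifPn => //.
  rewrite notin_setE/= in_itv/= -ler_norml => /negP; rewrite -ltNge => /f0 /= ->.
  by [].
have mI : measurable ([set` `[- L, L]] : set (measurableTypeR R)) by exact: measurable_itv.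
apply/(integrable_mkcond _ mI).
have fI : (mu [set` `[- L, L]%R] < +oo)%E.
  by rewrite lebesgue_measure_itv/=; case: ifP; rewrite ?ltry.
apply: measurable_bounded_integrable; first exact: measurable_itv.
- exact: fI.
- exact: measurable_funTS.
- by exists B; split; rewrite ?num_real// => x Bx y _ /=; rewrite (le_trans (fB y))// ltW.
Qed.

Lemma kernel1_integrable (a : R -> R) : kernel1 a -> mu.-integrable setT (EFin \o a).
Proof.
move=> ka; have [B _ hB] := kernel1_bounded ka; case: ka => sa [L aL].
apply: (integrable_bounded1 _ hB aL).
by apply: continuous_measurable_fun; exact: smooth1_continuous.
Qed.

(** Evenness identifies the convolution kernel eta(b - z) with eta(z - b). *)
Definition bump (d : R) (eta : R -> R) := [/\ smooth1 eta,
  forall x, 0 <= eta x, forall x, d <= `|x| -> eta x = 0,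
  forall x, eta (- x) = eta x & (\int[mu]_x (eta x)%:E = 1)%E].

Lemma bump_kernel1 d eta : bump d eta -> kernel1 eta.
Proof. by case=> s _ h _ _; split => //; exists d => x /ltW /h. Qed.

Lemma bump_exists (d : R) : 0 < d -> exists eta, bump d eta.
Proof.
move=> d0; pose b x : R := flat 1 (-1 * x + d) * flat 1 (1 * x + d).
have fl0 x : 0 <= flat (1 : {poly R}) x.
  by rewrite /flat; case: ltP => // _; rewrite hornerE mul1r expR_ge0.
have b0 x : 0 <= b x by rewrite mulr_ge0.
have bd x : d <= `|x| -> b x = 0.
  move=> dx; rewrite /b /flat; case: ltP => [h1|_]; last by rewrite mul0r.
  case: ltP => [h2|_]; last by rewrite mulr0.
  by move: dx; rewrite leNgt ltr_norml => /negP[]; lra.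
have bN x : b (- x) = b x by rewrite /b mulrC; congr (flat _ _ * flat _ _); ring.
have sb : smooth1 b by move=> k; apply: dkM; apply: dk_affine; exact: smooth1_flat.
have kb : kernel1 b by split => //; exists d => x /ltW; exact: bd.
have bi := kernel1_integrable kb.
pose I := \int[mu]_x b x.
have IE : (\int[mu]_x (b x)%:E = I%:E)%E.
  by rewrite fineK//; exact: integrable_fin_num.
(* A lower bound for [flat 1] on [d/2, oo): for |x| <= d/2 both factors of [b] are at least [m], so
   the integral of [b] is at least m^2 d > 0. *)
pose m : R := expR (- (d / 2)^-1).
have flm x : d / 2 <= x -> m <= flat 1 x.
  move=> hx; rewrite /flat ifT; last by apply: lt_le_trans hx; rewrite divr_gt0.
  rewrite hornerE mul1r /m ler_expR lerN2 lef_pV2// posrE ?divr_gt0//.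
  by apply: lt_le_trans hx; rewrite divr_gt0.
have m0 : 0 < m by exact: expR_gt0.
have I0 : 0 < I.
  have : ((m * m * d)%:E <= I%:E)%E.
    rewrite -IE; apply: (@le_trans _ _ (\int[mu]_(x in [set` `[- (d / 2), d / 2]%R]) (m * m)%:E)%E).
      rewrite integral_cst; last exact: measurable_itv.
      rewrite [X in (_ * X)%E](_ : _ = d%:E).
        by rewrite -EFinM.
      have e1 : mu [set` `[- (d / 2), d / 2]%R] = d%:E.
        rewrite lebesgue_measure_itv/= lte_fin ifT; last by lra.
        by rewrite -EFinB; congr EFin; field.
      exact: e1.
    rewrite integral_mkcond; apply: ge0_le_integral => //.
    - by move=> x _; rewrite patchE; case: ifP => // _; rewrite lee_fin mulr_ge0// ltW.
    - by apply/(measurable_restrictT _ (measurable_itv _)).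
    - by case/integrableP: bi.
    - move=> x _; rewrite patchE; case: ifPn => [|_]; last by rewrite lee_fin.
      rewrite inE/= in_itv/= => hx; rewrite lee_fin /b.
      by apply: ler_pM; rewrite ?(ltW m0)//; apply: flm; lra.
  by rewrite lee_fin; apply: lt_le_trans; rewrite !mulr_gt0.
exists (fun x => b x * I^-1); split.
- by move=> k; apply: dkM; [exact: sb|exact: dk_cst].
- by move=> x; rewrite mulr_ge0// invr_ge0 ltW.
- by move=> x /bd ->; rewrite mul0r.
- by move=> x; rewrite bN.
- under eq_integral do rewrite EFinM.
  by rewrite integralZr//= IE -EFinM divff// gt_eqF.
Qed.

Section functional.
Variable f : R * R -> R.
Hypothesis fi : mu2.-integrable setT (EFin \o f).

Definition bm (k : R * R -> R) :=
  mplane k /\ exists C, forall z, `|k z| <= C.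

Definition pairing (k : R * R -> R) : R := \int[mu2]_z (f z * k z).

Lemma pairing_integrable k : bm k -> mu2.-integrable setT (fun z => (f z * k z)%:E).
Proof.
move=> [mk [C kC]].
have := @integrableMl _ _ _ mu2 setT measurableT _ k fi mk.
rewrite (_ : (fun z => (f z * k z)%:E) = ((EFin \o f) \* (EFin \o k))%E)//; apply => //.
by exists C; split; rewrite ?num_real// => x Cx y _ /=; rewrite (le_trans (kC y))// ltW.
Qed.

Lemma bmD k l : bm k -> bm l -> bm (fun z => k z + l z).
Proof.
move=> [mk [C kC]] [ml [D lD]]; split; first exact: measurable_funD.
by exists (C + D) => z; rewrite (le_trans (ler_normD _ _))// lerD.
Qed.

Lemma bmZ c k : bm k -> bm (fun z => c * k z).
Proof.
move=> [mk [C kC]]; split; first exact: measurable_funM.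
by exists (`|c| * C) => z; rewrite normrM ler_wpM2l.
Qed.

Lemma bmM k l : bm k -> bm l -> bm (fun z => k z * l z).
Proof.
move=> [mk [C kC]] [ml [D lD]]; split; first exact: measurable_funM.
by exists (C * D) => z; rewrite normrM ler_pM.
Qed.

Lemma pairingD k l : bm k -> bm l ->
  pairing (fun z => k z + l z) = pairing k + pairing l.
Proof.
move=> bk bl; rewrite /pairing -RintegralD//; [|exact: pairing_integrable..].
by apply: eq_Rintegral => z _; rewrite mulrDr.
Qed.

Lemma pairingZ c k : bm k -> pairing (fun z => c * k z) = c * pairing k.
Proof.
move=> bk; rewrite /pairing -RintegralZl//; last exact: pairing_integrable.
by apply: eq_Rintegral => z _; rewrite mulrCA.
Qed.

Lemma pairingB k l : bm k -> bm l ->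
  pairing (fun z => k z - l z) = pairing k - pairing l.
Proof.
move=> bk bl; rewrite -mulN1r -pairingZ// -pairingD//; last exact: bmZ.
by apply: eq_Rintegral => z _; rewrite mulN1r.
Qed.

Lemma bmB k l : bm k -> bm l -> bm (fun z => k z - l z).
Proof.
move=> bk bl; rewrite (_ : (fun z => _) = fun z => k z + -1 * l z); last first.
  by apply/funext => z; rewrite mulN1r.
by apply: bmD => //; exact: bmZ.
Qed.

Definition L1norm : R := \int[mu2]_z `|f z|.

Lemma pairing_bound k C : bm k -> (forall z, `|k z| <= C) ->
  `|pairing k| <= C * L1norm.
Proof.
move=> bk kC; have fki := pairing_integrable bk.
apply: (le_trans (le_normr_Rintegral measurableT fki)).
rewrite /L1norm -RintegralZl//; last exact: (integrable_norm fi).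
apply: le_Rintegral => //; first exact: (integrable_norm fki).
- rewrite (_ : EFin \o _ = fun z => (C%:E * `|f z|%:E)%E)//.
  by apply: integrableZl => //; exact: (integrable_norm fi).
- by move=> z _; rewrite normrM mulrC ler_wpM2r.
Qed.

(** A tensor product kernel with independent factors: differentiating the mollification in one
    coordinate replaces one factor by its derivative and gives a mollification again. *)
Definition kxy (a b : R -> R) (p z : R * R) : R := a (p.1 - z.1) * b (p.2 - z.2).
Definition moll (a b : R -> R) (p : R * R) : R := pairing (kxy a b p).

Lemma bm_sec1 (a : R -> R) (x : R) : continuous a -> (exists B, forall y, `|a y| <= B) ->
  bm (fun z => a (x - z.1)).
Proof.
move=> ca [B aB]; split; last by exists B.
apply: (measurableT_comp (continuous_measurable_fun ca)).
by apply: measurable_funB => //; exact: measurable_fst.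
Qed.

Lemma bm_sec2 (a : R -> R) (x : R) : continuous a -> (exists B, forall y, `|a y| <= B) ->
  bm (fun z => a (x - z.2)).
Proof.
move=> ca [B aB]; split; last by exists B.
apply: (measurableT_comp (continuous_measurable_fun ca)).
by apply: measurable_funB => //; exact: measurable_snd.
Qed.

Lemma kernel1_cb (a : R -> R) : kernel1 a -> continuous a /\ exists B, forall y, `|a y| <= B.
Proof.
move=> ka; split; first by case: ka => /smooth1_continuous.
by have [B _ hB] := kernel1_bounded ka; exists B.
Qed.

Lemma bm_kxy a b p : kernel1 a -> kernel1 b -> bm (kxy a b p).
Proof.
move=> /kernel1_cb[ca Ba] /kernel1_cb[cb Bb].
by apply: bmM; [exact: bm_sec1|exact: bm_sec2].
Qed.

(** Differentiation under the integral sign: the Taylor remainder of [a] is quadratic in h uniformly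
    in z, and pairing with the integrable [f] preserves this, so [der_quad] applies. *)
Lemma moll_D1 (a a' b : R -> R) : kernel1 a -> kernel1 b ->
  (forall x, der a x (a' x)) -> kernel1 a' -> D1 (moll a b) (moll a' b).
Proof.
move=> ka kb aa' ka' x y.
have [a'' a'a'' ka''] := kernel1_der ka'.
have [B B0 hB] := kernel1_bounded ka''; have [Bb Bb0 hBb] := kernel1_bounded kb.
apply: (@der_quad _ _ _ _ (B * Bb * L1norm) 1) => // h _.
have b1 := bm_kxy (x + h, y) ka kb; have b2 := bm_kxy (x, y) ka kb.
have b3 := bmZ h (bm_kxy (x, y) ka' kb).
rewrite /moll -pairingZ; last exact: bm_kxy.
rewrite -(pairingB b1 b2) -(pairingB (bmB b1 b2) b3).
rewrite mulrAC; apply: pairing_bound; first by apply: bmB => //; exact: bmB.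
move=> z; rewrite /kxy/= mulrA -!mulrBl normrM mulrAC.
apply: ler_pM => //; rewrite (_ : x + h - z.1 = x - z.1 + h); last by ring.
exact: der_taylor aa' a'a'' hB.
Qed.

Lemma moll_D2 (a b b' : R -> R) : kernel1 a -> kernel1 b ->
  (forall x, der b x (b' x)) -> kernel1 b' -> D2 (moll a b) (moll a b').
Proof.
move=> ka kb bb' kb' x y.
have [b'' b'b'' kb''] := kernel1_der kb'.
have [B B0 hB] := kernel1_bounded kb''; have [Ba Ba0 hBa] := kernel1_bounded ka.
apply: (@der_quad _ _ _ _ (Ba * B * L1norm) 1) => // h _.
have b1 := bm_kxy (x, y + h) ka kb; have b2 := bm_kxy (x, y) ka kb.
have b3 := bmZ h (bm_kxy (x, y) ka kb').
rewrite /moll -pairingZ; last exact: bm_kxy.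
rewrite -(pairingB b1 b2) -(pairingB (bmB b1 b2) b3).
rewrite mulrAC; apply: pairing_bound; first by apply: bmB => //; exact: bmB.
move=> z; rewrite /kxy/= mulrCA -!mulrBr normrM -mulrA.
apply: ler_pM => //; rewrite (_ : y + h - z.2 = y - z.2 + h); last by ring.
exact: der_taylor bb' b'b'' hB.
Qed.

Lemma lip_continuous2 (g : R * R -> R) (C : R) :
  (forall p q, `|g p - g q| <= C * (`|p.1 - q.1| + `|p.2 - q.2|)) -> continuous g.
Proof.
move=> gC p; apply/cvgrPdist_le => e e0.
have C1 : 0 < `|C| + 1 by rewrite ltr_wpDl.
pose d : R := e / (`|C| + 1) / 2.
have d0 : 0 < d by rewrite !divr_gt0.
near=> q.
have [] : ball p.1 d q.1 /\ ball p.2 d q.2.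
  near: q; exists (ball p.1 d, ball p.2 d); last by [].
  by split; exact: nbhsx_ballx.
rewrite /ball/= => h1 h2; apply: (le_trans (gC p q)).
apply: (@le_trans _ _ ((`|C| + 1) * (d + d))).
  apply: ler_pM; rewrite ?addr_ge0//.
  - have := gC (0, 0) (1, 0); rewrite /= subrr normr0 addr0 sub0r normrN normr1 mulr1.
    exact: le_trans (normr_ge0 _).
  - by rewrite (le_trans (ler_norm _))// lerDl.
  - by rewrite lerD// ltW.
by rewrite /d -splitr mulrC divfK// gt_eqF.
Unshelve. all: by end_near. Qed.

Lemma moll_continuous (a b : R -> R) : kernel1 a -> kernel1 b -> continuous (moll a b).
Proof.
move=> ka kb.
have [a' aa' ka'] := kernel1_der ka; have [b' bb' kb'] := kernel1_der kb.
have [A A0 hA] := kernel1_bounded ka; have [B B0 hB] := kernel1_bounded kb.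
have [A' A'0 hA'] := kernel1_bounded ka'; have [B' B'0 hB'] := kernel1_bounded kb'.
have L0 : 0 <= L1norm by apply: Rintegral_ge0.
apply: (@lip_continuous2 _ ((A' * B + A * B') * L1norm)) => p q.
rewrite /moll -pairingB; [|exact: bm_kxy..].
rewrite mulrAC; apply: pairing_bound.
  by apply: bmB; exact: bm_kxy.
move=> z; rewrite /kxy.
have -> : a (p.1 - z.1) * b (p.2 - z.2) - a (q.1 - z.1) * b (q.2 - z.2) =
  (a (p.1 - z.1) - a (q.1 - z.1)) * b (p.2 - z.2) +
  a (q.1 - z.1) * (b (p.2 - z.2) - b (q.2 - z.2)) by ring.
have e1 : `|a (p.1 - z.1) - a (q.1 - z.1)| <= A' * `|p.1 - q.1|.
  have := der_lip (p.1 - z.1) (q.1 - z.1) aa' hA'.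
  by rewrite (_ : p.1 - z.1 - (q.1 - z.1) = p.1 - q.1)//; ring.
have e2 : `|b (p.2 - z.2) - b (q.2 - z.2)| <= B' * `|p.2 - q.2|.
  have := der_lip (p.2 - z.2) (q.2 - z.2) bb' hB'.
  by rewrite (_ : p.2 - z.2 - (q.2 - z.2) = p.2 - q.2)//; ring.
rewrite (le_trans (ler_normD _ _))// !normrM.
apply: (@le_trans _ _ (A' * `|p.1 - q.1| * B + A * (B' * `|p.2 - q.2|))).
  by apply: lerD; apply: ler_pM.
have h1 := mulr_ge0 (mulr_ge0 A'0 B0) (normr_ge0 (p.2 - q.2)).
have h2 := mulr_ge0 (mulr_ge0 A0 B'0) (normr_ge0 (p.1 - q.1)).
by rewrite -subr_ge0; have := addr_ge0 h1 h2; congr (_ <= _); ring.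
Qed.

End functional.

Lemma bump_prod_integral d eta : bump d eta ->
  (\int[mu2]_z (eta z.1 * eta z.2)%:E = 1)%E.
Proof.
move=> be; have ke := bump_kernel1 be; case: be => se e0 _ _ e1.
have me : measurable_fun [set: measurableTypeR R] eta.
  by apply: continuous_measurable_fun; exact: smooth1_continuous.
rewrite integral_xy; last 2 first.
- apply/measurable_EFinP; apply: measurable_funM.
    exact: (measurableT_comp me measurable_fst).
  exact: (measurableT_comp me measurable_snd).
- by move=> z; rewrite lee_fin mulr_ge0.
rewrite -e1; apply: eq_integral => x _ /=.
under eq_integral do rewrite EFinM.
transitivity ((eta x)%:E * \int[mu]_y (eta y)%:E)%E; last by rewrite e1 mule1.
by apply: ge0_integralZl => //; [exact/measurable_EFinP|move=> *; rewrite lee_fin|rewrite lee_fin].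
Qed.

Lemma moll_dist (f : R * R -> R) d eta b : mu2.-integrable setT (EFin \o f) ->
  bump d eta -> (`|moll f eta eta b - f b|%:E <=
  \int[mu2]_z (`|f z - f b| * (eta (z.1 - b.1)%R * eta (z.2 - b.2)%R))%:E)%E.
Proof.
move=> fi be; have ke := bump_kernel1 be; have e1 := bump_prod_integral be.
have [ce bbe] := kernel1_cb ke.
have mf : mplane f by move/integrableP: fi => [/measurable_EFinP].
have me := continuous_measurable_fun ce.
case: be => se e0 _ eN _.
pose K (z : R * R) := kxy eta eta b z.
have KE z : K z = eta (z.1 - b.1) * eta (z.2 - b.2).
  by rewrite /K /kxy -(opprB z.1) -(opprB z.2) !eN.
have bK : bm K by exact: bm_kxy.
have K1 : (\int[mu2]_z (K z)%:E = 1)%E.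
  rewrite -e1.
  rewrite -(@ge0_integral_shift2 _ (fun z => (eta z.1 * eta z.2)%:E) (- b.1, - b.2)).
  - by apply: eq_integral => z _; rewrite KE.
  - apply/measurable_EFinP; apply: measurable_funM.
      exact: (measurableT_comp me measurable_fst).
    exact: (measurableT_comp me measurable_snd).
  - by move=> z; rewrite lee_fin mulr_ge0.
have K0 z : 0 <= K z by rewrite KE mulr_ge0.
have Ki : mu2.-integrable setT (EFin \o K).
  apply/integrableP; split; first by apply/measurable_EFinP; case: bK.
  under eq_integral do rewrite /= ger0_norm//.
  by rewrite K1 ltry.
have fKi : mu2.-integrable setT (fun z => (f z * K z)%:E) by exact: pairing_integrable.
have cKi : mu2.-integrable setT (fun z => (f b * K z)%:E).
  by under eq_fun do rewrite EFinM; exact: integrableZl.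
have -> : moll f eta eta b - f b = \int[mu2]_z ((f z - f b) * K z).
  rewrite /moll /pairing -/(K).
  transitivity (\int[mu2]_z (f z * K z) - \int[mu2]_z (f b * K z)).
    by rewrite RintegralZl// [X in _ - _ * X]/Rintegral K1 mulr1.
  by rewrite -RintegralB//; apply: eq_Rintegral => z _; rewrite mulrBl.
have di : mu2.-integrable setT (fun z => ((f z - f b) * K z)%:E).
  under eq_fun do rewrite mulrBl EFinB.
  exact: integrableB.
rewrite (EFin_normr_Rintegral measurableT di).
apply: (le_trans (le_abse_integral _ measurableT _)); first by case/integrableP: di.
rewrite le_eqVlt; apply/orP; left; apply/eqP; apply: eq_integral => z _.
by rewrite abse_EFin normrM (ger0_norm (K0 z)) KE.
Qed.

Lemma measurable_omega2 (f : R * R -> R) : mplane f ->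
  mplane (omega2 f).
Proof.
move=> mf; pose F (p : RR * RR) : \bar R :=
  `|f ((p.2.1 : R) + p.1.1, (p.2.2 : R) + p.1.2) - f p.2|%:E.
apply: (@measurable_fun_fubini_tonelli_F _ _ _ _ _ mu2 F); last first.
  by move=> p; rewrite lee_fin.
have mfst : mplane (fst : RR -> R) by exact: measurable_fst.
have msnd : mplane (snd : RR -> R) by exact: measurable_snd.
apply/measurable_EFinP; apply: measurableT_comp => //; apply: measurable_funB.
  apply: (measurableT_comp mf); apply/measurable_fun_pairP; split.
  - apply: measurable_funD; [exact: (measurableT_comp mfst measurable_snd)|
      exact: (measurableT_comp mfst measurable_fst)].
  - apply: measurable_funD; [exact: (measurableT_comp msnd measurable_snd)|
      exact: (measurableT_comp msnd measurable_fst)].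
exact: (measurableT_comp mf measurable_snd).
Qed.

(** Since the kernel has mass 1, the error is bounded through [approx_identity] by the average of
    [omega2 f h] over the support of the kernel, where continuity of translations makes it at most
    e. *)
Lemma moll_L1 (f : R * R -> R) (e : R) : mu2.-integrable setT (EFin \o f) -> 0 < e ->
  exists2 d0, 0 < d0 & forall d eta, d <= d0 -> bump d eta ->
  (\int[mu2]_b `|moll f eta eta b - f b|%:E <= e%:E)%E.
Proof.
move=> fi ep; have mf : mplane f by move/integrableP: fi => [/measurable_EFinP].
have [d0 d00 hd0] := omega2_small fi ep.
exists d0 => // d eta dd0 be; have ke := bump_kernel1 be.
have [ce bbe] := kernel1_cb ke.
have me := continuous_measurable_fun ce.
have mK : mplane (fun z : RR => eta z.1 * eta z.2).
  apply: measurable_funM; first exact: (measurableT_comp me measurable_fst).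
  exact: (measurableT_comp me measurable_snd).
have e0 := let: And5 _ x _ _ _ := be in x.
have esup := let: And5 _ _ x _ _ := be in x.
have mm : mplane (moll f eta eta).
  by apply: continuous_measurable2; exact: moll_continuous.
pose F (p : RR * RR) : \bar R :=
  (`|f p.2 - f p.1| * (eta ((p.2.1 : R) - p.1.1)%R * eta ((p.2.2 : R) - p.1.2)%R))%:E.
have mF : measurable_fun [set: RR * RR] F.
  apply/measurable_EFinP; apply: measurable_funM.
    apply: measurableT_comp => //; apply: measurable_funB.
      exact: (measurableT_comp mf measurable_snd).
    exact: (measurableT_comp mf measurable_fst).
  exact: (measurableT_comp mK measurable_sub2).
apply: (@le_trans _ _ (\int[mu2]_b \int[mu2]_z F (b, z))%E).
  apply: ge0_le_integral => //.
  - exact: measurable_diff2.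
  - by apply: (@measurable_fun_fubini_tonelli_F _ _ _ _ _ mu2 F) => // z; rewrite lee_fin !mulr_ge0.
  - by move=> b _; exact: (moll_dist b fi be).
rewrite [leLHS](@approx_identity _ f (fun z => eta z.1 * eta z.2))//; last first.
  by move=> z; rewrite mulr_ge0.
apply: (@le_trans _ _ (\int[mu2]_h (e%:E * (eta h.1 * eta h.2)%:E))%E).
  apply: ge0_le_integral => //.
  - by move=> h _; rewrite mule_ge0 ?lee_fin ?mulr_ge0// integral_ge0.
  - apply: emeasurable_funM; first exact/measurable_EFinP.
    exact: measurable_omega2.
  - by apply: measurable_funeM; exact/measurable_EFinP.
  - move=> h _; rewrite [leRHS]muleC.
    have [h1|h1] := leP d `|h.1|; first by rewrite esup// mul0r !mul0e.
    have [h2|h2] := leP d `|h.2|; first by rewrite (esup h.2)// mulr0 !mul0e.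
    by rewrite lee_wpmul2l ?lee_fin ?mulr_ge0//; apply: hd0; apply: ltW; apply: lt_le_trans dd0.
rewrite ge0_integralZl//; last 3 first.
- exact/measurable_EFinP.
- by move=> z _; rewrite lee_fin mulr_ge0.
- by rewrite lee_fin ltW.
by rewrite (bump_prod_integral be) mule1.
Qed.

End mollifiers.

(** * Almost subharmonicity of ln |u| *)

Section plane_calculus.
Context {R : realType}.
Local Notation RR := (plane R).
Implicit Types f g : R * R -> R.

Lemma D1D f g f' g' : D1 f f' -> D1 g g' -> D1 (fun z => f z + g z) (fun z => f' z + g' z).
Proof. by move=> ff gg x y; exact: derD (ff x y) (gg x y). Qed.
Lemma D2D f g f' g' : D2 f f' -> D2 g g' -> D2 (fun z => f z + g z) (fun z => f' z + g' z).
Proof. by move=> ff gg x y; exact: derD (ff x y) (gg x y). Qed.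
Lemma D1B f g f' g' : D1 f f' -> D1 g g' -> D1 (fun z => f z - g z) (fun z => f' z - g' z).
Proof. by move=> ff gg x y; exact: derB (ff x y) (gg x y). Qed.
Lemma D2B f g f' g' : D2 f f' -> D2 g g' -> D2 (fun z => f z - g z) (fun z => f' z - g' z).
Proof. by move=> ff gg x y; exact: derB (ff x y) (gg x y). Qed.
Lemma D1M f g f' g' : D1 f f' -> D1 g g' ->
  D1 (fun z => f z * g z) (fun z => f' z * g z + f z * g' z).
Proof. by move=> ff gg x y; exact: derM (ff x y) (gg x y). Qed.
Lemma D2M f g f' g' : D2 f f' -> D2 g g' ->
  D2 (fun z => f z * g z) (fun z => f' z * g z + f z * g' z).
Proof. by move=> ff gg x y; exact: derM (ff x y) (gg x y). Qed.
Lemma D1V f f' : (forall z, f z != 0) -> D1 f f' ->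
  D1 (fun z => (f z)^-1) (fun z => - f' z / f z ^+ 2).
Proof. by move=> f0 ff x y; exact: (derV (f := fun s => f (s, y)) _ (ff x y)). Qed.
Lemma D2V f f' : (forall z, f z != 0) -> D2 f f' ->
  D2 (fun z => (f z)^-1) (fun z => - f' z / f z ^+ 2).
Proof. by move=> f0 ff x y; exact: (derV (f := fun s => f (x, s)) _ (ff x y)). Qed.
Lemma D1_comp (h h' : R -> R) f f' : (forall z, der h (f z) (h' (f z))) -> D1 f f' ->
  D1 (fun z => h (f z)) (fun z => h' (f z) * f' z).
Proof.
by move=> hh ff x y; exact: (der_comp (g := fun s => f (s, y)) (hh (x, y)) (ff x y)).
Qed.
Lemma D2_comp (h h' : R -> R) f f' : (forall z, der h (f z) (h' (f z))) -> D2 f f' ->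
  D2 (fun z => h (f z)) (fun z => h' (f z) * f' z).
Proof.
by move=> hh ff x y; exact: (der_comp (g := fun s => f (x, s)) (hh (x, y)) (ff x y)).
Qed.
Lemma D1N f f' : D1 f f' -> D1 (fun z => - f z) (fun z => - f' z).
Proof. by move=> ff x y; exact: derN (ff x y). Qed.
Lemma D2N f f' : D2 f f' -> D2 (fun z => - f z) (fun z => - f' z).
Proof. by move=> ff x y; exact: derN (ff x y). Qed.
Lemma D1_cst (c : R) : D1 (fun=> c) (fun=> 0).
Proof. by move=> x y; exact: der_cst. Qed.
Lemma D2_cst (c : R) : D2 (fun=> c) (fun=> 0).
Proof. by move=> x y; exact: der_cst. Qed.
Lemma D1_fst : D1 (fun z : R * R => z.1) (fun=> 1).
Proof. by move=> x y; exact: der_id. Qed.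
Lemma D2_snd : D2 (fun z : R * R => z.2) (fun=> 1).
Proof. by move=> x y; exact: der_id. Qed.
Lemma D1_snd : D1 (fun z : R * R => z.2) (fun=> 0).
Proof. by move=> x y; exact: der_cst. Qed.
Lemma D2_fst : D2 (fun z : R * R => z.1) (fun=> 0).
Proof. by move=> x y; exact: der_cst. Qed.
Lemma D1_eq f g g' : D1 f g -> (forall z, g z = g' z) -> D1 f g'.
Proof. by move=> fg gg x y; rewrite -gg; exact: fg. Qed.
Lemma D2_eq f g g' : D2 f g -> (forall z, g z = g' z) -> D2 f g'.
Proof. by move=> fg gg x y; rewrite -gg; exact: fg. Qed.

Lemma ctD f g : continuous f -> continuous g -> continuous (fun z => f z + g z).
Proof. by move=> cf cg z; apply: cvgD; [exact: cf|exact: cg]. Qed.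
Lemma ctB f g : continuous f -> continuous g -> continuous (fun z => f z - g z).
Proof. by move=> cf cg z; apply: cvgB; [exact: cf|exact: cg]. Qed.
Lemma ctN f : continuous f -> continuous (fun z => - f z).
Proof. by move=> cf z; apply: cvgN; exact: cf. Qed.
Lemma ctM f g : continuous f -> continuous g -> continuous (fun z => f z * g z).
Proof. by move=> cf cg z; apply: cvgM; [exact: cf|exact: cg]. Qed.
Lemma ctV f : (forall z, f z != 0) -> continuous f -> continuous (fun z => (f z)^-1).
Proof. by move=> f0 cf z; apply: cvgV => //; exact: cf. Qed.
Lemma ct_cst (c : R) : continuous (fun _ : R * R => c).
Proof. by move=> z; exact: cvg_cst. Qed.
Lemma ct_fst : continuous (fun z : R * R => z.1).
Proof. by move=> z; exact: cvg_fst. Qed.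
Lemma ct_snd : continuous (fun z : R * R => z.2).
Proof. by move=> z; exact: cvg_snd. Qed.
Lemma ctX f n : continuous f -> continuous (fun z => f z ^+ n).
Proof.
move=> cf; elim: n => [|n IH]; first by under eq_fun do rewrite expr0; exact: ct_cst.
by under eq_fun do rewrite exprS; exact: ctM.
Qed.
Lemma ct_comp (h : R -> R) f : continuous f -> (forall z, {for f z, continuous h}) ->
  continuous (fun z => h (f z)).
Proof. by move=> cf ch z; apply: (continuous_comp (cf z)); exact: ch. Qed.
Lemma ct_ln f : (forall z, 0 < f z) -> continuous f -> continuous (fun z => ln (f z)).
Proof. by move=> f0 cf; apply: ct_comp => // z; exact: continuous_ln. Qed.

Lemma der_ln (x : R) : 0 < x -> der (@ln R) x x^-1.
Proof. by move=> x0; exact: is_derive1_ln. Qed.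

(** A test function with its gradient and Laplacian, supported in a square. The pure second
    derivatives stay existentially quantified: the estimates see only their sum. *)
Record C2c (L : R) (psi px py lap : R * R -> R) : Prop := {
  C2c_x : D1 psi px;
  C2c_y : D2 psi py;
  C2c_xx : exists pxx pyy, [/\ D1 px pxx, D2 py pyy, continuous pxx, continuous pyy &
    (forall z, lap z = pxx z + pyy z) /\
    forall z, ~ cbox L z -> pxx z = 0 /\ pyy z = 0];
  C2c_ct : [/\ continuous psi, continuous px & continuous py];
  C2c_supp : forall z, ~ cbox L z -> [/\ psi z = 0, px z = 0, py z = 0 & lap z = 0] }.

(** * The integral inequality for smooth functions *)

Section star.
Variables (e : R) (v1 v2 v1x v1y v2x v2y v1xy v2xy : R * R -> R).
Hypothesis e0 : 0 < e.
Hypotheses (d1x : D1 v1 v1x) (d1y : D2 v1 v1y) (d2x : D1 v2 v2x) (d2y : D2 v2 v2y).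
Hypotheses (d1xy : D2 v1x v1xy) (d1yx : D1 v1y v1xy) (d2xy : D2 v2x v2xy) (d2yx : D1 v2y v2xy).
Hypotheses (c1 : continuous v1) (c2 : continuous v2) (c1x : continuous v1x)
  (c1y : continuous v1y) (c2x : continuous v2x) (c2y : continuous v2y)
  (c1xy : continuous v1xy) (c2xy : continuous v2xy).

Definition qq (a b : R) : R := a ^+ 2 + b ^+ 2 + e.
Definition Lam (a b : R) : R := ln (qq a b) / 2.
(* [a], [b] are the components of [v], and [g], [h] those of [2 dbar v]. *)
Definition integrand (a b g h p px py lap : R) : R :=
  Lam a b * lap + (a * g + b * h) / qq a b * px + (a * h - b * g) / qq a b * py
  + e / 2 * p * ((g ^+ 2 + h ^+ 2) / qq a b ^+ 2).

Lemma qq_gt0 a b : 0 < qq a b.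
Proof. by rewrite /qq ltr_wpDl// addr_ge0 ?sqr_ge0. Qed.

Lemma qq_ge a b : e <= qq a b.
Proof. by rewrite /qq lerDr addr_ge0 ?sqr_ge0. Qed.

(** With v = a + i b, four times the Jacobian ax bY - ay bx plus |2 dbar v|^2 equals |2 d v|^2,
    where d is the holomorphic derivative; the gap between the two sides is therefore p (e / 2) |2 d
    v|^2 / q^2 >= 0. The first-order terms agree because grad [Lam] minus the rotated differential
    of the argument depends on dbar v only. *)
Lemma integrand_ge (a b ax ay bx bY p px py lap : R) : 0 <= p ->
  Lam a b * lap + ((a * ax + b * bx) / qq a b * px - px * ((a * bY - b * ay) / qq a b)) +
    ((a * ay + b * bY) / qq a b * py + py * ((a * bx - b * ax) / qq a b)) -
    p * (2 * e * (ax * bY - ay * bx) / qq a b ^+ 2) <=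
  integrand a b (ax - bY) (bx + ay) p px py lap.
Proof.
move=> p0; have q0 := qq_gt0 a b.
rewrite /integrand -subr_ge0; set q := qq a b in q0 *.
set X := (X in 0 <= X).
have -> : X = p * (e / 2 * ((ax + bY) ^+ 2 + (bx - ay) ^+ 2) / q ^+ 2).
  by rewrite /X; field; rewrite gt_eqF.
rewrite mulr_ge0// divr_ge0// ?sqr_ge0// mulr_ge0 ?addr_ge0 ?sqr_ge0//.
by rewrite divr_ge0// ltW.
Qed.

Let q (z : R * R) := qq (v1 z) (v2 z).
Let q0 z : q z != 0. Proof. by rewrite gt_eqF// qq_gt0. Qed.
Let dq1 : D1 q (fun z => 2 * (v1 z * v1x z + v2 z * v2x z)).
Proof.
apply: (D1_eq (D1D (D1D (D1M d1x d1x) (D1M d2x d2x)) (D1_cst e))).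
by move=> z; ring.
Qed.
Let dq2 : D2 q (fun z => 2 * (v1 z * v1y z + v2 z * v2y z)).
Proof.
apply: (D2_eq (D2D (D2D (D2M d1y d1y) (D2M d2y d2y)) (D2_cst e))).
by move=> z; ring.
Qed.
Let cq : continuous q.
Proof. by apply: ctD; [apply: ctD; apply: ctX|exact: ct_cst]. Qed.
Let dL1 : D1 (fun z => Lam (v1 z) (v2 z)) (fun z => (v1 z * v1x z + v2 z * v2x z) / q z).
Proof.
have h z : der (@ln R) (q z) (q z)^-1 by apply: der_ln; exact: qq_gt0.
apply: (D1_eq (D1M (D1_comp (h' := fun x => x^-1) h dq1) (D1_cst 2^-1))).
by move=> z; field; exact: q0.
Qed.
Let dL2 : D2 (fun z => Lam (v1 z) (v2 z)) (fun z => (v1 z * v1y z + v2 z * v2y z) / q z).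
Proof.
have h z : der (@ln R) (q z) (q z)^-1 by apply: der_ln; exact: qq_gt0.
apply: (D2_eq (D2M (D2_comp (h' := fun x => x^-1) h dq2) (D2_cst 2^-1))).
by move=> z; field; exact: q0.
Qed.
Let cL : continuous (fun z => Lam (v1 z) (v2 z)).
Proof. by apply: ctM; [apply: ct_ln => // z; exact: qq_gt0|exact: ct_cst]. Qed.
Let cqV : continuous (fun z => (q z)^-1). Proof. exact: ctV. Qed.

Let ThX (z : R * R) := (v1 z * v2x z - v2 z * v1x z) / q z.
Let ThY (z : R * R) := (v1 z * v2y z - v2 z * v1y z) / q z.
Let ThXy (z : R * R) := (v1y z * v2x z + v1 z * v2xy z - (v2y z * v1x z + v2 z * v1xy z)) / q z
  - (v1 z * v2x z - v2 z * v1x z) * (2 * (v1 z * v1y z + v2 z * v2y z)) / q z ^+ 2.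
Let ThYx (z : R * R) := (v1x z * v2y z + v1 z * v2xy z - (v2x z * v1y z + v2 z * v1xy z)) / q z
  - (v1 z * v2y z - v2 z * v1y z) * (2 * (v1 z * v1x z + v2 z * v2x z)) / q z ^+ 2.

Let dThX : D2 ThX ThXy.
Proof.
apply: (D2_eq (D2M (D2B (D2M d1y d2xy) (D2M d2y d1xy)) (D2V q0 dq2))).
by move=> z; rewrite /ThXy; field; exact: q0.
Qed.
Let dThY : D1 ThY ThYx.
Proof.
apply: (D1_eq (D1M (D1B (D1M d1x d2yx) (D1M d2x d1yx)) (D1V q0 dq1))).
by move=> z; rewrite /ThYx; field; exact: q0.
Qed.
Let cq2V : continuous (fun z => (q z ^+ 2)^-1).
Proof. by apply: ctV; [move=> z; rewrite expf_neq0|exact: ctX]. Qed.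
Let cThX : continuous ThX.
Proof. by apply: ctM => //; apply: ctB; exact: ctM. Qed.
Let cThY : continuous ThY.
Proof. by apply: ctM => //; apply: ctB; exact: ctM. Qed.
Let cThXy : continuous ThXy.
Proof.
apply: ctB; apply: ctM => //.
  by apply: ctB; apply: ctD; exact: ctM.
apply: ctM; first by apply: ctB; exact: ctM.
by apply: ctM; [exact: ct_cst|apply: ctD; exact: ctM].
Qed.
Let cThYx : continuous ThYx.
Proof.
apply: ctB; apply: ctM => //.
  by apply: ctB; apply: ctD; exact: ctM.
apply: ctM; first by apply: ctB; exact: ctM.
by apply: ctM; [exact: ct_cst|apply: ctD; exact: ctM].
Qed.

(* Integrate the divergence of [Lam grad psi - psi (ThY, - ThX)], where
   [(ThX, ThY)] is the regularized differential of the argument of [v]; the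
   Jacobian in its curl is bounded below by [- |2 dbar v|^2 / 4]. *)
Lemma smooth_star L psi px py lap : C2c L psi px py lap -> (forall z, 0 <= psi z) ->
  0 <= \int[mu2]_z integrand (v1 z) (v2 z) (v1x z - v2y z) (v2x z + v1y z)
    (psi z) (px z) (py z) (lap z).
Proof.
move=> [dpx dpy [pxx [pyy [dpxx dpyy cpxx cpyy [lapE p20]]]] [cp cpx cpy] p0] psi0.
pose lam z := Lam (v1 z) (v2 z).
pose P z := lam z * px z - psi z * ThY z.
pose Q z := lam z * py z + psi z * ThX z.
pose Px z := (v1 z * v1x z + v2 z * v2x z) / q z * px z + lam z * pxx z -
  (px z * ThY z + psi z * ThYx z).
pose Qy z := (v1 z * v1y z + v2 z * v2y z) / q z * py z + lam z * pyy z +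
  (py z * ThX z + psi z * ThXy z).
have dP : D1 P Px by apply: D1B; exact: D1M.
have dQ : D2 Q Qy by apply: D2D; exact: D2M.
have cPx : continuous Px.
  apply: ctB; apply: ctD; apply: ctM => //.
  by apply: ctM => //; apply: ctD; exact: ctM.
have cQy : continuous Qy.
  apply: ctD; apply: ctD; apply: ctM => //.
  by apply: ctM => //; apply: ctD; exact: ctM.
have P0 z : ~ cbox L z -> P z = 0.
  by move=> /p0[h1 h2 h3 h4]; rewrite /P h1 h2; ring.
have Q0 z : ~ cbox L z -> Q z = 0.
  by move=> /p0[h1 h2 h3 h4]; rewrite /Q h1 h3; ring.
have Px0 z : ~ cbox L z -> Px z = 0.
  by move=> hz; have [h1 h2 h3 h4] := p0 z hz; have [h5 h6] := p20 z hz; rewrite /Px h1 h2 h5; ring.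
have Qy0 z : ~ cbox L z -> Qy z = 0.
  by move=> hz; have [h1 h2 h3 h4] := p0 z hz; have [h5 h6] := p20 z hz; rewrite /Qy h1 h3 h6; ring.
have iPx := Cc_integrable cPx Px0; have iQy := Cc_integrable cQy Qy0.
have : \int[mu2]_z (Px z + Qy z) = 0.
  by rewrite RintegralD// (int_D1 dP cPx P0 Px0) (int_D2 dQ cQy Q0 Qy0) addr0.
move=> <-; apply: le_Rintegral => //.
- rewrite (_ : EFin \o _ = ((EFin \o Px) \+ (EFin \o Qy))%E)//; exact: integrableD.
- apply: (@Cc_integrable _ _ L).
    have cg1 : continuous (fun z => v1x z - v2y z) by exact: ctB.
    have cg2 : continuous (fun z => v2x z + v1y z) by exact: ctD.
    have clap : continuous lap by rewrite (_ : lap = fun z => pxx z + pyy z);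
      [exact: ctD|exact/funext].
    apply: ctD; last first.
      apply: ctM; first by apply: ctM => //; exact: ct_cst.
      by apply: ctM => //; apply: ctD; exact: ctX.
    apply: ctD; last by apply: ctM => //; apply: ctM => //; apply: ctB; exact: ctM.
    apply: ctD; first exact: ctM.
    by apply: ctM => //; apply: ctM => //; apply: ctD; exact: ctM.
  by move=> z hz; have [-> -> -> ->] := p0 z hz; rewrite /integrand; ring.
- move=> z _; apply: le_trans (integrand_ge _ _ _ _ _ _ _ _ _ (psi0 z)).
  rewrite le_eqVlt; apply/orP; left; apply/eqP; rewrite /= lapE.
  (* With e expressed through q, what remains is an identity of rational functions. *)
  have -> : e = q z - v1 z ^+ 2 - v2 z ^+ 2 by rewrite /q /qq; ring.
  rewrite -/(lam z) -/(q z) /Px /Qy /ThX /ThY /ThXy /ThYx; field; exact: q0.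
Qed.

End star.

(** * The Cauchy-Pompeiu formula with a regularized kernel *)

Section cauchy_pompeiu.
Variables (w1 w2 w1x w1y w2x w2y : R * R -> R) (L : R).
Hypotheses (d1x : D1 w1 w1x) (d1y : D2 w1 w1y) (d2x : D1 w2 w2x) (d2y : D2 w2 w2y).
Hypotheses (c1 : continuous w1) (c2 : continuous w2) (c1x : continuous w1x)
  (c1y : continuous w1y) (c2x : continuous w2x) (c2y : continuous w2y).
Hypothesis supp : forall z, ~ cbox L z -> [/\ w1 z = 0, w2 z = 0, w1x z = 0 &
  [/\ w1y z = 0, w2x z = 0 & w2y z = 0]].

Definition cden (t : R) (z : R * R) : R := z.1 ^+ 2 + z.2 ^+ 2 + t.
(* Regularizations of the Cauchy kernel [1 / (x + i y)] and of [pi] times the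
   Dirac mass at the origin. *)
Definition ck1 (t : R) (z : R * R) : R := z.1 / cden t z.
Definition ck2 (t : R) (z : R * R) : R := - z.2 / cden t z.
Definition poisson (t : R) (z : R * R) : R := t / cden t z ^+ 2.

(** Integration by parts against conj(z - b) / (|z - b|^2 + t), whose dbar derivative is exactly t /
    (|z - b|^2 + t)^2. The two conjuncts are the real and imaginary parts, with w = w1 + i w2 and k
    = k1 + i k2. *)
Lemma cauchy_pompeiu (t : R) (b : R * R) : 0 < t ->
  let k1 z := ck1 t (z :-: b) in
  let k2 z := ck2 t (z :-: b) in
  let P z := poisson t (z :-: b) in
  \int[mu2]_z (w1 z * P z) =
    - (\int[mu2]_z ((w1x z - w2y z) * k1 z - (w2x z + w1y z) * k2 z)) / 2 /\
  \int[mu2]_z (w2 z * P z) =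
    - (\int[mu2]_z ((w1x z - w2y z) * k2 z + (w2x z + w1y z) * k1 z)) / 2.
Proof.
move=> t0 k1 k2 P.
pose d z : R := cden t (z :-: b).
have d_gt0 z : 0 < d z by rewrite /d /cden/= ltr_wpDl// addr_ge0 ?sqr_ge0.
have dn0 z : d z != 0 by rewrite gt_eqF.
pose X (z : R * R) := z.1 - b.1; pose Y (z : R * R) := z.2 - b.2.
have X1 : D1 X (fun=> 1) by apply: (D1_eq (D1B D1_fst (D1_cst _))) => z; rewrite subr0.
have Y1 : D1 Y (fun=> 0) by apply: (D1_eq (D1B D1_snd (D1_cst _))) => z; rewrite subr0.
have X2 : D2 X (fun=> 0) by apply: (D2_eq (D2B D2_fst (D2_cst _))) => z; rewrite subr0.
have Y2 : D2 Y (fun=> 1) by apply: (D2_eq (D2B D2_snd (D2_cst _))) => z; rewrite subr0.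
have dE z : d z = X z ^+ 2 + Y z ^+ 2 + t by [].
have dd1 : D1 d (fun z => 2 * X z).
  apply: (D1_eq (D1D (D1D (D1M X1 X1) (D1M Y1 Y1)) (D1_cst t))) => z; ring.
have dd2 : D2 d (fun z => 2 * Y z).
  apply: (D2_eq (D2D (D2D (D2M X2 X2) (D2M Y2 Y2)) (D2_cst t))) => z; ring.
pose k1x z := (d z)^-1 - 2 * X z ^+ 2 / d z ^+ 2.
pose kxy z := - (2 * X z * Y z / d z ^+ 2).
pose k1y := kxy.
pose k2x z := 2 * X z * Y z / d z ^+ 2.
pose k2y z := - (d z)^-1 + 2 * Y z ^+ 2 / d z ^+ 2.
have dk1x : D1 k1 k1x.
  by apply: (D1_eq (D1M X1 (D1V dn0 dd1))) => z; rewrite /k1x; field.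
have dk1y : D2 k1 k1y.
  by apply: (D2_eq (D2M X2 (D2V dn0 dd2))) => z; rewrite /k1y /kxy; field.
have dk2x : D1 k2 k2x.
  apply: (D1_eq (D1M (D1N Y1) (D1V dn0 dd1))) => z.
  by rewrite /k2x; field.
have dk2y : D2 k2 k2y.
  apply: (D2_eq (D2M (D2N Y2) (D2V dn0 dd2))) => z.
  by rewrite /k2y; field.
have cX : continuous X by apply: ctB; [exact: ct_fst|exact: ct_cst].
have cY : continuous Y by apply: ctB; [exact: ct_snd|exact: ct_cst].
have cd : continuous d by apply: ctD; [apply: ctD; exact: ctX|exact: ct_cst].
have cdV : continuous (fun z => (d z)^-1) by exact: ctV.
have cd2V : continuous (fun z => (d z ^+ 2)^-1).
  by apply: ctV; [move=> z; rewrite expf_neq0|exact: ctX].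
have ck1 : continuous k1 by exact: ctM.
have ck2 : continuous k2 by apply: ctM => //; exact: ctN.
have cP : continuous P by apply: ctM => //; exact: ct_cst.
(* The real part of dbar k = P; the imaginary part is the cancellation of [k1y] with [k2x]. *)
have k1xE z : k1x z = 2 * P z + k2y z.
  rewrite /k1x /k2y /P /poisson -/(d z).
  have -> : t = d z - X z ^+ 2 - Y z ^+ 2 by rewrite dE; ring.
  by field.
have c2c (c : R) : continuous (fun _ : R * R => c) by exact: ct_cst.
have ck2x : continuous k2x.
  by apply: ctM => //; apply: ctM => //; exact: ctM.
have ck1y : continuous k1y by exact: ctN.
have ck2y : continuous k2y.
  apply: ctD; first exact: ctN.
  by apply: ctM => //; apply: ctM => //; exact: ctX.
have ck1x : continuous k1x.
  apply: ctB => //; apply: ctM => //; apply: ctM => //; exact: ctX.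
(* Both formulas come from a compactly supported field (A, B) whose divergence is G + 2 w P. *)
have main (A B A' B' G : R * R -> R) : D1 A A' -> D2 B B' -> continuous A' -> continuous B' ->
    (forall z, ~ cbox L z -> [/\ A z = 0, B z = 0, A' z = 0 & B' z = 0]) ->
    forall w : R * R -> R, continuous w -> (forall z, ~ cbox L z -> w z = 0) ->
    (forall z, A' z + B' z = G z + 2 * (w z * P z)) ->
    \int[mu2]_z (w z * P z) = - (\int[mu2]_z G z) / 2.
  move=> dA dB cA' cB' AB0 w cw w0 E.
  have iA : mu2.-integrable setT (EFin \o A').
    by apply: (Cc_integrable cA' (L := L)) => z /AB0[].
  have iB : mu2.-integrable setT (EFin \o B').
    by apply: (Cc_integrable cB' (L := L)) => z /AB0[].
  have iw : mu2.-integrable setT (EFin \o (fun z => w z * P z)).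
    by apply: (@Cc_integrable _ _ L); [exact: ctM|move=> z /w0 ->; rewrite mul0r].
  have cG : continuous G.
    rewrite (_ : G = fun z => A' z + B' z - 2 * (w z * P z)).
      by apply: ctB; [exact: ctD|apply: ctM; [exact: ct_cst|exact: ctM]].
    by apply/funext => z; rewrite E addrK.
  have iG : mu2.-integrable setT (EFin \o G).
    apply: (@Cc_integrable _ _ L) => // z hz.
    have := E z; have [_ _ -> ->] := AB0 z hz; rewrite w0// mul0r mulr0 !addr0.
    by move=> <-.
  have h0 : \int[mu2]_z (A' z + B' z) = 0.
    rewrite RintegralD// (@int_D1 _ A _ L)//; [|by move=> z /AB0[]..].
    by rewrite (@int_D2 _ B _ L)//; [rewrite addr0|by move=> z /AB0[]..].
  have h1 : \int[mu2]_z (A' z + B' z) = \int[mu2]_z G z + 2 * \int[mu2]_z (w z * P z).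
    rewrite -RintegralZl// -RintegralD//; first by apply: eq_Rintegral => z _; exact: E.
    apply: (@Cc_integrable _ _ L); first by apply: ctM => //; exact: ctM.
    by move=> z /w0 ->; rewrite mul0r mulr0.
  by move: h1; rewrite h0 => h1; lra.
split.
- apply: (main (fun z => w1 z * k1 z - w2 z * k2 z) (fun z => - (w2 z * k1 z + w1 z * k2 z))
    (fun z => (w1x z * k1 z + w1 z * k1x z) - (w2x z * k2 z + w2 z * k2x z))
    (fun z => - ((w2y z * k1 z + w2 z * k1y z) + (w1y z * k2 z + w1 z * k2y z)))) => //.
  + by apply: D1B; exact: D1M.
  + by apply: D2N; apply: D2D; exact: D2M.
  + by apply: ctB; apply: ctD; exact: ctM.
  + by apply: ctN; apply: ctD; apply: ctD; exact: ctM.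
  + by move=> z /supp[-> -> -> [-> -> ->]]; split; ring.
  + by move=> z /supp[].
  + by move=> z; rewrite k1xE /k1y /kxy /k2x; ring.
- apply: (main (fun z => w1 z * k2 z + w2 z * k1 z) (fun z => w1 z * k1 z - w2 z * k2 z)
    (fun z => (w1x z * k2 z + w1 z * k2x z) + (w2x z * k1 z + w2 z * k1x z))
    (fun z => (w1y z * k1 z + w1 z * k1y z) - (w2y z * k2 z + w2 z * k2y z))) => //.
  + by apply: D1D; exact: D1M.
  + by apply: D2B; exact: D2M.
  + by apply: ctD; apply: ctD; exact: ctM.
  + by apply: ctB; apply: ctD; exact: ctM.
  + by move=> z /supp[-> -> -> [-> -> ->]]; split; ring.
  + by move=> z /supp[].
  + by move=> z; rewrite k1xE /k1y /kxy /k2x; ring.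
Qed.

End cauchy_pompeiu.
End plane_calculus.

(** * Integrable functions on the plane and Lipschitz dependence of the integrand *)

Section integrable_plane.
Context {R : realType}.
Local Notation RR := (plane R).
Implicit Types f g : R * R -> R.

Definition inR f := mu2.-integrable setT (EFin \o f).

Lemma inR_meas f : inR f -> mplane f.
Proof. by move=> /integrableP[/measurable_EFinP]. Qed.

Lemma inRD f g : inR f -> inR g -> inR (fun z => f z + g z).
Proof.
move=> fi gi; rewrite /inR (_ : EFin \o _ = ((EFin \o f) \+ (EFin \o g))%E)//.
exact: integrableD.
Qed.

Lemma inRZ c f : inR f -> inR (fun z => c * f z).
Proof.
move=> fi; rewrite /inR (_ : EFin \o _ = (fun z => c%:E * (EFin \o f) z)%E)//.
exact: integrableZl.
Qed.

Lemma inRN f : inR f -> inR (fun z => - f z).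
Proof.
move=> fi; rewrite (_ : (fun z => _) = fun z => -1 * f z); first exact: inRZ.
by apply/funext => z; rewrite mulN1r.
Qed.

Lemma inRB f g : inR f -> inR g -> inR (fun z => f z - g z).
Proof. by move=> fi gi; apply: inRD => //; exact: inRN. Qed.

Lemma inR_norm f : inR f -> inR (fun z => `|f z|).
Proof. exact: integrable_norm. Qed.

Lemma inR_le f g : mplane f -> inR g ->
  (forall z, `|f z| <= g z) -> inR f.
Proof.
move=> mf gi fg; apply: le_integrable gi => //; first exact/measurable_EFinP.
by move=> z _; rewrite lee_fin (le_trans (fg z))// ler_norm.
Qed.

Lemma inR_pairing f k : inR f -> bm k -> inR (fun z => f z * k z).
Proof. by move=> fi bk; exact: (pairing_integrable fi bk). Qed.

Lemma bm_indic (A : set RR) : measurable A -> bm (\1_A : R * R -> R).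
Proof.
move=> mA; split; first exact: measurable_indic.
by exists 1 => z; rewrite indicE; case: (_ \in _); rewrite ?normr0 ?normr1.
Qed.


Lemma inR_indic (A : set RR) L : measurable A -> A `<=` cbox L -> inR (\1_A : R * R -> R).
Proof.
move=> mA AL; have [mi [C iC]] := bm_indic mA; apply: (integrable_bbox (L := L) mi iC) => z nz.
by rewrite indicE memNset// => /AL.
Qed.

Lemma inR_cbox L : inR (\1_(cbox L) : R * R -> R).
Proof. exact: (inR_indic (measurable_cbox L) (fun z h => h)). Qed.

Lemma inR_ereal f e : inR f -> (\int[mu2]_z (f z)%:E <= e%:E)%E <-> \int[mu2]_z f z <= e.
Proof.
move=> fi; rewrite -lee_fin /Rintegral fineK//; exact: integrable_fin_num.
Qed.

Lemma RintB f g : inR f -> inR g ->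
  \int[mu2]_z (f z - g z) = \int[mu2]_z f z - \int[mu2]_z g z.
Proof. exact: RintegralB. Qed.

Lemma RintD f g : inR f -> inR g ->
  \int[mu2]_z (f z + g z) = \int[mu2]_z f z + \int[mu2]_z g z.
Proof. exact: RintegralD. Qed.

Lemma RintZ c f : inR f -> \int[mu2]_z (c * f z) = c * \int[mu2]_z f z.
Proof. exact: RintegralZl. Qed.

Lemma Rint_le f g : inR f -> inR g -> (forall z, f z <= g z) ->
  \int[mu2]_z f z <= \int[mu2]_z g z.
Proof. by move=> fi gi fg; apply: le_Rintegral. Qed.

Lemma Rint_ge0 f : (forall z, 0 <= f z) -> 0 <= \int[mu2]_z f z.
Proof. by move=> f0; apply: Rintegral_ge0. Qed.

Lemma moll_bounded f (B d : R) eta z : inR f -> (forall z, `|f z| <= B) -> bump d eta ->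
  `|moll f eta eta z| <= B.
Proof.
move=> fi fB be; have ke := bump_kernel1 be; have e1 := bump_prod_integral be.
have [ce bbe] := kernel1_cb ke; have me := continuous_measurable_fun ce.
case: be => se e0 _ eN _.
have bK : bm (kxy eta eta z) by exact: bm_kxy.
have K0 w : 0 <= kxy eta eta z w by rewrite mulr_ge0.
have K1 : (\int[mu2]_w (kxy eta eta z w)%:E = 1)%E.
  rewrite -e1 -(@ge0_integral_shift2 _ (fun z => (eta z.1 * eta z.2)%:E) (- z.1, - z.2)).
  - by apply: eq_integral => w _; rewrite /kxy -(opprB w.1) -(opprB w.2) !eN.
  - apply/measurable_EFinP; apply: measurable_funM.
      exact: (measurableT_comp me measurable_fst).
    exact: (measurableT_comp me measurable_snd).
  - by move=> w; rewrite lee_fin mulr_ge0.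
have Ki : inR (kxy eta eta z).
  apply/integrableP; split; first by apply/measurable_EFinP; case: bK.
  under eq_integral do rewrite /= ger0_norm//.
  by rewrite K1 ltry.
have fKi := inR_pairing fi bK.
apply: (le_trans (le_normr_Rintegral measurableT fKi)).
apply: (@le_trans _ _ (\int[mu2]_w (B * kxy eta eta z w))).
  apply: Rint_le; [exact: inR_norm|exact: inRZ|move=> w].
  by rewrite normrM (ger0_norm (K0 w)) ler_wpM2r.
by rewrite RintZ// /Rintegral K1 mulr1.
Qed.

Section lipschitz.
Variables (e B : R).
Hypotheses (e0 : 0 < e) (B0 : 0 <= B).
Local Notation T := (R * R * (R * R))%type.
Definition inbox (p : T) :=
  [/\ `|p.1.1| <= 1, `|p.1.2| <= 1, `|p.2.1| <= B & `|p.2.2| <= B].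
Definition dist4 (p q : T) :=
  `|p.1.1 - q.1.1| + `|p.1.2 - q.1.2| + `|p.2.1 - q.2.1| + `|p.2.2 - q.2.2|.
(** Bounded and Lipschitz on a box. The class is closed under the operations that build [integrand],
    so its Lipschitz constant is obtained without differentiating it; e > 0 keeps the denominators
    and the logarithm under control. *)
Definition LB (F : T -> R) := exists2 C, 0 <= C & forall p q, inbox p -> inbox q ->
  `|F p| <= C /\ `|F p - F q| <= C * dist4 p q.

Lemma dist4_ge0 p q : 0 <= dist4 p q.
Proof. by rewrite !addr_ge0. Qed.

Lemma LB_cst c : LB (fun=> c).
Proof.
exists `|c| => // p q _ _; split => //.
by rewrite subrr normr0 mulr_ge0// dist4_ge0.
Qed.

Lemma LB_coord (F : T -> R) : (forall p, inbox p -> `|F p| <= 1 + B) ->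
  (forall p q, `|F p - F q| <= dist4 p q) -> LB F.
Proof.
move=> FB Fd; exists (1 + B); first by rewrite addr_ge0.
move=> p q ip iq; split; first exact: FB.
by rewrite (le_trans (Fd p q))// mulrDl mul1r lerDl mulr_ge0// dist4_ge0.
Qed.

Lemma LB_proj : [/\ LB (fun p => p.1.1), LB (fun p => p.1.2), LB (fun p => p.2.1) &
  LB (fun p => p.2.2)].
Proof.
have h1 x : x <= 1 -> x <= 1 + B by move=> ?; rewrite (le_trans (y := 1))// lerDl.
have h2 x : x <= B -> x <= 1 + B by move=> ?; rewrite (le_trans (y := B))// lerDr.
by split; apply: LB_coord; do ?[by move=> p [? ? ? ?]; auto];
  move=> p q; rewrite /dist4; move: (normr_ge0 (p.1.1 - q.1.1))
    (normr_ge0 (p.1.2 - q.1.2)) (normr_ge0 (p.2.1 - q.2.1))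
    (normr_ge0 (p.2.2 - q.2.2));
  set a := `|_|; set b := `|_|; set c := `|_|; set d := `|_|; lra.
Qed.

Lemma LB_D F G : LB F -> LB G -> LB (fun p => F p + G p).
Proof.
move=> [C C0 hF] [D D0 hG]; exists (C + D); first exact: addr_ge0.
move=> p q ip iq; have [h1 h2] := hF p q ip iq; have [h3 h4] := hG p q ip iq; split.
  by rewrite (le_trans (ler_normD _ _))// lerD.
rewrite (_ : F p + G p - (F q + G q) = (F p - F q) + (G p - G q)); last by ring.
by rewrite (le_trans (ler_normD _ _))// mulrDl lerD.
Qed.

Lemma LB_M F G : LB F -> LB G -> LB (fun p => F p * G p).
Proof.
move=> [C C0 hF] [D D0 hG]; exists (C * D + C * D); first by rewrite addr_ge0// mulr_ge0.
move=> p q ip iq; have [h1 h2] := hF p q ip iq; have [h3 h4] := hG p q ip iq.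
have [h5 _] := hF q p iq ip.
split; first by rewrite normrM (le_trans (ler_pM _ _ h1 h3))// lerDl mulr_ge0.
rewrite (_ : F p * G p - F q * G q = (F p - F q) * G p + F q * (G p - G q)); last by ring.
rewrite (le_trans (ler_normD _ _))// !normrM mulrDl; apply: lerD.
  by rewrite (le_trans (ler_pM _ _ h2 h3))// mulrAC.
by rewrite (le_trans (ler_pM _ _ h5 h4))// mulrA.
Qed.

Lemma LB_N F : LB F -> LB (fun p => - F p).
Proof.
move=> hF; rewrite (_ : (fun p => _) = fun p => -1 * F p).
  by apply: LB_M => //; exact: LB_cst.
by apply/funext => p; rewrite mulN1r.
Qed.

Lemma LB_V F : (forall p, e <= F p) -> LB F -> LB (fun p => (F p)^-1).
Proof.
move=> eF [C C0 hF]; exists (e^-1 + C / (e * e)).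
  by rewrite addr_ge0 ?invr_ge0 ?divr_ge0 ?mulr_ge0// ltW.
have Fp p : 0 < F p by apply: lt_le_trans (eF p).
have Fe p : (F p)^-1 <= e^-1 by rewrite lef_pV2 ?posrE.
have V0 p : 0 <= (F p)^-1 by rewrite invr_ge0 ltW.
move=> p q ip iq; have [h1 h2] := hF p q ip iq; split.
  by rewrite ger0_norm// (le_trans (Fe p))// lerDl divr_ge0// mulr_ge0// ltW.
rewrite (_ : (F p)^-1 - (F q)^-1 = (F q - F p) * ((F p)^-1 * (F q)^-1)); last first.
  by field; rewrite !gt_eqF.
rewrite normrM distrC [X in _ * X]ger0_norm ?mulr_ge0//.
apply: (@le_trans _ _ (C * dist4 p q * (e^-1 * e^-1))).
  by apply: ler_pM => //; [rewrite mulr_ge0|apply: ler_pM].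
rewrite mulrDl -invfM mulrAC lerDr mulr_ge0// ?dist4_ge0// invr_ge0 ltW//.
Qed.

Lemma LB_ln F : (forall p, e <= F p) -> LB F -> LB (fun p => ln (F p)).
Proof.
move=> eF [C C0 hF].
have Fp p : 0 < F p by apply: lt_le_trans (eF p).
have lnle x y : e <= x -> e <= y -> ln x - ln y <= `|x - y| / e.
  move=> ex ey; have x0 : 0 < x by apply: lt_le_trans ex.
  have y0 : 0 < y by apply: lt_le_trans ey.
  rewrite -ln_div ?posrE//.
  have -> : x / y = 1 + (x - y) / y by field; rewrite gt_eqF.
  apply: (@le_trans _ _ ((x - y) / y)).
    apply: le_ln1Dx; rewrite mulrBl divff ?gt_eqF//.
    by have := divr_gt0 x0 y0; lra.
  apply: (@le_trans _ _ (`|x - y| / y)).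
    by rewrite ler_wpM2r ?ler_norm// invr_ge0 ltW.
  by rewrite ler_wpM2l// lef_pV2 ?posrE.
have lnlip x y : e <= x -> e <= y -> `|ln x - ln y| <= `|x - y| / e.
  move=> ex ey; rewrite ler_norml lnle// andbT lerNl opprB distrC; exact: lnle.
exists (`|ln e| + (C + e + C) / e).
  by rewrite addr_ge0// divr_ge0 ?addr_ge0// ltW.
move=> p q ip iq; have [h1 h2] := hF p q ip iq; split.
  rewrite -(subrK (ln e) (ln (F p))) addrC (le_trans (ler_normD _ _))// lerD2l.
  rewrite (le_trans (lnlip _ _ (eF p) (lexx _)))// ler_wpM2r ?invr_ge0 ?(ltW e0)//.
  rewrite (le_trans (ler_normB _ _))// (ger0_norm (ltW e0)) -addrA lerD// lerDl //.
rewrite (le_trans (lnlip _ _ (eF p) (eF q)))//.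
apply: (@le_trans _ _ (C * dist4 p q / e)); first by rewrite ler_wpM2r ?invr_ge0 ?(ltW e0).
rewrite mulrAC ler_wpM2r ?dist4_ge0//.
apply: (@le_trans _ _ ((C + e + C) / e)); last by rewrite lerDr.
by rewrite ler_wpM2r ?invr_ge0 ?(ltW e0)// -addrA lerDl addr_ge0// ltW.
Qed.

(** The integrand is linear in the weight and its derivatives, so these factor out of a constant
    that depends only on e and B. *)
Lemma integrand_LB : exists2 C, 0 <= C & forall P Q, inbox P -> inbox Q ->
  forall p px py lap, let F (P : T) := integrand e P.1.1 P.1.2 P.2.1 P.2.2 p px py lap in
  `|F P| <= C * (`|p| + `|px| + `|py| + `|lap|) /\
  `|F P - F Q| <= C * (`|p| + `|px| + `|py| + `|lap|) * dist4 P Q.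
Proof.
have [pa pb pg ph] := LB_proj.
have sq F : LB F -> LB (fun p => F p ^+ 2).
  by move=> hF; under eq_fun do rewrite expr2; exact: LB_M.
have hq : LB (fun p => qq e p.1.1 p.1.2).
  by apply: LB_D; [apply: LB_D; exact: sq|exact: LB_cst].
have qe (p : T) : e <= qq e p.1.1 p.1.2 by exact: qq_ge.
have hqV := LB_V qe hq.
have hL : LB (fun p => Lam e p.1.1 p.1.2).
  by apply: LB_M; [exact: LB_ln|exact: LB_cst].
have hX : LB (fun p => (p.1.1 * p.2.1 + p.1.2 * p.2.2) / qq e p.1.1 p.1.2).
  by apply: LB_M => //; apply: LB_D; exact: LB_M.
have hY : LB (fun p => (p.1.1 * p.2.2 - p.1.2 * p.2.1) / qq e p.1.1 p.1.2).
  by apply: LB_M => //; apply: LB_D; [exact: LB_M|apply: LB_N; exact: LB_M].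
have hE : LB (fun p => e / 2 * ((p.2.1 ^+ 2 + p.2.2 ^+ 2) / qq e p.1.1 p.1.2 ^+ 2)).
  apply: LB_M; first exact: LB_cst.
  apply: LB_M; first by apply: LB_D; exact: sq.
  by under eq_fun do rewrite -exprVn; exact: sq.
have [C1 C10 h1] := hL; have [C2 C20 h2] := hX.
have [C3 C30 h3] := hY; have [C4 C40 h4] := hE.
exists (C1 + C2 + C3 + C4); first by rewrite !addr_ge0.
move=> P Q iP iQ p px py lap F.
have [a1 b1] := h1 P Q iP iQ; have [a2 b2] := h2 P Q iP iQ.
have [a3 b3] := h3 P Q iP iQ; have [a4 b4] := h4 P Q iP iQ.
have FE S : F S = Lam e S.1.1 S.1.2 * lap +
  (S.1.1 * S.2.1 + S.1.2 * S.2.2) / qq e S.1.1 S.1.2 * px +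
  (S.1.1 * S.2.2 - S.1.2 * S.2.1) / qq e S.1.1 S.1.2 * py +
  e / 2 * ((S.2.1 ^+ 2 + S.2.2 ^+ 2) / qq e S.1.1 S.1.2 ^+ 2) * p.
  by rewrite /F /integrand; ring.
have main (x1 x2 x3 x4 D : R) : 0 <= D -> `|x1| <= C1 * D -> `|x2| <= C2 * D ->
    `|x3| <= C3 * D -> `|x4| <= C4 * D ->
    `|x1 * lap + x2 * px + x3 * py + x4 * p| <=
    (C1 + C2 + C3 + C4) * (`|p| + `|px| + `|py| + `|lap|) * D.
  move=> D0 y1 y2 y3 y4.
  have S0 : 0 <= `|p| + `|px| + `|py| + `|lap| by rewrite !addr_ge0.
  have st x C t : 0 <= C -> `|x| <= C * D -> `|t| <= `|p| + `|px| + `|py| + `|lap| ->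
      `|x * t| <= C * D * (`|p| + `|px| + `|py| + `|lap|).
    by move=> C0 xC tS; rewrite normrM ler_pM.
  have z1 := st x1 C1 lap C10 y1 ltac:(by rewrite lerDr !addr_ge0).
  have z2 := st x2 C2 px C20 y2 ltac:(by rewrite -!addrA lerDr addrA lerDl !addr_ge0 || (rewrite -!addrA; apply: ler_wpDl => //; rewrite lerDl !addr_ge0)).
  have z3 := st x3 C3 py C30 y3 ltac:(rewrite -addrA addrC -addrA lerDl !addr_ge0//).
  have z4 := st x4 C4 p C40 y4 ltac:(by rewrite -!addrA lerDl !addr_ge0).
  rewrite (le_trans (ler_normD _ _))//.
  have w1 := ler_normD (x1 * lap + x2 * px) (x3 * py).
  have w2 := ler_normD (x1 * lap) (x2 * px).
  set S := (_ + _ + _ + `|lap|) in S0 z1 z2 z3 z4 *.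
  have -> : (C1 + C2 + C3 + C4) * S * D = C1 * D * S + C2 * D * S + C3 * D * S + C4 * D * S.
    by ring.
  apply: lerD => //; apply: (le_trans w1); apply: lerD => //.
  by apply: (le_trans w2); exact: lerD.
split.
  rewrite FE -[leRHS]mulr1; apply: main; rewrite ?mulr1//.
rewrite !FE.
set A1 := Lam _ _ _ in b1 *; set A2 := _ / _ in b2 *; set A3 := _ / _ in b3 *.
have -> (y1 y2 y3 y4 z1 z2 z3 z4 : R) :
  y1 * lap + y2 * px + y3 * py + y4 * p - (z1 * lap + z2 * px + z3 * py + z4 * p) =
  (y1 - z1) * lap + (y2 - z2) * px + (y3 - z3) * py + (y4 - z4) * p by ring.
by apply: main => //; exact: dist4_ge0.
Qed.

End lipschitz.

End integrable_plane.

Lemma common_bound5 (a b c d e : nat) :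
  exists k, [/\ (a <= k)%N, (b <= k)%N, (c <= k)%N, (d <= k)%N & (e <= k)%N].
Proof. by exists (a + b + c + d + e)%N; split; lia. Qed.

(** * The integral inequality for weak solutions *)

Section star_limit.
Context {R : realType}.
Local Notation RR := (plane R).

(** The equation 2 dbar u = h tested against the mollifier centred at z, split into real and
    imaginary parts. All derivatives fall on the kernel, so [u] itself need not be
    differentiable. *)
Definition moll_eq (eta : R -> R) (u1 u2 h1 h2 : R * R -> R) (z : R * R) :=
  forall eta', (forall x, der eta x (eta' x)) ->
  moll u1 eta' eta z - moll u2 eta eta' z = moll h1 eta eta z /\
  moll u2 eta' eta z + moll u1 eta eta' z = moll h2 eta eta z.

Variables (u1 u2 h1 h2 : R * R -> R) (eta : nat -> R -> R).
Hypotheses (u1i : inR u1) (u2i : inR u2) (h1i : inR h1) (h2i : inR h2).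
Hypothesis (etab : forall k, bump (k.+1%:R^-1) (eta k)).

Lemma moll_L1_seq (f : R * R -> R) (d : R) : inR f -> 0 < d -> exists N, forall k, (N <= k)%N ->
  \int[mu2]_z `|moll f (eta k) (eta k) z - f z| <= d /\
  inR (fun z => `|moll f (eta k) (eta k) z - f z|).
Proof.
move=> fi d0; have [d1 d10 hd1] := moll_L1 fi d0.
have [N _ hN] := near_infty_natSinv_lt (PosNum d10).
exists N => k Nk; have kd : k.+1%:R^-1 <= d1 by apply: ltW; exact: hN.
have ke := bump_kernel1 (etab k).
have h := hd1 _ _ kd (etab k).
have mf : mplane (fun z => `|moll f (eta k) (eta k) z - f z|).
  apply: measurableT_comp => //; apply: measurable_funB; last exact: inR_meas.
  by apply: continuous_measurable2; exact: moll_continuous.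
have i : inR (fun z => `|moll f (eta k) (eta k) z - f z|).
  apply/integrableP; split; first exact/measurable_EFinP.
  under eq_integral do rewrite /= normr_id.
  by rewrite (le_lt_trans h)// ltry.
by split => //; apply/inR_ereal.
Qed.

Variables (e B : R).
Hypotheses (e0 : 0 < e) (u1B : forall z, `|u1 z| <= 1) (u2B : forall z, `|u2 z| <= 1)
  (h1B : forall z, `|h1 z| <= B) (h2B : forall z, `|h2 z| <= B).

Lemma measurable_integrand (psi px py lap : R * R -> R) :
  mplane psi -> mplane px ->
  mplane py -> mplane lap ->
  mplane (fun z => integrand e (u1 z) (u2 z) (h1 z) (h2 z)
    (psi z) (px z) (py z) (lap z)).
Proof.
move=> mp mx my ml.
have [m1 m2 m3 m4] : [/\ mplane u1, mplane u2,
  mplane h1 & mplane h2] by split; exact: inR_meas.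
have q0 z : 0 < qq e (u1 z) (u2 z) by exact: qq_gt0.
have mq : mplane (fun z => qq e (u1 z) (u2 z)).
  by apply: measurable_funD => //; apply: measurable_funD; exact: measurable_funX.
have mqV : mplane (fun z => (qq e (u1 z) (u2 z))^-1).
  rewrite (_ : (fun z => _) = fun z => expR (- ln (qq e (u1 z) (u2 z)))); last first.
    by apply/funext => z; rewrite expRN lnK ?posrE.
  apply: (measurableT_comp (continuous_measurable_fun (@continuous_expR R))).
  by apply: measurableT_comp => //; exact: (measurableT_comp (@measurable_ln R) mq).
rewrite /integrand.
apply: measurable_funD.
  apply: measurable_funD.
    apply: measurable_funD; apply: measurable_funM => //.
      apply: measurable_funM => //.
      exact: (measurableT_comp (@measurable_ln R) mq).
    by apply: measurable_funM => //; apply: measurable_funD; exact: measurable_funM.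
  apply: measurable_funM => //; apply: measurable_funM => //.
  by apply: measurable_funB; exact: measurable_funM.
apply: measurable_funM; first by apply: measurable_funM.
apply: measurable_funM; first by apply: measurable_funD; exact: measurable_funX.
by under eq_fun do rewrite -exprVn; exact: measurable_funX.
Qed.

Lemma C2c_meas L (psi px py lap : R * R -> R) : C2c L psi px py lap ->
  [/\ mplane psi, mplane px,
   mplane py & mplane lap].
Proof.
move=> [_ _ [pxx [pyy [_ _ c1 c2 [lapE _]]]] [cp cx cy] _].
split; apply: continuous_measurable2 => //.
by rewrite (_ : lap = fun z => pxx z + pyy z); [exact: ctD|exact/funext].
Qed.

Lemma C2c_bound L (psi px py lap : R * R -> R) : C2c L psi px py lap ->
  exists2 W, 0 <= W & forall z, `|psi z| + `|px z| + `|py z| + `|lap z| <= W.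
Proof.
move=> [_ _ [pxx [pyy [_ _ c1 c2 [lapE s2]]]] [cp cx cy] supp].
have [W1 W10 b1] := Cc_bounded cp (fun z hz => let: And4 x _ _ _ := supp z hz in x).
have [W2 W20 b2] := Cc_bounded cx (fun z hz => let: And4 _ x _ _ := supp z hz in x).
have [W3 W30 b3] := Cc_bounded cy (fun z hz => let: And4 _ _ x _ := supp z hz in x).
have cl : continuous lap.
  by rewrite (_ : lap = fun z => pxx z + pyy z); [exact: ctD|exact/funext].
have [W4 W40 b4] := Cc_bounded cl (fun z hz => let: And4 _ _ _ x := supp z hz in x).
by exists (W1 + W2 + W3 + W4); [rewrite !addr_ge0|move=> z; rewrite !lerD].
Qed.

Lemma inR_integrand L (psi px py lap : R * R -> R) : C2c L psi px py lap ->
  inR (fun z => integrand e (u1 z) (u2 z) (h1 z) (h2 z) (psi z) (px z) (py z) (lap z)).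
Proof.
move=> ct; have [m1 m2 m3 m4] := C2c_meas ct; have [W W0 hW] := C2c_bound ct.
have B0 : 0 <= B by apply: le_trans (h1B (0, 0)).
have [C C0 hC] := integrand_LB e0 B0.
apply: (@integrable_bbox _ _ L (C * W)).
- exact: measurable_integrand.
- move=> z; have iz : inbox B (u1 z, u2 z, (h1 z, h2 z)) by split => /=.
  have [h _] := hC _ _ iz iz (psi z) (px z) (py z) (lap z).
  by rewrite (le_trans h)// ler_wpM2l.
- by move=> z /(C2c_supp ct)[-> -> -> ->]; rewrite /integrand; ring.
Qed.

(** The smooth inequality is applied to the mollified u. On the support of the weight [moll_eq]
    turns its dbar derivative into the mollified h; mollification preserves the box of values, on
    which the integrand is Lipschitz, so the inequality survives the L^1 limit. *)
Lemma star_limit L (psi px py lap : R * R -> R) (S : set (R * R)%type) (k0 : nat) :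
  C2c L psi px py lap -> (forall z, 0 <= psi z) ->
  (forall z, ~ S z -> [/\ psi z = 0, px z = 0, py z = 0 & lap z = 0]) ->
  (forall k z, (k0 <= k)%N -> S z -> moll_eq (eta k) u1 u2 h1 h2 z) ->
  0 <= \int[mu2]_z integrand e (u1 z) (u2 z) (h1 z) (h2 z)
    (psi z) (px z) (py z) (lap z).
Proof.
move=> ct psi0 supp eqS; have [W W0 hW] := C2c_bound ct.
have B0 : 0 <= B by apply: le_trans (h1B (0, 0)).
have [C C0 hC] := integrand_LB e0 B0.
have Gi := inR_integrand ct.
apply/ler_addgt0Pl => d d0.
(* Chosen so that the four L^1 errors, each at most d' and multiplied by the Lipschitz constant C W,
   cost at most d in total. *)
pose d' : R := d / (4 * (C * W + 1)).
have CW : 0 < C * W + 1 by rewrite ltr_wpDl// mulr_ge0.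
have d'0 : 0 < d' by rewrite divr_gt0// mulr_gt0.
have [N1 hN1] := moll_L1_seq u1i d'0; have [N2 hN2] := moll_L1_seq u2i d'0.
have [N3 hN3] := moll_L1_seq h1i d'0; have [N4 hN4] := moll_L1_seq h2i d'0.
have [k [n1 n2 n3 n4 kk0]] := common_bound5 N1 N2 N3 N4 k0.
have [a1 i1] := hN1 k n1; have [a2 i2] := hN2 k n2.
have [a3 i3] := hN3 k n3; have [a4 i4] := hN4 k n4.
have ke := bump_kernel1 (etab k).
have [et' det' ket'] := kernel1_der ke.
pose v1 := moll u1 (eta k) (eta k); pose v2 := moll u2 (eta k) (eta k).
pose v1x := moll u1 et' (eta k); pose v1y := moll u1 (eta k) et'.
pose v2x := moll u2 et' (eta k); pose v2y := moll u2 (eta k) et'.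
have := @smooth_star R e v1 v2 v1x v1y v2x v2y (moll u1 et' et') (moll u2 et' et') e0
  (moll_D1 u1i ke ke det' ket') (moll_D2 u1i ke ke det' ket')
  (moll_D1 u2i ke ke det' ket') (moll_D2 u2i ke ke det' ket')
  (moll_D2 u1i ket' ke det' ket') (moll_D1 u1i ke ket' det' ket')
  (moll_D2 u2i ket' ke det' ket') (moll_D1 u2i ke ket' det' ket')
  (moll_continuous u1i ke ke) (moll_continuous u2i ke ke)
  (moll_continuous u1i ket' ke) (moll_continuous u1i ke ket')
  (moll_continuous u2i ket' ke) (moll_continuous u2i ke ket')
  (moll_continuous u1i ket' ket') (moll_continuous u2i ket' ket') L psi px py lap ct psi0.
pose g1 := moll h1 (eta k) (eta k); pose g2 := moll h2 (eta k) (eta k).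
have -> : \int[mu2]_z integrand e (v1 z) (v2 z) (v1x z - v2y z) (v2x z + v1y z)
   (psi z) (px z) (py z) (lap z) =
   \int[mu2]_z integrand e (v1 z) (v2 z) (g1 z) (g2 z) (psi z) (px z) (py z) (lap z).
  apply: eq_Rintegral => z _; have [Sz|nSz] := pselect (S z).
    rewrite /v1x /v1y /v2x /v2y /g1 /g2.
    by have [-> ->] := eqS k z kk0 Sz et' det'.
  by have [-> -> -> ->] := supp z nSz; rewrite /integrand; ring.
move=> H; apply: le_trans H _.
pose E z := `|v1 z - u1 z| + `|v2 z - u2 z| + `|g1 z - h1 z| + `|g2 z - h2 z|.
have Ei : inR E by do 3 apply: inRD => //.
have Eint : \int[mu2]_z E z <= 4 * d'.
  rewrite /E (RintD (f := fun z => `|v1 z - u1 z| + `|v2 z - u2 z| + `|g1 z - h1 z|))//; last first.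
    by do 2 apply: inRD => //.
  rewrite (RintD (f := fun z => `|v1 z - u1 z| + `|v2 z - u2 z|))//; last exact: inRD.
  by rewrite RintD//; move: a1 a2 a3 a4; rewrite -/v1 -/v2 -/g1 -/g2; lra.
have dE : d = C * W * (4 * d') + 4 * d'.
  by rewrite /d'; field; rewrite gt_eqF.
apply: (@le_trans _ _ (\int[mu2]_z ((C * W) * E z + integrand e (u1 z) (u2 z) (h1 z) (h2 z)
    (psi z) (px z) (py z) (lap z)))); last first.
  rewrite RintD//; last exact: inRZ.
  rewrite RintZ// lerD2r dE.
  have : C * W * \int[mu2]_z E z <= C * W * (4 * d') by rewrite ler_wpM2l// mulr_ge0.
  by lra.
have inv z : inbox B (v1 z, v2 z, (g1 z, g2 z)).
  by split => /=; apply: (moll_bounded _ _ _ (etab k)).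
have inu z : inbox B (u1 z, u2 z, (h1 z, h2 z)) by split => /=.
apply: Rint_le.
- have cl : continuous lap.
    case: ct => _ _ [pxx [pyy [_ _ c1 c2 [lapE s2]]]] _ _.
    by rewrite (_ : lap = fun z => pxx z + pyy z); [exact: ctD|exact/funext].
  have [cp cx cy] := C2c_ct ct.
  have cv1 : continuous v1 by exact: moll_continuous.
  have cv2 : continuous v2 by exact: moll_continuous.
  have cg1 : continuous g1 by exact: moll_continuous.
  have cg2 : continuous g2 by exact: moll_continuous.
  have cq : continuous (fun z => qq e (v1 z) (v2 z)).
    by apply: ctD; [apply: ctD; apply: ctX|exact: ct_cst].
  have cqV : continuous (fun z => (qq e (v1 z) (v2 z))^-1).
    by apply: ctV => // z; rewrite gt_eqF// qq_gt0.
  apply: (@Cc_integrable _ _ L); last first.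
    by move=> z /(C2c_supp ct)[-> -> -> ->]; rewrite /integrand; ring.
  apply: ctD; last first.
    apply: ctM; first by apply: ctM => //; exact: ct_cst.
    apply: ctM; first by apply: ctD; exact: ctX.
    apply: ctV; first by move=> z; rewrite expf_neq0// gt_eqF// qq_gt0.
    exact: ctX.
  apply: ctD; last by apply: ctM => //; apply: ctM => //; apply: ctB; exact: ctM.
  apply: ctD; last by apply: ctM => //; apply: ctM => //; apply: ctD; exact: ctM.
  apply: ctM => //; apply: ctM; last exact: ct_cst.
  by apply: ct_ln => // z; exact: qq_gt0.
- by apply: inRD => //; exact: inRZ.
- move=> z; rewrite -lerBlDr.
  have [_ h] := hC _ _ (inv z) (inu z) (psi z) (px z) (py z) (lap z).
  rewrite (le_trans (ler_norm _))// (le_trans h)//= /E.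
  by rewrite ler_wpM2r ?addr_ge0// ler_wpM2l.
Qed.

End star_limit.

(** * The Cauchy transform in L^1 *)

Section cutoffs.
Context {R : realType}.
Local Notation mu := (@lebesgue_measure R).
Local Notation RR := (plane R).

Definition pos (t : R) : R := Num.max t 0.

Lemma pos_ge0 t : 0 <= pos t. Proof. by rewrite /pos le_max lexx orbT. Qed.
Lemma posE t : 0 <= t -> pos t = t. Proof. by move=> t0; rewrite /pos max_l. Qed.
Lemma pos0 t : t <= 0 -> pos t = 0. Proof. by move=> t0; rewrite /pos max_r. Qed.

Lemma continuous_pos : continuous pos.
Proof.
move=> x; have : {for x, continuous ((fun y : R => y) \max (fun=> 0 : R))}.
  by apply: continuous_max; [exact: cvg_id|exact: cvg_cst].
exact.
Qed.

Lemma der_pos2 t : der (fun x => pos x ^+ 2) t (2 * pos t).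
Proof.
apply: (@der_quad _ _ _ _ 1 1) => // h _; rewrite mul1r ler_norml.
by have [t0|t0] := leP 0 t; have [th|th] := leP 0 (t + h);
  rewrite ?(posE t0) ?(pos0 (ltW t0)) ?(posE th) ?(pos0 (ltW th)); apply/andP; split; nra.
Qed.

Lemma der_pos3 t : der (fun x => pos x ^+ 3) t (3 * pos t ^+ 2).
Proof.
have h := derM (der_id t) (der_pos2 t).
apply: (@der_ext _ (fun x => x * pos x ^+ 2)).
  move=> x; have [x0|x0] := leP 0 x; first by rewrite posE// -exprS.
  by rewrite (pos0 (ltW x0)) !expr0n/= mulr0.
apply: (der_eq h); have [x0|x0] := leP 0 t; first by rewrite posE//; ring.
by rewrite (pos0 (ltW x0)) !expr0n/=; ring.
Qed.

Definition sqn (z : R * R) : R := z.1 ^+ 2 + z.2 ^+ 2.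
Definition nrm (z : R * R) : R := Num.sqrt (sqn z).

Lemma sqn_ge0 z : 0 <= sqn z. Proof. by rewrite addr_ge0 ?sqr_ge0. Qed.
Lemma nrm_ge0 z : 0 <= nrm z. Proof. exact: sqrtr_ge0. Qed.
Lemma nrm_sq z : nrm z ^+ 2 = sqn z. Proof. by rewrite sqr_sqrtr// sqn_ge0. Qed.
Lemma nrm_le z a : 0 <= a -> (nrm z <= a) = (sqn z <= a ^+ 2).
Proof. by move=> a0; rewrite -nrm_sq ler_sqr// nnegrE nrm_ge0. Qed.
Lemma nrm_ge z a : 0 <= a -> (a <= nrm z) = (a ^+ 2 <= sqn z).
Proof. by move=> a0; rewrite -nrm_sq ler_sqr// nnegrE nrm_ge0. Qed.
Lemma nrm_cbox z a : nrm z <= a -> cbox a z.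
Proof.
move=> za; have a0 : 0 <= a by apply: le_trans (nrm_ge0 z) za.
move: za; rewrite nrm_le// /sqn => za.
by split; rewrite -(ler_sqr (x := `|_|)) ?nnegrE// real_normK ?num_real//;
  apply: le_trans za; rewrite ?lerDl ?lerDr sqr_ge0.
Qed.

Lemma D1_sqn : D1 sqn (fun z => 2 * z.1).
Proof.
apply: (D1_eq (D1D (D1M (@D1_fst R) (@D1_fst R)) (D1M (@D1_snd R) (@D1_snd R)))) => z; ring.
Qed.
Lemma D2_sqn : D2 sqn (fun z => 2 * z.2).
Proof.
apply: (D2_eq (D2D (D2M (@D2_fst R) (@D2_fst R)) (D2M (@D2_snd R) (@D2_snd R)))) => z; ring.
Qed.
Lemma ct_sqn : continuous sqn.
Proof. by apply: ctD; apply: ctX; [exact: ct_fst|exact: ct_snd]. Qed.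
Lemma ct_nrm : continuous nrm.
Proof. by apply: ct_comp; [exact: ct_sqn|move=> z; exact: sqrt_continuous]. Qed.
Lemma measurable_nrm : mplane nrm.
Proof. exact: (continuous_measurable2 ct_nrm). Qed.

Lemma measurable_nrm_itv (i : interval R) :
  measurable ([set z | nrm z \in i] : set RR).
Proof.
have := measurable_nrm measurableT (measurable_itv i); rewrite setTI; exact.
Qed.

(* A C^1 smoothstep: second difference of [2 t_+^2]. *)
Definition sstep (t : R) : R := 2 * (pos t ^+ 2 - 2 * pos (t - 2^-1) ^+ 2 + pos (t - 1) ^+ 2).
Definition sstep' (t : R) : R := 4 * (pos t - 2 * pos (t - 2^-1) + pos (t - 1)).

Lemma der_sstep t : der sstep t (sstep' t).
Proof.
have sh (c : R) x : der (fun y => pos (y - c) ^+ 2) x (2 * pos (x - c)).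
  have := der_comp (f := fun y => pos y ^+ 2) (g := fun y => y - c) (der_pos2 (x - c)) (derB (der_id x) (der_cst c x)).
  by move/der_eq; apply; rewrite subr0 mulr1.
have := derM (der_cst 2 t) (derD (derB (der_pos2 t) (derM (der_cst 2 t) (sh 2^-1 t))) (sh 1 t)).
by move/der_eq; apply; rewrite /sstep'; ring.
Qed.

Lemma continuous_sstep' : continuous sstep'.
Proof.
have h (c : R) : continuous (fun t => pos (t - c)).
  move=> t; apply: (continuous_comp (f := fun t => t - c) (g := pos)); last exact: continuous_pos.
  by apply: cvgB; [exact: cvg_id|exact: cvg_cst].
move=> t; apply: cvgM; first exact: cvg_cst.
apply: cvgD; last exact: h.
apply: cvgB; first exact: continuous_pos.
by apply: cvgM; [exact: cvg_cst|exact: h].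
Qed.

Lemma sstep_lo t : t <= 0 -> sstep t = 0 /\ sstep' t = 0.
Proof. by move=> t0; rewrite /sstep /sstep' !pos0; [split; ring|lra..]. Qed.
Lemma sstep_hi t : 1 <= t -> sstep t = 1 /\ sstep' t = 0.
Proof. by move=> t1; rewrite /sstep /sstep' !posE; [split; field|lra..]. Qed.
Lemma sstep01 t : 0 <= sstep t <= 1.
Proof.
have [t0|t0] := leP t 0; first by have [-> _] := sstep_lo t0; rewrite lexx ler01.
have [t1|t1] := leP 1 t; first by have [-> _] := sstep_hi t1; rewrite lexx ler01.
rewrite /sstep (posE (ltW t0)) (@pos0 (t - 1)); last lra.
by have [t2|t2] := leP t 2^-1; [rewrite (@pos0 (t - 2^-1)); last lra|
  rewrite (@posE (t - 2^-1)); last lra]; apply/andP; split; nra.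
Qed.

Record cutoff (chi cx cy : R * R -> R) : Prop := {
  cut_x : D1 chi cx; cut_y : D2 chi cy;
  cut_ct : [/\ continuous chi, continuous cx & continuous cy];
  cut_01 : forall z, 0 <= chi z <= 1 }.

(** The smoothstep is composed with affine functions of |z|^2 rather than of |z|, which is
    differentiable at the origin as well. *)
Lemma cutoff_annulus (s1 s2 a : R) : 0 <= s1 -> s1 < s2 -> s2 <= a ->
  exists chi cx cy, [/\ cutoff chi cx cy,
   (forall z, nrm z <= s1 -> [/\ chi z = 0, cx z = 0 & cy z = 0]),
   (forall z, s2 <= nrm z <= a -> [/\ chi z = 1, cx z = 0 & cy z = 0]) &
   (forall z, a + 1 <= nrm z -> [/\ chi z = 0, cx z = 0 & cy z = 0])].
Proof.
move=> s10 s12 s2a; have a0 : 0 <= a by lra.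
pose d := s2 ^+ 2 - s1 ^+ 2; pose d' := (a + 1) ^+ 2 - a ^+ 2.
have d0 : 0 < d by rewrite subr_gt0 ltr_sqr ?nnegrE; lra.
have d'0 : 0 < d' by rewrite subr_gt0 ltr_sqr ?nnegrE; lra.
pose f z := (sqn z - s1 ^+ 2) * d^-1; pose f' z := (sqn z - a ^+ 2) * d'^-1.
have f1 : D1 f (fun z => 2 * z.1 * d^-1).
  by apply: (D1_eq (D1M (D1B D1_sqn (D1_cst _)) (D1_cst _))) => z; ring.
have f2 : D2 f (fun z => 2 * z.2 * d^-1).
  by apply: (D2_eq (D2M (D2B D2_sqn (D2_cst _)) (D2_cst _))) => z; ring.
have f1' : D1 f' (fun z => 2 * z.1 * d'^-1).
  by apply: (D1_eq (D1M (D1B D1_sqn (D1_cst _)) (D1_cst _))) => z; ring.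
have f2' : D2 f' (fun z => 2 * z.2 * d'^-1).
  by apply: (D2_eq (D2M (D2B D2_sqn (D2_cst _)) (D2_cst _))) => z; ring.
have cf : continuous f by apply: ctM; [apply: ctB; [exact: ct_sqn|exact: ct_cst]|exact: ct_cst].
have cf' : continuous f' by apply: ctM; [apply: ctB; [exact: ct_sqn|exact: ct_cst]|exact: ct_cst].
have cs (g : R * R -> R) : continuous g -> continuous (fun z => sstep (g z)).
  by move=> cg; apply: ct_comp => // z; exact: der_continuous (der_sstep _).
have cs' (g : R * R -> R) : continuous g -> continuous (fun z => sstep' (g z)).
  by move=> cg; apply: ct_comp => // z; exact: continuous_sstep'.
have c2 (c : R) : continuous (fun z : R * R => 2 * z.1 * c) /\ continuous (fun z : R * R => 2 * z.2 * c).
  by split; apply: ctM; rewrite //; do ?[exact: ct_cst]; apply: ctM;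
    [exact: ct_cst|exact: ct_fst|exact: ct_cst|exact: ct_snd].
have [cA cB] := c2 d^-1; have [cA' cB'] := c2 d'^-1.
exists (fun z => sstep (f z) * (1 - sstep (f' z))).
exists (fun z => sstep' (f z) * (2 * z.1 * d^-1) * (1 - sstep (f' z)) +
  sstep (f z) * (0 - sstep' (f' z) * (2 * z.1 * d'^-1))).
exists (fun z => sstep' (f z) * (2 * z.2 * d^-1) * (1 - sstep (f' z)) +
  sstep (f z) * (0 - sstep' (f' z) * (2 * z.2 * d'^-1))).
split; first split.
- apply: D1M; first exact: (D1_comp (h' := sstep') (fun z => der_sstep _) f1).
  by apply: D1B; [exact: D1_cst|exact: (D1_comp (h' := sstep') (fun z => der_sstep _) f1')].
- apply: D2M; first exact: (D2_comp (h' := sstep') (fun z => der_sstep _) f2).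
  by apply: D2B; [exact: D2_cst|exact: (D2_comp (h' := sstep') (fun z => der_sstep _) f2')].
- have k1 : continuous (fun _ : R * R => 1 : R) by exact: ct_cst.
  have k0 : continuous (fun _ : R * R => 0 : R) by exact: ct_cst.
  split.
  + by apply: ctM; [exact: cs|apply: ctB => //; exact: cs].
  + apply: ctD; apply: ctM; [|by apply: ctB => //; exact: cs|exact: cs|].
      by apply: ctM => //; exact: cs'.
    by apply: ctB => //; apply: ctM => //; exact: cs'.
  + apply: ctD; apply: ctM; [|by apply: ctB => //; exact: cs|exact: cs|].
      by apply: ctM => //; exact: cs'.
    by apply: ctB => //; apply: ctM => //; exact: cs'.
- move=> z; have /andP[h1 h2] := sstep01 (f z); have /andP[h3 h4] := sstep01 (f' z).
  by apply/andP; split; nra.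
- move=> z; rewrite nrm_le// => zs.
  have fz : f z <= 0 by rewrite pmulr_lle0 ?invr_gt0// subr_le0.
  by have [-> ->] := sstep_lo fz; split; ring.
- move=> z; rewrite nrm_ge ?nrm_le//; last by lra.
  move=> /andP[z1 z2].
  have fz : 1 <= f z by rewrite ler_pdivlMr// mul1r /d lerD2r.
  have f'z : f' z <= 0 by rewrite pmulr_lle0 ?invr_gt0// subr_le0.
  by have [-> ->] := sstep_hi fz; have [-> ->] := sstep_lo f'z; split; ring.
- move=> z; rewrite nrm_ge; last by lra.
  move=> z1; have fz : 1 <= f z.
    rewrite ler_pdivlMr// mul1r /d lerD2r; apply: le_trans z1.
    by rewrite ler_sqr ?nnegrE; lra.
  have f'z : 1 <= f' z by rewrite ler_pdivlMr// mul1r /d' lerD2r.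
  by have [-> ->] := sstep_hi fz; have [-> ->] := sstep_hi f'z; split; ring.
Qed.

End cutoffs.

(** * L^1 bounds for the regularized Cauchy kernel *)

Section kernel_bounds.
Context {R : realType}.
Local Notation RR := (plane R).

(** The regularization of 1 / |z|; it dominates both components of the regularized Cauchy kernel,
    see [ck_le]. *)
Definition ks (t : R) (z : R * R) : R := (Num.sqrt (cden t z))^-1.

Lemma cden_gt0 t (z : R * R) : 0 < t -> 0 < cden t z.
Proof. by move=> t0; rewrite /cden ltr_wpDl// addr_ge0 ?sqr_ge0. Qed.

Lemma ks_gt0 t (z : R * R) : 0 < t -> 0 < ks t z.
Proof. by move=> t0; rewrite invr_gt0 sqrtr_gt0 cden_gt0. Qed.

Lemma ct_cden t : continuous (@cden R t).
Proof. by apply: ctD; [exact: ct_sqn|exact: ct_cst]. Qed.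

Lemma ct_ks t : 0 < t -> continuous (ks t).
Proof.
move=> t0; apply: ctV; first by move=> z; rewrite gt_eqF// sqrtr_gt0 cden_gt0.
by apply: ct_comp; [exact: ct_cden|move=> z; exact: sqrt_continuous].
Qed.

Lemma der_sqrt (x : R) : 0 < x -> der Num.sqrt x (2 * Num.sqrt x)^-1.
Proof. by move=> x0; rewrite /der; exact: is_derive1_sqrt. Qed.

Lemma mu2_cbox (L : R) : 0 <= L -> mu2 (cbox L) = (4 * L ^+ 2)%:E.
Proof.
move=> L0; have h : lebesgue_measure [set` `[- L, L]%R] = (2 * L)%:E.
  rewrite lebesgue_measure_itv/= lte_fin; case: ltP => h.
    by rewrite -EFinB; congr EFin; ring.
  by congr EFin; lra.
transitivity (lebesgue_measure [set` `[- L, L]%R] * lebesgue_measure [set` `[- L, L]%R])%E.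
  by rewrite cboxE; exact: product_measure1E.
by rewrite h -EFinM; congr EFin; ring.
Qed.

Lemma Rint_indic_cbox (L : R) : 0 <= L ->
  \int[mu2]_z (\1_(cbox L) z : R) = 4 * L ^+ 2.
Proof.
move=> L0; have h := mu2_cbox L0.
have mc := @measurable_cbox R L.
by rewrite /Rintegral integral_indic// setIT; move: h => /= ->.
Qed.

(* The field [z / sqrt (|z|^2 + t)] has norm at most [1] and divergence at least
   [ks t]; testing it against a cutoff bounds [ks t] in [L^1] near the origin,
   uniformly in [t]. *)
Lemma ks_disc (t eta : R) : 0 < t -> 0 < eta ->
  (\int[mu2]_(z in [set z | (nrm z <= eta)%R]) (ks t z)%:E <= (64 * eta)%:E)%E.
Proof.
move=> t0 eta0.
(* The cutoff is the square of (1 - |z|^2 / (4 eta^2))_+, supported in the disc of radius 2 eta and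
   at least 9 / 16 on the disc of radius eta. *)
pose m : R := (4 * eta ^+ 2)^-1.
have m0 : 0 < m by rewrite invr_gt0 mulr_gt0// exprn_gt0.
pose c (z : R * R) := pos (1 - m * sqn z).
pose chi z := c z ^+ 2.
have lin1 : D1 (fun z => 1 - m * sqn z) (fun z => - (2 * m * z.1)).
  by apply: (D1_eq (D1B (D1_cst _) (D1M (D1_cst _) (@D1_sqn R)))) => z; ring.
have lin2 : D2 (fun z => 1 - m * sqn z) (fun z => - (2 * m * z.2)).
  by apply: (D2_eq (D2B (D2_cst _) (D2M (D2_cst _) (@D2_sqn R)))) => z; ring.
have chi1 : D1 chi (fun z => - (4 * m * z.1) * c z).
  apply: (D1_eq (D1_comp (h := fun x => pos x ^+ 2) (h' := fun x => 2 * pos x)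
    (fun z => der_pos2 _) lin1)) => z; rewrite /c; ring.
have chi2 : D2 chi (fun z => - (4 * m * z.2) * c z).
  apply: (D2_eq (D2_comp (h := fun x => pos x ^+ 2) (h' := fun x => 2 * pos x)
    (fun z => der_pos2 _) lin2)) => z; rewrite /c; ring.
pose r (z : R * R) := Num.sqrt (cden t z).
have d0 z : 0 < cden t z by exact: cden_gt0.
have r0 z : 0 < r z by rewrite sqrtr_gt0.
have rn0 z : r z != 0 by rewrite gt_eqF.
have r2 z : r z ^+ 2 = sqn z + t by rewrite /r sqr_sqrtr// ltW.
have den1 : D1 (cden t) (fun z => 2 * z.1).
  by apply: (D1_eq (D1D (@D1_sqn R) (D1_cst t))) => z; rewrite addr0.
have den2 : D2 (cden t) (fun z => 2 * z.2).
  by apply: (D2_eq (D2D (@D2_sqn R) (D2_cst t))) => z; rewrite addr0.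
have dr1 : D1 r (fun z => z.1 / r z).
  apply: (D1_eq (D1_comp (h' := fun x => (2 * Num.sqrt x)^-1) (fun z => der_sqrt (d0 z)) den1)).
  by move=> z; rewrite -/(r z); field.
have dr2 : D2 r (fun z => z.2 / r z).
  apply: (D2_eq (D2_comp (h' := fun x => (2 * Num.sqrt x)^-1) (fun z => der_sqrt (d0 z)) den2)).
  by move=> z; rewrite -/(r z); field.
pose Fx z := (r z)^-1 - z.1 ^+ 2 / r z ^+ 3; pose Fy z := (r z)^-1 - z.2 ^+ 2 / r z ^+ 3.
have dF1 : D1 (fun z => z.1 * (r z)^-1) Fx.
  by apply: (D1_eq (D1M (@D1_fst R) (D1V rn0 dr1))) => z; rewrite /Fx; field.
have dF2 : D2 (fun z => z.2 * (r z)^-1) Fy.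
  by apply: (D2_eq (D2M (@D2_snd R) (D2V rn0 dr2))) => z; rewrite /Fy; field.
have c0 z : ~ cbox (2 * eta) z -> c z = 0.
  move=> nz; apply: pos0; rewrite subr_le0 -ler_pdivrMl// mulr1 /m invrK.
  rewrite leNgt; apply/negP => h; apply: nz; apply: nrm_cbox; rewrite nrm_le; last by lra.
  by rewrite exprMn (_ : 2 ^+ 2 = 4 :> R) ?ltW//; ring.
pose Px z := (- (4 * m * z.1) * c z) * (z.1 * (r z)^-1) + chi z * Fx z.
pose Qy z := (- (4 * m * z.2) * c z) * (z.2 * (r z)^-1) + chi z * Fy z.
have dP : D1 (fun z => chi z * (z.1 * (r z)^-1)) Px by exact: D1M.
have dQ : D2 (fun z => chi z * (z.2 * (r z)^-1)) Qy by exact: D2M.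
have cc : continuous c.
  apply: ct_comp; last by move=> z; exact: continuous_pos.
  by apply: ctB; [exact: ct_cst|apply: ctM; [exact: ct_cst|exact: ct_sqn]].
have cr : continuous r by apply: ct_comp; [exact: ct_cden|move=> z; exact: sqrt_continuous].
have crV : continuous (fun z => (r z)^-1) by exact: ctV.
have cr3V : continuous (fun z => (r z ^+ 3)^-1).
  by apply: ctV; [move=> z; rewrite expf_neq0|exact: ctX].
have cf := @ct_fst R; have cs := @ct_snd R.
have kc (a : R) : continuous (fun _ : R * R => a) by exact: ct_cst.
have cFx : continuous Fx by apply: ctB => //; apply: ctM => //; exact: ctX.
have cFy : continuous Fy by apply: ctB => //; apply: ctM => //; exact: ctX.
have cPx : continuous Px.
  apply: ctD; apply: ctM => //; [|exact: ctM|exact: ctX].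
  by apply: ctM => //; apply: ctN; apply: ctM => //; exact: ctM.
have cQy : continuous Qy.
  apply: ctD; apply: ctM => //; [|exact: ctM|exact: ctX].
  by apply: ctM => //; apply: ctN; apply: ctM => //; exact: ctM.
have Px0 z : ~ cbox (2 * eta) z -> Px z = 0 by move=> /c0 h; rewrite /Px /chi h; ring.
have Qy0 z : ~ cbox (2 * eta) z -> Qy z = 0 by move=> /c0 h; rewrite /Qy /chi h; ring.
have iP := Cc_integrable cPx Px0; have iQ := Cc_integrable cQy Qy0.
have int0 : \int[mu2]_z (Px z + Qy z) = 0.
  rewrite RintD// (int_D1 dP cPx _ Px0); last by move=> z /c0 h; rewrite /chi h; ring.
  by rewrite (int_D2 dQ cQy _ Qy0) ?addr0// => z /c0 h; rewrite /chi h; ring.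
(* The gradient of the cutoff has size at most 2 / eta on a square of area 16 eta^2: this gives 32
   eta, and the factor 2 needed because the cutoff is at least 1/2 on the small disc gives 64
   eta. *)
pose W z : R := 2 / eta * \1_(cbox (2 * eta)) z.
have iW : inR W.
  apply: (@integrable_bbox _ _ (2 * eta) (2 / eta)).
  - by apply: measurable_funM => //; apply: measurable_indic; exact: measurable_cbox.
  - move=> z; rewrite /W indicE; case: (_ \in _); rewrite ?mulr1 ?mulr0 ?normr0 ?ger0_norm//;
      by rewrite divr_ge0// ltW.
  - by move=> z nz; rewrite /W indicE memNset// mulr0.
have ic : inR (fun z => chi z * (r z)^-1).
  by apply: (@Cc_integrable _ _ (2 * eta)); [apply: ctM => //; exact: ctX|
    move=> z /c0 h; rewrite /chi h; ring].
have sq0 z := @sqn_ge0 R z.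
have key z : chi z * (r z)^-1 <= (Px z + Qy z) + W z.
  have [bz|nz] := pselect (cbox (2 * eta) z); last first.
    by rewrite Px0// Qy0// /chi c0// /W indicE memNset// expr0n/= mul0r mulr0 !addr0.
  have -> : Px z + Qy z = chi z * (r z)^-1 + chi z * t / r z ^+ 3 - 4 * m * sqn z / r z * c z.
    rewrite /Px /Qy /Fx /Fy.
    have -> : t = r z ^+ 2 - z.1 ^+ 2 - z.2 ^+ 2 by rewrite r2 /sqn; ring.
    by rewrite /sqn; field.
  have h1 : 0 <= chi z * t / r z ^+ 3.
    apply: divr_ge0; last by apply: exprn_ge0; exact: ltW.
    by apply: mulr_ge0; [exact: sqr_ge0|exact: ltW].
  have h2 : 4 * m * sqn z / r z * c z <= W z.
    rewrite /W indicE mem_set// mulr1.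
    have [cz|cz] := leP (1 - m * sqn z) 0.
      by rewrite /c pos0// mulr0 divr_ge0// ltW.
    have c1 : c z <= 1.
      by rewrite /c posE ?(ltW cz)// gerBl mulr_ge0// ltW.
    have msq : m * sqn z <= 1 by lra.
    have n2 : nrm z <= 2 * eta.
      rewrite nrm_le; last by lra.
      rewrite -(ler_pM2l m0) (le_trans msq)// /m exprMn (_ : 2 ^+ 2 = 4 :> R); last by ring.
      by rewrite mulVf// gt_eqF// mulr_gt0// exprn_gt0.
    have nr : nrm z <= r z by apply: ler_wsqrtr; rewrite lerDl ltW.
    have n0 := nrm_ge0 z.
    apply: (@le_trans _ _ (4 * m * sqn z / r z)).
      rewrite ler_piMr//; apply: divr_ge0; last exact: ltW.
      by apply: mulr_ge0 => //; apply: mulr_ge0 => //; exact: ltW.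
    rewrite ler_pdivrMr// -nrm_sq expr2.
    apply: (@le_trans _ _ (4 * m * (2 * eta) * r z)).
      rewrite mulrA; have m4 : 0 <= 4 * m by apply: mulr_ge0 => //; exact: ltW.
      apply: ler_pM => //; first exact: mulr_ge0.
      by rewrite ler_wpM2l.
    rewrite ler_wpM2r//; first exact: ltW.
    rewrite /m le_eqVlt; apply/orP; left; apply/eqP.
    by field; rewrite gt_eqF.
  by lra.
have bound : \int[mu2]_z (chi z * (r z)^-1) <= 32 * eta.
  have le1 : \int[mu2]_z (chi z * (r z)^-1) <= \int[mu2]_z ((Px z + Qy z) + W z).
    by apply: Rint_le => //; apply: inRD => //; exact: inRD.
  apply: (le_trans le1); rewrite (RintD (inRD iP iQ) iW) int0 add0r /W RintZ; last first.
    apply: (@integrable_bbox _ _ (2 * eta) 1).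
    - by apply: measurable_indic; exact: measurable_cbox.
    - by move=> z; rewrite indicE; case: (_ \in _); rewrite ?normr0 ?normr1.
    - by move=> z nz; rewrite indicE memNset.
  rewrite Rint_indic_cbox; last by lra.
  by rewrite le_eqVlt; apply/orP; left; apply/eqP; field; rewrite gt_eqF.
have mD : measurable ([set z | nrm z <= eta] : set RR).
  rewrite (_ : mkset _ = [set z | nrm z \in `]-oo, eta]]); first exact: measurable_nrm_itv.
  by apply/seteqP; split=> z /=; rewrite in_itv.
rewrite integral_mkcond.
apply: (@le_trans _ _ (\int[mu2]_z (2 * (chi z * (r z)^-1))%:E)%E).
  apply: ge0_le_integral => //.
  - by move=> z _; rewrite patchE; case: ifP => // _; rewrite lee_fin ltW// ks_gt0.
  - apply/(measurable_restrictT _ mD)/measurable_funTS/measurable_EFinP.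
    by apply: continuous_measurable2; exact: ct_ks.
  - apply/measurable_EFinP; apply: continuous_measurable2; apply: ctM => //.
    by apply: ctM => //; exact: ctX.
  - move=> z _; rewrite patchE; case: ifPn => [|_].
      rewrite inE/= nrm_le; last exact: ltW.
      move=> hz; rewrite lee_fin /ks -/(r z) mulrA ler_peMl//; first by rewrite invr_ge0 ltW.
      have : 3 / 4 <= c z.
        have h : m * sqn z <= 4^-1.
          apply: (@le_trans _ _ (m * eta ^+ 2)); first by rewrite ler_wpM2l// ltW.
          by rewrite /m le_eqVlt; apply/orP; left; apply/eqP; field; rewrite gt_eqF.
        by rewrite /c posE; lra.
      by rewrite /chi; nra.
    rewrite lee_fin; apply: mulr_ge0 => //; apply: mulr_ge0; first exact: sqr_ge0.
    by rewrite invr_ge0 ltW.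
apply/(inR_ereal _ (inRZ 2 ic)); rewrite RintZ//.
lra.
Qed.


Lemma measurable_sub_pt (b : R * R) :
  mplane (fun z : R * R => (z :-: b) : RR).
Proof. exact: (measurable_shift2 (- b.1, - b.2)). Qed.

Lemma measurable_ks t : 0 < t -> mplane (@ks t).
Proof. by move=> t0; apply: continuous_measurable2; exact: ct_ks. Qed.

Lemma ks_le t (z : R * R) eta : 0 < t -> 0 < eta -> eta <= nrm z -> ks t z <= eta^-1.
Proof.
move=> t0 e0 ez; rewrite /ks lef_pV2 ?posrE ?sqrtr_gt0 ?cden_gt0//.
by rewrite (le_trans ez)// ler_wsqrtr// lerDl ltW.
Qed.

(** Within distance eta of b the bound is [ks_disc] translated; farther away the kernel is at most 1
    / eta. *)
Lemma ks_set (A : set RR) t eta (b : R * R) : measurable A -> 0 < t -> 0 < eta ->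
  (\int[mu2]_(z in A) (ks t (z :-: b)%R)%:E <=
   (64 * eta)%:E + (eta^-1)%:E * mu2 A)%E.
Proof.
move=> mA t0 e0.
have ks0 z : 0 <= ks t z by rewrite ltW// ks_gt0.
have mk : mplane (fun z : R * R => (ks t (z :-: b))%:E).
  by apply/measurable_EFinP; exact: (measurableT_comp (measurable_ks t0) (measurable_sub_pt b)).
pose B : set RR := [set z | nrm z <= eta].
have mB : measurable B.
  rewrite (_ : B = [set z | nrm z \in `]-oo, eta]]); first exact: measurable_nrm_itv.
  by apply/seteqP; split=> z /=; rewrite in_itv.
have mks : mplane (fun z : RR => (ks t z * \1_B z)%:E).
  apply/measurable_EFinP; apply: measurable_funM; first exact: measurable_ks.
  exact: measurable_indic.
have mks' : mplane (fun z : RR =>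
    (ks t (z :-: b) * \1_B (z :-: b)%R)%:E).
  exact: (measurableT_comp mks (measurable_sub_pt b)).
have mI : mplane (fun z : RR => (eta^-1)%:E * (\1_A z)%:E)%E.
  by apply: measurable_funeM; exact/measurable_EFinP/measurable_indic.
rewrite integral_mkcond.
apply: (@le_trans _ _ (\int[mu2]_z ((ks t (z :-: b) *
    \1_B (z :-: b))%R%:E + (eta^-1)%:E * (\1_A z)%:E))%E).
  apply: ge0_le_integral => //.
  - by move=> z _; rewrite patchE; case: ifP => // _; rewrite lee_fin.
  - by apply/(measurable_restrictT _ mA)/measurable_funTS.
  - exact: emeasurable_funD.
  - move=> z _; rewrite -EFinM -EFinD patchE; case: ifPn => zA; last first.
      by rewrite lee_fin addr_ge0// mulr_ge0// invr_ge0 ltW.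
    rewrite lee_fin [X in _ + _ * X]indicE zA mulr1 indicE.
    case: (boolP (_ \in B)) => [_|]; first by rewrite mulr1 lerDl invr_ge0 ltW.
    rewrite notin_setE /B/= => /negP; rewrite -ltNge => h.
    by rewrite mulr0 add0r; apply: ks_le => //; exact: ltW.
rewrite ge0_integralD//; last 2 first.
- by move=> z _; rewrite lee_fin mulr_ge0.
- by move=> z _; rewrite mule_ge0// lee_fin invr_ge0 ltW.
apply: leeD.
  rewrite (@ge0_integral_shift2 _ (fun z => (ks t z * \1_B z)%:E) (- b.1, - b.2))//; last first.
    by move=> z; rewrite lee_fin mulr_ge0.
  apply: le_trans (ks_disc t0 e0); rewrite [leRHS]integral_mkcond.
  apply: ge0_le_integral => //.
  - by move=> z _; rewrite lee_fin mulr_ge0.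
  - apply/(measurable_restrictT _ mB)/measurable_funTS/measurable_EFinP.
    exact: measurable_ks.
  - move=> z _; rewrite patchE indicE -/B; case: (z \in B); first by rewrite mulr1.
    by rewrite mulr0.
rewrite ge0_integralZl//.
- by rewrite integral_indic// setIT.
- exact/measurable_EFinP/measurable_indic.
- by rewrite lee_fin invr_ge0 ltW.
Qed.

Lemma omega2_bound (f : R * R -> R) h : inR f ->
  (omega2 f h <= \int[mu2]_z `|f z|%:E + \int[mu2]_z `|f z|%:E)%E.
Proof.
move=> fi; have mf := inR_meas fi.
have ma : mplane (fun z => `|f z|%:E) by exact/measurable_EFinP/measurableT_comp.
have mh : mplane (fun z => `|f (z.1 + h.1, z.2 + h.2)|%:E).
  exact: (measurableT_comp ma (measurable_shift2 h)).
rewrite -{1}(ge0_integral_shift2 h ma)// -ge0_integralD//.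
apply: ge0_le_integral => //.
- by apply: measurable_diff2 => //; exact: measurable_pt2.
- exact: emeasurable_funD.
- by move=> z _; rewrite -EFinD lee_fin ler_normB.
Qed.

Lemma ct_poisson t : 0 < t -> continuous (@poisson R t).
Proof.
move=> t0; apply: ctM; first exact: ct_cst.
apply: ctV; first by move=> z; rewrite expf_neq0// gt_eqF// cden_gt0.
by apply: ctX; exact: ct_cden.
Qed.

Lemma poisson_ge0 t (z : R * R) : 0 < t -> 0 <= poisson t z.
Proof. by move=> t0; apply: divr_ge0; [exact: ltW|exact: sqr_ge0]. Qed.

(** Cut off to a square, so that integrability and an upper bound on the far part are immediate. The
    mass is only estimated: it is at least 4 / 9 here, and it is bounded by 13 inside [local_uc]. *)
Definition tpoisson (L t : R) (z : R * R) : R := poisson t z * \1_(cbox L) z.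

Lemma tpoisson_ge0 L t z : 0 < t -> 0 <= tpoisson L t z.
Proof. by move=> t0; rewrite mulr_ge0// poisson_ge0. Qed.

Lemma inR_tpoisson L t : 0 < t -> inR (tpoisson L t).
Proof.
move=> t0; have mc := @measurable_cbox R L.
apply: (@integrable_bbox _ _ L (t / t ^+ 2)).
- apply: measurable_funM; last exact: measurable_indic.
  by apply: continuous_measurable2; exact: ct_poisson.
- move=> z; rewrite ger0_norm ?tpoisson_ge0// /tpoisson indicE.
  have h : poisson t z <= t / t ^+ 2.
    rewrite ler_wpM2l ?(ltW t0)// lef_pV2 ?posrE ?exprn_gt0 ?cden_gt0//.
    have tc : t <= cden t z by rewrite lerDr sqn_ge0.
    by rewrite ler_sqr// nnegrE ltW// cden_gt0.
  by case: (_ \in _); rewrite ?mulr1 ?mulr0// (le_trans (poisson_ge0 z t0)).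
- by move=> z nz; rewrite /tpoisson indicE memNset// mulr0.
Qed.

(** On the square of half-side sqrt t, whose area is 4 t, the denominator is at most (3 t)^2 and the
    kernel at least 1 / (9 t). *)
Lemma tpoisson_mass L t : 0 < t -> t <= 1 -> 1 <= L ->
  4 / 9 <= \int[mu2]_z tpoisson L t z.
Proof.
move=> t0 t1 L1; have st0 : 0 < Num.sqrt t by rewrite sqrtr_gt0.
have st1 : Num.sqrt t <= 1 by rewrite -sqrtr1 ler_wsqrtr.
have st2 : Num.sqrt t ^+ 2 = t by rewrite sqr_sqrtr// ltW.
have mc := @measurable_cbox R (Num.sqrt t).
have ii := @inR_cbox R (Num.sqrt t).
apply: (@le_trans _ _ (\int[mu2]_z ((9 * t)^-1 * \1_(cbox (Num.sqrt t)) z))).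
  rewrite RintZ// Rint_indic_cbox; last exact: ltW.
  rewrite st2 le_eqVlt; apply/orP; left; apply/eqP.
  by field; rewrite gt_eqF.
apply: Rint_le; [exact: inRZ|exact: inR_tpoisson|move=> z].
rewrite indicE; case: (boolP (_ \in _)) => [|_]; last by rewrite mulr0 tpoisson_ge0.
rewrite inE => bz; rewrite mulr1 /tpoisson indicE mem_set; last first.
  by apply: (cbox_sub _ bz); rewrite (le_trans st1).
rewrite mulr1 /poisson.
have sq : sqn z <= 2 * t.
  case: bz => b1 b2; rewrite /sqn -(real_normK (num_real z.1)) -(real_normK (num_real z.2)).
  have h1 : `|z.1| ^+ 2 <= t by rewrite -st2 ler_sqr ?nnegrE// ltW.
  have h2 : `|z.2| ^+ 2 <= t by rewrite -st2 ler_sqr ?nnegrE// ltW.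
  lra.
have c3 : cden t z <= 3 * t by rewrite /cden -/(sqn z); lra.
have -> : (9 * t)^-1 = t / (3 * t) ^+ 2 by field; rewrite gt_eqF.
rewrite ler_wpM2l ?(ltW t0)// lef_pV2 ?posrE ?exprn_gt0 ?cden_gt0 ?mulr_gt0//.
by rewrite ler_sqr ?nnegrE ?(ltW (cden_gt0 _ _))// mulr_ge0// ltW.
Qed.

(* [tpoisson L t] is an approximate identity, up to its total mass, as [t]
   tends to [0]. *)
Lemma tpoisson_approx (f : R * R -> R) (L e : R) : inR f -> 0 < e -> 0 <= L ->
  exists2 t0, 0 < t0 & forall t, 0 < t -> t <= t0 ->
  (\int[mu2]_b \int[mu2]_z (`|f z - f b| * tpoisson L t (z :-: b)%R)%:E <=
   (e * (\int[mu2]_z tpoisson L t z + 1))%:E)%E.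
Proof.
move=> fi e0 L0; have mf := inR_meas fi.
have [d d0 hd] := omega2_small fi e0.
pose N := \int[mu2]_z `|f z|.
have N0 : 0 <= N by exact: Rint_ge0.
have NE : (\int[mu2]_z `|f z|%:E = N%:E)%E.
  by rewrite fineK//; apply: (integrable_fin_num measurableT (inR_norm fi)).
(* Beyond the distance d the kernel is at most t / d^4 and the modulus at most 2 N; over a square of
   area 4 L^2 this contributes at most t C, hence at most e. *)
pose C := (2 * N + 1) / d ^+ 4 * (4 * L ^+ 2 + 1).
have d4 : 0 < d ^+ 4 by rewrite exprn_gt0.
have C0 : 0 < C.
  apply: mulr_gt0; last by rewrite ltr_wpDl// mulr_ge0// sqr_ge0.
  by apply: divr_gt0 => //; rewrite ltr_wpDl// mulr_ge0.
exists (e / C); first by rewrite divr_gt0.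
move=> t t0 te; have Ti := inR_tpoisson L t0.
rewrite approx_identity//; [|exact: inR_meas|by move=> z; exact: tpoisson_ge0].
have mc := @measurable_cbox R L.
have ii := @inR_cbox R L.
pose W h : R := e * tpoisson L t h + (2 * N) * (t / d ^+ 4) * \1_(cbox L) h.
have Wi : inR W by apply: inRD; exact: inRZ.
apply: (@le_trans _ _ (\int[mu2]_h (W h)%:E)%E).
  apply: ge0_le_integral => //.
  - by move=> h _; rewrite mule_ge0 ?lee_fin ?tpoisson_ge0// integral_ge0.
  - apply: emeasurable_funM; first by apply/measurable_EFinP; exact: inR_meas.
    exact: measurable_omega2.
  - by apply/measurable_EFinP; exact: inR_meas.
  - move=> h _; have [bL|nL] := pselect (cbox L h); last first.
      by rewrite /W /tpoisson !indicE memNset// !mulr0 mul0e addr0.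
    have T0 := tpoisson_ge0 L h t0.
    have [[h1 h2]|nd] := pselect (`|h.1| <= d /\ `|h.2| <= d).
      apply: (@le_trans _ _ ((tpoisson L t h)%:E * e%:E)%E).
        by rewrite lee_wpmul2l ?lee_fin//; exact: hd.
      rewrite -EFinM lee_fin mulrC /W lerDl; apply: mulr_ge0 => //.
      by apply: mulr_ge0; [rewrite mulr_ge0|apply: divr_ge0; exact: ltW].
    apply: (@le_trans _ _ ((tpoisson L t h)%:E * (2 * N)%:E)%E).
      rewrite lee_wpmul2l ?lee_fin//; apply: (le_trans (omega2_bound h fi)).
      by rewrite NE -EFinD lee_fin; lra.
    rewrite -EFinM lee_fin mulrC /W indicE mem_set// mulr1.
    apply: (@le_trans _ _ (2 * N * (t / d ^+ 4))); last first.
      by rewrite lerDr mulr_ge0// ltW.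
    rewrite ler_wpM2l ?mulr_ge0// /tpoisson indicE mem_set// mulr1 /poisson.
    rewrite ler_wpM2l ?(ltW t0)// lef_pV2 ?posrE ?exprn_gt0 ?cden_gt0//.
    rewrite -[4%N]/(2 * 2)%N exprM ler_sqr ?nnegrE ?sqr_ge0 ?(ltW (cden_gt0 _ _))//.
    rewrite /cden -/(sqn h); apply: (@le_trans _ _ (sqn h)); last by rewrite lerDl ltW.
    rewrite /sqn -(real_normK (num_real h.1)) -(real_normK (num_real h.2)).
    have [h1|h1] := leP `|h.1| d.
      have [h2|h2] := leP `|h.2| d; first by case: nd.
      have : d ^+ 2 <= `|h.2| ^+ 2 by rewrite ler_sqr ?nnegrE//; exact: ltW.
      by have := sqr_ge0 `|h.1|; lra.
    have : d ^+ 2 <= `|h.1| ^+ 2 by rewrite ler_sqr ?nnegrE//; exact: ltW.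
    by have := sqr_ge0 `|h.2|; lra.
apply/(inR_ereal _ Wi); rewrite RintD; [|exact: inRZ..].
rewrite !RintZ// Rint_indic_cbox// mulrDr mulr1 lerD2l.
have tC : t * C <= e by rewrite -ler_pdivlMr.
apply: le_trans tC.
rewrite (_ : t * C = (2 * N + 1) * (t / d ^+ 4) * (4 * L ^+ 2 + 1)); last first.
  by rewrite /C; field; rewrite gt_eqF.
have td : 0 <= t / d ^+ 4 by apply: divr_ge0; exact: ltW.
apply: ler_pM.
- by apply: mulr_ge0 => //; rewrite mulr_ge0.
- by rewrite mulr_ge0// sqr_ge0.
- by rewrite ler_wpM2r// lerDl.
- by rewrite lerDl.
Qed.

Lemma ck_le t (z : R * R) : 0 < t -> `|ck1 t z| <= ks t z /\ `|ck2 t z| <= ks t z.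
Proof.
move=> t0; have d0 := cden_gt0 z t0; pose r := Num.sqrt (cden t z).
have r0 : 0 < r by rewrite sqrtr_gt0.
have r2 : cden t z = r ^+ 2 by rewrite sqr_sqrtr// ltW.
have h (x : R) : x ^+ 2 <= cden t z -> `|x| <= r.
  move=> xd; rewrite -ler_sqr ?nnegrE//; last exact: ltW.
  by rewrite real_normK ?num_real// -r2.
have st : sqn z <= cden t z by rewrite lerDl ltW.
rewrite /ck1 /ck2 /ks -/r r2 !normrM normrN normfV (ger0_norm (sqr_ge0 r)).
split; rewrite expr2 invfM mulrA ler_piMl ?invr_ge0 ?(ltW r0)// ler_pdivrMr// mul1r;
  apply: h; apply: le_trans st; rewrite /sqn ?lerDl ?lerDr sqr_ge0//.
Qed.


Lemma inR_shift (f : R * R -> R) (h : R * R) : inR f ->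
  inR (fun z => f (z.1 + h.1, z.2 + h.2)) /\
  \int[mu2]_z f (z.1 + h.1, z.2 + h.2) = \int[mu2]_z f z.
Proof.
move=> fi; have mf := inR_meas fi.
have key (g : R * R -> R) : mplane g -> (forall z, 0 <= g z) ->
  (\int[mu2]_z (g (z.1 + h.1, z.2 + h.2)%R)%:E = \int[mu2]_z (g z)%:E)%E.
  move=> mg g0; apply: (@ge0_integral_shift2 _ (fun z => (g z)%:E) h).
    exact/measurable_EFinP.
  by move=> z; rewrite lee_fin.
have si (g : R * R -> R) : inR g -> inR (fun z => g (z.1 + h.1, z.2 + h.2)).
  move=> gi; have mg := inR_meas gi; apply/integrableP; split.
    by apply/measurable_EFinP; exact: measurable_pt2.
  under eq_integral do rewrite abse_EFin.
  rewrite (key (fun z => `|g z|))//; last exact: measurableT_comp.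
  by case/integrableP: gi => _; under eq_integral do rewrite abse_EFin.
split; first exact: si.
pose fp z := Num.max (f z) 0; pose fn z := Num.max (- f z) 0.
have m0 : measurable_fun [set: RR] (fun=> 0 : R) by exact: measurable_cst.
have pi' : inR fp.
  apply: (inR_le _ (inR_norm fi)); first exact: measurable_maxr.
  by move=> z; rewrite /fp ger0_norm ?le_max ?lexx ?orbT// ge_max ler_norm normr_ge0.
have ni : inR fn.
  apply: (inR_le _ (inR_norm fi)).
    apply: measurable_maxr => //; exact: measurableT_comp.
  by move=> z; rewrite /fn ger0_norm ?le_max ?lexx ?orbT// ge_max normr_ge0 -normrN ler_norm.
have fE z : f z = fp z - fn z.
  rewrite /fp /fn; have [h0|h0] := leP 0 (f z).
    by rewrite [X in _ - X]max_r ?oppr_le0// subr0.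
  by rewrite [X in _ - X]max_l ?oppr_ge0 ?opprK ?add0r// ltW.
transitivity (\int[mu2]_z fp (z.1 + h.1, z.2 + h.2) - \int[mu2]_z fn (z.1 + h.1, z.2 + h.2)).
  by rewrite -RintB; [apply: eq_Rintegral => z _; exact: fE|exact: si|exact: si].
transitivity (\int[mu2]_z fp z - \int[mu2]_z fn z).
  rewrite /Rintegral !key//; [exact: inR_meas|by move=> z; rewrite le_max lexx orbT|
    exact: inR_meas|by move=> z; rewrite le_max lexx orbT].
by rewrite -RintB//; apply: eq_Rintegral => z _; rewrite fE.
Qed.

Lemma bm_tpoisson L t (b : R * R) : 0 < t ->
  bm (fun z => tpoisson L t (z :-: b)).
Proof.
move=> t0; split.
  exact: (measurable_pt2 (- b.1, - b.2) (inR_meas (inR_tpoisson L t0))).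
exists (t / t ^+ 2) => z; move: (_, _) => {}z.
rewrite ger0_norm ?tpoisson_ge0// /tpoisson indicE.
have h : poisson t z <= t / t ^+ 2.
  rewrite ler_wpM2l ?(ltW t0)// lef_pV2 ?posrE ?exprn_gt0 ?cden_gt0//.
  have tc : t <= cden t z by rewrite lerDr sqn_ge0.
  by rewrite ler_sqr// nnegrE ltW// cden_gt0.
by case: (_ \in _); rewrite ?mulr1 ?mulr0// (le_trans (poisson_ge0 z t0)).
Qed.

Lemma avg_dist (f : R * R -> R) L t (b : R * R) : inR f -> 0 < t ->
  (`|\int[mu2]_z (f z * tpoisson L t (z :-: b)) -
     (\int[mu2]_z tpoisson L t z) * f b|%:E <=
  \int[mu2]_z (`|f z - f b| * tpoisson L t (z :-: b)%R)%:E)%E.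
Proof.
move=> fi t0; have bK := bm_tpoisson L b t0.
set K := fun z => tpoisson L t (z :-: b) in bK *.
have [Ki KE] := inR_shift (- b.1, - b.2) (inR_tpoisson L t0).
have fKi : inR (fun z => f z * K z) by exact: inR_pairing.
have cKi : inR (fun z => f b * K z) by exact: inRZ.
have -> : \int[mu2]_z (f z * K z) - (\int[mu2]_z tpoisson L t z) * f b =
    \int[mu2]_z ((f z - f b) * K z).
  rewrite -KE mulrC -RintZ// -RintB//.
  by apply: eq_Rintegral => z _; rewrite mulrBl.
have di : inR (fun z => (f z - f b) * K z).
  rewrite (_ : (fun z => _) = fun z => f z * K z - f b * K z); first exact: inRB.
  by apply/funext => z; rewrite mulrBl.
rewrite (EFin_normr_Rintegral measurableT di).
apply: (le_trans (le_abse_integral _ measurableT _)); first by case/integrableP: di.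
rewrite le_eqVlt; apply/orP; left; apply/eqP; apply: eq_integral => z _.
by rewrite abse_EFin normrM [X in _ * X]ger0_norm ?tpoisson_ge0.
Qed.

Lemma ks_sym t (z b : R * R) :
  ks t (z :-: b) = ks t (b :-: z).
Proof. by rewrite /ks /cden/= -(opprB z.1) -(opprB z.2) !sqrrN. Qed.

Lemma measurable_ks_pair t : 0 < t -> measurable_fun [set: RR * RR]
  (fun p : RR * RR => ks t ((p.2.1 : R) - p.1.1, (p.2.2 : R) - p.1.2)).
Proof. move=> t0; exact: (measurableT_comp (measurable_ks t0) (@measurable_sub2 R)). Qed.

(** Tonelli and the symmetry of the kernel: after exchanging the integrals, the inner one is the
    kernel integrated over [A] with pole z. *)
Lemma ks_fubini (A : set RR) (G : R * R -> R) t (kappa : R) : 0 < t -> measurable A ->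
  inR G -> (forall z, 0 <= G z) -> 0 <= kappa ->
  (forall b : R * R, (\int[mu2]_(z in A) (ks t (z :-: b)%R)%:E <= kappa%:E)%E) ->
  (\int[mu2]_b \int[mu2]_z (\1_A b * (G z * ks t (z :-: b)%R))%:E <=
   (kappa * \int[mu2]_z G z)%:E)%E.
Proof.
move=> t0 mA Gi G0 k0 hk; have mG := inR_meas Gi.
have ks0 z : 0 <= ks t z by rewrite ltW// ks_gt0.
pose F (p : RR * RR) : \bar R := (\1_A p.1 * (G p.2 * ks t (p.2.1 - p.1.1, p.2.2 - p.1.2)))%:E.
have mF : measurable_fun [set: RR * RR] F.
  apply/measurable_EFinP; apply: measurable_funM.
    have mI : mplane (\1_A : RR -> R) by exact: measurable_indic.
    exact: (measurableT_comp mI measurable_fst).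
  apply: measurable_funM; first exact: (measurableT_comp mG measurable_snd).
  exact: measurable_ks_pair.
have F0 p : (0 <= F p)%E by rewrite lee_fin !mulr_ge0.
rewrite -/(F _) (fubini_tonelli (m1 := mu2) (m2 := mu2) F mF F0)/=.
have kGi : inR (fun z => kappa * G z) by exact: inRZ.
rewrite -RintZ//; apply: (@le_trans _ _ (\int[mu2]_z (kappa * G z)%:E)%E); last first.
  exact/(inR_ereal _ kGi).
apply: ge0_le_integral => //.
- by move=> z _; exact: integral_ge0.
- exact: (@measurable_fun_fubini_tonelli_G _ _ _ _ _ mu2 F mF F0).
- by apply/measurable_EFinP; exact: inR_meas.
move=> z _.
have mk : mplane (fun b : R * R => ks t (b :-: z)).
  exact: (measurableT_comp (measurable_ks t0) (measurable_sub_pt z)).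
have -> : (\int[mu2]_b F (b, z) = (G z)%:E * \int[mu2]_(b in A) (ks t (b :-: z)%R)%:E)%E.
  rewrite [X in (_ = _ * X)%E]integral_mkcond -ge0_integralZl//.
  - apply: eq_integral => b _; rewrite /F/= patchE indicE ks_sym.
    by case: (b \in A); [rewrite mul1r EFinM|rewrite mul0r mule0].
  - apply/(measurable_restrictT _ mA)/measurable_funTS; exact/measurable_EFinP.
  - by move=> b _; rewrite patchE; case: ifP => // _; rewrite lee_fin.
  - by rewrite lee_fin.
by rewrite mulrC EFinM lee_wpmul2l// lee_fin.
Qed.

(** As t tends to 0 the averages of w against the kernel recover m w(b) in L^1, where m is the mass
    of the kernel, while each average is bounded by the Cauchy transform of G. Hence m W <= kappa I
    / 2 up to a small error, and m >= 4 / 9 yields 9 / 8. *)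
Lemma cauchy_L1_core (w G : R * R -> R) (L M kappa : R) (A : set RR) :
  continuous w -> (forall z, ~ cbox L z -> w z = 0) ->
  inR G -> (forall z, 0 <= G z) ->
  (forall t (b : R * R), 0 < t -> `|\int[mu2]_z (w z * poisson t (z :-: b))| <=
     (\int[mu2]_z (G z * ks t (z :-: b))) / 2) ->
  measurable A -> A `<=` cbox M -> 0 <= L -> 0 <= M -> 0 <= kappa ->
  (forall t (b : R * R), 0 < t ->
    (\int[mu2]_(z in A) (ks t (z :-: b)%R)%:E <= kappa%:E)%E) ->
  \int[mu2]_z (`|w z| * \1_A z) <= 9 / 8 * kappa * \int[mu2]_z G z.
Proof.
move=> cw sw Gi G0 hw mA sA L0 M0 k0 hk.
have wi : inR w by exact: Cc_integrable sw.
have mw := inR_meas wi; have mG := inR_meas Gi.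
(* For b in [A] and z in the support of w, the difference z - b stays in the square of half-side L',
   so the truncation of the kernel is invisible; the summand 1 gives the size required by
   [tpoisson_mass]. *)
pose L' := M + L + 1.
have L'1 : 1 <= L' by rewrite lerDr addr_ge0.
set I := \int[mu2]_z G z; have I0 : 0 <= I by exact: Rint_ge0.
have wAi : inR (fun z => `|w z| * \1_A z).
  by apply: inR_pairing; [exact: inR_norm|exact: bm_indic].
set W := \int[mu2]_z _; have W0 : 0 <= W by apply: Rint_ge0 => z; rewrite mulr_ge0.
apply/ler_addgt0Pr => e e0.
have e40 : 0 < e / 4 by rewrite divr_gt0.
have [t1 t10 ht] := tpoisson_approx wi e40 (le_trans ler01 L'1).
pose t := Num.min t1 1.
have t0 : 0 < t by rewrite lt_min t10 ltr01.
have tt1 : t <= 1 by rewrite ge_min lexx orbT.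
have {ht} ht := ht t t0 ltac:(by rewrite ge_min lexx).
have Ti := inR_tpoisson L' t0.
set m := \int[mu2]_z tpoisson L' t z in ht.
have m49 : 4 / 9 <= m by exact: tpoisson_mass.
have ks0 z : 0 <= ks t z by rewrite ltW// ks_gt0.
have mT := inR_meas Ti.
have madd := @measurable_sub2 R.
have main : (m * W <= kappa * I / 2 + e / 4 * (m + 1)).
  have mWi : inR (fun z => m * (`|w z| * \1_A z)) by exact: inRZ.
  rewrite /W -RintZ//; apply/(inR_ereal _ mWi).
  pose F1 (p : RR * RR) : \bar R := (\1_A p.1 * (G p.2 * ks t (p.2.1 - p.1.1, p.2.2 - p.1.2)))%:E.
  pose F2 (p : RR * RR) : \bar R := (`|w p.2 - w p.1| * tpoisson L' t (p.2.1 - p.1.1, p.2.2 - p.1.2))%:E.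
  have mF1 : measurable_fun [set: RR * RR] F1.
    apply/measurable_EFinP; apply: measurable_funM.
      have mI : mplane (\1_A : RR -> R) by exact: measurable_indic.
    exact: (measurableT_comp mI measurable_fst).
    apply: measurable_funM; first exact: (measurableT_comp mG measurable_snd).
    exact: measurable_ks_pair.
  have mF2 : measurable_fun [set: RR * RR] F2.
    apply/measurable_EFinP; apply: measurable_funM; last exact: (measurableT_comp mT madd).
    apply: measurableT_comp => //; apply: measurable_funB.
      exact: (measurableT_comp mw measurable_snd).
    exact: (measurableT_comp mw measurable_fst).
  have F10 p : (0 <= F1 p)%E by rewrite lee_fin !mulr_ge0.
  have F20 p : (0 <= F2 p)%E by rewrite lee_fin mulr_ge0// tpoisson_ge0.
  have mI1 := measurable_fun_fubini_tonelli_F (m2 := mu2) F1 mF1 F10.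
  have mI2 := measurable_fun_fubini_tonelli_F (m2 := mu2) F2 mF2 F20.
  have q0 z : (0 <= \int[mu2]_y F1 (z, y))%E by exact: integral_ge0.
  have q1 z : (0 <= \int[mu2]_y F2 (z, y))%E by exact: integral_ge0.
  apply: (@le_trans _ _ (\int[mu2]_b ((2^-1)%:E * (\int[mu2]_z F1 (b, z)) + \int[mu2]_z F2 (b, z)))%E).
    apply: ge0_le_integral => //.
    - by move=> z _; rewrite lee_fin !mulr_ge0// (le_trans _ m49)// divr_ge0.
    - by apply/measurable_EFinP; exact: inR_meas.
    - by apply: emeasurable_funD => //; exact: measurable_funeM.
    move=> b _; rewrite indicE; case: (boolP (b \in A)) => [bA|_]; last first.
      by rewrite !mulr0; apply: adde_ge0 => //; apply: mule_ge0 => //; rewrite lee_fin.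
    rewrite mulr1.
    have bM : cbox M b by apply: sA; rewrite inE in bA.
    have := avg_dist L' b wi t0.
    have -> : \int[mu2]_z (w z * tpoisson L' t (z :-: b)) =
        \int[mu2]_z (w z * poisson t (z :-: b)).
      apply: eq_Rintegral => z _.
      have [[z1 z2]|nz] := pselect (cbox L z); last by rewrite sw// !mul0r.
      rewrite /tpoisson indicE mem_set ?mulr1//; case: bM => b1 b2.
      by split => /=; rewrite (le_trans (ler_normB _ _))// /L' addrC;
        apply: ler_wpDr => //; apply: lerD.
    rewrite -/m => hd.
    have h1 := hw t b t0.
    set J := \int[mu2]_z _ in h1 hd.
    have JE : (\int[mu2]_z F1 (b, z) = (\int[mu2]_z (G z * ks t (z :-: b)))%:E)%E.
      rewrite fineK.
        by apply: eq_integral => z _; rewrite /F1/= indicE bA mul1r.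
      apply: (integrable_fin_num measurableT); apply: inR_pairing => //; split.
        exact: (measurableT_comp (measurable_ks t0) (measurable_sub_pt b)).
      exists (Num.sqrt t)^-1 => z; rewrite ger0_norm// /ks lef_pV2 ?posrE ?sqrtr_gt0 ?cden_gt0//.
      by rewrite ler_wsqrtr// lerDr (sqn_ge0 (z :-: b)).
    rewrite JE; set Q := \int[mu2]_z _ in h1 *.
    apply: (@le_trans _ _ ((2^-1 * Q)%:E + `|J - m * w b|%:E)%E); last by rewrite EFinM leeD2l.
    rewrite -EFinD lee_fin.
    have -> : m * `|w b| = `|m * w b|.
      by rewrite normrM (ger0_norm (x := m))// (le_trans _ m49)// divr_ge0.
    have : `|m * w b| <= `|J| + `|J - m * w b|.
      by rewrite -[X in `|X| <= _](subKr J) (le_trans (ler_normB _ _)).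
    by rewrite mulrC in h1 *; lra.
  rewrite ge0_integralD//; last 2 first.
  - by move=> z _; rewrite mule_ge0// lee_fin.
  - exact: measurable_funeM.
  rewrite EFinD; apply: leeD; last exact: ht.
  rewrite ge0_integralZl ?lee_fin//.
  rewrite mulrC EFinM lee_wpmul2l ?lee_fin//.
  exact: (ks_fubini t0 mA Gi G0 k0 (fun b => hk t b t0)).
have kI : 0 <= kappa * I by exact: mulr_ge0.
have m0 : 0 < m by apply: lt_le_trans m49; rewrite divr_gt0.
rewrite -(ler_pM2l m0); apply: (le_trans main).
have : 4 / 9 * (kappa * I) <= m * (kappa * I) by rewrite ler_wpM2r.
have : 4 / 9 * e <= m * e by rewrite ler_wpM2r// ltW.
lra.
Qed.

Section cauchy_estimate.
Variables (w1 w2 w1x w1y w2x w2y : R * R -> R) (L : R).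
Hypotheses (d1x : D1 w1 w1x) (d1y : D2 w1 w1y) (d2x : D1 w2 w2x) (d2y : D2 w2 w2y).
Hypotheses (c1 : continuous w1) (c2 : continuous w2) (c1x : continuous w1x)
  (c1y : continuous w1y) (c2x : continuous w2x) (c2y : continuous w2y).
Hypothesis supp : forall z, ~ cbox L z -> [/\ w1 z = 0, w2 z = 0, w1x z = 0 &
  [/\ w1y z = 0, w2x z = 0 & w2y z = 0]].

(** The L^1 norm of w on a set is controlled by the L^1 norm of dbar w, with a constant proportional
    to the worst L^1 norm of the kernel on that set, which is small when the set is thin. *)
Lemma cauchy_L1 (M kappa : R) (A : set RR) :
  measurable A -> A `<=` cbox M -> 0 <= L -> 0 <= M -> 0 <= kappa ->
  (forall t (b : R * R), 0 < t ->
    (\int[mu2]_(z in A) (ks t (z :-: b)%R)%:E <= kappa%:E)%E) ->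
  \int[mu2]_z ((`|w1 z| + `|w2 z|) * \1_A z) <=
  9 / 4 * kappa * \int[mu2]_z (`|w1x z - w2y z| + `|w2x z + w1y z|).
Proof.
move=> mA sA L0 M0 k0 hk.
pose g1 z := w1x z - w2y z; pose g2 z := w2x z + w1y z.
have cg1 : continuous g1 by exact: ctB.
have cg2 : continuous g2 by exact: ctD.
have i1 : inR g1.
  by apply: (@Cc_integrable _ _ L) => // z nz; rewrite /g1; have [_ _ -> [_ _ ->]] := supp nz; rewrite subrr.
have i2 : inR g2.
  by apply: (@Cc_integrable _ _ L) => // z nz; rewrite /g2; have [_ _ _ [-> -> _]] := supp nz; rewrite addr0.
pose G z := `|g1 z| + `|g2 z|.
have Gi : inR G by apply: inRD; exact: inR_norm.
have G0 z : 0 <= G z by rewrite addr_ge0.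
have s1 z : ~ cbox L z -> w1 z = 0 by move=> /supp[].
have s2 z : ~ cbox L z -> w2 z = 0 by move=> /supp[].
have bk t (b : R * R) (k : R -> R * R -> R) : 0 < t -> continuous (k t) ->
    (forall z, `|k t z| <= ks t z) -> bm (fun z => k t (z :-: b)).
  move=> t0 ck hk'; split.
    exact: (measurable_pt2 (- b.1, - b.2) (continuous_measurable2 ck)).
  exists (Num.sqrt t)^-1 => z; apply: le_trans (hk' _) _.
  rewrite /ks lef_pV2 ?posrE ?sqrtr_gt0 ?cden_gt0//.
  by rewrite ler_wsqrtr// lerDr (sqn_ge0 (z :-: b)).
have ct1 t : 0 < t -> continuous (@ck1 R t).
  move=> t0; apply: ctM; first exact: ct_fst.
  by apply: ctV; [move=> z; rewrite gt_eqF// cden_gt0|exact: ct_cden].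
have ct2 t : 0 < t -> continuous (@ck2 R t).
  move=> t0; apply: ctM; first by apply: ctN; exact: ct_snd.
  by apply: ctV; [move=> z; rewrite gt_eqF// cden_gt0|exact: ct_cden].
have est t (b : R * R) (f : R * R -> R) : 0 < t -> inR f ->
    (forall z, `|f z| <= G z * ks t (z :-: b)) ->
    `|- (\int[mu2]_z f z) / 2| <= (\int[mu2]_z (G z * ks t (z :-: b))) / 2.
  move=> t0 fi hf; rewrite normrM normrN (ger0_norm (x := 2^-1))// ler_wpM2r//.
  apply: (le_trans (le_normr_Rintegral measurableT fi)).
  apply: Rint_le => //; first exact: inR_norm.
  apply: inR_pairing => //; apply: bk => //; first exact: ct_ks.
  by move=> z; rewrite ger0_norm// ltW// ks_gt0.
have k1 t b z : 0 < t -> `|ck1 t (z :-: b)| <= ks t (z :-: b).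
  by move=> t0; case: (ck_le (z :-: b) t0).
have k2 t b z : 0 < t -> `|ck2 t (z :-: b)| <= ks t (z :-: b).
  by move=> t0; case: (ck_le (z :-: b) t0).
have e1 : \int[mu2]_z (`|w1 z| * \1_A z) <= 9 / 8 * kappa * \int[mu2]_z G z.
  apply: (@cauchy_L1_core _ _ L M) => // t b t0.
  have [-> _] := cauchy_pompeiu d1x d1y d2x d2y c1 c2 c1x c1y c2x c2y supp b t0.
  apply: est => //.
    apply: inRB; apply: inR_pairing => //; apply: bk => //; [exact: ct1|..|exact: ct2|].
    - by move=> z; case: (ck_le z t0).
    - by move=> z; case: (ck_le z t0).
  move=> z; apply: (le_trans (ler_normB _ _)); rewrite (normrM (w1x z - w2y z)) (normrM (w2x z + w1y z)) mulrDl.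
  by apply: lerD; rewrite ler_wpM2l//; [exact: k1|exact: k2].
have e2 : \int[mu2]_z (`|w2 z| * \1_A z) <= 9 / 8 * kappa * \int[mu2]_z G z.
  apply: (@cauchy_L1_core _ _ L M) => // t b t0.
  have [_ ->] := cauchy_pompeiu d1x d1y d2x d2y c1 c2 c1x c1y c2x c2y supp b t0.
  apply: est => //.
    apply: inRD; apply: inR_pairing => //; apply: bk => //; [exact: ct2|..|exact: ct1|].
    - by move=> z; case: (ck_le z t0).
    - by move=> z; case: (ck_le z t0).
  move=> z; apply: (le_trans (ler_normD _ _)); rewrite (normrM (w1x z - w2y z)) (normrM (w2x z + w1y z)) mulrDl.
  by apply: lerD; rewrite ler_wpM2l//; [exact: k2|exact: k1].
have bA := bm_indic mA.
have -> : \int[mu2]_z ((`|w1 z| + `|w2 z|) * \1_A z) =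
   \int[mu2]_z (`|w1 z| * \1_A z) + \int[mu2]_z (`|w2 z| * \1_A z).
  rewrite -RintD; first by apply: eq_Rintegral => z _; rewrite mulrDl.
  - by apply: inR_pairing => //; apply: inR_norm; apply: Cc_integrable s1.
  - by apply: inR_pairing => //; apply: inR_norm; apply: Cc_integrable s2.
rewrite -/(G _); set I := \int[mu2]_z G z in e1 e2; move: e1 e2.
rewrite -[\int[mu2]_z (`|w1x z - w2y z| + `|w2x z + w1y z|)]/I; lra.
Qed.

End cauchy_estimate.
End kernel_bounds.

(** * Inward unique continuation *)

Section ae_tools.
Context {R : realType}.
Local Notation RR := (plane R).

Lemma Rint_le_ae (f g : R * R -> R) : inR f -> inR g ->
  {ae mu2, forall z : RR, f z <= g z} -> \int[mu2]_z f z <= \int[mu2]_z g z.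
Proof.
move=> fi gi fg; rewrite -subr_ge0 -RintB//.
have di := inRB gi fi; have md := inR_meas di.
rewrite (_ : \int[mu2]_z (g z - f z) = \int[mu2]_z (Num.max (g z - f z) 0)).
  by apply: Rint_ge0 => z; rewrite le_max lexx orbT.
rewrite /Rintegral; congr fine; apply: ae_eq_integral => //.
- exact/measurable_EFinP.
- by apply/measurable_EFinP; apply: measurable_maxr.
apply: ae_imply fg => z fg _; congr EFin.
by apply/esym; rewrite max_l// subr_ge0.
Qed.

Lemma Rint_le0_ae (f : R * R -> R) : inR f -> (forall z, 0 <= f z) ->
  \int[mu2]_z f z <= 0 -> {ae mu2, forall z : RR, f z = 0}.
Proof.
move=> fi f0 h; have mf := inR_meas fi.
have /(ae_eq_integral_abs mu2 measurableT) : measurable_fun setT (EFin \o f : RR -> \bar R).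
  exact/measurable_EFinP.
case=> /(_ _)H _.
have : ae_eq mu2 setT (EFin \o f) (cst 0%E).
  apply: H; apply/eqP; rewrite eq_le integral_ge0// andbT.
  have -> : (\int[mu2]_z `|(EFin \o f) z| = \int[mu2]_z (f z)%:E)%E.
    by apply: eq_integral => z _; rewrite /= ger0_norm.
  by apply/(inR_ereal 0 fi).
by apply: ae_imply => z /(_ I)[].
Qed.

(** Every vertical line meets the circle in at most two points. *)
Lemma mu2_circle (s : R) : mu2 [set z | nrm z = s] = 0%E.
Proof.
have mC : measurable ([set z | nrm z = s] : set RR).
  rewrite (_ : [set z | _] = [set z | nrm z \in `[s, s]]).
    exact: measurable_nrm_itv.
  apply/seteqP; split=> z /=; first by move=> ->; rewrite in_itv/= lexx.
  by rewrite in_itv/= => /andP[h1 h2]; apply/le_anti/andP.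
have mI : mplane (fun z => (\1_[set z : R * R | nrm z = s] z : R)%:E).
  by apply/measurable_EFinP; exact: measurable_indic.
transitivity (\int[mu2]_z (\1_[set z : R * R | nrm z = s] z : R)%:E)%E.
  by rewrite integral_indic//= setIT.
rewrite integral_xy//.
rewrite integral0_eq// => x _.
rewrite (_ : (fun y => _) = fun y => (\1_[set y : R | nrm (x, y) = s] y : R)%:E).
  have fC : countable [set y : R | nrm (x, y) = s].
    apply: sub_countable (finite_set_countable (finite_set2 (Num.sqrt (s ^+ 2 - x ^+ 2)) (- Num.sqrt (s ^+ 2 - x ^+ 2)))).
    apply: subset_card_le => y /= ys.
    have : y ^+ 2 = Num.sqrt (s ^+ 2 - x ^+ 2) ^+ 2.
      have h : s ^+ 2 = x ^+ 2 + y ^+ 2 by rewrite -ys nrm_sq.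
      by rewrite h addrC addrA addNr add0r sqr_sqrtr ?sqr_ge0.
    by move/eqP; rewrite eqf_sqr => /orP[] /eqP; [left|right].
  rewrite integral_indic//= ?setIT; last exact: countable_measurable.
  exact: countable_lebesgue_measure0.
by apply/funext => y; congr EFin; rewrite !indicE; congr (_ %:R).
Qed.

Lemma bm_Cc (f : R * R -> R) (L : R) : continuous f ->
  (forall z, ~ cbox L z -> f z = 0) -> bm f.
Proof.
move=> cf sf; split; first exact: continuous_measurable2.
by have [M _ hM] := Cc_bounded cf sf; exists M.
Qed.

(** Continuity from above of the measure: the intersection of the annuli is contained in a
    circle. *)
Lemma thin_annulus (s e : R) : 0 < e -> exists2 d, 0 < d & forall s2, s - d <= s2 ->
  (mu2 [set z | nrm z \in `]s2, s]] <= e%:E)%E.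
Proof.
move=> e0; pose F (n : nat) : set RR := [set z | nrm z \in `]s - n.+1%:R^-1, s]].
have mF n : measurable (F n) by exact: measurable_nrm_itv.
have cF : (mu2 (F n) @[n --> \oo] --> mu2 (\bigcap_n F n))%E.
  apply: nonincreasing_cvg_mu => //.
  - apply: (@le_lt_trans _ _ (mu2 (cbox s))); last exact: mu2_cbox_lty.
    apply: le_measure; rewrite ?inE//; first exact: measurable_cbox.
    by move=> z; rewrite /F/= in_itv/= => /andP[_ zs]; exact: nrm_cbox.
  - exact: bigcap_measurable.
  - move=> m n mn; apply/subsetPset => z; rewrite /F/= !in_itv/= => /andP[h ->]; rewrite andbT.
    apply: le_lt_trans h; rewrite lerD2l lerN2 lef_pV2 ?posrE ?ltr0n//.
    by rewrite ler_nat.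
have I0 : mu2 (\bigcap_n F n) = 0%E.
  apply/eqP; rewrite eq_le measure_ge0 andbT -(mu2_circle s).
  apply: le_measure; rewrite ?inE.
  - exact: bigcap_measurable.
  - rewrite (_ : [set z | _] = [set z | nrm z \in `[s, s]]); first exact: measurable_nrm_itv.
    apply/seteqP; split=> z /=; first by move=> ->; rewrite in_itv/= lexx.
    by rewrite in_itv/= => /andP[h1 h2]; apply/le_anti/andP.
  move=> z hz /=; apply/le_anti/andP; split.
    by have := hz 0%N I; rewrite /F/= in_itv/= => /andP[].
  apply/ler_addgt0Pr => d d0.
  have [n hn] : exists n : nat, n.+1%:R^-1 < d.
    by near \oo%classic => n; exists n; near: n; exact: near_infty_natSinv_lt (PosNum d0).
  have := hz n I; rewrite /F/= in_itv/= => /andP[h _].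
  by rewrite ltW// -ltrBlDr; apply: le_lt_trans h; rewrite lerD2l lerN2 ltW.
rewrite I0 in cF.
have /fine_cvgP[_ /cvgrPdist_lt /(_ _ e0)] := cF.
case=> N _ /(_ N (leqnn N)) hN.
exists N.+1%:R^-1; first by rewrite invr_gt0.
move=> s2 hs; apply: (@le_trans _ _ (mu2 (F N))).
  apply: le_measure; rewrite ?inE//; first exact: measurable_nrm_itv.
  move=> z; rewrite /F/= !in_itv/= => /andP[h ->]; rewrite andbT.
  exact: le_lt_trans h.
have fin : mu2 (F N) \is a fin_num.
  rewrite ge0_fin_numE//; apply: (@le_lt_trans _ _ (mu2 (cbox s))); last exact: mu2_cbox_lty.
  apply: le_measure; rewrite ?inE//; first exact: measurable_cbox.
  by move=> z; rewrite /F/= in_itv/= => /andP[_ zs]; exact: nrm_cbox.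
rewrite -(fineK fin) lee_fin ltW//.
by move: hN; rewrite /= sub0r normrN => /(le_lt_trans _); apply; exact: ler_norm.
Unshelve. all: by end_near. Qed.

(* real and imaginary parts of [(x + i y) ^ N] *)
Fixpoint zpow (N : nat) (z : R * R) : R * R :=
  if N is N'.+1 then
    let p := zpow N' z in (z.1 * p.1 - z.2 * p.2, z.1 * p.2 + z.2 * p.1)
  else (1, 0).

Lemma sqn_zpow N z : sqn (zpow N z) = sqn z ^+ N.
Proof.
elim: N => [|N IH]; first by rewrite /sqn/=; ring.
by rewrite exprS -IH /sqn/=; ring.
Qed.

Lemma ct_zpow N : continuous (fun z : R * R => (zpow N z).1) /\
  continuous (fun z : R * R => (zpow N z).2).
Proof.
elim: N => [|N [c1 c2]]; first by split; exact: ct_cst.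
by split; [apply: ctB|apply: ctD]; apply: ctM => //; (exact: ct_fst || exact: ct_snd).
Qed.

(** The Cauchy-Riemann equations, encoded by using the same two functions for the partial
    derivatives of both parts. *)
Lemma zpow_CR N : exists px py, [/\ D1 (fun z => (zpow N z).1) px,
  D2 (fun z => (zpow N z).1) py, D1 (fun z => (zpow N z).2) (fun z => - py z) &
  D2 (fun z => (zpow N z).2) px] /\ continuous px /\ continuous py.
Proof.
elim: N => [|N [px [py [[h1 h2 h3 h4] [cx cy]]]]].
  exists (fun=> 0), (fun=> 0); split; last by split; exact: ct_cst.
  split; [exact: D1_cst|exact: D2_cst| |exact: D2_cst].
  by apply: (D1_eq (D1_cst _)) => z; rewrite oppr0.
exists (fun z => (zpow N z).1 + z.1 * px z - z.2 * - py z).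
exists (fun z => z.1 * py z - ((zpow N z).2 + z.2 * px z)).
have [c1 c2] := ct_zpow N.
split; last first.
  split; first exact: (ctB (ctD c1 (ctM ct_fst cx)) (ctM ct_snd (ctN cy))).
  exact: (ctB (ctM ct_fst cy) (ctD c2 (ctM ct_snd cx))).
split.
- by apply: (D1_eq (D1B (D1M D1_fst h1) (D1M D1_snd h3))) => z; ring.
- by apply: (D2_eq (D2B (D2M D2_fst h2) (D2M D2_snd h4))) => z; ring.
- by apply: (D1_eq (D1D (D1M D1_fst h3) (D1M D1_snd h1))) => z; ring.
- by apply: (D2_eq (D2D (D2M D2_fst h4) (D2M D2_snd h2))) => z; ring.
Qed.

Lemma geo_le0 (c K q : R) : 0 <= q -> q < 1 -> (forall N : nat, c <= K * q ^+ N) -> c <= 0.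
Proof.
move=> q0 q1 h.
have : (K * q ^+ N @[N --> \oo] --> K * 0).
  by apply: cvgM; [exact: cvg_cst|apply: cvg_expr; rewrite ger0_norm].
rewrite mulr0 => hc; rewrite -(cvg_lim _ hc)//; apply: limr_ge; first by apply/cvg_ex; exists 0.
by near=> N; exact: h.
Unshelve. all: by end_near. Qed.

End ae_tools.

(** * A Carleman inequality in L^1 *)

Section carleman.
Context {R : realType}.
Local Notation RR := (plane R).

Section inequality.
Variables (u1 u2 h1 h2 : R * R -> R) (eta : nat -> R -> R).
Hypotheses (u1i : inR u1) (u2i : inR u2) (h1i : inR h1) (h2i : inR h2).
Hypothesis etab : forall k, bump (k.+1%:R^-1) (eta k).

Let U z := `|u1 z| + `|u2 z|.
Let H z := `|h1 z| + `|h2 z|.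

(** Multiplication of a + i b by p + i q of modulus r, with pairs measured in the l^1 norm; the
    reverse bound [absM_ge] costs a factor 2. *)
Lemma absM_le (p q a b r : R) : 0 <= r -> p ^+ 2 + q ^+ 2 = r ^+ 2 ->
  `|p * a - q * b| <= r * (`|a| + `|b|) /\ `|p * b + q * a| <= r * (`|a| + `|b|).
Proof.
move=> r0 pq.
have h (x y : R) : x ^+ 2 + y ^+ 2 = r ^+ 2 -> `|x| <= r.
  move=> xy; rewrite -ler_sqr ?nnegrE// real_normK ?num_real// -xy lerDl sqr_ge0//.
have pr := h _ _ pq; have qr : `|q| <= r by apply: (h q p); rewrite addrC.
split.
- apply: (le_trans (ler_normB _ _)); rewrite !normrM mulrDr.
  by apply: lerD; rewrite ler_wpM2r.
- apply: (le_trans (ler_normD _ _)); rewrite !normrM mulrDr addrC.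
  by apply: lerD; rewrite ler_wpM2r.
Qed.

Lemma absM_ge (p q a b r : R) : 0 <= r -> p ^+ 2 + q ^+ 2 = r ^+ 2 ->
  r * (`|a| + `|b|) <= 2 * (`|p * a - q * b| + `|p * b + q * a|).
Proof.
move=> r0 pq; set x := p * a - q * b; set y := p * b + q * a.
have e : x ^+ 2 + y ^+ 2 = r ^+ 2 * (a ^+ 2 + b ^+ 2) by rewrite -pq /x /y; ring.
have h (c : R) : c ^+ 2 <= a ^+ 2 + b ^+ 2 -> r * `|c| <= `|x| + `|y|.
  move=> hc; rewrite -(ler_sqr (x := r * _)) ?nnegrE ?mulr_ge0 ?addr_ge0//.
  rewrite exprMn real_normK ?num_real//.
  apply: (@le_trans _ _ (r ^+ 2 * (a ^+ 2 + b ^+ 2))); first by rewrite ler_wpM2l// sqr_ge0.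
  rewrite -e -(real_normK (num_real x)) -(real_normK (num_real y)).
  by have : 0 <= `|x| * `|y| by []; nra.
have ha : r * `|a| <= `|x| + `|y| by apply: h; rewrite lerDl sqr_ge0.
have hb : r * `|b| <= `|x| + `|y| by apply: h; rewrite lerDr sqr_ge0.
lra.
Qed.

Lemma l1_close (a b x y c d : R) : 0 <= c -> 0 <= d ->
  `|a| + `|b| <= `|x| + `|y| + (`|a - x| + `|b - y| + c + d).
Proof.
move=> c0 d0.
have t1 : `|a| <= `|x| + `|a - x| by rewrite -[X in `|X| <= _](subrK x) addrC ler_normD.
have t2 : `|b| <= `|y| + `|b - y| by rewrite -[X in `|X| <= _](subrK y) addrC ler_normD.
lra.
Qed.

(** Apply [cauchy_L1] to the cutoff times z^N times the mollified u. Since z^N is holomorphic, its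
    derivatives cancel in dbar and the constant does not depend on N. The constant 9 is 9 / 4 from
    the Cauchy transform, times 2 from [absM_ge], times 2 for the two components of dbar. *)
Lemma carleman_ineq (N : nat) (A : set RR) (T kappa : R) (chi cx cy : R * R -> R) (k0 : nat) :
  cutoff chi cx cy -> 0 <= T ->
  (forall z, ~ cbox T z -> [/\ chi z = 0, cx z = 0 & cy z = 0]) ->
  measurable A -> A `<=` cbox T -> (forall z, A z -> chi z = 1) -> 0 <= kappa ->
  (forall t (b : R * R), 0 < t ->
    (\int[mu2]_(z in A) (ks t (z :-: b)%R)%:E <= kappa%:E)%E) ->
  (forall k z, (k0 <= k)%N -> chi z != 0 -> moll_eq (eta k) u1 u2 h1 h2 z) ->
  \int[mu2]_z (nrm z ^+ N * U z * \1_A z) <=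
  9 * kappa * \int[mu2]_z (nrm z ^+ N * ((`|cx z| + `|cy z|) * U z + chi z * H z)).
Proof.
move=> [c_x c_y [cc ccx ccy] c01] T0 cs mA sA cA ka0 hk me.
have Ui : inR U by apply: inRD; exact: inR_norm.
have Hi : inR H by apply: inRD; exact: inR_norm.
have U0 z : 0 <= U z by rewrite addr_ge0.
have H0 z : 0 <= H z by rewrite addr_ge0.
have r0 (z : R * R) : 0 <= nrm z ^+ N by rewrite exprn_ge0// nrm_ge0.
have crN : continuous (fun z : R * R => nrm z ^+ N) by apply: ctX; exact: ct_nrm.
have cab (f : R * R -> R) : continuous f -> continuous (fun z => `|f z|).
  by move=> cf z; apply: cvg_norm; exact: cf.
pose rc z := nrm z ^+ N * chi z.
pose rx z := nrm z ^+ N * (`|cx z| + `|cy z|).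
have crc : continuous rc by exact: ctM.
have crx : continuous rx by apply: ctM => //; apply: ctD; exact: cab.
have src z : ~ cbox T z -> rc z = 0 by move=> /cs[h _ _]; rewrite /rc h mulr0.
have srx z : ~ cbox T z -> rx z = 0 by move=> /cs[_ h h']; rewrite /rx h h' normr0 addr0 mulr0.
have [B1 B10 hB1] := Cc_bounded crc src.
have [B2 B20 hB2] := Cc_bounded crx srx.
have rc0 z : 0 <= rc z by rewrite mulr_ge0//; case/andP: (c01 z).
have rx0 z : 0 <= rx z by rewrite mulr_ge0// addr_ge0.
have bA := bm_indic mA.
have brc := bm_Cc crc src; have brx := bm_Cc crx srx.
pose F z := rx z * U z + rc z * H z.
have Fi : inR F.
  apply: inRD.
    rewrite (_ : (fun z => _) = fun z => U z * rx z); first exact: inR_pairing.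
    by apply/funext => z; rewrite mulrC.
  rewrite (_ : (fun z => _) = fun z => H z * rc z); first exact: inR_pairing.
  by apply/funext => z; rewrite mulrC.
have -> : \int[mu2]_z (nrm z ^+ N * ((`|cx z| + `|cy z|) * U z + chi z * H z)) =
    \int[mu2]_z F z.
  by apply: eq_Rintegral => z _; rewrite mulrDr !mulrA.
have EA z : nrm z ^+ N * U z * \1_A z = U z * (rc z * \1_A z).
  rewrite indicE; case: (boolP (z \in A)) => [|_]; last by rewrite !mulr0.
  by rewrite inE => /cA cz; rewrite /rc cz !mulr1 mulrC.
have Xi : inR (fun z => U z * (rc z * \1_A z)) by apply: inR_pairing => //; exact: bmM.
have -> : \int[mu2]_z (nrm z ^+ N * U z * \1_A z) = \int[mu2]_z (U z * (rc z * \1_A z)).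
  by apply: eq_Rintegral => z _; rewrite EA.
have C0 : 0 < 36 * kappa * (B1 + B2) + 4 * B1 + 1.
  by rewrite ltr_wpDl// !addr_ge0 ?mulr_ge0 ?addr_ge0.
apply/ler_addgt0Pr => e e0.
(* The denominator collects the coefficients of d in the estimates below, plus 1. *)
pose d := e / (36 * kappa * (B1 + B2) + 4 * B1 + 1).
have d0 : 0 < d by exact: divr_gt0.
have [n1 hn1] := moll_L1_seq etab u1i d0.
have [n2 hn2] := moll_L1_seq etab u2i d0.
have [n3 hn3] := moll_L1_seq etab h1i d0.
have [n4 hn4] := moll_L1_seq etab h2i d0.
have [k [k1 k2 k3 k4 k5]] := common_bound5 n1 n2 n3 n4 k0.
have {hn1} [D1' I1] := hn1 k k1; have {hn2} [D2' I2] := hn2 k k2.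
have {hn3} [D3' I3] := hn3 k k3; have {hn4} [D4' I4] := hn4 k k4.
have ke := bump_kernel1 (etab k).
have [eta' de ke'] := kernel1_der ke.
pose a := moll u1 (eta k) (eta k); pose b := moll u2 (eta k) (eta k).
pose g := moll h1 (eta k) (eta k); pose h := moll h2 (eta k) (eta k).
have ax : D1 a (moll u1 eta' (eta k)) by exact: moll_D1.
have ay : D2 a (moll u1 (eta k) eta') by exact: moll_D2.
have bx : D1 b (moll u2 eta' (eta k)) by exact: moll_D1.
have bY : D2 b (moll u2 (eta k) eta') by exact: moll_D2.
set ax' := moll u1 eta' _ in ax; set ay' := moll u1 _ eta' in ay.
set bx' := moll u2 eta' _ in bx; set bY' := moll u2 _ eta' in bY.
have cfa : continuous a by exact: moll_continuous.
have cfb : continuous b by exact: moll_continuous.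
have cax : continuous ax' by exact: moll_continuous.
have cay : continuous ay' by exact: moll_continuous.
have cbx : continuous bx' by exact: moll_continuous.
have cby : continuous bY' by exact: moll_continuous.
pose E z := `|a z - u1 z| + `|b z - u2 z| + `|g z - h1 z| + `|h z - h2 z|.
have Ei : inR E by do !apply: inRD.
have E0 z : 0 <= E z by rewrite !addr_ge0.
have IE : \int[mu2]_z E z <= 4 * d.
  rewrite /E RintD//; last by do !apply: inRD.
  rewrite RintD//; last by do !apply: inRD.
  by rewrite RintD//; move: D1' D2' D3' D4'; rewrite -/a -/b -/g -/h; clear; lra.
have [px [py [[p1 p2 q1 q2] [cpx cpy]]]] := @zpow_CR R N.
have [cp cq] := @ct_zpow R N.
pose p (z : R * R) := (zpow N z).1; pose q (z : R * R) := (zpow N z).2.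
have pq z : p z ^+ 2 + q z ^+ 2 = (nrm z ^+ N) ^+ 2.
  by rewrite -exprM mulnC exprM nrm_sq -sqn_zpow.
pose s1 z := p z * a z - q z * b z; pose s2 z := p z * b z + q z * a z.
pose s1x z := (px z * a z + p z * ax' z) - (- py z * b z + q z * bx' z).
pose s1y z := (py z * a z + p z * ay' z) - (px z * b z + q z * bY' z).
pose s2x z := (px z * b z + p z * bx' z) + (- py z * a z + q z * ax' z).
pose s2y z := (py z * b z + p z * bY' z) + (px z * a z + q z * ay' z).
have ds1x : D1 s1 s1x by exact: (D1B (D1M p1 ax) (D1M q1 bx)).
have ds1y : D2 s1 s1y by exact: (D2B (D2M p2 ay) (D2M q2 bY)).
have ds2x : D1 s2 s2x by exact: (D1D (D1M p1 bx) (D1M q1 ax)).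
have ds2y : D2 s2 s2y by exact: (D2D (D2M p2 bY) (D2M q2 ay)).
have cs1 : continuous s1 by exact: (ctB (ctM cp cfa) (ctM cq cfb)).
have cs2 : continuous s2 by exact: (ctD (ctM cp cfb) (ctM cq cfa)).
have cs1x : continuous s1x.
  exact: (ctB (ctD (ctM cpx cfa) (ctM cp cax)) (ctD (ctM (ctN cpy) cfb) (ctM cq cbx))).
have cs1y : continuous s1y.
  exact: (ctB (ctD (ctM cpy cfa) (ctM cp cay)) (ctD (ctM cpx cfb) (ctM cq cby))).
have cs2x : continuous s2x.
  exact: (ctD (ctD (ctM cpx cfb) (ctM cp cbx)) (ctD (ctM (ctN cpy) cfa) (ctM cq cax))).
have cs2y : continuous s2y.
  exact: (ctD (ctD (ctM cpy cfb) (ctM cp cby)) (ctD (ctM cpx cfa) (ctM cq cay))).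
pose w1 z := chi z * s1 z; pose w2 z := chi z * s2 z.
pose w1x z := cx z * s1 z + chi z * s1x z; pose w1y z := cy z * s1 z + chi z * s1y z.
pose w2x z := cx z * s2 z + chi z * s2x z; pose w2y z := cy z * s2 z + chi z * s2y z.
have sup z : ~ cbox T z -> [/\ w1 z = 0, w2 z = 0, w1x z = 0 &
    [/\ w1y z = 0, w2x z = 0 & w2y z = 0]].
  move=> /cs[z1 z2 z3]; rewrite /w1 /w2 /w1x /w1y /w2x /w2y z1 z2 z3.
  by rewrite !mul0r !addr0.
have := @cauchy_L1 R w1 w2 w1x w1y w2x w2y T (D1M c_x ds1x) (D2M c_y ds1y)
  (D1M c_x ds2x) (D2M c_y ds2y) (ctM cc cs1) (ctM cc cs2)
  (ctD (ctM ccx cs1) (ctM cc cs1x)) (ctD (ctM ccy cs1) (ctM cc cs1y))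
  (ctD (ctM ccx cs2) (ctM cc cs2x)) (ctD (ctM ccy cs2) (ctM cc cs2y)) sup
  T kappa A mA sA T0 T0 ka0 hk.
set W := \int[mu2]_z _; set G := \int[mu2]_z _ => WG.
have w1i : inR w1 by apply: (@Cc_integrable _ _ T); [exact: ctM|move=> z /sup[]].
have w2i : inR w2 by apply: (@Cc_integrable _ _ T); [exact: ctM|move=> z /sup[]].
have Wi : inR (fun z => (`|w1 z| + `|w2 z|) * \1_A z).
  by apply: inR_pairing => //; apply: inRD; exact: inR_norm.
have st1 : \int[mu2]_z (U z * (rc z * \1_A z)) <= 2 * W + B1 * (4 * d).
  apply: (@le_trans _ _ (\int[mu2]_z (2 * ((`|w1 z| + `|w2 z|) * \1_A z) + B1 * E z))).
    apply: Rint_le => //; first by apply: inRD; exact: inRZ.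
    move=> z; rewrite indicE; case: (boolP (z \in A)) => [|_]; last first.
      by rewrite !mulr0 add0r mulr_ge0.
    rewrite inE => Az; rewrite !mulr1.
    have cz := cA _ Az; rewrite /w1 /w2 cz !mul1r.
    have rz : rc z = nrm z ^+ N by rewrite /rc cz mulr1.
    have h3 := absM_ge (a z) (b z) (r0 z) (pq z).
    rewrite -rz in h3; rewrite /s1 /s2.
    apply: (@le_trans _ _ (rc z * (`|a z| + `|b z|) + rc z * E z)); last first.
      apply: lerD => //; apply: ler_wpM2r => //.
      by apply: le_trans (hB1 z); exact: ler_norm.
    rewrite -mulrDr mulrC ler_wpM2l//.
    by rewrite /U /E (distrC (a z)) (distrC (b z)) l1_close.
  rewrite RintD; [|exact: inRZ..]; rewrite !RintZ//.
  by apply: lerD => //; rewrite ler_wpM2l.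
have st2 : G <= 2 * \int[mu2]_z F z + 2 * (B1 + B2) * (4 * d).
  apply: (@le_trans _ _ (\int[mu2]_z (2 * F z + 2 * (B1 + B2) * E z))).
    apply: Rint_le; [|by apply: inRD; exact: inRZ|].
      apply: inRD; apply: inR_norm.
        apply: inRB; (apply: (@Cc_integrable _ _ T); [|by move=> z /sup[_ _ ? []]]).
          exact: (ctD (ctM ccx cs1) (ctM cc cs1x)).
        exact: (ctD (ctM ccy cs2) (ctM cc cs2y)).
      apply: inRD; (apply: (@Cc_integrable _ _ T); [|by move=> z /sup[_ _ ? []]]).
        exact: (ctD (ctM ccx cs2) (ctM cc cs2x)).
      exact: (ctD (ctM ccy cs1) (ctM cc cs1y)).
    move=> z.
    (* The mollified equation is available only where the cutoff is nonzero, so it is used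
       multiplied by [chi]. *)
    have [m1 m2] : chi z * (ax' z - bY' z) = chi z * g z /\ chi z * (bx' z + ay' z) = chi z * h z.
      have [->|nz] := eqVneq (chi z) 0; first by rewrite !mul0r.
      by have [-> ->] := me k z k5 nz _ de.
    have e1 : w1x z - w2y z = cx z * s1 z - cy z * s2 z + chi z * (p z * g z - q z * h z).
      transitivity (cx z * s1 z - cy z * s2 z + (p z * (chi z * (ax' z - bY' z)) - q z * (chi z * (bx' z + ay' z)))).
        by rewrite /w1x /w2y /s1x /s2y; ring.
      by rewrite m1 m2; ring.
    have e2 : w2x z + w1y z = cx z * s2 z + cy z * s1 z + chi z * (p z * h z + q z * g z).
      transitivity (cx z * s2 z + cy z * s1 z + (q z * (chi z * (ax' z - bY' z)) + p z * (chi z * (bx' z + ay' z)))).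
        by rewrite /w2x /w1y /s2x /s1y; ring.
      by rewrite m1 m2; ring.
    have [b1 b2] := absM_le (a z) (b z) (r0 z) (pq z).
    have [b3 b4] := absM_le (g z) (h z) (r0 z) (pq z).
    have ch0 : 0 <= chi z by case/andP: (c01 z).
    pose V := `|a z| + `|b z|; pose K := `|g z| + `|h z|.
    have VU : V <= U z + E z.
      by rewrite /V /U /E; have := l1_close (a z) (b z) (u1 z) (u2 z) (normr_ge0 (g z - h1 z)) (normr_ge0 (h z - h2 z)).
    have KH : K <= H z + E z.
      have -> : E z = `|g z - h1 z| + `|h z - h2 z| + `|a z - u1 z| + `|b z - u2 z|.
        by rewrite /E -addrA [LHS]addrC !addrA.
      exact: l1_close.
    have rV : rx z * V = `|cx z| * (nrm z ^+ N * V) + `|cy z| * (nrm z ^+ N * V).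
      by rewrite /rx; ring.
    have f1 : `|w1x z - w2y z| <= rx z * V + rc z * K.
      rewrite e1; apply: (le_trans (ler_normD _ _)); apply: lerD.
        apply: (le_trans (ler_normB _ _)); rewrite !normrM rV.
        by apply: lerD; rewrite ler_wpM2l.
      by rewrite normrM (ger0_norm ch0) /rc [nrm z ^+ N * _]mulrC -mulrA ler_wpM2l.
    have f2 : `|w2x z + w1y z| <= rx z * V + rc z * K.
      rewrite e2; apply: (le_trans (ler_normD _ _)); apply: lerD.
        apply: (le_trans (ler_normD _ _)); rewrite !normrM rV.
        by apply: lerD; rewrite ler_wpM2l.
      by rewrite normrM (ger0_norm ch0) /rc [nrm z ^+ N * _]mulrC -mulrA ler_wpM2l.
    have f3 : rx z * V <= rx z * U z + B2 * E z.
      apply: (@le_trans _ _ (rx z * (U z + E z))); first by rewrite ler_wpM2l.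
      rewrite mulrDr lerD2l ler_wpM2r//; apply: le_trans (hB2 z); exact: ler_norm.
    have f4 : rc z * K <= rc z * H z + B1 * E z.
      apply: (@le_trans _ _ (rc z * (H z + E z))); first by rewrite ler_wpM2l.
      rewrite mulrDr lerD2l ler_wpM2r//; apply: le_trans (hB1 z); exact: ler_norm.
    by rewrite /F; clear -f1 f2 f3 f4; lra.
  rewrite RintD; [|exact: inRZ..]; rewrite !RintZ// lerD2l ler_wpM2l//.
  by rewrite mulr_ge0// addr_ge0.
apply: (le_trans st1).
have st3 : 2 * W <= 9 / 2 * kappa * G.
  by clear -WG; lra.
have st4 : 9 / 2 * kappa * G <= 9 / 2 * kappa * (2 * \int[mu2]_z F z + 2 * (B1 + B2) * (4 * d)).
  by rewrite ler_wpM2l// mulr_ge0// divr_ge0.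
have dE : d * (36 * kappa * (B1 + B2) + 4 * B1 + 1) = e by rewrite /d divfK// gt_eqF.
set IF := \int[mu2]_z F z in st2 st4 *.
apply: (@le_trans _ _ (9 * kappa * IF + d * (36 * kappa * (B1 + B2) + 4 * B1 + 1))); last by rewrite dE.
apply: (@le_trans _ _ (9 / 2 * kappa * (2 * IF + 2 * (B1 + B2) * (4 * d)) + B1 * (4 * d))).
  by rewrite lerD2r (le_trans st3).
rewrite -subr_ge0 (_ : _ - _ = d); first exact: ltW.
by field.
Qed.

End inequality.
End carleman.

Lemma ae_imply2 d (T : measurableType d) (R : realType)
    (m : {measure set T -> \bar R}) (P Q S : T -> Prop) :
  (forall x, P x -> Q x -> S x) -> {ae m, forall x, P x} -> {ae m, forall x, Q x} ->
  {ae m, forall x, S x}.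
Proof.
move=> h hP hQ.
have [_ hI _] := ae_filter_ringOfSetsType m.
by apply: ae_imply (hI _ _ hP hQ) => x [px qx]; exact: h.
Qed.

(** * Propagation of vanishing towards the origin *)

Section inward.
Context {R : realType}.
Local Notation RR := (plane R).

Lemma ks_thin (A : set RR) (e t : R) (b : R * R) : measurable A -> 0 < t -> 0 < e ->
  (mu2 A <= (e ^+ 2)%:E)%E ->
  (\int[mu2]_(z in A) (ks t (z :-: b)%R)%:E <= (65 * e)%:E)%E.
Proof.
move=> mA t0 e0 hA; apply: (le_trans (ks_set b mA t0 e0)).
apply: (@le_trans _ _ ((64 * e)%:E + (e^-1)%:E * (e ^+ 2)%:E)%E).
  by apply: leeD2l; apply: lee_wpmul2l => //; rewrite lee_fin invr_ge0 ltW.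
rewrite -EFinM -EFinD lee_fin (_ : e^-1 * e ^+ 2 = e); last by field; rewrite gt_eqF.
by clear; lra.
Qed.

Variables (u1 u2 h1 h2 : R * R -> R) (eta : nat -> R -> R) (D1 M : R).
Hypotheses (u1i : inR u1) (u2i : inR u2) (h1i : inR h1) (h2i : inR h2).
Hypothesis etab : forall k, bump (k.+1%:R^-1) (eta k).
Hypotheses (D0 : 0 <= D1) (M0 : 0 <= M).
Hypothesis hM : forall z, D1 < nrm z -> `|h1 z| + `|h2 z| <= M * (`|u1 z| + `|u2 z|).
Hypothesis hme : forall k z, D1 + 2 / k.+1%:R < nrm z -> moll_eq (eta k) u1 u2 h1 h2 z.

Let U z := `|u1 z| + `|u2 z|.
Let H z := `|h1 z| + `|h2 z|.

(** On an annulus [A] just inside radius s, thin enough for the potential term to be absorbed, the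
    Carleman inequality leaves only the inner ramp of the cutoff, where |z|^N <= s2^N. Letting N
    grow kills u where |z| > s3 > s2. *)
Lemma inward_step (s : R) : D1 < s -> {ae mu2, forall z : RR, s < nrm z -> U z = 0} ->
  exists2 s', D1 < s' < s & {ae mu2, forall z : RR, s' < nrm z -> U z = 0}.
Proof.
move=> Ds Us; have s0 : 0 < s by exact: le_lt_trans Ds.
have Ui : inR U by apply: inRD; exact: inR_norm.
have Hi : inR H by apply: inRD; exact: inR_norm.
have U0 z : 0 <= U z by rewrite addr_ge0.
have H0 z : 0 <= H z by rewrite addr_ge0.
(* Makes 9 (65 e) M <= 1 / 2, the coefficient of the term to be absorbed. *)
pose e : R := (18 * 65 * (M + 1))^-1.
have e0 : 0 < e by rewrite invr_gt0 !mulr_gt0// ltr_wpDl.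
have [d d0 hd] := thin_annulus s (exprn_gt0 2 e0).
pose s1 := (D1 + s) / 2.
(* Within d of s, so that the annulus is thin, and beyond s1, so that the cutoff has room to rise
   from 0 at s1 to 1 at s2. *)
pose s2 := Num.max (s - d) ((s1 + s) / 2).
have [Ds1 s1s] := midf_lt Ds; rewrite -/s1 in Ds1 s1s; have [s11 s1s'] := midf_lt s1s.
have s12 : s1 < s2 by rewrite lt_max s11 orbT.
have s2s : s2 < s by rewrite gt_max ltrBlDr ltrDl d0.
pose A : set RR := [set z | nrm z \in `]s2, s]].
have mA : measurable A by exact: measurable_nrm_itv.
have hA : (mu2 A <= (e ^+ 2)%:E)%E by apply: hd; rewrite le_max lexx.
have s10 : 0 <= s1 by rewrite (le_trans D0)// ltW.
have [chi [cx [cy [hc c1 c2 c3]]]] := @cutoff_annulus R s1 s2 s s10 s12 (ltW s2s).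
have [k0 hk0] : exists k0 : nat, forall k, (k0 <= k)%N -> D1 + 2 / k.+1%:R < s1.
  have [k0 hk0] : exists k0 : nat, k0.+1%:R^-1 < (s1 - D1) / 2.
    have q : 0 < (s1 - D1) / 2 by rewrite divr_gt0// subr_gt0.
    by near \oo%classic => n; exists n; near: n; exact: near_infty_natSinv_lt (PosNum q).
  exists k0 => k kk; have : k.+1%:R^-1 <= k0.+1%:R^-1 :> R.
    by rewrite lef_pV2 ?posrE ?ltr0n// ler_nat ltnS.
  by move=> kk'; rewrite -ltrBrDl mulrC -ltr_pdivlMr//; exact: le_lt_trans hk0.
have s1T : 0 <= s + 1 by rewrite addr_ge0// ltW.
have kap0 : 0 <= 65 * e by rewrite mulr_ge0// ltW.
have car N := @carleman_ineq R u1 u2 h1 h2 eta u1i u2i h1i h2i etab N A (s + 1) (65 * e)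
  chi cx cy k0 hc s1T _ mA _ _ kap0 (fun t b t0 => ks_thin b mA t0 e0 hA) _.
have {}car N : \int[mu2]_z (nrm z ^+ N * U z * \1_A z) <=
  9 * (65 * e) * \int[mu2]_z (nrm z ^+ N * ((`|cx z| + `|cy z|) * U z + chi z * H z)).
  apply: car.
  - move=> z nz; apply: c3; rewrite leNgt; apply/negP => h; apply: nz.
    by apply: nrm_cbox; exact: ltW.
  - move=> z; rewrite /A/= in_itv/= => /andP[_ zs]; apply: nrm_cbox.
    by rewrite (le_trans zs)// lerDl.
  - move=> z; rewrite /A/= in_itv/= => /andP[zs zs']; have [] := c2 z => //.
    by rewrite zs' ltW.
  - move=> k z kk nz; apply: hme; apply: (lt_trans (hk0 k kk)); rewrite ltNge.
    by apply/negP => /c1[h _ _]; rewrite h eqxx in nz.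
case: hc => [c_x c_y [cc ccx ccy] c01].
have cab (f : R * R -> R) : continuous f -> continuous (fun z => `|f z|).
  by move=> cf z; apply: cvg_norm; exact: cf.
have cc' : continuous (fun z => `|cx z| + `|cy z|) by apply: ctD; exact: cab.
have sup z : ~ cbox (s + 1) z -> [/\ chi z = 0, cx z = 0 & cy z = 0].
  move=> nz; apply: c3; rewrite leNgt; apply/negP => h; apply: nz.
  by apply: nrm_cbox; exact: ltW.
have scc z : ~ cbox (s + 1) z -> `|cx z| + `|cy z| = 0.
  by move=> /sup[_ -> ->]; rewrite normr0 addr0.
have [B B0 hB] := Cc_bounded cc' scc.
pose I := \int[mu2]_z U z.
have I0 : 0 <= I by exact: Rint_ge0.
have crN N : continuous (fun z : R * R => nrm z ^+ N) by apply: ctX; exact: ct_nrm.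
have r0 N (z : R * R) : 0 <= nrm z ^+ N by rewrite exprn_ge0// nrm_ge0.
have bA := bm_indic mA.
have b1 N : bm (fun z => nrm z ^+ N * \1_A z).
  split.
    by apply: measurable_funM; [exact: continuous_measurable2|case: bA].
  exists (s ^+ N) => z; rewrite indicE; case: (boolP (z \in A)) => [|_]; last first.
    by rewrite mulr0 normr0 exprn_ge0// ltW.
  rewrite inE /A/= in_itv/= mulr1 => /andP[_ zs]; rewrite ger0_norm// lerXn2r// nnegrE.
    exact: nrm_ge0.
  exact: ltW.
have Xi N : inR (fun z => nrm z ^+ N * U z * \1_A z).
  rewrite (_ : (fun z => _) = fun z => U z * (nrm z ^+ N * \1_A z)); first exact: inR_pairing.
  by apply/funext => z; rewrite mulrCA mulrA.
pose X N := \int[mu2]_z (nrm z ^+ N * U z * \1_A z).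
have b2 N : bm (fun z => nrm z ^+ N * (`|cx z| + `|cy z|)).
  by apply: bm_Cc; [exact: ctM|move=> z /scc ->; rewrite mulr0].
have b3 N : bm (fun z => nrm z ^+ N * chi z).
  by apply: bm_Cc; [exact: ctM|move=> z /sup[-> _ _]; rewrite mulr0].
have Yi N : inR (fun z => nrm z ^+ N * ((`|cx z| + `|cy z|) * U z + chi z * H z)).
  rewrite (_ : (fun z => _) = fun z => U z * (nrm z ^+ N * (`|cx z| + `|cy z|)) +
    H z * (nrm z ^+ N * chi z)); last by apply/funext => z; ring.
  by apply: inRD; exact: inR_pairing.
(* Four zones: the cutoff vanishes up to s1; on its ramp |z|^N <= s2^N; on [A] it is constant and
   only the potential contributes; beyond s both u and h vanish. *)
have XN N : X N <= 9 * (65 * e) * (s2 ^+ N * (B + M) * I + M * X N).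
  have k9 : 0 <= 9 * (65 * e) by rewrite mulr_ge0.
  apply: (le_trans (car N)); apply: (ler_wpM2l k9).
  rewrite /I /X -!RintZ// -RintD; [|exact: inRZ..].
  apply: Rint_le_ae => //; first by apply: inRD; exact: inRZ.
  apply: ae_imply Us => z Us.
  have ch : 0 <= chi z <= 1 by exact: c01.
  have UB : (`|cx z| + `|cy z|) * U z <= B * U z.
    by rewrite ler_wpM2r//; apply: le_trans (hB z); exact: ler_norm.
  have q1 : 0 <= s2 ^+ N * (B + M) * U z.
    rewrite !mulr_ge0// ?addr_ge0// exprn_ge0// (le_trans s10)//; exact: ltW.
  have q2 : 0 <= nrm z ^+ N * U z * \1_A z by rewrite !mulr_ge0.
  have [zs1|zs1] := leP (nrm z) s1.
    have [-> -> ->] := c1 z zs1.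
    by rewrite normr0 addr0 !mul0r addr0 mulr0 addr_ge0// mulr_ge0.
  have HU : H z <= M * U z by apply: hM; exact: lt_trans zs1.
  have cH : chi z * H z <= M * U z.
    case/andP: ch => ch0 ch1; apply: le_trans HU; exact: ler_piMl.
  have [zs2|zs2] := leP (nrm z) s2.
    apply: (@le_trans _ _ (s2 ^+ N * (B + M) * U z)); last by rewrite lerDl mulr_ge0.
    rewrite -mulrA; apply: ler_pM => //.
    - by apply: addr_ge0; apply: mulr_ge0 => //; case/andP: ch.
    - by rewrite lerXn2r// nnegrE ?nrm_ge0// (le_trans s10)// ltW.
    - by rewrite [leRHS]mulrDl lerD.
  have [zs|zs] := leP (nrm z) s.
    have [-> -> ->] : [/\ chi z = 1, cx z = 0 & cy z = 0] by apply: c2; rewrite zs ltW.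
    rewrite normr0 addr0 mul0r add0r mul1r indicE mem_set; last by rewrite /A/= in_itv/= zs2.
    rewrite mulr1; apply: (@le_trans _ _ (M * (nrm z ^+ N * U z))); last by rewrite lerDr.
    by rewrite mulrCA ler_wpM2l.
  have U00 := Us zs; rewrite U00 in HU *.
  have H00 : H z = 0 by apply/le_anti; rewrite H0 andbT (le_trans HU)// mulr0.
  by rewrite H00 !mulr0 addr0 !mulr0 mul0r mulr0 addr0.
have X0 N : 0 <= X N by apply: Rint_ge0 => z; rewrite !mulr_ge0.
have eM : 9 * (65 * e) * M <= 1 / 2.
  have h : 18 * 65 * (M + 1) * e = 1 by rewrite /e mulfV// gt_eqF// !mulr_gt0// ltr_wpDl.
  by have := ltW e0; move: h M0; move: (M) => m; nra.
have XK N : X N <= 2 * (9 * (65 * e)) * (B + M) * I * s2 ^+ N.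
  have h1' := XN N; have h2' : 9 * (65 * e) * M * X N <= 1 / 2 * X N by rewrite ler_wpM2r.
  rewrite mulrDr [9 * (65 * e) * (M * _)]mulrA in h1'.
  have -> : 2 * (9 * (65 * e)) * (B + M) * I * s2 ^+ N = 2 * (9 * (65 * e) * (s2 ^+ N * (B + M) * I)) by ring.
  move: h1' h2'.
  set a := 9 * (65 * e) * (s2 ^+ N * (B + M) * I); set b := _ * X N; clear; lra.
have s20 : 0 < s2 by exact: le_lt_trans s12.
pose s3 := (s2 + s) / 2.
have [s23 s3s] := midf_lt s2s; rewrite -/s3 in s23 s3s.
have s30 : 0 < s3 by exact: lt_trans s23.
exists s3; first by rewrite s3s andbT (lt_trans Ds1)// (lt_trans s12).
pose A3 : set RR := [set z | nrm z \in `]s3, s]].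
have mA3 : measurable A3 by exact: measurable_nrm_itv.
have b3' := bm_indic mA3.
have Zi : inR (fun z => U z * \1_A3 z) by exact: inR_pairing.
have Z0 : \int[mu2]_z (U z * \1_A3 z) <= 0.
  (* On [A3] the weight |z|^N is at least s3^N, whence geometric decay with ratio s2 / s3 < 1. *)
  apply: (@geo_le0 _ _ (2 * (9 * (65 * e)) * (B + M) * I) (s2 / s3)).
  - by rewrite divr_ge0// ltW.
  - by rewrite ltr_pdivrMr// mul1r.
  move=> N; rewrite expr_div_n [leRHS]mulrA ler_pdivlMr ?exprn_gt0//.
  apply: le_trans (XK N); rewrite mulrC -RintZ//.
  apply: Rint_le => //; first exact: inRZ.
  move=> z; rewrite !indicE; case: (boolP (z \in A3)) => [|_]; last first.
    by rewrite !mulr0 mulr_ge0// mulr_ge0.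
  rewrite inE /A3/= in_itv/= => /andP[z3 zs]; rewrite mem_set; last first.
    by rewrite /A/= in_itv/= zs (lt_trans s23).
  rewrite !mulr1 ler_wpM2r// lerXn2r// ?nnegrE ?nrm_ge0//; exact: ltW.
have := Rint_le0_ae Zi (fun z => mulr_ge0 (U0 z) (ler0n _ _)) Z0.
move=> hz; apply: (ae_imply2 _ Us hz) => z h1' h2' z3.
have [zs|/h1'//] := leP (nrm z) s.
by move: h2'; rewrite indicE mem_set ?mulr1// /A3/= in_itv/= z3.
Unshelve. all: by end_near. Qed.

(** Consider the infimum of the radii beyond which u vanishes. It belongs to the set, by a countable
    intersection, so [inward_step] forbids it to exceed [D1]. *)
Lemma uc_inward (s : R) : {ae mu2, forall z : RR, s < nrm z -> U z = 0} ->
  {ae mu2, forall z : RR, D1 < nrm z -> U z = 0}.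
Proof.
move=> Us; pose E := [set t : R | D1 <= t /\ {ae mu2, forall z : RR, t < nrm z -> U z = 0}].
have [sD|Ds] := leP s D1.
  by apply: ae_imply Us => z h zD; apply: h; exact: le_lt_trans zD.
have Es : E s by split => //; exact: ltW.
have hE : has_inf E by split; [exists s|exists D1 => t []].
pose i := inf E.
have iD : D1 <= i by apply: lb_le_inf; [exists s|move=> t []].
have Ei : {ae mu2, forall z : RR, i < nrm z -> U z = 0}.
  have h (n : nat) : {ae mu2, forall z : RR, i + n.+1%:R^-1 < nrm z -> U z = 0}.
    have n0 : (0 : R) < n.+1%:R^-1 by rewrite invr_gt0.
    have [t [_ Et] ti] := inf_adherent n0 hE.
    by apply: ae_imply Et => z h zi; apply: h; exact: lt_trans zi.
  have : {ae mu2, forall z : RR, forall n : nat, i + n.+1%:R^-1 < nrm z -> U z = 0}.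
    by apply/ae_foralln.
  apply: ae_imply => z hz zi.
  have q : 0 < nrm z - i by rewrite subr_gt0.
  have [n hn] : exists n : nat, n.+1%:R^-1 < nrm z - i.
    by near \oo%classic => n; exists n; near: n; exact: near_infty_natSinv_lt (PosNum q).
  by apply: (hz n); rewrite -ltrBrDl.
have [Di|iD'] := ltP D1 i; last first.
  by apply: ae_imply Ei => z h zD; apply: h; exact: le_lt_trans zD.
have [s' /andP[Ds' s'i] Es'] := inward_step Di Ei.
have : i <= s' by apply: ge_inf; [case: hE|split=> //; exact: ltW].
by rewrite leNgt s'i.
Unshelve. all: by end_near. Qed.

End inward.

(** * A local submean inequality *)

Section profile.
Context {R : realType}.
Implicit Types t x : R.

(** Applied to 1 - (|z - b|^2 + tau) / (s^2 + tau), the logarithm is a regularized potential of a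
    point mass at b. Subtracting its second-order Taylor polynomial makes the profile vanish to
    third order at 0, so that its extension by 0 is C^2. [G1] and [G2] are its first two
    derivatives. *)
Definition G0 t : R := - (ln (1 - pos t) + pos t + pos t ^+ 2 / 2) / 2.
Definition G1 t : R := pos t ^+ 2 / (1 - pos t) / 2.
Definition G2 t : R := (2 * pos t - pos t ^+ 2) / (1 - pos t) ^+ 2 / 2.

Lemma pos_lt1 t : t < 1 -> pos t < 1.
Proof. by move=> t1; rewrite /pos gt_max t1 ltr01. Qed.

Lemma ln_le_sub1 x : 0 < x -> ln x <= x - 1.
Proof.
move=> x0; have := expR_ge1Dx (ln x); rewrite lnK ?posrE//; lra.
Qed.

Lemma ln1p_bounds (p : R) : 0 <= p -> p <= 2^-1 ->
  0 <= - ln (1 - p) - p /\ - ln (1 - p) - p <= 2 * p ^+ 2.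
Proof.
move=> p0 p1; have q0 : 0 < 1 - p by lra.
split; first by have := ln_le_sub1 q0; lra.
rewrite -lnV ?posrE//.
have i0 : 0 < (1 - p)^-1 by rewrite invr_gt0.
have h1 := ln_le_sub1 i0; have h2 : (1 - p)^-1 * (1 - p) = 1 by rewrite mulVf// gt_eqF.
move: h1 h2; set q := (1 - p)^-1 => h1 h2.
have q2 : q <= 2 by rewrite /q -[leRHS]invrK lef_pV2 ?posrE//; lra.
nra.
Qed.

(** A profile that is a function of the positive part is differentiable at 0 as soon as it is
    quadratically small there. *)
Lemma der_posglue (f F F' : R -> R) (C x : R) : (forall t, f t = F (pos t)) -> F 0 = 0 ->
  F' 0 = 0 -> (forall t, 0 < t -> t < 1 -> der F t (F' t)) ->
  (forall t, 0 <= t -> t <= 2^-1 -> `|F t| <= C * t ^+ 2) -> x < 1 -> der f x (F' (pos x)).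
Proof.
move=> fE F0 F'0 dF qF x1; have [x0|x0|->] := ltgtP x 0.
- rewrite pos0 ?ltW// F'0; apply: (der_near (f := fun=> 0)); last exact: der_cst.
  near=> y; rewrite fE pos0 ?F0// ltW//; near: y; exact: lt_nbhsl.
- rewrite posE ?ltW//; apply: (der_near (f := F)); last exact: dF.
  near=> y; rewrite fE posE// ltW//; near: y; exact: lt_nbhsr.
- rewrite pos0// F'0; have C0 : 0 <= C.
    have h2 : (0 : R) <= 2^-1 by rewrite invr_ge0.
    have := qF _ h2 (lexx _).
    move/(le_trans (normr_ge0 _)); rewrite pmulr_lge0// exprn_gt0// invr_gt0//.
  apply: (@der_quad _ f 0 0 C 2^-1); first by rewrite invr_gt0.
  move=> h hd; rewrite add0r !fE [pos 0]pos0// F0 subr0 mulr0 subr0.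
  have [h0|h0] := leP h 0; first by rewrite pos0// F0 normr0 mulr_ge0// sqr_ge0.
  rewrite (posE (ltW h0)); apply: qF; first exact: ltW.
  by apply: ltW; apply: le_lt_trans hd; exact: ler_norm.
Unshelve. all: by end_near. Qed.

Lemma der_G0 x : x < 1 -> der G0 x (G1 x).
Proof.
apply: (@der_posglue _ (fun p => - (ln (1 - p) + p + p ^+ 2 / 2) / 2)
  (fun p => p ^+ 2 / (1 - p) / 2) 2) => //.
- by rewrite subr0 ln1; lra.
- by rewrite expr0n/= !mul0r.
- move=> t t0 t1; have q0 : 0 < 1 - t by lra.
  have d1 : der (fun p => 1 - p) t (-1).
    by apply: (der_eq (derB (der_cst 1 t) (der_id t))); rewrite sub0r.
  have d2 := der_comp (f := @ln R) (g := fun p => 1 - p) (der_ln q0) d1.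
  have d3 := derM (der_id t) (der_id t).
  have := derM (derN (derD (derD d2 (der_id t)) (derM d3 (der_cst 2^-1 t)))) (der_cst 2^-1 t).
  move/der_eq; apply; rewrite /=; field; lra.
- move=> t t0 t1; have [h1 h2] := ln1p_bounds t0 t1.
  have := sqr_ge0 t; rewrite ler_norml => h3; apply/andP; split; lra.
Qed.

Lemma der_G1 x : x < 1 -> der G1 x (G2 x).
Proof.
apply: (@der_posglue _ (fun p => p ^+ 2 / (1 - p) / 2)
  (fun p => (2 * p - p ^+ 2) / (1 - p) ^+ 2 / 2) 1) => //.
- by rewrite expr0n/= !mul0r.
- by rewrite expr0n/= mulr0 subr0 !mul0r.
- move=> t t0 t1; have q0 : 0 < 1 - t by lra.
  have d1 : der (fun p => 1 - p) t (-1).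
    by apply: (der_eq (derB (der_cst 1 t) (der_id t))); rewrite sub0r.
  have d2 := derV (f := fun p => 1 - p) (lt0r_neq0 q0) d1.
  have d3 := derM (der_id t) (der_id t).
  have := derM (derM d3 d2) (der_cst 2^-1 t).
  move/der_eq; apply; rewrite /=; field; lra.
- move=> t t0 t1; rewrite ger0_norm; last first.
    by apply: divr_ge0 => //; apply: divr_ge0; [exact: sqr_ge0|lra].
  have q0 : 0 < 1 - t by lra.
  have : (1 - t)^-1 <= 2 by rewrite -[leRHS]invrK lef_pV2 ?posrE//; lra.
  have := sqr_ge0 t; nra.
Qed.

Lemma G_ge0 t : t < 1 -> 0 <= G0 t /\ 0 <= G1 t.
Proof.
move=> t1; have p1 := pos_lt1 t1; have p0 := pos_ge0 t; split; last first.
  by apply: divr_ge0 => //; apply: divr_ge0; [exact: sqr_ge0|lra].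
have main (p : R) : 0 <= p -> p < 1 -> 0 <= - ln (1 - p) - p - p ^+ 2 / 2.
  move=> p00 p11; pose f (p : R) := - ln (1 - p) - p - p ^+ 2 / 2.
  have df c : c < 1 -> der f c (c ^+ 2 / (1 - c)).
    move=> c1; have q0 : 0 < 1 - c by lra.
    have d1 : der (fun p => 1 - p) c (-1).
      by apply: (der_eq (derB (der_cst 1 c) (der_id c))); rewrite sub0r.
    have d2 := der_comp (f := @ln R) (g := fun p => 1 - p) (der_ln q0) d1.
    have d3 := derM (der_id c) (der_id c).
    have := derB (derB (derN d2) (der_id c)) (derM d3 (der_cst 2^-1 c)).
    by move/der_eq; apply; rewrite /=; field; lra.
  have f0 : f 0 = 0 by rewrite /f !subr0 ln1 expr0n/=; lra.
  rewrite -/(f p) -f0.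
  have [||c] := @MVT_segment R f (fun c => c ^+ 2 / (1 - c)) 0 p p00.
  - by move=> c; rewrite in_itv/= => /andP[_ cp]; apply: df; lra.
  - apply: continuous_in_subspaceT => c; rewrite inE/= in_itv/= => /andP[_ cp].
    by apply: (der_continuous (df _ _)); lra.
  rewrite in_itv/= => /andP[c0 cp] h; rewrite -subr_ge0 h subr0 mulr_ge0//.
  by apply: divr_ge0; [exact: sqr_ge0|lra].
by rewrite /G0; have := main _ p0 p1; lra.
Qed.

End profile.

(** * The weight for the submean inequality *)

Section local_weight.
Context {R : realType}.
Local Notation RR := (plane R).
Variables (b : R * R) (s tau : R).
Hypotheses (s0 : 0 < s) (t0 : 0 < tau) (t1 : tau <= 1).

Definition Sq : R := s ^+ 2 + tau.
Definition dsq (z : R * R) : R := sqn (z :-: b).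
Definition Tw (z : R * R) : R := (s ^+ 2 - dsq z) / Sq.
Definition lpsi z := G0 (Tw z).
Definition lpx z := G1 (Tw z) * (- (2 * (z.1 - b.1)) / Sq).
Definition lpy z := G1 (Tw z) * (- (2 * (z.2 - b.2)) / Sq).
Definition llap z := G2 (Tw z) * (4 * dsq z / Sq ^+ 2) - G1 (Tw z) * (4 / Sq).

Lemma Sq_gt0 : 0 < Sq. Proof. by rewrite ltr_wpDl// sqr_ge0. Qed.

Lemma dsq_ge0 z : 0 <= dsq z. Proof. exact: sqn_ge0. Qed.

Lemma Tw_lt1 z : Tw z < 1.
Proof.
rewrite /Tw ltr_pdivrMr ?Sq_gt0// mul1r /Sq; have := dsq_ge0 z; have := t0; lra.
Qed.

Lemma Tw_cden z : (1 - Tw z) * Sq = cden tau (z :-: b).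
Proof.
rewrite mulrBl mul1r /Tw divfK ?gt_eqF ?Sq_gt0// /Sq /cden /dsq /sqn/=; ring.
Qed.

(** The logarithm produces the regularized Dirac mass at b, with the factor -2; the quadratic
    correction produces the first term, a bounded positive weight on the disc. *)
Lemma llap_eq z : 0 < Tw z ->
  llap z = 4 / Sq * (Tw z + tau / Sq / 2) - 2 * poisson tau (z :-: b).
Proof.
move=> T0; have S0 := Sq_gt0; have q0 : 0 < 1 - Tw z by have := Tw_lt1 z; lra.
rewrite /poisson -Tw_cden.
rewrite /llap /G1 /G2 posE ?ltW//.
have -> : dsq z = Sq * (1 - Tw z) - tau.
  have := Tw_cden z; rewrite /cden mulrC => ->; rewrite /dsq /sqn/=; ring.
by field; rewrite !gt_eqF.
Qed.

Lemma local0 z : Tw z <= 0 -> [/\ lpsi z = 0, lpx z = 0, lpy z = 0 & llap z = 0].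
Proof.
move=> T0; have p0 := pos0 T0; rewrite /lpsi /lpx /lpy /llap /G0 /G1 /G2 p0.
rewrite !expr0n/= !subr0 ln1; split; ring.
Qed.

Lemma Tw_le0 z : (Tw z <= 0) = (s ^+ 2 <= dsq z).
Proof. by rewrite /Tw pmulr_lle0 ?invr_gt0 ?Sq_gt0// subr_le0. Qed.

Lemma Tw_far z : s <= nrm (z :-: b) -> Tw z <= 0.
Proof. by rewrite Tw_le0 nrm_ge// ltW. Qed.

Lemma lpsi_ge0 z : 0 <= lpsi z.
Proof. by case: (G_ge0 (Tw_lt1 z)). Qed.

Let X1 : D1 (fun z : R * R => z.1 - b.1) (fun=> 1).
Proof. by apply: (D1_eq (D1B (@D1_fst R) (D1_cst _))) => z; rewrite subr0. Qed.
Let X2 : D2 (fun z : R * R => z.1 - b.1) (fun=> 0).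
Proof. by apply: (D2_eq (D2B (@D2_fst R) (D2_cst _))) => z; rewrite subr0. Qed.
Let Y1 : D1 (fun z : R * R => z.2 - b.2) (fun=> 0).
Proof. by apply: (D1_eq (D1B (@D1_snd R) (D1_cst _))) => z; rewrite subr0. Qed.
Let Y2 : D2 (fun z : R * R => z.2 - b.2) (fun=> 1).
Proof. by apply: (D2_eq (D2B (@D2_snd R) (D2_cst _))) => z; rewrite subr0. Qed.

Let T1 : D1 Tw (fun z => - (2 * (z.1 - b.1)) / Sq).
Proof.
apply: (D1_eq (D1M (D1B (D1_cst (s ^+ 2)) (D1D (D1M X1 X1) (D1M Y1 Y1))) (D1_cst Sq^-1))) => z.
by ring.
Qed.
Let T2 : D2 Tw (fun z => - (2 * (z.2 - b.2)) / Sq).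
Proof.
apply: (D2_eq (D2M (D2B (D2_cst (s ^+ 2)) (D2D (D2M X2 X2) (D2M Y2 Y2))) (D2_cst Sq^-1))) => z.
by ring.
Qed.

Let ctX' : continuous (fun z : R * R => z.1 - b.1).
Proof. by apply: ctB; [exact: ct_fst|exact: ct_cst]. Qed.
Let ctY' : continuous (fun z : R * R => z.2 - b.2).
Proof. by apply: ctB; [exact: ct_snd|exact: ct_cst]. Qed.

Let ct_dsq : continuous dsq.
Proof. by apply: ctD; exact: ctX. Qed.

Lemma ct_Tw : continuous Tw.
Proof. by apply: ctM; [apply: ctB => //; exact: ct_cst|exact: ct_cst]. Qed.

Let ct_pos : continuous (fun z => pos (Tw z)).
Proof. by apply: ct_comp; [exact: ct_Tw|move=> z; exact: continuous_pos]. Qed.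

Let ct_1pos : continuous (fun z => 1 - pos (Tw z)).
Proof. by apply: ctB => //; exact: ct_cst. Qed.

Let pos1 z : 0 < 1 - pos (Tw z).
Proof. by rewrite subr_gt0; exact: pos_lt1 (Tw_lt1 z). Qed.

Let ct_G1 : continuous (fun z => G1 (Tw z)).
Proof.
apply: ctM; last exact: ct_cst; apply: ctM; first exact: ctX.
by apply: ctV => // z; rewrite gt_eqF.
Qed.

Let ct_G2 : continuous (fun z => G2 (Tw z)).
Proof.
apply: ctM; last exact: ct_cst; apply: ctM.
  by apply: ctB; [apply: ctM => //; exact: ct_cst|exact: ctX].
by apply: ctV; [move=> z; rewrite expf_neq0// gt_eqF|exact: ctX].
Qed.

Let ct_lpsi : continuous lpsi.
Proof.
apply: ctM; last exact: ct_cst; apply: ctN; apply: ctD; first apply: ctD => //.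
  exact: ct_ln.
by apply: ctM; [exact: ctX|exact: ct_cst].
Qed.

Lemma local_C2c L : `|b.1| + s <= L -> `|b.2| + s <= L -> C2c L lpsi lpx lpy llap.
Proof.
move=> b1 b2.
have far z : ~ cbox L z -> Tw z <= 0.
  move=> nz; apply: Tw_far; rewrite leNgt; apply/negP => h; apply: nz.
  have [h1 h2] := nrm_cbox (ltW h); split.
    rewrite -[z.1](subrK b.1) (le_trans (ler_normD _ _))// addrC.
    by apply: le_trans b1; rewrite lerD2l.
  rewrite -[z.2](subrK b.2) (le_trans (ler_normD _ _))// addrC.
  by apply: le_trans b2; rewrite lerD2l.
split.
- by apply: (D1_comp (h := @G0 R) (h' := @G1 R) _ T1) => z; exact: der_G0 (Tw_lt1 z).
- by apply: (D2_comp (h := @G0 R) (h' := @G1 R) _ T2) => z; exact: der_G0 (Tw_lt1 z).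
- exists (fun z => G2 (Tw z) * (4 * (z.1 - b.1) ^+ 2 / Sq ^+ 2) - G1 (Tw z) * (2 / Sq)).
  exists (fun z => G2 (Tw z) * (4 * (z.2 - b.2) ^+ 2 / Sq ^+ 2) - G1 (Tw z) * (2 / Sq)).
  have S0 : Sq != 0 by rewrite gt_eqF// Sq_gt0.
  split.
  + have dG : D1 (fun z => G1 (Tw z)) (fun z => G2 (Tw z) * (- (2 * (z.1 - b.1)) / Sq)).
      by apply: (D1_comp (h := @G1 R) (h' := @G2 R) _ T1) => z; exact: der_G1 (Tw_lt1 z).
    apply: (D1_eq (D1M dG (D1M (D1N (D1M (D1_cst 2) X1)) (D1_cst Sq^-1)))) => z.
    by field.
  + have dG : D2 (fun z => G1 (Tw z)) (fun z => G2 (Tw z) * (- (2 * (z.2 - b.2)) / Sq)).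
      by apply: (D2_comp (h := @G1 R) (h' := @G2 R) _ T2) => z; exact: der_G1 (Tw_lt1 z).
    apply: (D2_eq (D2M dG (D2M (D2N (D2M (D2_cst 2) Y2)) (D2_cst Sq^-1)))) => z.
    by field.
  + apply: ctB; apply: ctM => //; last exact: ct_cst.
    by apply: ctM; last exact: ct_cst; apply: ctM; [exact: ct_cst|exact: ctX].
  + apply: ctB; apply: ctM => //; last exact: ct_cst.
    by apply: ctM; last exact: ct_cst; apply: ctM; [exact: ct_cst|exact: ctX].
  + split; first by move=> z; rewrite /llap /dsq /sqn/=; field.
    by move=> z /far T0; rewrite /G1 /G2 (pos0 T0) !expr0n/= mulr0 subr0 !mul0r subr0.
- split => //; apply: ctM => //; apply: ctM; try exact: ct_cst;
    apply: ctN; apply: ctM => //; exact: ct_cst.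
- by move=> z /far; exact: local0.
Qed.

(** The inequality ln x <= x - 1 at x = (1 - Tw)^(-1/2), which is exactly the right-hand side. *)
Lemma lpsi_le z : lpsi z <= Num.sqrt Sq * ks tau (z :-: b).
Proof.
have S0 := Sq_gt0; have c0 := cden_gt0 (z :-: b) t0.
rewrite /ks -sqrtrV; last exact: ltW.
rewrite -sqrtrM; last exact: ltW.
have [T0|T0] := leP (Tw z) 0.
  by have [-> _ _ _] := local0 T0; exact: sqrtr_ge0.
have q0 : 0 < 1 - Tw z by have := Tw_lt1 z; lra.
have -> : Sq / cden tau (z :-: b) = (1 - Tw z)^-1.
  by rewrite -Tw_cden; field; rewrite !gt_eqF.
have r0 : 0 < Num.sqrt (1 - Tw z)^-1 by rewrite sqrtr_gt0 invr_gt0.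
have h := ln_le_sub1 r0.
have : ln (1 - Tw z)^-1 = 2 * ln (Num.sqrt (1 - Tw z)^-1).
  by rewrite -[X in ln X = _]sqr_sqrtr ?invr_ge0 ?ltW// lnXn// mulr_natl.
rewrite lnV ?posrE// => h2; rewrite /lpsi /G0 (posE (ltW T0)).
have := sqr_ge0 (Tw z); move: h h2 r0 T0.
set x := Num.sqrt _; set y := ln (1 - Tw z); set w := ln x; lra.
Qed.

(** The gradient is, up to sign, Tw^2 <= 1 times (z - b) / (|z - b|^2 + tau). *)
Lemma lgrad_le z : `|lpx z| <= ks tau (z :-: b) /\
  `|lpy z| <= ks tau (z :-: b).
Proof.
have S0 := Sq_gt0; have c0 := cden_gt0 (z :-: b) t0.
have k0 : 0 <= ks tau (z :-: b) by rewrite ltW// ks_gt0.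
have [T0|T0] := leP (Tw z) 0.
  by have [_ -> -> _] := local0 T0; rewrite normr0.
have T1' := Tw_lt1 z; have q0 : 0 < 1 - Tw z by lra.
have [k1 k2] := ck_le (z :-: b) t0.
have T2' : 0 <= Tw z ^+ 2 <= 1 by rewrite sqr_ge0 expr_le1// ltW.
have aux (x : R) : `|G1 (Tw z) * (- (2 * x) / Sq)| <= `|x / cden tau (z :-: b)|.
  have -> : G1 (Tw z) * (- (2 * x) / Sq) = - (Tw z ^+ 2 * (x / cden tau (z :-: b))).
    by rewrite /G1 posE ?ltW// -Tw_cden; field; rewrite !gt_eqF.
  by case/andP: T2' => T2' T3'; rewrite normrN normrM (ger0_norm T2') ler_piMl.
split; first exact: le_trans (aux _) k1.
by apply: le_trans (aux _) _; move: k2; rewrite /ck2/= mulNr normrN.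
Qed.

End local_weight.

(** * The submean inequality and local vanishing *)

Section local.
Context {R : realType}.
Local Notation RR := (plane R).

Lemma nrmD (p q : R * R) : nrm (p.1 + q.1, p.2 + q.2) <= nrm p + nrm q.
Proof.
rewrite nrm_le ?addr_ge0 ?nrm_ge0//.
have p0 := nrm_ge0 p; have q0 := nrm_ge0 q; have p2 := nrm_sq p; have q2 := nrm_sq q.
have cs : p.1 * q.1 + p.2 * q.2 <= nrm p * nrm q.
  apply: (le_trans (ler_norm _)); rewrite -ler_sqr ?nnegrE ?mulr_ge0//.
  rewrite real_normK ?num_real// exprMn p2 q2 /sqn.
  have := sqr_ge0 (p.1 * q.2 - p.2 * q.1); nra.
rewrite sqrrD p2 q2 /sqn/=; nra.
Qed.

Lemma dot_le (x y p q m : R) : 0 <= m -> x ^+ 2 + y ^+ 2 <= m ^+ 2 ->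
  x * p + y * q <= m * nrm (p, q).
Proof.
move=> m0 xy; have n0 := nrm_ge0 (p, q); have n2 := nrm_sq (p, q).
apply: (le_trans (ler_norm _)); rewrite -ler_sqr ?nnegrE ?mulr_ge0//.
rewrite real_normK ?num_real// exprMn n2 /sqn/=.
have h : (x * p + y * q) ^+ 2 <= (x ^+ 2 + y ^+ 2) * (p ^+ 2 + q ^+ 2).
  have := sqr_ge0 (x * q - y * p); nra.
by apply: (le_trans h); rewrite ler_wpM2r// addr_ge0 ?sqr_ge0.
Qed.

(** The field multiplying the gradient of the weight is conj(v) (g + i h) / q up to the order of its
    components, so its length is at most m when |g + i h| <= m |v|. *)
Lemma integrand_le (e a b g h p px py lap m : R) : 0 < e -> 0 <= m ->
  g ^+ 2 + h ^+ 2 <= m ^+ 2 * (a ^+ 2 + b ^+ 2) ->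
  integrand e a b g h p px py lap <= Lam e a b * lap + m * nrm (px, py) +
    e / 2 * p * ((g ^+ 2 + h ^+ 2) / qq e a b ^+ 2).
Proof.
move=> e0 m0 gh; have q0 := @qq_gt0 R e e0 a b.
rewrite /integrand -!addrA lerD2l !addrA lerD2r; apply: dot_le => //.
have -> : ((a * g + b * h) / qq e a b) ^+ 2 + ((a * h - b * g) / qq e a b) ^+ 2 =
    (a ^+ 2 + b ^+ 2) * (g ^+ 2 + h ^+ 2) / qq e a b ^+ 2.
  by field; rewrite gt_eqF.
have n0 : 0 <= a ^+ 2 + b ^+ 2 by rewrite addr_ge0 ?sqr_ge0.
have nq : a ^+ 2 + b ^+ 2 <= qq e a b by rewrite /qq lerDl ltW.
rewrite ler_pdivrMr ?exprn_gt0//.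
apply: (@le_trans _ _ ((a ^+ 2 + b ^+ 2) * (m ^+ 2 * (a ^+ 2 + b ^+ 2)))).
  by rewrite ler_wpM2l.
rewrite mulrCA ler_wpM2l ?sqr_ge0// expr2; exact: ler_pM.
Qed.

(** The numerator is at most m^2 |v|^2, and both e and |v|^2 are at most q: the bound is uniform in
    e. *)
Lemma err_le (e a b g h p m : R) : 0 < e -> 0 <= p ->
  g ^+ 2 + h ^+ 2 <= m ^+ 2 * (a ^+ 2 + b ^+ 2) ->
  e / 2 * p * ((g ^+ 2 + h ^+ 2) / qq e a b ^+ 2) <= m ^+ 2 / 2 * p.
Proof.
move=> e0 p0 gh; have q0 := @qq_gt0 R e e0 a b.
have n0 : 0 <= a ^+ 2 + b ^+ 2 by rewrite addr_ge0 ?sqr_ge0.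
have main : e * ((g ^+ 2 + h ^+ 2) / qq e a b ^+ 2) <= m ^+ 2.
  rewrite mulrA ler_pdivrMr ?exprn_gt0//.
  apply: (@le_trans _ _ (e * (m ^+ 2 * (a ^+ 2 + b ^+ 2)))).
    by rewrite ler_wpM2l// ltW.
  rewrite mulrCA ler_wpM2l ?sqr_ge0// expr2; apply: ler_pM => //; first exact: ltW.
    exact: qq_ge.
  by rewrite /qq lerDl ltW.
rewrite (_ : _ * _ = p / 2 * (e * ((g ^+ 2 + h ^+ 2) / qq e a b ^+ 2))); last ring.
rewrite (_ : m ^+ 2 / 2 * p = p / 2 * m ^+ 2); last ring.
by rewrite ler_wpM2l// divr_ge0.
Qed.

Lemma C2c_lap0 L (psi px py lap : R * R -> R) : C2c L psi px py lap ->
  \int[mu2]_z lap z = 0 /\ inR lap.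
Proof.
move=> ct; have [_ _ [pxx [pyy [dx dy cxx cyy [lapE s]]]] _ sp] := ct.
have i1 : inR pxx by apply: Cc_integrable => // z /s[].
have i2 : inR pyy by apply: Cc_integrable => // z /s[].
have E : lap = fun z => pxx z + pyy z by apply/funext.
split; last by rewrite E; exact: inRD.
rewrite E RintD// (int_D1 dx cxx (L := L)) ?(int_D2 dy cyy (L := L)) ?addr0//.
- by move=> z /sp[].
- by move=> z /s[].
- by move=> z /sp[].
- by move=> z /s[].
Qed.


Section submean.
Variables (u1 u2 h1 h2 : R * R -> R) (eta : nat -> R -> R) (B m : R).
Hypotheses (u1i : inR u1) (u2i : inR u2) (h1i : inR h1) (h2i : inR h2).
Hypothesis etab : forall k, bump (k.+1%:R^-1) (eta k).
Hypotheses (u1B : forall z, `|u1 z| <= 1) (u2B : forall z, `|u2 z| <= 1).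
Hypotheses (h1B : forall z, `|h1 z| <= B) (h2B : forall z, `|h2 z| <= B).
Hypothesis m0 : 0 <= m.

(** The shift by 1 makes the function nonpositive, since |u|^2 + e <= 3. It is harmless because the
    Laplacian of a test function has integral 0. *)
Let ell e z := Lam e (u1 z) (u2 z) - 1.

Lemma ell_le0 e z : 0 < e -> e <= 1 -> ell e z <= 0.
Proof.
move=> e0 e1; rewrite /ell /Lam subr_le0 ler_pdivrMr// mul1r.
have q0 := @qq_gt0 R e e0 (u1 z) (u2 z).
apply: (le_trans (ln_le_sub1 q0)); rewrite lerBlDr /qq.
have h1' : u1 z ^+ 2 <= 1 by rewrite -(real_normK (num_real _)) expr_le1.
have h2' : u2 z ^+ 2 <= 1 by rewrite -(real_normK (num_real _)) expr_le1.
by move: h1' h2'; set x := u1 z ^+ 2; set y := u2 z ^+ 2; lra.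
Qed.

Lemma bm_ell e : 0 < e -> e <= 1 -> bm (ell e).
Proof.
move=> e0 e1; split.
  apply: measurable_funB; last exact: measurable_cst.
  apply: measurable_funM; last exact: measurable_cst.
  have mq : mplane (fun z => qq e (u1 z) (u2 z)).
    apply: measurable_funD; last exact: measurable_cst.
    by apply: measurable_funD; apply: measurable_funX; exact: inR_meas.
  exact: (measurableT_comp (@measurable_ln R) mq).
exists (1 - ln e / 2) => z; rewrite ler0_norm ?ell_le0// /ell opprB lerD2l lerN2.
by rewrite /Lam ler_pM2r// ler_ln ?posrE ?qq_gt0// qq_ge.
Qed.

Section one_disc.
Variables (b : R * R) (s tau e : R) (k0 : nat).
Hypotheses (s0 : 0 < s) (t0 : 0 < tau) (t1 : tau <= 1) (e0 : 0 < e) (e1 : e <= 1).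
Hypothesis hball : forall z, nrm (z :-: b) < s ->
  h1 z ^+ 2 + h2 z ^+ 2 <= m ^+ 2 * (u1 z ^+ 2 + u2 z ^+ 2) /\
  forall k, (k0 <= k)%N -> moll_eq (eta k) u1 u2 h1 h2 z.

Let D : set RR := [set z | 0 < Tw b s tau z].
Let S := Sq s tau.
Let Tz := Tw b s tau.
Let P (z : R * R) := poisson tau (z :-: b).
Let Kz (z : R * R) := ks tau (z :-: b).

Lemma disc_E z : D z <-> nrm (z :-: b) < s.
Proof.
have sn : s \is Num.nneg by rewrite nnegrE ltW.
have nn : nrm (z :-: b) \is Num.nneg by rewrite nnegrE nrm_ge0.
by rewrite /D/= ltNge Tw_le0// -ltNge /dsq -nrm_sq ltr_sqr.
Qed.

Lemma measurable_disc : measurable D.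
Proof.
have ->: D = [set z | Tz z \in `]0, +oo[].
  by apply/seteqP; split=> z /=; rewrite in_itv/= andbT.
have mT : mplane Tz by apply: continuous_measurable2; exact: ct_Tw.
by have := mT measurableT _ (measurable_itv `]0, +oo[); rewrite setTI.
Qed.

Lemma inR_disc : inR (\1_D : R * R -> R).
Proof.
apply: (inR_indic (L := Num.max (`|b.1| + s) (`|b.2| + s)) measurable_disc) => z /disc_E h.
have [h1' h2'] := nrm_cbox (ltW h); split.
  rewrite -[z.1](subrK b.1) (le_trans (ler_normD _ _))// addrC le_max.
  by rewrite lerD2l h1'.
rewrite -[z.2](subrK b.2) (le_trans (ler_normD _ _))// addrC le_max.
by rewrite lerD2l h2' orbT.
Qed.

Lemma disc_area : \int[mu2]_z (\1_D z : R) <= 4 * s ^+ 2.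
Proof.
have ii := @inR_cbox R s.
have [ci cE] := inR_shift (- b.1, - b.2) ii.
rewrite -Rint_indic_cbox; last exact: ltW.
rewrite -cE; apply: Rint_le => //; first exact: inR_disc.
move=> z; rewrite !indicE; case: (boolP (z \in D)) => [|_]; last by case: (_ \in _).
rewrite inE => /disc_E h; rewrite mem_set//; exact: nrm_cbox (ltW h).
Qed.

Lemma bm_P : bm P.
Proof.
split; first exact: (measurable_pt2 (- b.1, - b.2) (continuous_measurable2 (ct_poisson t0))).
exists (tau / tau ^+ 2) => z; rewrite /P; move: (_, _) => {}z.
rewrite ger0_norm ?poisson_ge0// ler_wpM2l ?(ltW t0)// lef_pV2 ?posrE ?exprn_gt0 ?cden_gt0//.
have tc : tau <= cden tau z by rewrite lerDr sqn_ge0.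
by rewrite ler_sqr// nnegrE ltW// cden_gt0.
Qed.

Lemma bm_K : bm Kz.
Proof.
split; first exact: (measurable_pt2 (- b.1, - b.2) (continuous_measurable2 (ct_ks t0))).
exists (Num.sqrt tau)^-1 => z; rewrite ger0_norm; last by rewrite ltW// ks_gt0.
rewrite /Kz /ks lef_pV2 ?posrE ?sqrtr_gt0 ?cden_gt0//.
by rewrite ler_wsqrtr// lerDr (sqn_ge0 (z :-: b)).
Qed.

Let W (z : R * R) := pos (Tz z) + tau / S / 2.

Lemma W_le z : 0 <= W z <= 3 / 2.
Proof.
have S0 := Sq_gt0 s t0.
have h : 0 <= tau / S <= 1.
  rewrite divr_ge0 ?(ltW t0) ?(ltW S0)//= ler_pdivrMr// mul1r.
  by rewrite /S /Sq lerDr sqr_ge0.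
have := pos_ge0 (Tz z); have := pos_lt1 (Tw_lt1 b s t0 z).
by move: h; rewrite /W -/(Tz z); set x := tau / S; set y := pos _; lra.
Qed.

Lemma bm_W : bm W.
Proof.
split.
  apply: continuous_measurable2; apply: ctD; last exact: ct_cst.
  by apply: ct_comp; [exact: ct_Tw|move=> z; exact: continuous_pos].
by exists (3 / 2) => z; have /andP[h h'] := W_le z; rewrite ger0_norm.
Qed.

Lemma lap_disc z : llap b s tau z = \1_D z * (4 / S * W z - 2 * P z).
Proof.
rewrite indicE; have [T0|T0] := ltP 0 (Tz z).
  by rewrite mem_set// mul1r llap_eq// /W posE// ltW.
rewrite memNset; last by rewrite /D/= -/(Tz z) ltNge T0.
by rewrite mul0r; have [] := local0 T0.
Qed.

Let L := Num.max (`|b.1| + s) (`|b.2| + s).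
Let ct : C2c L (lpsi b s tau) (lpx b s tau) (lpy b s tau) (llap b s tau).
Proof. by apply: local_C2c => //; rewrite le_max lexx ?orbT. Qed.

(** The Laplacian of the local weight has integral 0, which balances the mass of [P] against that of
    the bounded weight [W] <= 3 / 2 on a set of area at most 4 s^2. *)
Lemma poisson_mass : \int[mu2]_z (\1_D z * P z) <= 12.
Proof.
have [l0 li] := C2c_lap0 ct; have Di := inR_disc; have S0 := Sq_gt0 s t0.
have i1 : inR (fun z => \1_D z * P z) by apply: inR_pairing => //; exact: bm_P.
have i2 : inR (fun z => \1_D z * W z) by apply: inR_pairing => //; exact: bm_W.
have : 4 / S * (\int[mu2]_z (\1_D z * W z)) - 2 * \int[mu2]_z (\1_D z * P z) = 0.
  rewrite -!RintZ// -RintB; [|exact: inRZ..]; rewrite -l0.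
  by apply: eq_Rintegral => z _; rewrite lap_disc; ring.
have : \int[mu2]_z (\1_D z * W z) <= 3 / 2 * (4 * s ^+ 2).
  apply: (@le_trans _ _ (3 / 2 * \int[mu2]_z (\1_D z : R))); last first.
    by rewrite ler_wpM2l ?disc_area.
  rewrite -RintZ//; apply: Rint_le => //; first exact: inRZ.
  move=> z; rewrite mulrC ler_wpM2r//; by case/andP: (W_le z).
set I := \int[mu2]_z _; set J := \int[mu2]_z _ => hI hJ.
have J2 : 2 * J = 4 * I / S by move: hJ => /eqP; rewrite subr_eq0 => /eqP <-; ring.
have hS : I / S <= 6.
  rewrite ler_pdivrMr//; apply: (le_trans hI); rewrite /S /Sq.
  by have := sqr_ge0 s; move: (s ^+ 2) t0 => x; lra.
by move: hS J2; rewrite -[4 * I / S]mulrA; move: (I / S) => x; lra.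
Qed.

(** The integral inequality tested with the local weight: the average of ln |u| near b is at most
    its weighted average over the disc, plus the contribution of V. The gradient and the weight
    itself are both bounded by the kernel [ks], whose integral is at most 64 s; dividing by 2 gives
    32 s. *)
Lemma submean : \int[mu2]_z (\1_D z * (ell e z * P z)) <=
  2 / S * (\int[mu2]_z (\1_D z * (ell e z * W z))) + 32 * s * (2 * m + m ^+ 2 / 2 * Num.sqrt S).
Proof.
have [l0 li] := C2c_lap0 ct; have Di := inR_disc; have S0 := Sq_gt0 s t0.
have be := bm_ell e0 e1.
have i1 : inR (fun z => \1_D z * (ell e z * P z)).
  by apply: inR_pairing => //; apply: bmM => //; exact: bm_P.
have i2 : inR (fun z => \1_D z * (ell e z * W z)).
  by apply: inR_pairing => //; apply: bmM => //; exact: bm_W.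
have i3 : inR (fun z => \1_D z * Kz z) by apply: inR_pairing => //; exact: bm_K.
have i4 : inR (fun z => llap b s tau z * ell e z) by exact: inR_pairing.
have H := @star_limit R u1 u2 h1 h2 eta u1i u2i h1i h2i etab e B e0 u1B u2B h1B h2B
  L _ _ _ _ D k0 ct (lpsi_ge0 b s t0).
have h0 : 0 <= \int[mu2]_z integrand e (u1 z) (u2 z) (h1 z) (h2 z) (lpsi b s tau z)
    (lpx b s tau z) (lpy b s tau z) (llap b s tau z).
  apply: H.
    by move=> z /negP; rewrite -leNgt => T0; exact: local0.
  by move=> k z kk /disc_E/hball[_]; apply.
have Ki : \int[mu2]_z (\1_D z * Kz z) <= 64 * s.
  apply/(inR_ereal _ i3).
  apply: le_trans (ks_disc t0 s0).
  rewrite [leRHS]integral_mkcond.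
  pose B1 : set RR := [set z | nrm z <= s].
  have mB : measurable B1.
    rewrite (_ : B1 = [set z | nrm z \in `]-oo, s]]); first exact: measurable_nrm_itv.
    by apply/seteqP; split=> z /=; rewrite in_itv.
  have mks : mplane (((fun z : R * R => (ks tau z)%:E) \_ B1) : RR -> \bar R).
    by apply/(measurable_restrictT _ mB)/measurable_funTS/measurable_EFinP; exact: measurable_ks.
  have mks0 z : (0 <= ((fun z : R * R => (ks tau z)%:E) \_ B1) z)%E.
    by rewrite patchE; case: ifP => // _; rewrite lee_fin ltW// ks_gt0.
  rewrite -(@ge0_integral_shift2 _ _ (- b.1, - b.2) mks mks0).
  apply: ge0_le_integral => //.
  - by move=> z _; rewrite lee_fin mulr_ge0// ltW// ks_gt0.
  - by apply/measurable_EFinP; exact: inR_meas.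
  - exact: (measurableT_comp mks (measurable_shift2 (- b.1, - b.2))).
  - move=> z _; rewrite indicE; case: (boolP (z \in D)) => [|_]; last by rewrite mul0r.
    rewrite inE => /disc_E h; rewrite mul1r patchE mem_set//=; exact: ltW.
pose c := 2 * m + m ^+ 2 / 2 * Num.sqrt S.
have c0 : 0 <= c by rewrite addr_ge0 ?mulr_ge0// ?divr_ge0 ?sqr_ge0.
have hi := inR_integrand u1i u2i h1i h2i e0 u1B u2B h1B h2B ct.
have up : \int[mu2]_z integrand e (u1 z) (u2 z) (h1 z) (h2 z) (lpsi b s tau z)
    (lpx b s tau z) (lpy b s tau z) (llap b s tau z) <=
   \int[mu2]_z (llap b s tau z * ell e z + llap b s tau z + c * (\1_D z * Kz z)).
  apply: Rint_le => //.
    by apply: inRD; [exact: inRD|exact: inRZ].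
  move=> z; have [T0|T0] := ltP 0 (Tz z); last first.
    have [-> -> -> ->] := local0 T0.
    have -> : (\1_D z : R) = 0.
      by rewrite indicE memNset// /D/= -/(Tz z) ltNge T0.
    by rewrite le_eqVlt; apply/orP; left; apply/eqP; rewrite /integrand; ring.
  have Dz : D z by [].
  rewrite indicE mem_set// mul1r.
  have [hm _] := hball (proj1 (disc_E z) Dz).
  have p0 := lpsi_ge0 b s t0 z.
  have := integrand_le (lpsi b s tau z) (lpx b s tau z) (lpy b s tau z) (llap b s tau z) e0 m0 hm.
  move/le_trans; apply.
  have -> : llap b s tau z * ell e z + llap b s tau z + c * Kz z =
    Lam e (u1 z) (u2 z) * llap b s tau z + m * (2 * Kz z) + m ^+ 2 / 2 * (Num.sqrt S * Kz z).
    by rewrite /ell /c; ring.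
  apply: lerD; first rewrite lerD2l ler_wpM2l//.
    have [g1 g2] := lgrad_le b s t0 z.
    have n0 := nrm_ge0 (lpx b s tau z, lpy b s tau z).
    have k0' : 0 <= Kz z by rewrite ltW// ks_gt0.
    rewrite nrm_le ?mulr_ge0// /sqn/= -(real_normK (num_real (lpx _ _ _ _))) -(real_normK (num_real (lpy _ _ _ _))).
    move: g1 g2; rewrite -/(Kz z); have := normr_ge0 (lpx b s tau z); have := normr_ge0 (lpy b s tau z).
    by move: `|lpx _ _ _ _| `|lpy _ _ _ _| (Kz z) k0' => x y w; nra.
  apply: (le_trans (err_le e0 p0 hm)); rewrite ler_wpM2l ?divr_ge0 ?sqr_ge0//.
  exact: lpsi_le.
have {}up := le_trans h0 up.
rewrite RintD in up; [|exact: inRD|exact: inRZ].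
rewrite RintD// l0 addr0 RintZ// in up.
have EE : \int[mu2]_z (llap b s tau z * ell e z) =
    4 / S * (\int[mu2]_z (\1_D z * (ell e z * W z))) - 2 * \int[mu2]_z (\1_D z * (ell e z * P z)).
  rewrite -!RintZ// -RintB; [|exact: inRZ..].
  by apply: eq_Rintegral => z _; rewrite lap_disc; ring.
have cK : c * \int[mu2]_z (\1_D z * Kz z) <= c * (64 * s) by rewrite ler_wpM2l.
rewrite EE in up; rewrite -/c.
move: up cK; set I := \int[mu2]_z _; set J := \int[mu2]_z _; set Q := \int[mu2]_z _.
have -> : 2 / S * I = (4 / S * I) / 2 by field; rewrite gt_eqF.
have -> : 32 * s * c = (c * (64 * s)) / 2 by field.
by move: (4 / S * I) (c * (64 * s)) (c * Q) => x y w; lra.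
Qed.

End one_disc.

(** At a point b' near b where |u| >= c the function [ell] is bounded below, whereas the submean
    inequality makes its averages around b' arbitrarily negative once the integral over V is. Such
    points are thus points of bad approximation by the averaging kernel, and these have measure
    tending to 0 with tau. *)
Lemma local_uc (b : R * R) (s r M : R) (V : set RR) (k0 : nat) :
  0 < r -> 2 * r < s -> measurable V -> V `<=` cbox M ->
  (forall z, nrm (z :-: b) < s + r ->
    h1 z ^+ 2 + h2 z ^+ 2 <= m ^+ 2 * (u1 z ^+ 2 + u2 z ^+ 2) /\
    forall k, (k0 <= k)%N -> moll_eq (eta k) u1 u2 h1 h2 z) ->
  (forall z, V z -> nrm (z :-: b) <= s - 2 * r) ->
  (forall K : R, exists2 e, 0 < e <= 1 & \int[mu2]_z (\1_V z * Lam e (u1 z) (u2 z)) <= - K) ->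
  {ae mu2, forall z : R * R, nrm (z :-: b) <= r -> u1 z ^+ 2 + u2 z ^+ 2 = 0}.
Proof.
move=> r0 rs mV sV hball hV hK.
have s0 : 0 < s by apply: lt_trans rs; rewrite mulr_gt0.
have mu1 := inR_meas u1i; have mu2' := inR_meas u2i.
have Vi := inR_indic mV sV.
have key (c : R) : 0 < c ->
    mu2 [set z : R * R | nrm (z :-: b) <= r /\ c ^+ 2 <= u1 z ^+ 2 + u2 z ^+ 2] = 0%E /\
    measurable [set z : R * R | nrm (z :-: b) <= r /\ c ^+ 2 <= u1 z ^+ 2 + u2 z ^+ 2].
  move=> c0; set E := [set z : RR | _].
  have mE : measurable E.
    have mn : mplane (fun z : R * R => nrm (z :-: b)).
      exact: (measurableT_comp (@measurable_nrm R) (measurable_sub_pt b)).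
    have mq : mplane (fun z => u1 z ^+ 2 + u2 z ^+ 2).
      by apply: measurable_funD; exact: measurable_funX.
    have -> : E = [set z : R * R | nrm (z :-: b) \in `]-oo, r] ] `&`
        [set z | u1 z ^+ 2 + u2 z ^+ 2 \in `[c ^+ 2, +oo[].
      by apply/seteqP; split=> z /=; rewrite !in_itv/= andbT.
    apply: measurableI.
      by have := mn measurableT _ (measurable_itv `]-oo, r]); rewrite setTI.
    by have := mq measurableT _ (measurable_itv `[c ^+ 2, +oo[); rewrite setTI.
  split=> //.
  (* A lower bound for the weight given to V by the disc about b': the factor 2 / S times Tw, where
     s^2 - (s - r)^2 >= r s on V and S <= s^2 + 1. *)
  pose dl := (2 / (s ^+ 2 + 1)) * (r * s / (s ^+ 2 + 1)).
  have S10 : 0 < s ^+ 2 + 1 by rewrite ltr_wpDl// sqr_ge0.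
  have dl0 : 0 < dl by rewrite mulr_gt0 ?divr_gt0 ?mulr_gt0.
  pose K1 := 32 * s * (2 * m + m ^+ 2 / 2 * Num.sqrt (s ^+ 2 + 1)).
  (* The kernel has mass at most 13 and f(b') >= -(1 + |ln c|); the final 1 is the gap between the
     average and the value at b'. *)
  pose Q := 13 * (1 + `|ln c|) + 1.
  have K10 : 0 <= K1.
    rewrite /K1 mulr_ge0 ?addr_ge0 ?mulr_ge0 ?(ltW s0) ?divr_ge0 ?sqr_ge0//.
  have Q0 : 0 <= Q by rewrite /Q addr_ge0// mulr_ge0// addr_ge0.
  have rk0 : 0 <= r * s / (s ^+ 2 + 1).
    by rewrite divr_ge0 ?mulr_ge0 ?(ltW r0) ?(ltW s0) ?(ltW S10).
  (* The order matters: e is fixed once c is given, and tau tends to 0 afterwards with [f] fixed. *)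
  have [e /andP[e0 e1] he] := hK ((Q + K1) / dl).
  have be := bm_ell e0 e1.
  pose L := `|b.1| + `|b.2| + s + r.
  pose f z := \1_(cbox L) z * ell e z.
  have fi : inR f.
    by apply: inR_pairing => //; exact: inR_cbox.
  have el0 z := ell_le0 z e0 e1.
  have near_b (z b' : R * R) : nrm (b'.1 - b.1, b'.2 - b.2) <= r ->
      nrm (z.1 - b'.1, z.2 - b'.2) < s -> nrm (z :-: b) < s + r.
    move=> hb hz; have := nrmD (z.1 - b'.1, z.2 - b'.2) (b'.1 - b.1, b'.2 - b.2).
    rewrite /= !addrA !subrK => /le_lt_trans; apply; exact: ltr_leD.
  have inL (z : R * R) : nrm (z :-: b) < s + r -> cbox L z.
    move=> /ltW/nrm_cbox[h1' h2']; split.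
      rewrite -[z.1](subrK b.1) (le_trans (ler_normD _ _))// /L.
      by move: h1' (normr_ge0 b.2) => /=; lra.
    rewrite -[z.2](subrK b.2) (le_trans (ler_normD _ _))// /L.
    by move: h2' (normr_ge0 b.1) => /=; lra.
  have main (b' : R * R) (tau : R) : E b' -> 0 < tau -> tau <= 1 -> 4 * tau <= s ^+ 2 ->
     (1%:E <= \int[mu2]_z (`|f z - f b'| * tpoisson s tau (z.1 - b'.1, z.2 - b'.2)%R)%:E)%E /\
     \int[mu2]_z tpoisson s tau z <= 13.
    move=> [hb hc] t0 t1 t4.
    have hb' z : nrm (z.1 - b'.1, z.2 - b'.2) < s ->
        h1 z ^+ 2 + h2 z ^+ 2 <= m ^+ 2 * (u1 z ^+ 2 + u2 z ^+ 2) /\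
        forall k, (k0 <= k)%N -> moll_eq (eta k) u1 u2 h1 h2 z.
      by move=> hz; apply: hball; exact: near_b hz.
    have sm := submean s0 t0 e0 e1 hb'.
    have pm := poisson_mass b' s0 t0.
    set D : set RR := [set z | 0 < Tw b' s tau z] in sm pm.
    have Di : inR (\1_D : R * R -> R) := inR_disc b' s0 t0.
    have DE z : D z <-> nrm (z.1 - b'.1, z.2 - b'.2) < s := disc_E b' s0 t0 z.
    set S := Sq s tau in sm.
    have S0 : 0 < S := Sq_gt0 s t0.
    have S1 : S <= s ^+ 2 + 1 by rewrite lerD2l.
    have bP : bm (fun z => poisson tau (z.1 - b'.1, z.2 - b'.2)) := bm_P b' t0.
    have p0 z : 0 <= poisson tau z by exact: poisson_ge0.
    have V1 : \int[mu2]_z (\1_D z * (ell e z * (pos (Tw b' s tau z) + tau / S / 2))) <=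
        r * s / (s ^+ 2 + 1) * \int[mu2]_z (\1_V z * ell e z).
      rewrite -RintZ; last exact: inR_pairing.
      apply: Rint_le.
      - by apply: inR_pairing => //; apply: bmM => //; exact: bm_W.
      - by apply: inRZ; exact: inR_pairing.
      move=> z; have c1 : 0 <= pos (Tw b' s tau z) + tau / S / 2.
        by case/andP: (W_le b' s t0 z).
      have [Vz|nV] := pselect (V z); last first.
        by rewrite [\1_V z]indicE memNset// mul0r mulr0 mulr_ge0_le0// mulr_le0_ge0.
      have zr : nrm (z.1 - b'.1, z.2 - b'.2) <= s - r.
        have := nrmD (z :-: b) (b.1 - b'.1, b.2 - b'.2).
        rewrite /= !addrA !subrK => /le_trans; apply.
        have -> : nrm (b.1 - b'.1, b.2 - b'.2) = nrm (b'.1 - b.1, b'.2 - b.2).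
          by rewrite /nrm /sqn/= -(opprB b'.1) -(opprB b'.2) !sqrrN.
        by have := hV _ Vz; lra.
      have Dz : D z by apply/DE; lra.
      rewrite !indicE !mem_set// !mul1r mulrC ler_wnM2r//.
      rewrite (posE (ltW (Dz : 0 < _))).
      apply: (@le_trans _ _ (Tw b' s tau z)); last first.
        by rewrite lerDl divr_ge0// divr_ge0// ltW.
      rewrite /Tw -/S; apply: (@le_trans _ _ (r * s / S)).
        by rewrite ler_wpM2l ?mulr_ge0 ?(ltW r0) ?(ltW s0)// lef_pV2.
      rewrite ler_wpM2r ?invr_ge0 ?(ltW S0)// /dsq -nrm_sq.
      have n0 := nrm_ge0 (z.1 - b'.1, z.2 - b'.2).
      by move: n0 zr; move: (nrm _) => n n0 zr; nra.
    have V2 : \int[mu2]_z (\1_V z * ell e z) <= - ((Q + K1) / dl).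
      apply: le_trans he; apply: Rint_le.
      - exact: inR_pairing.
      - rewrite (_ : (fun z => _) = fun z => \1_V z * ell e z + \1_V z).
          by apply: inRD => //; exact: inR_pairing.
        by apply/funext => z; rewrite /ell; ring.
      - by move=> z; rewrite ler_wpM2l// /ell gerBl.
    have sm2 : \int[mu2]_z (\1_D z * (ell e z * poisson tau (z.1 - b'.1, z.2 - b'.2))) <= - Q.
      apply: (le_trans sm).
      have I0 : \int[mu2]_z (\1_D z * (ell e z * (pos (Tw b' s tau z) + tau / S / 2))) <= 0.
        apply: (le_trans V1); apply: mulr_ge0_le0 => //.
        apply: (le_trans V2); rewrite oppr_le0; apply: divr_ge0; last exact: ltW.
        exact: addr_ge0.
      move: V1 I0; set I := \int[mu2]_z _ => V1 I0.
      have j1 : 2 / S * I <= 2 / (s ^+ 2 + 1) * I.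
        by rewrite ler_wnM2r// ler_wpM2l// lef_pV2.
      have j2 : 2 / (s ^+ 2 + 1) * I <= dl * - ((Q + K1) / dl).
        rewrite {1}/dl -[leRHS]mulrA; apply: ler_wpM2l; first by rewrite divr_ge0// ltW.
        by apply: (le_trans V1); exact: ler_wpM2l.
      have j3 : dl * - ((Q + K1) / dl) = - (Q + K1) by field; rewrite gt_eqF.
      have j4 : 32 * s * (2 * m + m ^+ 2 / 2 * Num.sqrt S) <= K1.
        rewrite ler_wpM2l ?mulr_ge0 ?(ltW s0)// lerD2l ler_wpM2l ?divr_ge0 ?sqr_ge0//.
        by rewrite ler_wsqrtr.
      by rewrite j3 in j2; apply: le_trans (lerD (le_trans j1 j2) j4) _; rewrite opprD subrK.
    have Ti := inR_tpoisson s t0.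
    have [Ki KE] := inR_shift (- b'.1, - b'.2) Ti.
    have Ps : \int[mu2]_z (f z * tpoisson s tau (z.1 - b'.1, z.2 - b'.2)) <= - Q.
      apply: le_trans sm2; apply: Rint_le.
      - by apply: inR_pairing => //; exact: bm_tpoisson.
      - by apply: inR_pairing => //; exact: bmM.
      move=> z; have [Dz|nD] := pselect (D z); last first.
        rewrite [\1_D z]indicE memNset// mul0r mulr_le0_ge0 ?tpoisson_ge0//.
        by rewrite /f mulr_ge0_le0.
      have zs := proj1 (DE z) Dz.
      rewrite /f /tpoisson !indicE !mem_set ?mul1r ?mulr1//.
        exact: (nrm_cbox (ltW zs)).
      by apply: inL; exact: near_b zs.
    have mass : \int[mu2]_z tpoisson s tau z <= 13.
      rewrite -KE; apply: (@le_trans _ _ (\int[mu2]_z (\1_D z * poisson tau (z.1 - b'.1, z.2 - b'.2) +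
         (tau / s ^+ 4) * \1_(cbox s) (z.1 - b'.1, z.2 - b'.2)))).
        have ii := @inR_cbox R s.
        have [cki _] := inR_shift (- b'.1, - b'.2) ii.
        apply: Rint_le => //; first by apply: inRD; [exact: inR_pairing|exact: inRZ].
        move=> z; rewrite /tpoisson; have [Dz|nD] := pselect (D z).
          rewrite [\1_D z]indicE mem_set// mul1r.
          apply: (@le_trans _ _ (poisson tau (z.1 - b'.1, z.2 - b'.2))).
            by apply: ler_piMr => //; rewrite indicE; case: (_ \in _).
          by rewrite lerDl mulr_ge0// divr_ge0 ?exprn_ge0 ?(ltW t0) ?(ltW s0).
        rewrite [\1_D z]indicE memNset// mul0r add0r ler_wpM2r// /poisson.
        rewrite ler_wpM2l ?(ltW t0)// lef_pV2 ?posrE ?exprn_gt0 ?cden_gt0//.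
        have zs : s <= nrm (z.1 - b'.1, z.2 - b'.2).
          by rewrite leNgt; apply/negP => h; apply: nD; exact/DE.
        rewrite -[4%N]/(2 * 2)%N exprM ler_sqr ?nnegrE ?sqr_ge0//; last first.
          exact: ltW (cden_gt0 _ t0).
        rewrite /cden -/(sqn (z.1 - b'.1, z.2 - b'.2)) -nrm_sq.
        apply: (@le_trans _ _ (nrm (z.1 - b'.1, z.2 - b'.2) ^+ 2)).
          by rewrite ler_sqr ?nnegrE ?nrm_ge0//; exact: ltW.
        by rewrite lerDl ltW.
      have ii := @inR_cbox R s.
      have [cki ckE] := inR_shift (- b'.1, - b'.2) ii.
      rewrite RintD; [|exact: inR_pairing|exact: inRZ].
      rewrite RintZ// ckE Rint_indic_cbox; last exact: ltW.
      have -> : tau / s ^+ 4 * (4 * s ^+ 2) = 4 * tau / s ^+ 2 by field; rewrite gt_eqF.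
      have : 4 * tau / s ^+ 2 <= 1 by rewrite ler_pdivrMr ?exprn_gt0// mul1r.
      by move=> h; rewrite [leRHS](_ : _ = 12 + 1); [exact: lerD|ring].
    split=> //.
    apply: le_trans (avg_dist s b' fi t0); rewrite lee_fin.
    set MM := \int[mu2]_z tpoisson _ _ z in mass *; move: Ps.
    set J := \int[mu2]_z _ => Ps.
    have MM0 : 0 <= MM by apply: Rint_ge0 => z; exact: tpoisson_ge0.
    have fb : - (1 + `|ln c|) <= f b'.
      have Lb : cbox L b'.
        by apply: inL; apply: le_lt_trans hb _; rewrite ltrDr.
      rewrite /f indicE mem_set// mul1r /ell.
      have : ln c <= Lam e (u1 b') (u2 b').
        rewrite /Lam ler_pdivlMr// mulr_natr -lnXn// ler_ln ?posrE ?exprn_gt0 ?qq_gt0//.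
        by rewrite (le_trans hc)// /qq lerDl ltW.
      have := ler_norm (- ln c); rewrite normrN => h h'.
        by rewrite opprD addrC lerD2r (le_trans _ h')// lerNl.
    have MF : - (13 * (1 + `|ln c|)) <= MM * f b'.
      apply: (@le_trans _ _ (MM * - (1 + `|ln c|))); last by rewrite ler_wpM2l.
      by rewrite mulrN lerN2 ler_wpM2r// addr_ge0.
    rewrite distrC; apply: le_trans (ler_norm _).
    move: Ps; rewrite /Q => Ps; rewrite lerBrDr; apply: le_trans MF.
    by rewrite -lerBrDl -opprD.
  apply/eqP; rewrite eq_le measure_ge0 andbT.
  apply/lee_addgt0Pr => d d0; rewrite add0e.
  (* The mass of the kernel plus 1 is at most 14. *)
  have d14 : 0 < d / 14 by rewrite divr_gt0.
  have [t1 t10 ht] := tpoisson_approx fi d14 (ltW s0).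
  pose tau := Num.min t1 (Num.min 1 (s ^+ 2 / 4)).
  have tau0 : 0 < tau by rewrite !lt_min t10 ltr01 divr_gt0// exprn_gt0.
  have tau1 : tau <= 1 by rewrite !ge_min lexx !orbT.
  have tau4 : 4 * tau <= s ^+ 2.
    by rewrite mulrC -ler_pdivlMr// !ge_min lexx !orbT.
  have taut : tau <= t1 by rewrite ge_min lexx.
  have {}ht := ht _ tau0 taut.
  have [->|/set0P[b0 Eb0]] := eqVneq E set0; first by rewrite measure0 lee_fin ltW.
  have [_ mass] := main b0 tau Eb0 tau0 tau1 tau4.
  rewrite -(setIT E) -integral_indic//.
  apply: (le_trans (y := (\int[mu2]_b0 \int[mu2]_z (`|f z - f b0| * tpoisson s tau (z :-: b0)%R)%:E)%E)).
    have mf := inR_meas fi.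
    pose F2 (p : RR * RR) : \bar R := (`|f p.2 - f p.1| * tpoisson s tau (p.2.1 - p.1.1, p.2.2 - p.1.2))%:E.
    have mF2 : measurable_fun [set: RR * RR] F2.
      apply/measurable_EFinP; apply: measurable_funM; last first.
        exact: (measurableT_comp (inR_meas (inR_tpoisson s tau0)) (@measurable_sub2 R)).
      apply: measurableT_comp => //; apply: measurable_funB.
        exact: (measurableT_comp mf measurable_snd).
      exact: (measurableT_comp mf measurable_fst).
    have F20 p : (0 <= F2 p)%E by rewrite lee_fin mulr_ge0// tpoisson_ge0.
    have mI2 := measurable_fun_fubini_tonelli_F (m2 := mu2) F2 mF2 F20.
    apply: ge0_le_integral => //.
    - by apply/measurable_EFinP; exact: measurable_indic.
    move=> z _; have [Ez|nE] := pselect (E z).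
      by rewrite indicE mem_set//; have [h _] := main z tau Ez tau0 tau1 tau4.
    by rewrite indicE memNset//; apply: integral_ge0 => y _; exact: F20 (z, y).
  apply: (le_trans ht); rewrite lee_fin.
  rewrite mulrAC ler_pdivrMr//.
  apply: ler_wpM2l; first exact: ltW.
    by rewrite [leRHS](_ : _ = 13 + 1); [rewrite lerD2r|ring].
have hn (n : nat) : {ae mu2, forall z : R * R, ~ (nrm (z :-: b) <= r /\
    n.+1%:R^-1 ^+ 2 <= u1 z ^+ 2 + u2 z ^+ 2)}.
  have n0 : (0 : R) < n.+1%:R^-1 by rewrite invr_gt0.
  set E := [set z : R * R | nrm (z :-: b) <= r /\
    n.+1%:R^-1 ^+ 2 <= u1 z ^+ 2 + u2 z ^+ 2].
  by have [k1 k2] := key _ n0; exists E; split => // z /= /contrapT.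
have : {ae mu2, forall z : R * R, forall n : nat, ~ (nrm (z :-: b) <= r /\
    n.+1%:R^-1 ^+ 2 <= u1 z ^+ 2 + u2 z ^+ 2)} by apply/ae_foralln.
apply: ae_imply => z hz zr; apply/eqP; rewrite eq_le addr_ge0 ?sqr_ge0// andbT leNgt.
apply/negP => uu.
have su : 0 < Num.sqrt (u1 z ^+ 2 + u2 z ^+ 2) by rewrite sqrtr_gt0.
have [n hn'] : exists n : nat, n.+1%:R^-1 < Num.sqrt (u1 z ^+ 2 + u2 z ^+ 2).
  by near \oo%classic => n; exists n; near: n; exact: near_infty_natSinv_lt (PosNum su).
apply: (hz n); split=> //.
rewrite -[leRHS]sqr_sqrtr; last exact: ltW.
by rewrite ler_sqr ?nnegrE ?invr_ge0 ?sqrtr_ge0//; exact: ltW.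
Unshelve. all: by end_near.
Qed.

End submean.

End local.

(** * The logarithmic weight on far rings *)

Section potential.
Context {R : realType}.
Local Notation mu := (@lebesgue_measure R).
Variables (phi Phi : R -> R) (R0 : R).
Hypothesis phi0 : forall s, R0 <= s -> 0 <= phi s.
Hypothesis Phi0 : forall t, t <= R0 -> Phi t = 0.
Hypothesis Phi_bounds : forall s t, R0 <= s -> s <= t ->
  (t - s) * phi t <= Phi t - Phi s <= (t - s) * phi s.

Lemma Phi_mono s t : s <= t -> Phi s <= Phi t.
Proof.
move=> st; have [sR|/ltW Rs] := leP s R0; last first.
  have /andP[h _] := Phi_bounds Rs st; rewrite -subr_ge0; apply: le_trans h.
  by rewrite mulr_ge0 ?subr_ge0// phi0// (le_trans Rs).
rewrite (Phi0 sR); have [tR|/ltW Rt] := leP t R0; first by rewrite (Phi0 tR).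
have /andP[h _] := Phi_bounds (lexx R0) Rt.
rewrite (Phi0 (lexx R0)) subr0 in h; apply: le_trans h.
by rewrite mulr_ge0 ?subr_ge0// phi0.
Qed.

Lemma Phi_lip s t : `|Phi s - Phi t| <= phi R0 * `|s - t|.
Proof.
wlog st : s t / s <= t.
  by move=> H; case: (leP s t) => [/H//|/ltW/H]; rewrite distrC (distrC t).
have p0 := phi0 (lexx R0).
rewrite distrC ger0_norm ?subr_ge0 ?Phi_mono// distrC ger0_norm ?subr_ge0//.
pose s' := Num.max s R0; pose t' := Num.max t R0.
have E x : Phi (Num.max x R0) = Phi x.
  by have [xR|//] := leP x R0; rewrite (Phi0 (lexx R0)) (Phi0 xR).
have s't' : s' <= t' by rewrite /s' /t' ge_max !le_max st lexx !orbT.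
have R't : R0 <= t' by rewrite le_max lexx orbT.
have R's : R0 <= s' by rewrite le_max lexx orbT.
have hphi : phi s' <= phi R0.
  have [->//|ne] := eqVneq s' R0.
  have lt : R0 < s' by rewrite lt_neqAle eq_sym ne.
  have /andP[a b] := Phi_bounds (lexx R0) R's.
  by have := le_trans a b; rewrite ler_pM2l// subr_gt0.
have /andP[_] := Phi_bounds R's s't'; rewrite !E => /le_trans; apply.
rewrite mulrC; apply: ler_pM => //; [exact: phi0|by rewrite subr_ge0|].
rewrite /s' /t'; have [h1|h1] := leP s R0; have [h2|h2] := leP t R0; move: st h1 h2; lra.
Qed.

Lemma Phi_continuous : continuous Phi.
Proof.
move=> x; apply/cvgrPdist_le => e e0; near=> y.
apply: (le_trans (Phi_lip _ _)).
have C0 : 0 < phi R0 + 1 by rewrite ltr_wpDl// phi0.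
apply: (@le_trans _ _ ((phi R0 + 1) * `|x - y|)); first by rewrite ler_wpM2r// lerDl.
rewrite mulrC -ler_pdivlMr//.
near: y; exists (e / (phi R0 + 1)); [by rewrite /= divr_gt0// ltr_wpDl// phi0|by move=> y /= /ltW].
Unshelve. all: by end_near. Qed.

(** A second primitive, since [Phi] is Lipschitz but need not be differentiable: differences of [Th]
    will give a C^1 function. *)
Lemma Phi_antideriv : exists2 Th : R -> R, forall x, der Th x (Phi x) &
  forall x, x <= R0 -> Th x = 0.
Proof.
(* Starting one unit before R0 makes R0 itself an interior point for the fundamental theorem of
   calculus. *)
pose a := R0 - 1.
pose Th (x : R) := \int[mu]_(t in [set` Interval (BLeft a) (BRight x)]) Phi t.
have Th0 x : x <= R0 -> Th x = 0.
  move=> xR; rewrite /Th /Rintegral integral0_eq// => t /=; rewrite in_itv/= => /andP[_ tx].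
  by rewrite Phi0// (le_trans tx).
exists Th => // x; have [xR|xR] := ltP x R0.
  rewrite (Phi0 (ltW xR)); apply: (der_near (f := fun=> 0)); last exact: der_cst.
  by near=> y; rewrite Th0// ltW//; near: y; exact: lt_nbhsl.
have xa : a < x by rewrite /a; move: xR; lra.
have := @continuous_FTC1 R Phi (BLeft a) x (x + 1) _ _ _ _.
rewrite ltrDl ltr01 => /(_ isT); case.
- apply: continuous_compact_integrable; first exact: segment_compact.
  by apply: continuous_subspaceT; exact: Phi_continuous.
- by rewrite lte_fin.
- exact: Phi_continuous.
move=> dT TE; split; first exact: dT.
by rewrite -derive1E TE.
Unshelve. all: by end_near. Qed.

(** The mean of Phi over [s - 1, s]. It is C^1 and at most Phi, yet its derivative Phi(s) - Phi(s -
    1) dominates phi(s) because phi is nonincreasing: this is the radial comparison function. *)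
Lemma Psi_exists : exists Psi Psi' : R -> R, [/\ forall s, der Psi s (Psi' s),
  continuous Psi', forall s, s <= R0 -> Psi s = 0 /\ Psi' s = 0,
  forall s, R0 + 1 <= s -> phi s <= Psi' s <= phi R0 &
  forall s, Phi (s - 1) <= Psi s <= Phi s].
Proof.
have [Th dT T0] := Phi_antideriv.
have ds (s : R) : der (fun x : R => x - 1) s 1.
  by apply: (der_eq (derB (der_id s) (der_cst 1 s))); rewrite subr0.
exists (fun s => Th s - Th (s - 1)), (fun s => Phi s - Phi (s - 1)); split.
- move=> s; apply: (der_eq (derB (dT s) (der_comp (f := Th) (g := fun x : R => x - 1) (dT (s - 1)) (ds s)))).
  by rewrite mulr1.
- move=> s; apply: cvgB; first exact: Phi_continuous.
  apply: (cvg_comp (fun x => x - 1) Phi); last exact: Phi_continuous.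
  by apply: cvgB; [exact: cvg_id|exact: cvg_cst].
- move=> s sR; have s1 : s - 1 <= R0 by move: sR; lra.
  by rewrite !T0// !Phi0// subrr.
- move=> s sR; have s1 : R0 <= s - 1 by move: sR; lra.
  have s2 : s - 1 <= s by lra.
  have /andP[h1 h2] := Phi_bounds s1 s2.
  have e1 : s - (s - 1) = 1 by ring.
  rewrite e1 !mul1r in h1 h2; rewrite h1/=.
  have := Phi_lip s (s - 1); rewrite e1 normr1 mulr1 => /(le_trans _); apply; exact: ler_norm.
- move=> s; have s2 : s - 1 <= s by lra.
  have [||c] := @MVT_segment R Th Phi _ _ s2.
  - by move=> z _; exact: dT.
  - by apply: continuous_subspaceT => z; exact: der_continuous (dT z).
  rewrite in_itv/= => /andP[c1 c2] ->; have -> : s - (s - 1) = 1 by ring.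
  by rewrite mulr1 !Phi_mono.
Qed.

End potential.

(** * Radial weights and Green's formula *)

Section radial.
Context {R : realType}.
Local Notation RR := (plane R).

Lemma D1_radial (F F' : R -> R) : (forall t, der F t (F' t)) ->
  D1 (fun z : R * R => F (sqn z)) (fun z => F' (sqn z) * (2 * z.1)).
Proof. by move=> dF; apply: (D1_comp (h := F) (h' := F') _ (@D1_sqn R)) => z; exact: dF. Qed.

Lemma D2_radial (F F' : R -> R) : (forall t, der F t (F' t)) ->
  D2 (fun z : R * R => F (sqn z)) (fun z => F' (sqn z) * (2 * z.2)).
Proof. by move=> dF; apply: (D2_comp (h := F) (h' := F') _ (@D2_sqn R)) => z; exact: dF. Qed.

Lemma ct_radial (F : R -> R) : continuous F -> continuous (fun z : R * R => F (sqn z)).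
Proof. by move=> cF; apply: ct_comp; [exact: ct_sqn|move=> z; exact: cF]. Qed.

Let c1 : continuous (fun z : R * R => 2 * z.1).
Proof. by apply: ctM; [exact: ct_cst|exact: ct_fst]. Qed.
Let c2 : continuous (fun z : R * R => 2 * z.2).
Proof. by apply: ctM; [exact: ct_cst|exact: ct_snd]. Qed.

Lemma radial_C2c (F F' F'' : R -> R) (L : R) : (forall t, der F t (F' t)) ->
  (forall t, der F' t (F'' t)) -> continuous F'' ->
  (forall t, L ^+ 2 <= t -> [/\ F t = 0, F' t = 0 & F'' t = 0]) -> 0 <= L ->
  C2c L (fun z => F (sqn z)) (fun z => F' (sqn z) * (2 * z.1))
    (fun z => F' (sqn z) * (2 * z.2)) (fun z => 4 * sqn z * F'' (sqn z) + 4 * F' (sqn z)).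
Proof.
move=> dF dF' cF'' F0 L0.
have cF : continuous F by move=> t; exact: der_continuous (dF t).
have cF' : continuous F' by move=> t; exact: der_continuous (dF' t).
have far (z : R * R) : ~ cbox L z -> L ^+ 2 <= sqn z.
  move=> nz; rewrite -nrm_ge// leNgt; apply/negP => h; apply: nz.
  exact: nrm_cbox (ltW h).
split.
- exact: D1_radial.
- exact: D2_radial.
- exists (fun z => F'' (sqn z) * (2 * z.1) * (2 * z.1) + F' (sqn z) * 2).
  exists (fun z => F'' (sqn z) * (2 * z.2) * (2 * z.2) + F' (sqn z) * 2).
  split.
  + apply: (D1_eq (D1M (D1_radial dF') (D1M (D1_cst 2) (@D1_fst R)))) => z; ring.
  + apply: (D2_eq (D2M (D2_radial dF') (D2M (D2_cst 2) (@D2_snd R)))) => z; ring.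
  + apply: ctD; last by apply: ctM; [exact: ct_radial|exact: ct_cst].
    by apply: ctM => //; apply: ctM => //; exact: ct_radial.
  + apply: ctD; last by apply: ctM; [exact: ct_radial|exact: ct_cst].
    by apply: ctM => //; apply: ctM => //; exact: ct_radial.
  + split; first by move=> z; rewrite /sqn; ring.
    by move=> z /far/F0[_ -> ->]; rewrite !mul0r addr0.
- by split; [exact: ct_radial|apply: ctM => //; exact: ct_radial|apply: ctM => //; exact: ct_radial].
- by move=> z /far/F0[-> -> ->]; rewrite !mul0r !mulr0 addr0.
Qed.

Lemma green (G gx gy psi px py lap : R * R -> R) L : D1 G gx -> D2 G gy -> continuous G ->
  continuous gx -> continuous gy -> C2c L psi px py lap ->
  \int[mu2]_z (G z * lap z) = - \int[mu2]_z (gx z * px z + gy z * py z).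
Proof.
move=> dx dy cG cgx cgy ct.
have [_ _ [pxx [pyy [dpx dpy cxx cyy [lapE sx]]]] [cp cpx cpy] sp] := ct.
have i1 : inR (fun z => gx z * px z + G z * pxx z).
  apply: (@Cc_integrable _ _ L); first by apply: ctD; exact: ctM.
  by move=> z nz; have [_ -> _ _] := sp z nz; have [-> _] := sx z nz; rewrite !mulr0 addr0.
have i2 : inR (fun z => gy z * py z + G z * pyy z).
  apply: (@Cc_integrable _ _ L); first by apply: ctD; exact: ctM.
  by move=> z nz; have [_ _ -> _] := sp z nz; have [_ ->] := sx z nz; rewrite !mulr0 addr0.
have e1 : \int[mu2]_z (gx z * px z + G z * pxx z) = 0.
  apply: (int_D1 (D1M dx dpx) (L := L)); first by apply: ctD; exact: ctM.
    by move=> z nz; have [_ -> _ _] := sp z nz; rewrite mulr0.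
  by move=> z nz; have [_ -> _ _] := sp z nz; have [-> _] := sx z nz; rewrite !mulr0 addr0.
have e2 : \int[mu2]_z (gy z * py z + G z * pyy z) = 0.
  apply: (int_D2 (D2M dy dpy) (L := L)); first by apply: ctD; exact: ctM.
    by move=> z nz; have [_ _ -> _] := sp z nz; rewrite mulr0.
  by move=> z nz; have [_ _ -> _] := sp z nz; have [_ ->] := sx z nz; rewrite !mulr0 addr0.
have i3 : inR (fun z => gx z * px z + gy z * py z).
  apply: (@Cc_integrable _ _ L); first by apply: ctD; exact: ctM.
  by move=> z nz; have [_ -> -> _] := sp z nz; rewrite !mulr0 addr0.
have i4 : inR (fun z => G z * lap z).
  rewrite (_ : (fun z => _) = fun z => (gx z * px z + G z * pxx z) + (gy z * py z + G z * pyy z) -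
    (gx z * px z + gy z * py z)); first by apply: inRB => //; exact: inRD.
  by apply/funext => z; rewrite lapE; ring.
apply/eqP; rewrite -subr_eq0 opprK -RintD//; apply/eqP.
transitivity (\int[mu2]_z ((gx z * px z + G z * pxx z) + (gy z * py z + G z * pyy z))).
  by apply: eq_Rintegral => z _; rewrite lapE; ring.
by rewrite RintD// e1 e2 addr0.
Qed.

(** A C^2 ramp: the second difference of t_+^3 / 6. It is 0 for t <= 0 and t - 1 for t >= 2, and its
    second derivative is the hat function on [0, 2]. *)
Definition Sf (t : R) : R := (pos t ^+ 3 - 2 * pos (t - 1) ^+ 3 + pos (t - 2) ^+ 3) / 6.
Definition Sf' (t : R) : R := (pos t ^+ 2 - 2 * pos (t - 1) ^+ 2 + pos (t - 2) ^+ 2) / 2.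
Definition Sf'' (t : R) : R := pos t - 2 * pos (t - 1) + pos (t - 2).

Let der_sh (c x : R) : der (fun t => t - c) x 1.
Proof. by apply: (der_eq (derB (der_id x) (der_cst c x))); rewrite subr0. Qed.

Lemma der_Sf t : der Sf t (Sf' t).
Proof.
have sh c : der (fun t => pos (t - c) ^+ 3) t (3 * pos (t - c) ^+ 2).
  apply: (der_eq (der_comp (f := fun y => pos y ^+ 3) (g := fun t => t - c) (der_pos3 _) (der_sh c t))).
  by rewrite mulr1.
have := derM (derD (derB (der_pos3 t) (derM (der_cst 2 t) (sh 1))) (sh 2)) (der_cst 6^-1 t).
by move/der_eq; apply; rewrite /Sf'; field.
Qed.

Lemma der_Sf' t : der Sf' t (Sf'' t).
Proof.
have sh c : der (fun t => pos (t - c) ^+ 2) t (2 * pos (t - c)).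
  apply: (der_eq (der_comp (f := fun y => pos y ^+ 2) (g := fun t => t - c) (der_pos2 _) (der_sh c t))).
  by rewrite mulr1.
have := derM (derD (derB (der_pos2 t) (derM (der_cst 2 t) (sh 1))) (sh 2)) (der_cst 2^-1 t).
by move/der_eq; apply; rewrite /Sf''; field.
Qed.

Lemma ct_Sf'' : continuous Sf''.
Proof.
have sh c : continuous (fun t : R => pos (t - c)).
  move=> t; apply: (cvg_comp (fun x => x - c) (@pos R)); last exact: continuous_pos.
  by apply: cvgB; [exact: cvg_id|exact: cvg_cst].
move=> t; apply: cvgD; last exact: sh.
apply: cvgB; first exact: continuous_pos.
by apply: cvgM; [exact: cvg_cst|exact: sh].
Qed.

Lemma Sf_lo t : t <= 0 -> [/\ Sf t = 0, Sf' t = 0 & Sf'' t = 0].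
Proof.
move=> t0; have h1 : t - 1 <= 0 by move: t0; lra.
have h2 : t - 2 <= 0 by move: t0; lra.
by rewrite /Sf /Sf' /Sf'' !pos0// !expr0n/= !mulr0 !subr0 !addr0 !mul0r.
Qed.

Lemma Sf_hi t : 2 <= t -> [/\ Sf t = t - 1, Sf' t = 1 & Sf'' t = 0].
Proof.
move=> t0; rewrite /Sf /Sf' /Sf'' !posE; [|move: t0; lra..].
by split; field.
Qed.

Lemma Sf_cases t : t <= 0 \/ (0 <= t /\ t <= 1 /\ [/\ Sf t = t ^+ 3 / 6, Sf' t = t ^+ 2 / 2 & Sf'' t = t]) \/
  (1 <= t /\ t <= 2 /\ [/\ Sf t = (t ^+ 3 - 2 * (t - 1) ^+ 3) / 6, Sf' t = (t ^+ 2 - 2 * (t - 1) ^+ 2) / 2 & Sf'' t = 2 - t]) \/ 2 <= t.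
Proof.
have [t0|/ltW t0] := leP t 0; [by left|right].
have [t1|/ltW t1] := leP t 1; [left|right].
  split=> //; split=> //; rewrite /Sf /Sf' /Sf'' (posE t0).
  have h1 : t - 1 <= 0 by move: t1; lra.
  have h2 : t - 2 <= 0 by move: t1; lra.
  by rewrite (pos0 h1) (pos0 h2) !expr0n/= !mulr0 !subr0 !addr0.
have [t2|/ltW t2] := leP t 2; [left|by right].
split=> //; split=> //; rewrite /Sf /Sf' /Sf'' (posE t0).
have h1 : 0 <= t - 1 by move: t1; lra.
have h2 : t - 2 <= 0 by move: t2; lra.
rewrite (posE h1) (pos0 h2) !expr0n/= !addr0; split=> //; ring.
Qed.

Lemma Sf_bounds t : [/\ 0 <= Sf t, t - 1 <= Sf t, 0 <= Sf' t <= 1 & 0 <= Sf'' t <= 1].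
Proof.
have [t0|[[t0 [t1 [-> -> ->]]]|[[t1 [t2 [-> -> ->]]]|t2]]] := Sf_cases t.
- by have [-> -> ->] := Sf_lo t0; rewrite !lexx ler01; split => //; move: t0; lra.
- have h : 0 <= t ^+ 3 by rewrite exprn_ge0.
  have h2 : t ^+ 2 <= 1 by rewrite expr_le1.
  have h3 := sqr_ge0 t.
  by split; [|..|apply/andP; split|apply/andP; split]; lra.
- have h : 0 <= (2 - t) ^+ 3 by rewrite exprn_ge0//; lra.
  have h3 : (2 - t) ^+ 2 <= 1 by rewrite expr_le1//; lra.
  have h4 := sqr_ge0 (2 - t).
  have e1 : (t ^+ 3 - 2 * (t - 1) ^+ 3) / 6 = (2 - t) ^+ 3 / 6 + (t - 1) by field.
  have e2 : (t ^+ 2 - 2 * (t - 1) ^+ 2) / 2 = 1 - (2 - t) ^+ 2 / 2 by field.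
  rewrite e1 e2.
  by split; [|..|apply/andP; split|apply/andP; split]; lra.
- by have [-> -> ->] := Sf_hi t2; rewrite !lexx ler01; split => //; move: t2; lra.
Qed.

End radial.

(** * Profiles in the logarithm of the modulus *)

Section glue.
Context {R : realType}.
Implicit Types f : R -> R.

Lemma der_glue0 (f f' : R -> R) (d : R) : 0 < d -> (forall t, t < d -> f t = 0 /\ f' t = 0) ->
  (forall t, 0 < t -> der f t (f' t)) -> forall t, der f t (f' t).
Proof.
move=> d0 f0 df t; have [t0|t0] := ltP 0 t; first exact: df.
have td : t < d by exact: le_lt_trans d0.
rewrite (f0 _ td).2; apply: (der_near (f := fun=> 0)); last exact: der_cst.
by near=> y; rewrite (f0 y _).1//; near: y; exact: lt_nbhsl.
Unshelve. all: by end_near. Qed.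

Lemma ct_glue0 (f : R -> R) (d : R) : 0 < d -> (forall t, t < d -> f t = 0) ->
  (forall t, 0 < t -> {for t, continuous f}) -> continuous f.
Proof.
move=> d0 f0 df t; have [t0|t0] := ltP 0 t; first exact: df.
have td : t < d by exact: le_lt_trans d0.
have := der_near (f := fun=> 0) (g := f) (x := t) _ (der_cst 0 t).
case=> [|h _]; first by near=> y; rewrite f0//; near: y; exact: lt_nbhsl.
apply: (@der_continuous R f t 0); apply: (der_near (f := fun=> 0)); last exact: der_cst.
by near=> y; rewrite f0//; near: y; exact: lt_nbhsl.
Unshelve. all: by end_near. Qed.

(** Uses the convention that [ln] is 0 on nonpositive reals. *)
Lemma ln_le0_total (t : R) : t <= 1 -> ln t <= 0.
Proof.
by move=> t1; have [t0|t0] := leP t 0; [rewrite ln0|rewrite -ln1 ler_ln ?posrE].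
Qed.

Section log_profile.
Variables (h h' h'' : R -> R).
Hypothesis dh : forall s, der h s (h' s).
Hypothesis dh' : forall s, der h' s (h'' s).
Hypothesis ch'' : continuous h''.
Hypothesis h0 : forall s, s <= 0 -> [/\ h s = 0, h' s = 0 & h'' s = 0].

(** A function of |z|^2 whose value is h(ln |z|); the Laplacian of such a function is h''(ln |z|) /
    |z|^2. Vanishing of h on the negative axis removes the singularity at the origin. *)
Definition logF t := h (ln t / 2).
Definition logF' t := h' (ln t / 2) / (2 * t).
Definition logF'' t := h'' (ln t / 2) / (4 * t ^+ 2) - h' (ln t / 2) / (2 * t ^+ 2).

Lemma logF0 t : t <= 1 -> [/\ logF t = 0, logF' t = 0 & logF'' t = 0].
Proof.
move=> t1; have l0 : ln t / 2 <= 0 by rewrite pmulr_lle0// ln_le0_total.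
by have [e1 e2 e3] := h0 l0; rewrite /logF /logF' /logF'' e1 e2 e3 !mul0r subr0.
Qed.

Let dln (t : R) : 0 < t -> der (fun t : R => ln t / 2) t (2 * t)^-1.
Proof.
move=> t0; apply: (der_eq (derM (der_ln t0) (der_cst 2^-1 t))).
by rewrite mulr0 addr0 invfM mulrC.
Qed.

Lemma der_logF t : der logF t (logF' t).
Proof.
move: t; apply: (@der_glue0 _ _ 1) => //.
  by move=> t /ltW/logF0[].
move=> t t0; exact: (der_comp (g := fun t => ln t / 2) (dh _) (dln t0)).
Qed.

Lemma der_logF' t : der logF' t (logF'' t).
Proof.
move: t; apply: (@der_glue0 _ _ 1) => //.
  by move=> t /ltW/logF0[].
move=> t t0; have t20 : 2 * t != 0 by rewrite mulf_neq0 ?gt_eqF.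
have d2 := derV (f := fun t => 2 * t) t20 (derM (der_cst 2 t) (der_id t)).
apply: (der_eq (derM (der_comp (g := fun t => ln t / 2) (dh' _) (dln t0)) d2)).
by rewrite /logF''; field; rewrite gt_eqF.
Qed.

Lemma ct_lnhalf (k : R -> R) (t : R) : 0 < t -> continuous k ->
  {for t, continuous (fun t => k (ln t / 2))}.
Proof.
move=> t0 ck; apply: (cvg_comp (fun t : R => ln t / 2) k); last exact: ck.
exact: (der_continuous (dln t0)).
Qed.

Lemma ct_logF'' : continuous logF''.
Proof.
apply: (@ct_glue0 _ 1) => //; first by move=> t /ltW/logF0[].
move=> t t0; have ch' : continuous h' by move=> s; exact: der_continuous (dh' s).
have tn : t != 0 by rewrite gt_eqF.
apply: cvgB; apply: cvgM; try exact: ct_lnhalf.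
  apply: cvgV; first by rewrite mulf_neq0 ?expf_neq0.
  by apply: cvgM; [exact: cvg_cst|rewrite /=; apply: cvgM; exact: cvg_id].
apply: cvgV; first by rewrite mulf_neq0 ?expf_neq0.
by apply: cvgM; [exact: cvg_cst|rewrite /=; apply: cvgM; exact: cvg_id].
Qed.

End log_profile.
End glue.

Section profile.
Context {R : realType}.
Variables (a c : R).
Hypothesis a0 : 0 <= a.
Hypothesis ac : a + 8 <= c.

(** The profile in ln |z| rises from 0 with slope 1 over a length 4 from a, then descends with slope
    -lam to 0; lam is the slope that returns from height 4 over the length c - a - 4. The three
    kinks are smoothed over [a, a + 2], [a + 4, a + 6] and [c, c + 2]. *)
Definition lam : R := 4 / (c - a - 4).
Definition Hf (s : R) : R := Sf (s - a) - (1 + lam) * Sf (s - (a + 4)) + lam * Sf (s - c).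
Definition Hf' (s : R) : R := Sf' (s - a) - (1 + lam) * Sf' (s - (a + 4)) + lam * Sf' (s - c).
Definition Hf'' (s : R) : R := Sf'' (s - a) - (1 + lam) * Sf'' (s - (a + 4)) + lam * Sf'' (s - c).

Lemma lam01 : 0 < lam <= 1.
Proof.
have h : 0 < c - a - 4 by move: ac; lra.
rewrite divr_gt0//= ler_pdivrMr// mul1r; move: ac; lra.
Qed.

Lemma lamE : lam * (c - a - 4) = 4.
Proof. by rewrite /lam divfK// gt_eqF//; move: ac; lra. Qed.

Let dsh (k k' : R -> R) (b s : R) : (forall t, der k t (k' t)) -> der (fun s => k (s - b)) s (k' (s - b)).
Proof.
move=> dk; have d1 : der (fun s => s - b) s 1.
  by apply: (der_eq (derB (der_id s) (der_cst b s))); rewrite subr0.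
by apply: (der_eq (der_comp (g := fun s => s - b) (dk _) d1)); rewrite mulr1.
Qed.

Lemma der_Hf s : der Hf s (Hf' s).
Proof.
have := derD (derB (dsh a s (@der_Sf R)) (derM (der_cst (1 + lam) s) (dsh (a + 4) s (@der_Sf R))))
  (derM (der_cst lam s) (dsh c s (@der_Sf R))).
by move/der_eq; apply; rewrite /Hf'; ring.
Qed.

Lemma der_Hf' s : der Hf' s (Hf'' s).
Proof.
have := derD (derB (dsh a s (@der_Sf' R)) (derM (der_cst (1 + lam) s) (dsh (a + 4) s (@der_Sf' R))))
  (derM (der_cst lam s) (dsh c s (@der_Sf' R))).
by move/der_eq; apply; rewrite /Hf''; ring.
Qed.

Lemma ct_shift1 (k : R -> R) (b : R) : continuous k -> continuous (fun s => k (s - b)).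
Proof.
move=> ck s; apply: (cvg_comp (fun s => s - b) k); last exact: ck.
by apply: cvgB; [exact: cvg_id|exact: cvg_cst].
Qed.

Lemma ct_Hf'' : continuous Hf''.
Proof.
have cs b : continuous (fun s : R => Sf'' (s - b)) by apply: ct_shift1; exact: ct_Sf''.
move=> s; apply: cvgD; [apply: cvgB|]; first exact: cs.
  by apply: cvgM; [exact: cvg_cst|exact: cs].
by apply: cvgM; [exact: cvg_cst|exact: cs].
Qed.

Lemma Hf_lo s : s <= a -> [/\ Hf s = 0, Hf' s = 0 & Hf'' s = 0].
Proof.
move=> sa; rewrite /Hf /Hf' /Hf''.
have [-> -> ->] := @Sf_lo R (s - a) ltac:(move: sa; lra).
have [-> -> ->] := @Sf_lo R (s - (a + 4)) ltac:(move: sa; lra).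
have [-> -> ->] := @Sf_lo R (s - c) ltac:(move: sa ac; lra).
by rewrite !mulr0 subr0 addr0.
Qed.

Lemma Hf_hi s : c + 2 <= s -> [/\ Hf s = 0, Hf' s = 0 & Hf'' s = 0].
Proof.
move=> sa; rewrite /Hf /Hf' /Hf''.
have [-> -> ->] := @Sf_hi R (s - a) ltac:(move: sa ac; lra).
have [-> -> ->] := @Sf_hi R (s - (a + 4)) ltac:(move: sa ac; lra).
have [-> -> ->] := @Sf_hi R (s - c) ltac:(move: sa; lra).
have := lamE => h; split; [|ring|ring].
transitivity (4 - lam * (c - a - 4)); [ring|rewrite h; ring].
Qed.

(** Three ranges: the rise, the smoothed kink where the height is at least 3 while the correction is
    at most 2, and the descent, compared with its broken line through [lamE]. *)
Lemma Hf_ge0 s : 0 <= Hf s.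
Proof.
have /andP[l0 l1] := lam01; have lE := lamE.
have [a1 a2 _ _] := Sf_bounds (s - a); have [b1 b2 _ _] := Sf_bounds (s - (a + 4)).
have [c1 c2 _ _] := Sf_bounds (s - c).
have lc : 0 <= lam * Sf (s - c) by rewrite mulr_ge0// ltW.
have [s4|s4] := leP s (a + 4).
  rewrite /Hf; have [-> _ _] := @Sf_lo R (s - (a + 4)) ltac:(move: s4; lra).
  by move: lc a1; lra.
have [s6|s6] := leP s (a + 6).
  rewrite /Hf.
  have S1 : Sf (s - (a + 4)) <= 1.
    have [t0|[[t0 [t1 [-> _ _]]]|[[t1 [t2 [-> _ _]]]|t2]]] := Sf_cases (s - (a + 4)).
    - by have [-> _ _] := Sf_lo t0.
    - by have : (s - (a + 4)) ^+ 3 <= 1 by [rewrite expr_le1|]; lra.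
    - move: t1 t2; move: (s - (a + 4)) => x t1 t2.
      have y0 : 0 <= 2 - x by move: t2; lra.
      have h : (2 - x) ^+ 3 <= 2 - x.
        by rewrite exprS ler_piMr// expr_le1//; move: t1; lra.
      have -> : (x ^+ 3 - 2 * (x - 1) ^+ 3) / 6 = (2 - x) ^+ 3 / 6 + (x - 1) by field.
      by move: h t2; lra.
    - by have [-> _ _] := Sf_hi t2; move: s6; lra.
  have : (1 + lam) * Sf (s - (a + 4)) <= 2 * 1 by apply: ler_pM => //; lra.
  by move: lc a2 s4; lra.
rewrite /Hf; have [-> _ _] := @Sf_hi R (s - (a + 4)) ltac:(move: s6; lra).
have : lam * (s - c - 1) <= lam * Sf (s - c) by rewrite ler_wpM2l// ltW.
have -> : (1 + lam) * (s - (a + 4) - 1) = (s - (a + 4) - 1) + lam * (c - a - 4) + lam * (s - c - 1) by ring.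
by rewrite lE; move: a2; lra.
Qed.

Lemma Hf'_le s : `|Hf' s| <= 2.
Proof.
have /andP[l0 l1] := lam01.
have [_ _ /andP[a1 a2] _] := Sf_bounds (s - a).
have [_ _ /andP[b1 b2] _] := Sf_bounds (s - (a + 4)).
have [_ _ /andP[c1 c2] _] := Sf_bounds (s - c).
rewrite /Hf'; move: a1 a2 b1 b2 c1 c2; move: (Sf' (s - a)) (Sf' (s - (a + 4))) (Sf' (s - c)) => x y w x0 x1 y0 y1 w0 w1.
have h1 : 0 <= (1 + lam) * y <= 2 by apply/andP; split; nra.
have h2 : 0 <= lam * w <= 1 by apply/andP; split; nra.
by rewrite ler_norml; move: h1 h2; move: (_ * y) (lam * w) => p q; lra.
Qed.

Lemma Hf'_le0 s : a + 6 <= s -> Hf' s <= 0.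
Proof.
move=> sa; have /andP[l0 l1] := lam01.
have [_ _ /andP[c1 c2] _] := Sf_bounds (s - c).
rewrite /Hf'; have [_ -> _] := @Sf_hi R (s - (a + 4)) ltac:(move: sa; lra).
have [_ -> _] := @Sf_hi R (s - a) ltac:(move: sa; lra).
have : lam * Sf' (s - c) <= lam * 1 by rewrite ler_wpM2l// ltW.
lra.
Qed.

End profile.

(** * Ring weights *)

Section rings.
Context {R : realType}.
Local Notation RR := (plane R).

Definition elog (z : R * R) : R := ln (sqn z) / 2.

Lemma nrm_elog z : 0 < sqn z -> nrm z = expR (elog z).
Proof.
move=> z0; rewrite /nrm -[in LHS](lnK (x := sqn z)) ?posrE//.
have -> : ln (sqn z) = elog z + elog z by rewrite /elog; field.
by rewrite expRD -expr2 sqrtr_sqr ger0_norm// expR_ge0.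
Qed.

Lemma elog_pos z : 0 < elog z -> 0 < sqn z.
Proof.
move=> h; rewrite lt_neqAle eq_sym sqn_ge0 andbT; apply/eqP => e.
by rewrite /elog e ln0// mul0r ltxx in h.
Qed.

Lemma elog_itv (b1 b2 : R) z : 0 <= b1 -> b1 < elog z -> elog z < b2 -> expR b1 < nrm z < expR b2.
Proof.
by move=> b0 h1 h2; rewrite nrm_elog ?ltr_expR ?h1//; apply: elog_pos; exact: le_lt_trans h1.
Qed.

(** The Laplacian of Sf(ln |z| - b): a bump on the ring where ln |z| lies between b and b + 2. *)
Definition rw (b : R) (z : R * R) : R := Sf'' (elog z - b) / sqn z.

Lemma Sf''_supp (t : R) : Sf'' t != 0 -> 0 < t < 2.
Proof.
move=> t0; apply/andP; split.
  by rewrite ltNge; apply/negP => /Sf_lo[_ _ e]; rewrite e eqxx in t0.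
by rewrite ltNge; apply/negP => /Sf_hi[_ _ e]; rewrite e eqxx in t0.
Qed.

Lemma rw_supp b z : 0 <= b -> rw b z != 0 -> expR b < nrm z < expR (b + 2).
Proof.
move=> b0 h; have : Sf'' (elog z - b) != 0.
  by apply: contraNN h => /eqP e; rewrite /rw e mul0r.
move=> /Sf''_supp/andP[h1 h2]; apply: elog_itv => //; [move: h1|move: h2]; lra.
Qed.

Lemma rw_bounds b z : 0 <= b -> 0 <= rw b z <= 1.
Proof.
move=> b0; have [_ _ _ /andP[s0 s1]] := Sf_bounds (elog z - b).
have n0 : 0 <= rw b z by rewrite /rw divr_ge0// sqn_ge0.
rewrite n0/=; have [->//|h] := eqVneq (rw b z) 0.
have /andP[z1 _] := rw_supp b0 h.
have e1 : 1 < nrm z by apply: le_lt_trans z1; rewrite -expR0 ler_expR.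
have q1 : 1 <= sqn z by rewrite -nrm_sq; apply: exprn_ege1; exact: ltW.
by rewrite ler_pdivrMr ?mul1r ?(le_trans s1)// (lt_le_trans ltr01).
Qed.

Lemma rw_cbox b z : 0 <= b -> ~ cbox (expR (b + 2)) z -> rw b z = 0.
Proof.
move=> b0 nz; apply/eqP; apply: contrapT => /negP h; apply: nz.
by have /andP[_ h'] := rw_supp b0 h; apply: nrm_cbox; exact: ltW.
Qed.

Lemma rw_meas b : 0 <= b -> mplane (rw b).
Proof.
move=> b0; apply: continuous_measurable2.
apply: (@ct_radial R (fun t => Sf'' (ln t / 2 - b) / t)).
apply: (@ct_glue0 R _ 1) => //.
  move=> t /ltW t1; have [_ _ ->] := @Sf_lo R (ln t / 2 - b) ltac:(
    have := ln_le0_total t1; move: b0; lra).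
  by rewrite mul0r.
move=> t t0; apply: cvgM.
  by apply: (@ct_lnhalf R (fun s => Sf'' (s - b))) => //; apply: ct_shift1; exact: ct_Sf''.
by apply: cvgV; [rewrite gt_eqF|exact: cvg_id].
Qed.

Lemma rw_inR b : 0 <= b -> inR (rw b).
Proof.
move=> b0; apply: (@integrable_bbox _ _ (expR (b + 2)) 1); first exact: rw_meas.
  by move=> z; have /andP[h h'] := rw_bounds z b0; rewrite ger0_norm.
by move=> z; exact: rw_cbox.
Qed.

Lemma bm_rw b : 0 <= b -> bm (rw b).
Proof.
move=> b0; split; first exact: rw_meas.
by exists 1 => z; have /andP[h h'] := rw_bounds z b0; rewrite ger0_norm.
Qed.

Lemma rw_mass b : 0 <= b -> \int[mu2]_z rw b z <= 4 * expR (b + 2) ^+ 2.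
Proof.
move=> b0; rewrite -Rint_indic_cbox ?expR_ge0//; apply: Rint_le; [exact: rw_inR|exact: inR_cbox|].
move=> z; have [h|h] := pselect (cbox (expR (b + 2)) z).
  by rewrite indicE mem_set//; case/andP: (rw_bounds z b0).
by rewrite rw_cbox.
Qed.

(** Between the squares of half-sides r and 3 r / 2 the hat function is at least 1/2 and |z|^2 <= 9
    r^2 / 2, so the weight is at least 1 / (9 r^2) on an area 5 r^2. *)
Lemma rw_mass_ge b : 0 <= b -> 1 / 2 <= \int[mu2]_z rw b z.
Proof.
move=> b0; pose r := expR (b + 1 / 2).
have r0 : 0 < r by exact: expR_gt0.
have i1 := inR_cbox (3 / 2 * r); have i2 := inR_cbox r.
apply: (@le_trans _ _ (\int[mu2]_z ((9 * r ^+ 2)^-1 * (\1_(cbox (3 / 2 * r)) z - \1_(cbox r) z)))).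
  rewrite RintZ; last exact: inRB.
  rewrite RintB// !Rint_indic_cbox; [|exact: ltW|by rewrite mulr_ge0// ltW].
  have -> : (9 * r ^+ 2)^-1 * (4 * (3 / 2 * r) ^+ 2 - 4 * r ^+ 2) = 5 / 9.
    by field; rewrite gt_eqF.
  lra.
apply: Rint_le; [by apply: inRZ; exact: inRB|exact: rw_inR|move=> z].
have /andP[w0 _] := rw_bounds z b0.
have r20 : 0 <= (9 * r ^+ 2)^-1 by rewrite invr_ge0 mulr_ge0// sqr_ge0.
have [zr|zr] := pselect (cbox r z).
  rewrite [\1_(cbox r) z]indicE mem_set//; apply: le_trans w0.
  apply: mulr_ge0_le0 => //; rewrite subr_le0 indicE; by case: (_ \in _).
have [z3|z3] := pselect (cbox (3 / 2 * r) z); last first.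
  by rewrite !indicE !memNset// subr0 mulr0.
rewrite !indicE mem_set// memNset// subr0 mulr1.
have lo : r < nrm z by rewrite ltNge; apply/negP => /nrm_cbox.
have z0 : 0 < sqn z by rewrite -nrm_sq exprn_gt0// (lt_trans r0).
have up : sqn z <= (9 / 2) * r ^+ 2.
  case: z3 => h1 h2; rewrite /sqn -(real_normK (num_real z.1)) -(real_normK (num_real z.2)).
  have k1 : `|z.1| ^+ 2 <= (3 / 2 * r) ^+ 2.
    by rewrite ler_sqr ?nnegrE ?mulr_ge0// ltW.
  have k2 : `|z.2| ^+ 2 <= (3 / 2 * r) ^+ 2.
    by rewrite ler_sqr ?nnegrE ?mulr_ge0// ltW.
  by move: k1 k2; rewrite exprMn; lra.
(* The crude bound exp 1 >= (3/2)^2 is enough for sqrt (9/2) <= exp 1, which keeps the region inside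
   the ring. *)
have e2 : (9 / 4 : R) <= expR 1.
  have -> : expR 1 = expR (1 / 2) * expR (1 / 2) :> R by rewrite -expRD; congr expR; field.
  have h : (3 / 2 : R) <= expR (1 / 2) by have := @expR_ge1Dx R (1 / 2); lra.
  have : 3 / 2 * (3 / 2) <= expR (1 / 2) * expR (1 / 2) :> R by apply: ler_pM.
  lra.
have up2 : nrm z <= r * expR 1.
  rewrite nrm_le; last by rewrite mulr_ge0 ?expR_ge0// ltW.
  apply: (le_trans up); rewrite exprMn mulrC ler_wpM2l ?sqr_ge0//.
  have : (9 / 4) ^+ 2 <= expR 1 ^+ 2 :> R by rewrite ler_sqr ?nnegrE ?expR_ge0.
  lra.
have l1 : b + 1 / 2 < elog z by rewrite -ltr_expR -nrm_elog.
have l2 : elog z <= b + 3 / 2.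
  rewrite -ler_expR -nrm_elog// (le_trans up2)// /r -expRD ler_expR; lra.
have S1 : 1 / 2 <= Sf'' (elog z - b).
  have [t0|[[t0 [t1 [_ _ ->]]]|[[t1 [t2 [_ _ ->]]]|t2]]] := Sf_cases (elog z - b).
  - by move: t0 l1; lra.
  - by move: l1; lra.
  - by move: l2; lra.
  - by move: t2 l2; lra.
rewrite /rw ler_pdivlMr//; apply: le_trans S1.
rewrite ler_pdivrMl ?mulr_gt0 ?exprn_gt0//; apply: (le_trans up); lra.
Qed.

End rings.

Lemma final_arith (R : realFieldType) (A L G l C D I M : R) :
  (L + C * G) * l <= A -> M <= - C * D + I ->
  L * l + M <= A - C * (G * l) - C * D + I.
Proof. by rewrite mulrDl -mulrA mulNr; move: (L * l) (C * (G * l)) (C * D) => x y z; lra. Qed.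

Lemma final_arith2 (R : realFieldType) (A E W lam q Q I CP E6 C ER : R) :
  A <= 4 * E -> lam * q * Q <= lam * q * (1 / 2) ->
  0 <= A - (1 + lam) * W + lam * q * Q - C * - I - C * I + 4 * C * CP * (4 * E6) + ER ->
  (1 + lam) * W <= 4 * E + 16 * C * CP * E6 + lam / 2 * q + ER.
Proof.
have -> : lam / 2 * q = lam * q * (1 / 2) by field.
have -> : 4 * C * CP * (4 * E6) = 16 * C * CP * E6 by ring.
by move: (lam * q * Q) ((1 + lam) * W) (lam * q * (1 / 2)) (16 * C * CP * E6) => a b c d; lra.
Qed.

(** * The inequality on far rings *)

Section star_ring.
Context {R : realType}.
Local Notation RR := (plane R).
Variables (u1 u2 h1 h2 : R * R -> R) (eta : nat -> R -> R) (B : R).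
Hypotheses (u1i : inR u1) (u2i : inR u2) (h1i : inR h1) (h2i : inR h2).
Hypothesis etab : forall k, bump (k.+1%:R^-1) (eta k).
Hypotheses (u1B : forall z, `|u1 z| <= 1) (u2B : forall z, `|u2 z| <= 1).
Hypotheses (h1B : forall z, `|h1 z| <= B) (h2B : forall z, `|h2 z| <= B).

(** Dominated convergence: the error is bounded by m^2 psi / 2; it tends to 0 where u does not
    vanish, because of its factor e, and where u = 0 the weight or h vanishes. *)
Lemma err_small (psi : R * R -> R) (m L : R) : continuous psi -> (forall z, 0 <= psi z) ->
  (forall z, ~ cbox L z -> psi z = 0) ->
  (forall z, psi z != 0 -> h1 z ^+ 2 + h2 z ^+ 2 <= m ^+ 2 * (u1 z ^+ 2 + u2 z ^+ 2)) ->
  forall d, 0 < d -> exists N, forall n, (N <= n)%N ->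
   \int[mu2]_z (n.+1%:R^-1 / 2 * psi z * ((h1 z ^+ 2 + h2 z ^+ 2) / qq (n.+1%:R^-1) (u1 z) (u2 z) ^+ 2)) <= d.
Proof.
move=> cpsi psi0 spsi hm d d0.
have mu1 := inR_meas u1i; have mu2' := inR_meas u2i.
have mh1 := inR_meas h1i; have mh2 := inR_meas h2i.
have mpsi := continuous_measurable2 cpsi.
have psii : inR psi by exact: Cc_integrable spsi.
pose f (n : nat) (z : R * R) : R := n.+1%:R^-1 / 2 * psi z * ((h1 z ^+ 2 + h2 z ^+ 2) / qq (n.+1%:R^-1) (u1 z) (u2 z) ^+ 2).
have e0 n : (0 : R) < n.+1%:R^-1 by rewrite invr_gt0.
have f0 n z : 0 <= f n z.
  rewrite /f; apply: mulr_ge0; first by apply: mulr_ge0 => //; rewrite divr_ge0// ltW.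
  by apply: divr_ge0; [rewrite addr_ge0 ?sqr_ge0|exact: sqr_ge0].
have fle n z : f n z <= m ^+ 2 / 2 * psi z.
  have [p0|p0] := eqVneq (psi z) 0; first by rewrite /f p0 !mulr0 mul0r.
  by apply: err_le => //; exact: hm.
have mf n : mplane (fun z => (f n z)%:E).
  apply/measurable_EFinP; apply: measurable_funM.
    by apply: measurable_funM => //; exact: measurable_cst.
  apply: measurable_funM.
    by apply: measurable_funD; exact: measurable_funX.
  have mq : mplane (fun z => qq (n.+1%:R^-1) (u1 z) (u2 z)).
    apply: measurable_funD; last exact: measurable_cst.
    by apply: measurable_funD; exact: measurable_funX.
  rewrite (_ : (fun z => _) = fun z => expR (- ln (qq (n.+1%:R^-1) (u1 z) (u2 z) ^+ 2))); last first.
    by apply/funext => z; rewrite expRN lnK// posrE exprn_gt0// qq_gt0.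
  apply: (measurableT_comp (continuous_measurable_fun (@continuous_expR R))).
  apply: measurableT_comp => //.
  by apply: (measurableT_comp (@measurable_ln R)); exact: measurable_funX.
have mf0 : measurable_fun [set: RR] (fun=> 0%E : \bar R) by exact: measurable_cst.
have gi : mu2.-integrable setT (fun z => (m ^+ 2 / 2 * psi z)%:E) by exact: inRZ.
have [] := @dominated_convergence _ _ _ mu2 setT measurableT (fun n z => (f n z)%:E) (fun=> 0%E) _ mf mf0 _ gi _.
- apply: aeW => z _; apply/fine_cvgP; split; first by near=> n.
  rewrite /=.
  have [uu|uu] := eqVneq (u1 z ^+ 2 + u2 z ^+ 2) 0.
    have fz n : f n z = 0.
      rewrite /f; have [p0|p0] := eqVneq (psi z) 0; first by rewrite p0 mulr0 mul0r.
      have h0 : h1 z ^+ 2 + h2 z ^+ 2 = 0.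
        by apply/le_anti; rewrite addr_ge0 ?sqr_ge0// andbT (le_trans (hm z p0))// uu mulr0.
      by rewrite h0 mul0r mulr0.
    by rewrite (_ : fine \o _ = fun=> 0); [exact: cvg_cst|apply/funext => n /=; exact: fz].
  have uu0 : 0 < u1 z ^+ 2 + u2 z ^+ 2 by rewrite lt_neqAle eq_sym uu addr_ge0 ?sqr_ge0.
  set U := u1 z ^+ 2 + u2 z ^+ 2 in uu0.
  have cK : (n.+1%:R^-1 * (psi z / 2 * ((h1 z ^+ 2 + h2 z ^+ 2) / U ^+ 2)) : R) @[n --> \oo] --> (0 : R).
    by rewrite -(mul0r (psi z / 2 * ((h1 z ^+ 2 + h2 z ^+ 2) / U ^+ 2))); apply: cvgM; [exact: cvg_harmonic|exact: cvg_cst].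
  apply: (squeeze_cvgr _ (cvg_cst 0) cK); near=> n.
  rewrite /= f0/= /f (_ : _ / 2 * psi z * _ = n.+1%:R^-1 * (psi z / 2 * ((h1 z ^+ 2 + h2 z ^+ 2) / qq n.+1%:R^-1 (u1 z) (u2 z) ^+ 2))); last ring.
  rewrite ler_wpM2l ?(ltW (e0 n))// ler_wpM2l ?divr_ge0//.
  rewrite ler_wpM2l ?addr_ge0 ?sqr_ge0// lef_pV2 ?posrE ?exprn_gt0 ?qq_gt0//.
  rewrite ler_sqr ?nnegrE ?(ltW uu0)//; last by rewrite ltW// qq_gt0.
  by rewrite /qq lerDl ltW.
- apply: aeW => z n _; rewrite /= lee_fin ger0_norm//; exact: fle.
move=> _ _; rewrite integral0 => /fine_cvgP[_ /cvgrPdist_lt /(_ _ d0)].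
case=> N _ hN; exists N => n /hN /=; rewrite sub0r normrN => h.
by apply: ltW; apply: le_lt_trans h; exact: ler_norm.
Unshelve. all: by end_near. Qed.

Variables (Phi Psi Psi' : R -> R) (R0 P0 C1 dl a c : R) (k0 : nat).
Hypotheses (R00 : 0 < R0) (P00 : 0 <= P0) (C10 : 0 <= C1) (dl0 : 0 < dl) (a0 : 0 <= a) (ac : a + 8 <= c).
Hypothesis aR : R0 + 1 <= expR a.
Hypothesis dPsi : forall s, der Psi s (Psi' s).
Hypothesis cPsi' : continuous Psi'.
Hypothesis Psi_0 : forall s, s <= R0 -> Psi s = 0 /\ Psi' s = 0.
Hypothesis Psi'_b : forall s, R0 + 1 <= s -> 0 <= Psi' s <= P0.
Hypothesis Psi_b : forall s, Phi (s - 1) <= Psi s <= Phi s.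
Hypothesis Phi_m : forall s t, s <= t -> Phi s <= Phi t.
Hypothesis Phi_p : forall s, 0 <= Phi s.
Let T := expR (c + 2).
Hypothesis hreg : forall z, expR a <= nrm z -> nrm z <= T ->
  [/\ h1 z ^+ 2 + h2 z ^+ 2 <= (C1 * Psi' (nrm z)) ^+ 2 * (u1 z ^+ 2 + u2 z ^+ 2),
      u1 z ^+ 2 + u2 z ^+ 2 <= expR (- (2 * ((C1 + dl) * Phi (nrm z)))) &
      forall k, (k0 <= k)%N -> moll_eq (eta k) u1 u2 h1 h2 z].
Hypothesis c_large : 1 <= dl * Phi (expR c - 1).

Let gG t : R := Psi (Num.sqrt t).
Let gG' t : R := Psi' (Num.sqrt t) / (2 * Num.sqrt t).

Let sqrt_small t : t < R0 ^+ 2 -> Num.sqrt t <= R0.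
Proof.
move=> tR; rewrite -(ger0_norm (ltW R00)) -sqrtr_sqr ler_wsqrtr//; exact: ltW.
Qed.

Let der_gG t : der gG t (gG' t).
Proof.
move: t; apply: (@der_glue0 _ _ _ (R0 ^+ 2)); first by rewrite exprn_gt0.
  by move=> t /sqrt_small/Psi_0[e1 e2]; rewrite /gG /gG' e1 e2 mul0r.
by move=> t t0; apply: (der_comp (g := Num.sqrt) (dPsi _) (der_sqrt t0)).
Qed.

Let ct_gG' : continuous gG'.
Proof.
apply: (@ct_glue0 _ _ (R0 ^+ 2)); first by rewrite exprn_gt0.
  by move=> t /sqrt_small/Psi_0[e1 e2]; rewrite /gG' e2 mul0r.
move=> t t0; apply: cvgM.
  by apply: (cvg_comp Num.sqrt Psi'); [exact: sqrt_continuous|exact: cPsi'].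
apply: cvgV; first by rewrite mulf_neq0 ?gt_eqF ?sqrtr_gt0.
by apply: cvgM; [exact: cvg_cst|exact: sqrt_continuous].
Qed.

Let F := logF (Hf a c).
Let F' := logF' (Hf' a c).
Let F'' := logF'' (Hf' a c) (Hf'' a c).
Let psi z : R := F (sqn z).
Let px z := F' (sqn z) * (2 * z.1).
Let py z := F' (sqn z) * (2 * z.2).
Let lap z := 4 * sqn z * F'' (sqn z) + 4 * F' (sqn z).

Let H0 s : s <= 0 -> [/\ Hf a c s = 0, Hf' a c s = 0 & Hf'' a c s = 0].
Proof. by move=> s0; apply: Hf_lo => //; exact: le_trans a0. Qed.

Let ct_F'' : continuous F''.
Proof. by have := ct_logF'' (@der_Hf' R a c) (@ct_Hf'' R a c) H0; apply. Qed.

Let ct_lap : continuous lap.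
Proof.
have cF' : continuous F' by move=> t; exact: der_continuous (der_logF' (@der_Hf' R a c) H0 t).
apply: ctD; apply: ctM; [|exact: (ct_radial ct_F'')|exact: ct_cst|exact: ct_radial].
by apply: ctM; [exact: ct_cst|exact: ct_sqn].
Qed.

Let ct : C2c T psi px py lap.
Proof.
apply: radial_C2c; last exact: expR_ge0.
- exact: (der_logF (@der_Hf R a c) H0).
- exact: (der_logF' (@der_Hf' R a c) H0).
- exact: ct_F''.
- move=> t tT; have t0 : 0 < t by apply: lt_le_trans tT; rewrite exprn_gt0// expR_gt0.
  have lt : c + 2 <= ln t / 2.
    rewrite ler_pdivlMr// -ler_expR lnK ?posrE//; apply: le_trans tT.
    by rewrite -expRM_natr mulr_natr.
  have [e1 e2 e3] := Hf_hi ac lt.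
  by rewrite /F /F' /F'' /logF /logF' /logF'' e1 e2 e3 !mul0r subr0.
Qed.

Let psi0 z : 0 <= psi z. Proof. exact: Hf_ge0. Qed.

Let supp z : ~ (expR a <= nrm z /\ nrm z <= T) -> [/\ psi z = 0, px z = 0, py z = 0 & lap z = 0].
Proof.
move=> nz; suff [e1 e2 e3] : [/\ F (sqn z) = 0, F' (sqn z) = 0 & F'' (sqn z) = 0].
  by rewrite /psi /px /py /lap e1 e2 e3 !mul0r !mulr0 addr0.
suff [e1 e2 e3] : [/\ Hf a c (elog z) = 0, Hf' a c (elog z) = 0 & Hf'' a c (elog z) = 0].
  by rewrite /F /F' /F'' /logF /logF' /logF'' -/(elog z) e1 e2 e3 !mul0r subr0.
have [la|la] := leP (elog z) a; first exact: Hf_lo.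
have [lc|lc] := leP (c + 2) (elog z); first exact: Hf_hi.
exfalso; apply: nz; have z0 : 0 < sqn z by apply: elog_pos; exact: le_lt_trans la.
by rewrite nrm_elog// /T !ler_expR !ltW.
Qed.

(** Only the three kinks of the profile contribute, with the signs of the changes of slope. *)
Let lapE z : 0 < sqn z -> lap z = rw a z - (1 + lam a c) * rw (a + 4) z + lam a c * rw c z.
Proof.
move=> z0; rewrite /lap /F' /F'' /logF' /logF'' -/(elog z) /rw /Hf''.
by field; rewrite gt_eqF.
Qed.

(** The first summand bounds the mass of the inner ring weight, the second the cost of the disc |z|
    <= exp (a + 6), outside which the profile does not increase. *)
Let K0 : R := 4 * expR (a + 2) ^+ 2 + 16 * C1 * P0 * expR (a + 6) ^+ 2.

(** The integral inequality for u, with C1 Psi(|z|) added to Lam_e. On the descent of the profile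
    the gradient of Psi pays for the field of V, by Green's formula; at the outer ring the sum Lam_e
    + C1 Psi is at most 1 - dl Phi. What is left bounds the integral over the middle ring from
    above. *)
Lemma star_ring_e e : 0 < e -> e <= 1 -> e <= expR (- (2 * ((C1 + dl) * Phi T))) ->
  (1 + lam a c) * \int[mu2]_z (rw (a + 4) z * Lam e (u1 z) (u2 z)) <=
  K0 + lam a c / 2 * (1 - dl * Phi (expR c - 1)) +
  \int[mu2]_z (e / 2 * psi z * ((h1 z ^+ 2 + h2 z ^+ 2) / qq e (u1 z) (u2 z) ^+ 2)).
Proof.
move=> e0 e1 eT.
have /andP[l0 l1] := lam01 ac.
pose G z := gG (sqn z); pose gx z := gG' (sqn z) * (2 * z.1); pose gy z := gG' (sqn z) * (2 * z.2).
have ctG : continuous gG by move=> t; exact: der_continuous (der_gG t).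
have cgx : continuous gx.
  by apply: ctM; [exact: ct_radial|apply: ctM; [exact: ct_cst|exact: ct_fst]].
have cgy : continuous gy.
  by apply: ctM; [exact: ct_radial|apply: ctM; [exact: ct_cst|exact: ct_snd]].
have cG : continuous G by exact: ct_radial.
have grn := green (D1_radial der_gG) (D2_radial der_gG) cG cgx cgy ct.
have [_ _ _ [cpsi cpx cpy] csupp] := ct.
have bell := bm_ell u1i u2i u1B u2B e0 e1.
have bL : bm (fun z => Lam e (u1 z) (u2 z)).
  rewrite (_ : (fun z => _) = fun z => (Lam e (u1 z) (u2 z) - 1) + 1 * 1).
    apply: bmD => //; split; [exact: measurable_cst|exists 1 => z; by rewrite mulr1 normr1].
  by apply/funext => z; rewrite mulr1 subrK.
have a4 : 0 <= a + 4 by rewrite addr_ge0.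
have c0 : 0 <= c by move: a0 ac; lra.
have w1i := rw_inR a0; have w2i := rw_inR a4; have w3i := rw_inR c0.
have [_ li] := C2c_lap0 ct.
have Lwi : inR (fun z => rw (a + 4) z * Lam e (u1 z) (u2 z)) by exact: inR_pairing.
pose er z := e / 2 * psi z * ((h1 z ^+ 2 + h2 z ^+ 2) / qq e (u1 z) (u2 z) ^+ 2).
have hi := inR_integrand u1i u2i h1i h2i e0 u1B u2B h1B h2B ct.
pose inte z := integrand e (u1 z) (u2 z) (h1 z) (h2 z) (psi z) (px z) (py z) (lap z).
have h0 : 0 <= \int[mu2]_z inte z.
  apply: (@star_limit R u1 u2 h1 h2 eta u1i u2i h1i h2i etab e B e0 u1B u2B h1B h2B
    T _ _ _ _ [set z | expR a <= nrm z /\ nrm z <= T] k0 ct psi0) => //.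
  by move=> k z kk [z1 z2]; have [_ _] := hreg z1 z2; apply.
have eri : inR er.
  have psii : inR psi by apply: (@Cc_integrable _ _ T) => // z /csupp[].
  have m0' : measurable_fun [set: RR] (fun=> 0 : R) by exact: measurable_cst.
  apply: (inR_le _ (inRZ (e / 2 * (2 * B ^+ 2 / e ^+ 2)) psii)).
    rewrite (_ : er = fun z => integrand e (u1 z) (u2 z) (h1 z) (h2 z) (psi z) 0 0 0); last first.
      by apply/funext => z; rewrite /er /integrand; ring.
    by apply: measurable_integrand => //; exact: continuous_measurable2.
  move=> z; have er0 : 0 <= er z.
    rewrite /er; apply: mulr_ge0; first by apply: mulr_ge0 => //; rewrite divr_ge0// ltW.
    by apply: divr_ge0; [rewrite addr_ge0 ?sqr_ge0|exact: sqr_ge0].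
  rewrite ger0_norm// /er mulrAC; apply: ler_wpM2r => //; apply: ler_wpM2l.
    by rewrite divr_ge0// ltW.
  have B0 : 0 <= B by apply: le_trans (h1B z).
  apply: ler_pM; rewrite ?addr_ge0 ?sqr_ge0 ?invr_ge0 ?sqr_ge0//.
    have b1 : h1 z ^+ 2 <= B ^+ 2.
      by rewrite -(real_normK (num_real (h1 z))) ler_sqr ?nnegrE.
    have b2 : h2 z ^+ 2 <= B ^+ 2.
      by rewrite -(real_normK (num_real (h2 z))) ler_sqr ?nnegrE.
    by rewrite mulr_natl mulr2n lerD.
  rewrite lef_pV2 ?posrE ?exprn_gt0 ?qq_gt0// ler_sqr ?nnegrE ?(ltW e0)//; last exact: ltW (qq_gt0 _ _ _).
  exact: qq_ge.
have Gli : inR (fun z => G z * lap z).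
  apply: (@Cc_integrable _ _ T); first exact: ctM.
  by move=> z /csupp[_ _ _ ->]; rewrite mulr0.
have pi' : inR (fun z => gx z * px z + gy z * py z).
  apply: (@Cc_integrable _ _ T); first by apply: ctD; exact: ctM.
  by move=> z /csupp[_ -> -> _]; rewrite !mulr0 addr0.
pose tot z := rw a z - (1 + lam a c) * (rw (a + 4) z * Lam e (u1 z) (u2 z)) +
  (lam a c * (1 - dl * Phi (expR c - 1))) * rw c z - C1 * (G z * lap z)
  - C1 * (gx z * px z + gy z * py z)
  + (4 * C1 * P0) * \1_(cbox (expR (a + 6))) z + er z.
have i6 := inR_cbox (R := R) (expR (a + 6)).
have tot1 : inR (fun z => rw a z - (1 + lam a c) * (rw (a + 4) z * Lam e (u1 z) (u2 z))).
  by apply: inRB => //; exact: inRZ.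
have tot2 : inR (fun z => rw a z - (1 + lam a c) * (rw (a + 4) z * Lam e (u1 z) (u2 z)) +
  (lam a c * (1 - dl * Phi (expR c - 1))) * rw c z) by apply: inRD => //; exact: inRZ.
have tot3 : inR (fun z => rw a z - (1 + lam a c) * (rw (a + 4) z * Lam e (u1 z) (u2 z)) +
  (lam a c * (1 - dl * Phi (expR c - 1))) * rw c z - C1 * (G z * lap z)).
  by apply: inRB => //; exact: inRZ.
have tot4 : inR (fun z => rw a z - (1 + lam a c) * (rw (a + 4) z * Lam e (u1 z) (u2 z)) +
  (lam a c * (1 - dl * Phi (expR c - 1))) * rw c z - C1 * (G z * lap z)
  - C1 * (gx z * px z + gy z * py z)).
  by apply: inRB => //; exact: inRZ.
have tot5 : inR (fun z => rw a z - (1 + lam a c) * (rw (a + 4) z * Lam e (u1 z) (u2 z)) +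
  (lam a c * (1 - dl * Phi (expR c - 1))) * rw c z - C1 * (G z * lap z)
  - C1 * (gx z * px z + gy z * py z) + (4 * C1 * P0) * \1_(cbox (expR (a + 6))) z).
  by apply: inRD => //; exact: inRZ.
have toti : inR tot by exact: inRD.
have up : \int[mu2]_z inte z <= \int[mu2]_z tot z.
  apply: Rint_le => // z.
  have er0 : 0 <= er z.
    rewrite /er; apply: mulr_ge0; first by apply: mulr_ge0 => //; rewrite divr_ge0// ltW.
    by apply: divr_ge0; [rewrite addr_ge0 ?sqr_ge0|exact: sqr_ge0].
  have [zin|zout] := pselect (expR a <= nrm z /\ nrm z <= T); last first.
    have [p1 p2 p3 p4] := supp zout.
    have w0 b : 0 <= b -> a <= b -> b <= c -> rw b z = 0.
      move=> b0 ab bc; apply/eqP; apply: contrapT => /negP h; apply: zout.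
      have /andP[y1 y2] := rw_supp b0 h; split.
        by apply: ltW; apply: le_lt_trans y1; rewrite ler_expR.
      by apply: ltW; apply: lt_le_trans y2 _; rewrite ler_expR lerD2r.
    have ac4 : a + 4 <= c by rewrite (le_trans _ ac)// lerD2l ler_nat.
    have ac0 : a <= c by rewrite (le_trans _ ac4)// lerDl.
    have wa := w0 a a0 (lexx a) ac0.
    have wb : rw (a + 4) z = 0 by apply: w0 => //; rewrite lerDl.
    have wc := w0 c c0 ac0 (lexx c).
    have -> : inte z = 0 by rewrite /inte p1 p2 p3 p4 /integrand; ring.
    rewrite /tot wa wb wc p2 p3 p4 (_ : _ - _ + _ - _ - _ = 0); last ring.
    by rewrite add0r addr_ge0// mulr_ge0// mulr_ge0// mulr_ge0.
  case: zin => z1 z2; have [hm hu _] := hreg z1 z2.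
  have nz : 0 < nrm z by apply: lt_le_trans z1; exact: expR_gt0.
  have z0 : 0 < sqn z by rewrite -nrm_sq exprn_gt0.
  have /andP[P1 P2] := Psi'_b (le_trans aR z1).
  have CP0 : 0 <= C1 * Psi' (nrm z) by exact: mulr_ge0.
  apply: (le_trans (integrand_le _ _ _ _ e0 CP0 hm)).
  rewrite /tot -/(er z) lerD2r.
  have nE : nrm (px z, py z) = `|Hf' a c (elog z)| / nrm z.
    rewrite /nrm /px /py /sqn/= -/(sqn z).
    rewrite (_ : _ + _ = (2 * F' (sqn z)) ^+ 2 * sqn z); last by rewrite /sqn; ring.
    rewrite sqrtrM ?sqr_ge0// sqrtr_sqr -/(nrm z) /F' /logF' -/(elog z) -nrm_sq.
    rewrite (_ : 2 * _ = Hf' a c (elog z) / nrm z ^+ 2); last by field; rewrite gt_eqF.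
    rewrite normrM normfV (ger0_norm (sqr_ge0 _)); field; by rewrite gt_eqF.
  have dE : gx z * px z + gy z * py z = Psi' (nrm z) * Hf' a c (elog z) / nrm z.
    rewrite /gx /gy /px /py.
    rewrite (_ : _ + _ = 4 * sqn z * gG' (sqn z) * F' (sqn z)); last by rewrite /sqn; ring.
    rewrite /gG' /F' /logF' -/(elog z) -/(nrm z) -nrm_sq; field; by rewrite gt_eqF.
  (* Where the profile decreases the scalar product with grad Psi absorbs the term exactly;
     elsewhere each of the two terms is at most 2 C1 P0, because |[Hf']| <= 2 and |z| >= 1. *)
  have Tz : C1 * Psi' (nrm z) * nrm (px z, py z) <=
     - C1 * (gx z * px z + gy z * py z) + 4 * C1 * P0 * \1_(cbox (expR (a + 6))) z.
    rewrite nE dE.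
    have [l6|l6] := leP (a + 6) (elog z).
      have Hn := Hf'_le0 ac l6; rewrite ler0_norm//.
      rewrite (_ : - C1 * _ = C1 * Psi' (nrm z) * (- Hf' a c (elog z) / nrm z)); last by ring.
      by rewrite lerDl !mulr_ge0.
    have zb : cbox (expR (a + 6)) z by apply: nrm_cbox; rewrite nrm_elog// ler_expR ltW.
    rewrite indicE mem_set// mulr1 -lerBlDl.
    have n1 : 1 <= nrm z by apply: le_trans z1; rewrite -expR0 ler_expR.
    have Hb := Hf'_le ac (elog z).
    have Hd : `|Hf' a c (elog z)| / nrm z <= 2.
      by rewrite ler_pdivrMr//; apply: (le_trans Hb); rewrite ler_peMr.
    have Hd2 : Hf' a c (elog z) / nrm z <= 2.
      by apply: le_trans Hd; rewrite ler_wpM2r ?invr_ge0 ?(ltW nz)// ler_norm.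
    rewrite (_ : _ - _ = C1 * Psi' (nrm z) * (`|Hf' a c (elog z)| / nrm z + Hf' a c (elog z) / nrm z)); last by ring.
    rewrite (_ : 4 * C1 * P0 = C1 * P0 * 4); last ring.
    apply: (@le_trans _ _ (C1 * Psi' (nrm z) * 4)).
      by rewrite ler_wpM2l// [leRHS](_ : _ = 2 + 2); [exact: lerD|ring].
    by rewrite ler_wpM2r// ler_wpM2l.
  (* The condition on e makes it smaller than the bound for |u|^2 everywhere on |z| <= T, so
     regularization at most doubles that bound. *)
  have Lup : Lam e (u1 z) (u2 z) <= 1 - (C1 + dl) * Phi (nrm z).
    rewrite /Lam ler_pdivrMr//.
    have PT : expR (- (2 * ((C1 + dl) * Phi T))) <= expR (- (2 * ((C1 + dl) * Phi (nrm z)))).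
      rewrite ler_expR lerN2 ler_wpM2l// ler_wpM2l ?addr_ge0 ?(ltW dl0)//; exact: Phi_m.
    have q2 : qq e (u1 z) (u2 z) <= 2 * expR (- (2 * ((C1 + dl) * Phi (nrm z)))).
      by rewrite /qq mulr_natl mulr2n lerD// (le_trans eT PT).
    have q0 := qq_gt0 e0 (u1 z) (u2 z).
    apply: (@le_trans _ _ (ln (2 * expR (- (2 * ((C1 + dl) * Phi (nrm z))))))).
      by rewrite ler_ln ?posrE// mulr_gt0// expR_gt0.
    rewrite lnM ?posrE ?expR_gt0// expRK.
    rewrite mulrBl mul1r [X in _ - X]mulrC lerD2r.
    by rewrite (le_trans (ln_le_sub1 _))// gerBl.
  have Gz : G z = Psi (nrm z) by [].
  have /andP[PG1 PG2] := Psi_b (nrm z).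
  have G0 : 0 <= G z by rewrite Gz (le_trans _ PG1).
  (* The spare decay dl is what remains after C1 Psi <= C1 Phi has been paid for. *)
  have LG : Lam e (u1 z) (u2 z) + C1 * G z <= 1 - dl * G z.
    have : (C1 + dl) * G z <= (C1 + dl) * Phi (nrm z).
      by rewrite ler_wpM2l ?addr_ge0 ?(ltW dl0)// Gz.
    by rewrite lerBrDr -addrA -mulrDl -lerBrDr => h; rewrite (le_trans Lup)// lerD2l lerN2.
  have /andP[w10 _] := rw_bounds z a0; have /andP[w20 _] := rw_bounds z a4.
  have /andP[w30 _] := rw_bounds z c0.
  have Lp : (Lam e (u1 z) (u2 z) + C1 * G z) * lap z <= rw a z -
     (1 + lam a c) * (rw (a + 4) z * Lam e (u1 z) (u2 z)) +
     lam a c * (1 - dl * Phi (expR c - 1)) * rw c z.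
    rewrite lapE//.
    have t1 : (Lam e (u1 z) (u2 z) + C1 * G z) * rw a z <= rw a z.
      rewrite -[leRHS]mul1r ler_wpM2r//; apply: (le_trans LG).
      by rewrite gerBl mulr_ge0// ltW.
    have t2 : (1 + lam a c) * (rw (a + 4) z * Lam e (u1 z) (u2 z)) <=
        (1 + lam a c) * rw (a + 4) z * (Lam e (u1 z) (u2 z) + C1 * G z).
      rewrite mulrA; apply: ler_wpM2l; first by apply: mulr_ge0 => //; rewrite addr_ge0// ltW.
      by rewrite lerDl mulr_ge0.
    have t3 : (Lam e (u1 z) (u2 z) + C1 * G z) * rw c z <= (1 - dl * Phi (expR c - 1)) * rw c z.
      have [->|w3] := eqVneq (rw c z) 0; first by rewrite !mulr0.
      rewrite ler_wpM2r//; apply: (le_trans LG); rewrite lerD2l lerN2 ler_wpM2l ?(ltW dl0)//.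
      rewrite Gz (le_trans _ PG1)//; apply: Phi_m; rewrite lerD2r.
      by case/andP: (rw_supp c0 w3) => /ltW.
    have t4 : lam a c * ((Lam e (u1 z) (u2 z) + C1 * G z) * rw c z) <= lam a c * ((1 - dl * Phi (expR c - 1)) * rw c z).
      by rewrite ler_wpM2l// ltW.
    rewrite (_ : _ * (_ - _ + _) = (Lam e (u1 z) (u2 z) + C1 * G z) * rw a z -
      (1 + lam a c) * rw (a + 4) z * (Lam e (u1 z) (u2 z) + C1 * G z) +
      lam a c * ((Lam e (u1 z) (u2 z) + C1 * G z) * rw c z)); last ring.
    rewrite -[lam a c * _ * rw c z]mulrA.
    by apply: lerD => //; apply: lerB.
  move: Lp Tz; apply: final_arith.
have := le_trans h0 up; rewrite /tot.
rewrite RintD// RintD//; last exact: inRZ.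
rewrite RintB//; last exact: inRZ.
rewrite RintB//; last exact: inRZ.
rewrite RintD//; last exact: inRZ.
rewrite RintB//; last exact: inRZ.
rewrite !RintZ// grn Rint_indic_cbox ?expR_ge0//.
have m1 := rw_mass a0; have m3 := rw_mass_ge c0.
have neg : lam a c * (1 - dl * Phi (expR c - 1)) <= 0.
  by rewrite mulr_ge0_le0 ?(ltW l0)// subr_le0.
have t3 : lam a c * (1 - dl * Phi (expR c - 1)) * \int[mu2]_z rw c z <= lam a c * (1 - dl * Phi (expR c - 1)) * (1 / 2).
  exact: ler_wnM2l.
move: m1 t3; rewrite /K0 -/(er _).
by apply: final_arith2.
Qed.

Lemma star_ring : exists2 e, 0 < e <= 1 &
  (1 + lam a c) * \int[mu2]_z (rw (a + 4) z * Lam e (u1 z) (u2 z)) <=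
  K0 + lam a c / 2 * (1 - dl * Phi (expR c - 1)) + 1.
Proof.
have [_ _ _ [cpsi _ _] csupp] := ct.
have [N hN] : exists N, forall n, (N <= n)%N ->
   \int[mu2]_z (n.+1%:R^-1 / 2 * psi z * ((h1 z ^+ 2 + h2 z ^+ 2) / qq (n.+1%:R^-1) (u1 z) (u2 z) ^+ 2)) <= 1.
  apply: (@err_small psi (C1 * P0) T) => //.
  - by move=> z /csupp[].
  - move=> z pz; have [[z1 z2]|nz] := pselect (expR a <= nrm z /\ nrm z <= T); last first.
      by have [e] := supp nz; rewrite e eqxx in pz.
    have [hm _ _] := hreg z1 z2; apply: (le_trans hm).
    have /andP[P1 P2] := Psi'_b (le_trans aR z1).
    rewrite ler_wpM2r ?addr_ge0 ?sqr_ge0// ler_sqr ?nnegrE ?mulr_ge0//.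
    by rewrite ler_wpM2l.
pose E := expR (- (2 * ((C1 + dl) * Phi T))).
have [n1 hn1] : exists n : nat, n.+1%:R^-1 < E.
  by near \oo%classic => n; exists n; near: n; exact: near_infty_natSinv_lt (PosNum (expR_gt0 _)).
(* One index serves both requirements: the error term at most 1, and e below the decay of |u|^2 up
   to radius T. *)
pose n := maxn N n1.
have nE : n.+1%:R^-1 <= E.
  apply: le_trans (ltW hn1); rewrite lef_pV2 ?posrE ?ltr0n// ler_nat ltnS.
  exact: leq_maxr.
have n0 : (0 : R) < n.+1%:R^-1 by rewrite invr_gt0.
have n1' : (n.+1%:R^-1 : R) <= 1 by rewrite invf_le1// ler1n.
exists (n.+1%:R^-1); first by rewrite n0.
apply: (le_trans (star_ring_e n0 n1' nE)).
by rewrite lerD2l; apply: hN; exact: leq_maxl.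
Unshelve. all: by end_near. Qed.

End star_ring.

(** * Concentration and vanishing on slices *)

Section trunc.
Context {R : realType}.
Local Notation RR := (plane R).

Lemma nrm_le_sum (p : R * R) : nrm p <= `|p.1| + `|p.2|.
Proof.
rewrite nrm_le ?addr_ge0// /sqn -(real_normK (num_real p.1)) -(real_normK (num_real p.2)).
have : 0 <= `|p.1| * `|p.2| by [].
by rewrite sqrrD; lra.
Qed.

Lemma nrm_sub_le (z b : R * R) : nrm z <= nrm b + nrm (z :-: b).
Proof.
by have := nrmD b (z :-: b); rewrite /= !(addrC b.1) !(addrC b.2) !subrK -surjective_pairing.
Qed.

Lemma nrm_subC (z b : R * R) : nrm (z :-: b) = nrm (b :-: z).
Proof. by rewrite /nrm /sqn/= -(opprB z.1) -(opprB z.2) !sqrrN. Qed.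

Lemma nrm_box (z xi : R * R) d : `|z.1 - xi.1| <= d -> `|z.2 - xi.2| <= d ->
  nrm z - 2 * d <= nrm xi <= nrm z + 2 * d.
Proof.
move=> z1 z2; have n1 := nrm_le_sum (z :-: xi).
have n2 := nrm_sub_le z xi; have n3 := nrm_sub_le xi z; rewrite nrm_subC in n3.
by move: n1 => /=; move: z1 z2 n2 n3; lra.
Qed.

Lemma moll_ae (f g : R * R -> R) (k l : R -> R) (z : R * R) d :
  mplane f -> mplane g -> kernel1 k -> kernel1 l ->
  (forall x, d < `|x| -> k x = 0) -> (forall x, d < `|x| -> l x = 0) ->
  {ae mu2, forall xi : RR, `|z.1 - xi.1| <= d -> `|z.2 - xi.2| <= d -> f xi = g xi} ->
  moll f k l z = moll g k l z.
Proof.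
move=> mf mg kk kl k0 l0 fg; rewrite /moll /pairing /Rintegral; congr fine.
have [mk _] := bm_kxy z kk kl.
apply: ae_eq_integral => //.
- by apply/measurable_EFinP; exact: measurable_funM.
- by apply/measurable_EFinP; exact: measurable_funM.
apply: ae_imply fg => xi fg _; congr EFin.
have [h1|h1] := leP `|z.1 - xi.1| d; last by rewrite /kxy k0// mul0r !mulr0.
have [h2|h2] := leP `|z.2 - xi.2| d; last by rewrite /kxy l0// !mulr0.
by rewrite fg.
Qed.

(** The mollified equation at z sees the functions only almost everywhere on the square of half-side
    d about z, so they may be truncated away from it. *)
Lemma moll_eq_ae (eta : R -> R) d (u1 u2 h1 h2 u1' u2' h1' h2' : R * R -> R) z :
  bump d eta ->
  [/\ mplane u1, mplane u2, mplane h1 &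
   mplane h2] ->
  [/\ mplane u1', mplane u2', mplane h1' &
   mplane h2'] ->
  {ae mu2, forall xi : RR, `|z.1 - xi.1| <= d -> `|z.2 - xi.2| <= d ->
    [/\ u1 xi = u1' xi, u2 xi = u2' xi, h1 xi = h1' xi & h2 xi = h2' xi]} ->
  moll_eq eta u1 u2 h1 h2 z -> moll_eq eta u1' u2' h1' h2' z.
Proof.
move=> be [m1 m2 m3 m4] [m1' m2' m3' m4'] hae me eta' de.
have ke := bump_kernel1 be.
have [eta'' de'' ke''] := kernel1_der ke.
have ee : eta' = eta'' by apply/funext => x; exact: der_uniq (de x) (de'' x).
have ke' : kernel1 eta' by rewrite ee.
have e0 x : d < `|x| -> eta x = 0 by case: be => _ _ h _ _ /ltW/h.
have e0' := der_support e0 de.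
have [ma mb] := me eta' de.
have r1 : {ae mu2, forall xi : RR, `|z.1 - xi.1| <= d -> `|z.2 - xi.2| <= d -> u1 xi = u1' xi}.
  by apply: ae_imply hae => xi h x1 x2; case: (h x1 x2).
have r2 : {ae mu2, forall xi : RR, `|z.1 - xi.1| <= d -> `|z.2 - xi.2| <= d -> u2 xi = u2' xi}.
  by apply: ae_imply hae => xi h x1 x2; case: (h x1 x2).
have r3 : {ae mu2, forall xi : RR, `|z.1 - xi.1| <= d -> `|z.2 - xi.2| <= d -> h1 xi = h1' xi}.
  by apply: ae_imply hae => xi h x1 x2; case: (h x1 x2).
have r4 : {ae mu2, forall xi : RR, `|z.1 - xi.1| <= d -> `|z.2 - xi.2| <= d -> h2 xi = h2' xi}.
  by apply: ae_imply hae => xi h x1 x2; case: (h x1 x2).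
rewrite -(moll_ae m1 m1' ke' ke e0' e0 r1) -(moll_ae m2 m2' ke ke' e0 e0' r2).
rewrite -(moll_ae m2 m2' ke' ke e0' e0 r2) -(moll_ae m1 m1' ke ke' e0 e0' r1).
by rewrite -(moll_ae m3 m3' ke ke e0 e0 r3) -(moll_ae m4 m4' ke ke e0 e0 r4).
Qed.

Definition ann (r L : R) : set RR := [set z | nrm z \in `]r, L]].

Lemma measurable_ann r L : measurable (ann r L).
Proof. exact: measurable_nrm_itv. Qed.

Definition trunc r L (f : R * R -> R) z := f z * \1_(ann r L) z.

Lemma trunc_in r L f z : r < nrm z -> nrm z <= L -> trunc r L f z = f z.
Proof. by move=> h1 h2; rewrite /trunc indicE mem_set ?mulr1// /ann/= in_itv/= h1. Qed.

Lemma trunc_out r L f z : ~ (r < nrm z /\ nrm z <= L) -> trunc r L f z = 0.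
Proof.
move=> h; rewrite /trunc indicE memNset ?mulr0//= /ann/= in_itv/= => /andP[h1 h2].
exact: h.
Qed.

Lemma trunc_meas r L f : mplane f -> mplane (trunc r L f).
Proof.
move=> mf; apply: measurable_funM => //; apply: measurable_indic; exact: measurable_ann.
Qed.

Lemma trunc_inR D r L L' f : D <= r -> L <= L' -> inR (trunc D L' f) -> inR (trunc r L f).
Proof.
move=> Dr LL fi; rewrite (_ : trunc r L f = fun z => trunc D L' f z * \1_(ann r L) z).
  by apply: inR_pairing => //; apply: bm_indic; exact: measurable_ann.
apply/funext => z; rewrite {1}/trunc indicE; case: (boolP (z \in ann r L)) => [|_]; last by rewrite !mulr0.
rewrite inE /ann/= in_itv/= => /andP[h1 h2]; rewrite !mulr1 trunc_in//.
  exact: le_lt_trans h1.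
exact: le_trans h2 LL.
Qed.
End trunc.

(** * Sets on which ln |u| concentrates *)

Section concentration.
Context {R : realType}.
Local Notation RR := (plane R).
Variables (u1 u2 : R * R -> R) (rho : R).
Hypotheses (mu1 : mplane u1) (mu2' : mplane u2).
Hypothesis ub : forall z, rho < nrm z -> u1 z ^+ 2 + u2 z ^+ 2 <= 1.

(** The integrals of Lam_e over V are unbounded below as e varies in (0, 1], the regularized form of
    ln |u| having integral -oo on V. *)
Definition conc (V : set RR) := forall K : R, exists2 e, 0 < e <= 1 &
  \int[mu2]_z (\1_V z * Lam e (u1 z) (u2 z)) <= - K.

Definition good (V : set RR) := [/\ measurable V, exists M, V `<=` cbox M &
  forall z, V z -> rho < nrm z].

Lemma Lam_le1 e a b : 0 < e -> e <= 1 -> a ^+ 2 + b ^+ 2 <= 1 :> R -> Lam e a b <= 1.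
Proof.
move=> e0 e1 ab; rewrite /Lam ler_pdivrMr// mul1r.
apply: (le_trans (ln_le_sub1 (qq_gt0 e0 a b))); rewrite /qq; lra.
Qed.

Lemma good_inR V e : good V -> 0 < e -> e <= 1 ->
  inR (fun z => \1_V z * Lam e (u1 z) (u2 z)) /\ inR (\1_V : R * R -> R).
Proof.
move=> [mV [M sV] rV] e0 e1.
have mi : mplane (\1_V : RR -> R) by exact: measurable_indic.
split; last exact: inR_indic mV sV.
apply: (@integrable_bbox _ _ M (1 + `|ln e / 2|)).
- apply: measurable_funM => //; apply: measurable_funM; last exact: measurable_cst.
  have mq : mplane (fun z => qq e (u1 z) (u2 z)).
    apply: measurable_funD; last exact: measurable_cst.
    by apply: measurable_funD; exact: measurable_funX.
  exact: (measurableT_comp (@measurable_ln R) mq).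
- move=> z; rewrite indicE; case: (boolP (z \in V)) => [|_]; last first.
    by rewrite mul0r normr0 addr_ge0.
  rewrite inE => /rV/ub uz; rewrite mul1r ler_norml.
  have h1 := Lam_le1 e0 e1 uz; have h2 : ln e / 2 <= Lam e (u1 z) (u2 z).
    by rewrite /Lam ler_pM2r// ler_ln ?posrE ?qq_gt0// qq_ge.
  have h3 := ler_norm (- (ln e / 2)); rewrite normrN in h3.
  have h4 := normr_ge0 (ln e / 2).
  by apply/andP; split; lra.
- by move=> z nz; rewrite indicE memNset ?mul0r// => /sV.
Qed.

(** If neither piece concentrated, the integrals over each would be bounded below uniformly in e,
    hence so would their sum. *)
Lemma conc_split (V A : set RR) : good V -> measurable A -> conc V ->
  exists V', [/\ good V', V' `<=` V, conc V' & V' `<=` A \/ V' `<=` ~` A].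
Proof.
move=> gV mA cV; apply: contrapT => nex.
have [mV [M sV] rV] := gV.
have nc (V' : set RR) : good V' -> V' `<=` V -> (V' `<=` A \/ V' `<=` ~` A) ->
    exists K : R, forall e, 0 < e <= 1 -> - K < \int[mu2]_z (\1_V' z * Lam e (u1 z) (u2 z)).
  move=> g' s' A'; apply: contrapT => h; apply: nex; exists V'; split => // K.
  apply: contrapT => h2; apply: h; exists K => e e01.
  by rewrite ltNge; apply/negP => h3; apply: h2; exists e.
have g1 : good (V `&` A).
  split; [exact: measurableI|by exists M => z [/sV]|by move=> z [/rV]].
have g2 : good (V `\` A).
  split; [exact: measurableD|by exists M => z [/sV]|by move=> z [/rV]].
have [K1 hK1] := nc _ g1 (@subIsetl _ _ _) (or_introl (@subIsetr _ _ _)).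
have [K2 hK2] := nc _ g2 (@subDsetl _ _ _) (or_intror (fun z => @proj2 _ _)).
have [e e01 he] := cV (K1 + K2).
have := e01 => /andP[e0 e1].
have [i1 _] := good_inR g1 e0 e1; have [i2 _] := good_inR g2 e0 e1.
have E : \int[mu2]_z (\1_V z * Lam e (u1 z) (u2 z)) =
   \int[mu2]_z (\1_(V `&` A) z * Lam e (u1 z) (u2 z)) +
   \int[mu2]_z (\1_(V `\` A) z * Lam e (u1 z) (u2 z)).
  rewrite -RintD//; apply: eq_Rintegral => z _; rewrite -mulrDl; congr (_ * _).
  rewrite !indicE; have [Vz|nV] := pselect (V z); last first.
    by rewrite !memNset ?addr0// => -[].
  rewrite (mem_set Vz); have [Az|nA] := pselect (A z).
    by rewrite mem_set// memNset ?addr0// => -[].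
  by rewrite memNset ?mem_set ?add0r// => -[].
by have := hK1 e e01; have := hK2 e e01; move: he; rewrite E; lra.
Qed.

Lemma conc_halve (c : R * R -> R) (V : set RR) (x l : R) : mplane c ->
  good V -> conc V -> (forall z, V z -> x <= c z <= x + l) ->
  forall n : nat, exists V' y, [/\ good V', V' `<=` V, conc V' &
    forall z, V' z -> y <= c z <= y + l / 2 ^+ n].
Proof.
move=> mc gV cV hV; elim=> [|n [V' [y [g' s' c' h']]]].
  by exists V, x; split => // z; rewrite expr0 divr1; exact: hV.
pose A : set RR := [set z | c z \in `]-oo, y + l / 2 ^+ n.+1] ].
have mA : measurable A.
  by have := mc measurableT _ (measurable_itv `]-oo, y + l / 2 ^+ n.+1]); rewrite setTI.
have [W [gW sW cW [WA|WA]]] := conc_split g' mA c'.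
  exists W, y; split => //; first exact: subset_trans s'.
  move=> z Wz; have := WA z Wz; rewrite /A/= in_itv/= => ->; rewrite andbT.
  by case/andP: (h' z (sW z Wz)).
exists W, (y + l / 2 ^+ n.+1); split => //; first exact: subset_trans s'.
move=> z Wz; have := WA z Wz; rewrite /A/= in_itv/= => /negP; rewrite -ltNge => h.
rewrite (ltW h)/=; have /andP[_ h2] := h' z (sW z Wz); apply: (le_trans h2).
rewrite -addrA lerD2l exprS le_eqVlt; apply/orP; left; apply/eqP.
by field; rewrite expf_neq0.
Qed.

(** Bisection in each coordinate until both sides are at most d / 2. The set obtained is nonempty,
    an integral over the empty set being 0. *)
Lemma conc_small (V : set RR) (d : R) : good V -> conc V -> 0 < d ->
  exists V' a, [/\ good V', V' `<=` V, conc V', V a &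
    forall z, V' z -> nrm (z :-: a) <= d].
Proof.
move=> gV cV d0; have [mV [M0 sV0] rV] := gV.
pose M := Num.max M0 0.
have sV : V `<=` cbox M.
  by move=> z /sV0; apply: cbox_sub; rewrite le_max lexx.
have M00 : 0 <= M by rewrite le_max lexx orbT.
have [n hn] : exists n : nat, 2 * M / 2 ^+ n <= d / 2.
  have : (2 * M) * (2^-1) ^+ n @[n --> \oo] --> (2 * M * 0 : R).
    apply: cvgM; first exact: cvg_cst.
    by apply: cvg_expr; rewrite ger0_norm ?invr_ge0// invf_lt1// ltr1n.
  rewrite mulr0 => /cvgrPdist_le /(_ (d / 2)); rewrite divr_gt0// => /(_ isT)[N _ /(_ N (leqnn N))].
  rewrite sub0r normrN ger0_norm; last by rewrite !mulr_ge0// exprn_ge0// invr_ge0.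
  by rewrite exprVn => h; exists N.
have m1 : mplane (fst : RR -> R) by exact: measurable_fst.
have m2 : mplane (snd : RR -> R) by exact: measurable_snd.
have b1 z : V z -> - M <= z.1 <= - M + 2 * M.
  by move=> /sV[h _]; move: h; rewrite ler_norml; lra.
have [V1 [x [g1 s1 c1 h1]]] := conc_halve m1 gV cV b1 n.
have b2 z : V1 z -> - M <= z.2 <= - M + 2 * M.
  by move=> /s1/sV[_ h]; move: h; rewrite ler_norml; lra.
have [V2 [y [g2 s2 c2 h2]]] := conc_halve m2 g1 c1 b2 n.
have [a Va] : exists a, V2 a.
  apply: contrapT => ne; have [e _] := c2 1.
  rewrite (_ : (fun z => _) = fun=> 0).
    by rewrite /Rintegral integral0/=; lra.
  by apply/funext => z; rewrite indicE memNset ?mul0r// => h; apply: ne; exists z.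
exists V2, a; split => //; [exact: subset_trans s1|by apply/s1/s2|].
move=> z Vz; apply: (le_trans (nrm_le_sum _)) => /=.
have p1 := h1 _ (s2 _ Vz); have p2 := h2 _ Vz.
have q1 := h1 _ (s2 _ Va); have q2 := h2 _ Va.
have e1 : `|z.1 - a.1| <= d / 2 by rewrite ler_norml; move: p1 q1 hn; lra.
have e2 : `|z.2 - a.2| <= d / 2 by rewrite ler_norml; move: p2 q2 hn; lra.
by move: e1 e2; lra.
Qed.

(** Where u = 0, Lam_e is the constant ln e / 2, which tends to -oo: vanishing on a disc is a source
    of concentration for the next disc. *)
Lemma conc_zero (a : R * R) (r : R) : 0 < r -> rho + r < nrm a ->
  {ae mu2, forall z : R * R, nrm (z :-: a) <= r -> u1 z ^+ 2 + u2 z ^+ 2 = 0} ->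
  let V := [set z : R * R | nrm (z :-: a) <= r] in good V /\ conc V.
Proof.
move=> r0 ra uz V.
have mV : measurable V.
  have mn : mplane (fun z : R * R => nrm (z :-: a)).
    exact: (measurableT_comp (@measurable_nrm R) (measurable_sub_pt a)).
  have := mn measurableT _ (measurable_itv `]-oo, r]); rewrite setTI.
  by rewrite (_ : V = [set z : R * R | nrm (z :-: a) \in `]-oo, r] ]).
have gV : good V.
  split=> //.
    exists (nrm a + r) => z Vz; apply: nrm_cbox; apply: (le_trans (nrm_sub_le z a)).
    by rewrite lerD2l.
  move=> z Vz; have := nrm_sub_le a z; rewrite nrm_subC; move: ra Vz; rewrite /V/=; lra.
split=> // K.
have [_ Vi] := good_inR gV ltr01 (lexx _).
pose A := \int[mu2]_z (\1_V z : R).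
have A0 : 0 < A.
  have ii := inR_cbox (R := R) (r / 2).
  have [ci cE] := inR_shift (- a.1, - a.2) ii.
  apply: (@lt_le_trans _ _ (4 * (r / 2) ^+ 2)); first by rewrite mulr_gt0// exprn_gt0// divr_gt0.
  rewrite -Rint_indic_cbox; last by rewrite divr_ge0// ltW.
  rewrite -cE; apply: Rint_le => // z; rewrite !indicE; case: (boolP (_ \in cbox _)) => [|_]; last by case: (_ \in _).
  rewrite inE => -[/= z1 z2]; rewrite mem_set// /V/=; apply: (le_trans (nrm_le_sum _)) => /=.
  by move: z1 z2; lra.
have h e : 0 < e -> e <= 1 -> \int[mu2]_z (\1_V z * Lam e (u1 z) (u2 z)) = ln e / 2 * A.
  move=> e0 e1; rewrite /A -RintZ// /Rintegral; congr fine.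
  have [i1 _] := good_inR gV e0 e1.
  apply: ae_eq_integral => //.
  - by apply/measurable_EFinP; exact: inR_meas.
  - by apply/measurable_EFinP; apply: inR_meas; exact: inRZ.
  apply: ae_imply uz => z uz _; congr EFin; rewrite indicE.
  case: (boolP (z \in V)) => [|_]; last by rewrite mul0r mulr0.
  by rewrite inE => /uz uu; rewrite mul1r mulr1 /Lam /qq uu add0r.
pose e := expR (- (2 * `|K| / A)).
have e01 : 0 < e <= 1.
  by rewrite expR_gt0/= -expR0 ler_expR oppr_le0 divr_ge0 ?mulr_ge0 ?(ltW A0).
exists e => //; have /andP[e0 e1] := e01; rewrite h// expRK.
rewrite (_ : _ / 2 * A = - `|K|); last by field; rewrite gt_eqF.
by rewrite lerN2 ler_norm.
Qed.

End concentration.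

(** * Reaching every direction around the origin *)

Section spiral.
Context {R : realType}.

Definition mul22 (z : R * R) : R * R := (2 * z.1 - 2 * z.2, 2 * z.1 + 2 * z.2).

(** Multiplication by 2 + 2i moves a by sqrt 5 |a| < 9/4 |a| and stretches it by 2 sqrt 2 > 14/5.
    The difference of these factors exceeds 1/2, so the disc about the image that reaches back to a
    stays away from the origin. *)
Lemma mul22_far (a : R * R) (q : R) : 2 * q <= nrm a -> 0 <= q ->
  nrm ((mul22 a).1 - a.1, (mul22 a).2 - a.2) + q <= nrm (mul22 a) /\ nrm a <= nrm (mul22 a).
Proof.
move=> qa q0; have n0 := nrm_ge0 a; have n2 := nrm_sq a.
have h1 : nrm ((mul22 a).1 - a.1, (mul22 a).2 - a.2) <= 9 / 4 * nrm a.
  rewrite nrm_le; last by rewrite mulr_ge0.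
  rewrite exprMn n2 /sqn/=.
  rewrite (_ : _ + _ = 5 * (a.1 ^+ 2 + a.2 ^+ 2)); last ring.
  have h5 : 0 <= a.1 ^+ 2 + a.2 ^+ 2 by rewrite addr_ge0 ?sqr_ge0.
  lra.
have h2 : 14 / 5 * nrm a <= nrm (mul22 a).
  rewrite nrm_ge; last by rewrite mulr_ge0.
  rewrite exprMn n2 /sqn/=.
  rewrite (_ : (_ - _) ^+ 2 + _ = 8 * (a.1 ^+ 2 + a.2 ^+ 2)); last ring.
  have h5 : 0 <= a.1 ^+ 2 + a.2 ^+ 2 by rewrite addr_ge0 ?sqr_ge0.
  lra.
by split; lra.
Qed.

(** When b is at least twice as far as a and the angle between them is at most 60 degrees, |b - a|
    falls short of |b| by at least |a| / 10. *)
Lemma far_dot (a b : R * R) (q : R) : 10 * q <= nrm a -> 0 <= q -> 2 * nrm a <= nrm b ->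
  nrm a * nrm b <= 2 * (a.1 * b.1 + a.2 * b.2) -> nrm (b :-: a) + q <= nrm b.
Proof.
move=> qa q0 ab dot; have na := nrm_ge0 a; have nb := nrm_ge0 b.
have a2 := nrm_sq a; have b2 := nrm_sq b.
rewrite -lerBrDr nrm_le; last lra.
have -> : sqn (b :-: a) = sqn b - 2 * (a.1 * b.1 + a.2 * b.2) + sqn a.
  by rewrite /sqn/=; ring.
rewrite -a2 -b2; move: dot; move: (nrm a) (nrm b) na nb qa ab => x y na nb qa ab; nra.
Qed.

Lemma iter2_mul22 (n : nat) (a : R * R) : iter n.+2 mul22 a =
  (- (8 * (iter n mul22 a).2), 8 * (iter n mul22 a).1).
Proof. by rewrite /= /mul22/=; congr pair; ring. Qed.

Lemma nrmZ (c : R) (a : R * R) : 0 <= c -> nrm (c * a.1, c * a.2) = c * nrm a.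
Proof.
move=> c0; rewrite /nrm (_ : sqn _ = c ^+ 2 * sqn a); last by rewrite /sqn/=; ring.
by rewrite sqrtrM ?sqr_ge0// sqrtr_sqr ger0_norm.
Qed.

Lemma nrm_rot (a : R * R) : nrm (- a.2, a.1) = nrm a.
Proof. by rewrite /nrm; congr Num.sqrt; rewrite /sqn/=; ring. Qed.

Lemma nrmN (a : R * R) : nrm (- a.1, - a.2) = nrm a.
Proof. by rewrite /nrm; congr Num.sqrt; rewrite /sqn/=; ring. Qed.

Lemma scaled_dot (c C : R) (d a b : R * R) : 0 <= c -> c <= C -> nrm d = nrm a ->
  nrm a * nrm b <= 2 * (d.1 * b.1 + d.2 * b.2) ->
  nrm (c * d.1, c * d.2) <= C * nrm a /\
  nrm (c * d.1, c * d.2) * nrm b <= 2 * (c * d.1 * b.1 + c * d.2 * b.2).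
Proof.
move=> c0 cC da h; rewrite nrmZ// da; split; first by rewrite ler_wpM2r// nrm_ge0.
rewrite (_ : 2 * _ = c * (2 * (d.1 * b.1 + d.2 * b.2))); last ring.
by rewrite -mulrA ler_wpM2l.
Qed.

(* Multiplication by 2 + 2i turns by an eighth of a turn, so that some iterate
   points in a direction close to that of [b]. *)
Lemma iter_mul22_dot (a b : R * R) : exists n, [/\ (0 < n)%N,
  nrm (iter n mul22 a) <= 8 ^+ 4 * nrm a &
  nrm (iter n mul22 a) * nrm b <= 2 * ((iter n mul22 a).1 * b.1 + (iter n mul22 a).2 * b.2)].
Proof.
have c0 k : 0 <= 8 ^+ k :> R by exact: exprn_ge0.
have cC k : (k <= 4)%N -> 8 ^+ k <= 8 ^+ 4 :> R by move=> k4; rewrite ler_weXn2l// ler1n.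
have e2 : iter 2 mul22 a = (8 ^+ 1 * - a.2, 8 ^+ 1 * a.1) by rewrite iter2_mul22 /= expr1 mulrN.
have e4 : iter 4 mul22 a = (8 ^+ 2 * - a.1, 8 ^+ 2 * - a.2).
  by rewrite iter2_mul22 e2/=; congr pair; ring.
have e6 : iter 6 mul22 a = (8 ^+ 3 * - - a.2, 8 ^+ 3 * - a.1).
  by rewrite iter2_mul22 e4/=; congr pair; ring.
have e8 : iter 8 mul22 a = (8 ^+ 4 * a.1, 8 ^+ 4 * a.2).
  by rewrite iter2_mul22 e6/=; congr pair; ring.
(* The iterates of even order 2, 4, 6, 8 are a turned by the four quarter turns. As al^2 + be^2 =
   |a|^2 |b|^2, one of the four scalar products is at least half of |a| |b|. *)
pose al := a.1 * b.1 + a.2 * b.2; pose be := - a.2 * b.1 + a.1 * b.2.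
have ab : al ^+ 2 + be ^+ 2 = (nrm a * nrm b) ^+ 2.
  by rewrite exprMn !nrm_sq /sqn /al /be; ring.
have nab : 0 <= nrm a * nrm b by rewrite mulr_ge0 ?nrm_ge0.
have [h|h] := leP (nrm a * nrm b) (2 * al).
  have [k1 k2] := scaled_dot (c0 4) (cC 4 isT) (erefl (nrm a)) h.
  by exists 8; rewrite e8.
have [h'|h'] := leP (nrm a * nrm b) (2 * - al).
  have dE : 2 * - al = 2 * ((- a.1, - a.2).1 * b.1 + (- a.1, - a.2).2 * b.2).
    by rewrite /al/=; ring.
  rewrite dE in h'; have [k1 k2] := scaled_dot (c0 2) (cC 2 isT) (nrmN a) h'.
  by exists 4; rewrite e4.
have [g|g] := leP (nrm a * nrm b) (2 * be).
  have [k1 k2] := @scaled_dot _ _ (- a.2, a.1) a b (c0 1) (cC 1 isT) (nrm_rot a) g.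
  by exists 2; rewrite e2.
have [g'|g'] := leP (nrm a * nrm b) (2 * - be).
  have ee : nrm (- - a.2, - a.1) = nrm a by rewrite (nrmN (- a.2, a.1)) nrm_rot.
  have dE : 2 * - be = 2 * ((- - a.2, - a.1).1 * b.1 + (- - a.2, - a.1).2 * b.2).
    by rewrite /be/=; ring.
  rewrite dE in g'; have [k1 k2] := scaled_dot (c0 3) (cC 3 isT) ee g'.
  by exists 6; rewrite e6.
exfalso; move: ab nab h h' g g'; move: (nrm a * nrm b) => x ab x0 h h' g g'.
have k1 : al ^+ 2 <= (x / 2) ^+ 2.
  by rewrite -(real_normK (num_real al)) ler_sqr ?nnegrE ?divr_ge0// ler_norml; lra.
have k2 : be ^+ 2 <= (x / 2) ^+ 2.
  by rewrite -(real_normK (num_real be)) ler_sqr ?nnegrE ?divr_ge0// ler_norml; lra.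
have x1 : 0 < x by lra.
have := exprn_gt0 2 x1; move: ab k1 k2; rewrite exprMn; lra.
Qed.

End spiral.

(** * The theorem in one variable *)

Section slice.
Context {R : realType}.
Local Notation RR := (plane R).
Variables (u1 u2 h1 h2 : R * R -> R) (eta : nat -> R -> R) (D M rho : R).
Variables (phi Phi : R -> R) (R0 C1 dl : R).
Hypothesis etab : forall k, bump (k.+1%:R^-1) (eta k).
Hypotheses (mu1 : mplane u1) (mu2' : mplane u2).
Hypotheses (mh1 : mplane h1) (mh2 : mplane h2).
Hypothesis iu : forall L, [/\ inR (trunc D L u1), inR (trunc D L u2), inR (trunc D L h1) & inR (trunc D L h2)].
Hypotheses (D0 : 0 <= D) (M0 : 0 <= M) (R00 : 0 < R0) (C10 : 0 <= C1) (dl0 : 0 < dl).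
Hypothesis hM : forall z, D < nrm z -> `|h1 z| + `|h2 z| <= M * (`|u1 z| + `|u2 z|).
Hypothesis hme : forall k z, D + 2 / k.+1%:R < nrm z -> moll_eq (eta k) u1 u2 h1 h2 z.
Hypothesis phi0 : forall s, R0 <= s -> 0 <= phi s.
Hypothesis phim : forall s t, R0 <= s -> s <= t -> phi t <= phi s.
Hypothesis Phi0 : forall t, t <= R0 -> Phi t = 0.
Hypothesis Phi_bounds : forall s t, R0 <= s -> s <= t ->
  (t - s) * phi t <= Phi t - Phi s <= (t - s) * phi s.
Hypothesis Phi_lim : forall A : R, exists r0 : R, forall r, r0 <= r -> A * ln r <= Phi r.
Hypothesis hrho : forall z, rho <= nrm z ->
  h1 z ^+ 2 + h2 z ^+ 2 <= (C1 * phi (nrm z)) ^+ 2 * (u1 z ^+ 2 + u2 z ^+ 2) /\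
  u1 z ^+ 2 + u2 z ^+ 2 <= expR (- (2 * ((C1 + dl) * Phi (nrm z)))).

Let rho1 : R := Num.max rho (Num.max (R0 + 1) (D + 1)).
Let rho_le : rho <= rho1. Proof. by rewrite le_max lexx. Qed.
Let R0_le : R0 + 1 <= rho1. Proof. by rewrite !le_max lexx !orbT. Qed.
Let D_le : D + 1 <= rho1. Proof. by rewrite !le_max lexx !orbT. Qed.

Let Phi_m := Phi_mono phi0 Phi0 Phi_bounds.
Let Phi_p s : 0 <= Phi s.
Proof. by have [h|/ltW h] := leP s R0; [rewrite Phi0|rewrite -(Phi0 (lexx R0)) Phi_m]. Qed.

Let u_le1 z : rho1 < nrm z -> u1 z ^+ 2 + u2 z ^+ 2 <= 1.
Proof.
move=> h; have [_ hu] := hrho (le_trans rho_le (ltW h)); apply: (le_trans hu).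
by rewrite -expR0 ler_expR oppr_le0 !mulr_ge0// addr_ge0// ltW.
Qed.

Let m : R := C1 * phi R0.
Let m0 : 0 <= m. Proof. by rewrite mulr_ge0// phi0. Qed.

Let h_le z : rho1 < nrm z -> h1 z ^+ 2 + h2 z ^+ 2 <= m ^+ 2 * (u1 z ^+ 2 + u2 z ^+ 2).
Proof.
move=> h; have [hh _] := hrho (le_trans rho_le (ltW h)); apply: (le_trans hh).
have Rz : R0 <= nrm z by move: R0_le h; lra.
rewrite ler_wpM2r ?addr_ge0 ?sqr_ge0// ler_sqr ?nnegrE ?mulr_ge0 ?phi0//.
by rewrite ler_wpM2l// phim.
Qed.

Section one_trunc.
Variable L : R.
Let v1 := trunc rho1 L u1. Let v2 := trunc rho1 L u2.
Let g1 := trunc rho1 L h1. Let g2 := trunc rho1 L h2.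

Lemma trunc_data : [/\ inR v1, inR v2, inR g1 & inR g2] /\
  [/\ forall z, `|v1 z| <= 1, forall z, `|v2 z| <= 1, forall z, `|g1 z| <= m & forall z, `|g2 z| <= m].
Proof.
have Dr : D <= rho1 by move: D_le; lra.
split; first by have [a b c d] := iu L; split; exact: (trunc_inR Dr (lexx L)).
have sq (x y b : R) : 0 <= b -> x ^+ 2 + y ^+ 2 <= b ^+ 2 -> `|x| <= b /\ `|y| <= b.
  move=> b0 xy; split; rewrite -ler_sqr ?nnegrE// real_normK ?num_real//; apply: le_trans xy.
    by rewrite lerDl sqr_ge0.
  by rewrite lerDr sqr_ge0.
have uu z : `|v1 z| <= 1 /\ `|v2 z| <= 1.
  have [h|h] := pselect (rho1 < nrm z /\ nrm z <= L); last first.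
    by rewrite /v1 /v2 !trunc_out// normr0.
  by case: h => h h'; rewrite /v1 /v2 !trunc_in//; apply: sq => //; rewrite expr1n u_le1.
have gg z : `|g1 z| <= m /\ `|g2 z| <= m.
  have [h|h] := pselect (rho1 < nrm z /\ nrm z <= L); last first.
    by rewrite /g1 /g2 !trunc_out// normr0.
  case: h => h h'; rewrite /g1 /g2 !trunc_in//; apply: sq => //.
  by apply: (le_trans (h_le h)); rewrite ler_piMr ?sqr_ge0// u_le1.
by split=> z; [case: (uu z)|case: (uu z)|case: (gg z)|case: (gg z)].
Qed.

(** For k >= 2 the mollifier at z reaches a distance at most 2 / (k + 1) < 1, so one unit inside the
    annulus the truncation goes unnoticed. *)
Lemma trunc_me k z : (2 <= k)%N -> rho1 + 1 <= nrm z -> nrm z <= L - 1 ->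
  moll_eq (eta k) v1 v2 g1 g2 z.
Proof.
move=> k2 z1 z2.
have d1 : 2 * k.+1%:R^-1 < 1 :> R.
  by rewrite ltr_pdivrMr// mul1r ltr_nat.
apply: (moll_eq_ae (etab k) (u1 := u1) (u2 := u2) (h1 := h1) (h2 := h2)) => //.
- by split; exact: trunc_meas.
- apply: aeW => xi x1 x2; have := nrm_box x1 x2; move: d1; move: (k.+1%:R^-1 : R) => t d1 /andP[y1 y2].
  have a1 : rho1 < nrm xi by move: z1 y1 d1; lra.
  have a2 : nrm xi <= L by move: z2 y2 d1; lra.
  by rewrite /v1 /v2 /g1 /g2 !trunc_in.
- by apply: hme; move: z1 d1 D_le; move: (k.+1%:R^-1 : R) => t; lra.
Qed.

End one_trunc.

Let Z (b : R * R) := {ae mu2, forall z : R * R, nrm (z :-: b) <= 1 ->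
  u1 z ^+ 2 + u2 z ^+ 2 = 0}.

(** The disc about b with radius s = |b - a| + q + 2 contains the concentration set with a margin 2,
    and enlarged by 1 it still avoids the disc of radius rho1 + 1: [local_uc] applies with r = 1. *)
Lemma chainV (V : set RR) (a b : R * R) (q : R) : good rho1 V -> conc u1 u2 V -> 0 < q ->
  (forall z, V z -> nrm (z :-: a) <= q) ->
  nrm (b :-: a) + (q + 5 + rho1) <= nrm b -> Z b.
Proof.
move=> [mV [MV sV] rV] cV q0 hV hb.
pose s := nrm (b :-: a) + q + 2.
pose L := nrm b + s + 3.
have n0 := nrm_ge0 (b :-: a).
have [[i1 i2 i3 i4] [b1 b2 b3 b4]] := trunc_data L.
have s1 : 2 * 1 < s by rewrite /s; move: n0 q0; lra.
have VL z : V z -> nrm z <= L.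
  move=> Vz; have := nrm_sub_le z a; have := nrm_sub_le a b; rewrite (nrm_subC a b).
  by have := hV z Vz; rewrite /L /s; move: n0; lra.
have := @local_uc R _ _ _ _ eta m m i1 i2 i3 i4 etab b1 b2 b3 b4 m0 b s 1 MV V 2 ltr01 s1 mV sV.
case.
- move=> z zb.
  have := nrm_sub_le z b; have := nrm_sub_le b z; rewrite (nrm_subC b z) => e1 e2.
  have z1 : rho1 + 1 <= nrm z by move: hb zb e1; rewrite /s; lra.
  have z2 : nrm z <= L - 1 by move: zb e2; rewrite /L; lra.
  split; last by move=> k k2; exact: trunc_me.
  have z3 : rho1 < nrm z by move: z1; lra.
  have z4 : nrm z <= L by move: z2; lra.
  by rewrite !trunc_in// h_le.
- move=> z Vz; have := nrmD (z :-: a) (a :-: b).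
  rewrite /= !addrA !subrK => /le_trans; apply.
  by rewrite (nrm_subC a b) /s; have := hV z Vz; lra.
- move=> K; have [e e01 he] := cV K; exists e => //.
  apply: le_trans he; rewrite le_eqVlt; apply/orP; left; apply/eqP.
  apply: eq_Rintegral => z _; rewrite indicE; case: (boolP (z \in V)) => [|_]; last by rewrite !mul0r.
  rewrite inE => Vz; have y1 := rV z Vz; have y2 := VL z Vz; by rewrite !trunc_in.
move=> N [mN N0 sN]; exists N; split => // z /= hz; apply: sN => /= h; apply: hz => zb.
have := h zb; have := nrm_sub_le z b; have := nrm_sub_le b z; rewrite (nrm_subC b z) => e1 e2.
have z1 : rho1 < nrm z by move: hb zb e1; move: n0 q0; lra.
have z2 : nrm z <= L by move: zb e2; rewrite /L; move: s1; lra.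
by rewrite !trunc_in.
Qed.

Lemma chainZ (a b : R * R) : Z a -> rho1 + 1 < nrm a ->
  nrm (b :-: a) + (6 + rho1) <= nrm b -> Z b.
Proof.
move=> Za ra hb.
have [gV cV] := conc_zero mu1 mu2' u_le1 ltr01 ra Za.
by apply: (@chainV _ a b 1 gV cV ltr01).
Qed.

(** The inner scale a is fixed and c tends to infinity: lam decreases like 4 / c, but Phi / ln -> oo
    makes lam Phi(e^c - 1) unbounded, while the other terms of [star_ring] depend on a only. *)
Lemma ring_conc (Q : R) : exists V, [/\ good rho1 V, conc u1 u2 V & forall z, V z -> Q <= nrm z].
Proof.
have [Psi [Psi' [dP cP P0 Pb PB]]] := Psi_exists phi0 Phi0 Phi_bounds.
pose W := rho1 + 2 + `|Q| + 1.
have r10 : 0 < rho1 by move: R0_le R00; lra.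
have W1 : 1 <= W by rewrite /W; have := normr_ge0 Q; move: r10; lra.
have W0 : 0 < W by exact: lt_le_trans ltr01 W1.
pose a := ln W; have a0 : 0 <= a by rewrite ln_ge0.
have ea : expR a = W by rewrite lnK.
have aR : R0 + 1 <= expR a by rewrite ea /W; have := normr_ge0 Q; move: R0_le; lra.
have a4 : 0 <= a + 4 by rewrite addr_ge0.
pose P1 := phi R0; have P10 : 0 <= P1 by exact: phi0.
pose V : set RR := [set z | nrm z \in `[expR (a + 4), expR (a + 6)] ].
have Va z : V z -> W <= nrm z.
  by rewrite /V/= in_itv/= => /andP[h _]; rewrite -ea (le_trans _ h)// ler_expR lerDl.
have gV : good rho1 V.
  split; first exact: measurable_nrm_itv.
    by exists (expR (a + 6)) => z; rewrite /V/= in_itv/= => /andP[_ h]; exact: nrm_cbox.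
  move=> z /Va; apply: lt_le_trans; rewrite /W; have := normr_ge0 Q; lra.
exists V; split => //; last first.
  by move=> z /Va; apply: le_trans; rewrite /W; have := ler_norm Q; move: r10; lra.
have K0E : 0 <= 4 * expR (a + 2) ^+ 2 + 16 * C1 * P1 * expR (a + 6) ^+ 2.
  by rewrite addr_ge0 ?mulr_ge0 ?sqr_ge0.
have [K0 K0d] : exists K0 : R, K0 = 4 * expR (a + 2) ^+ 2 + 16 * C1 * P1 * expR (a + 6) ^+ 2 by eexists.
rewrite -K0d in K0E.
have main (K : R) : 0 <= K -> exists2 e, 0 < e <= 1 &
    \int[mu2]_z (rw (a + 4) z * Lam e (u1 z) (u2 z)) <= - K.
  move=> Kp.
  (* The slope for which Phi >= A ln turns the outer term into less than -(K0 + 1 + 2 K); the factor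
     2 in 2 K compensates 1 + lam <= 2. *)
  pose A := (K0 + 2 + 2 * K) / dl.
  have K02 : 0 <= K0 + 2 + 2 * K by move: K0E Kp; lra.
  have A0 : 0 <= A by rewrite divr_ge0 ?(ltW dl0).
  have [r0 hr0] := Phi_lim A.
  pose c := Num.max (a + 8) (Num.max 2 (ln (Num.max r0 1 + 1))).
  have ac : a + 8 <= c by rewrite le_max lexx.
  have c2 : 2 <= c by rewrite !le_max lexx orbT.
  have c3 : r0 <= expR c - 1.
    have w0 : 0 < Num.max r0 1 + 1 by rewrite ltr_wpDl// le_max ler01 orbT.
    rewrite lerBrDr; apply: (@le_trans _ _ (Num.max r0 1 + 1)); first by rewrite lerD2r le_max lexx.
    by rewrite -ler_ln ?posrE ?expR_gt0// expRK !le_max lexx !orbT.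
  have lc : c - 1 <= ln (expR c - 1).
    have e1 : 2 <= expR 1 :> R by have := @expR_ge1Dx R 1; lra.
    have e2 : 2 * expR (c - 1) <= expR c.
      have -> : expR c = expR 1 * expR (c - 1) by rewrite -expRD; congr expR; ring.
      by rewrite ler_wpM2r ?expR_ge0.
    have e3 : 1 <= expR (c - 1).
      apply: (@le_trans _ _ (expR 0)); first by rewrite expR0.
      by rewrite ler_expR; move: c2; lra.
    rewrite -ler_expR lnK ?posrE; last by move: e2 e3; lra.
    by move: e2 e3; lra.
  have PA : A * (c - 1) <= Phi (expR c - 1).
    by apply: le_trans (hr0 _ c3); rewrite ler_wpM2l.
  have dA : dl * A = K0 + 2 + 2 * K by rewrite /A mulrC divfK// gt_eqF.
  have dP1 : (K0 + 2 + 2 * K) * (c - 1) <= dl * Phi (expR c - 1).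
    by rewrite -dA -mulrA ler_wpM2l// ltW.
  have cl : 1 <= dl * Phi (expR c - 1).
    apply: le_trans dP1; have : 1 * 1 <= (K0 + 2 + 2 * K) * (c - 1) by apply: ler_pM => //; move: K0E Kp c2; lra.
    by rewrite mulr1.
  pose L := expR (c + 2) + 2.
  have [[i1 i2 i3 i4] [b1 b2 b3 b4]] := trunc_data L.
  have ina z : expR a <= nrm z -> nrm z <= L -> rho1 < nrm z /\ nrm z <= L.
    move=> h1' ->; split => //; apply: lt_le_trans h1'; rewrite ea /W.
    by have := normr_ge0 Q; lra.
  have Pb' s : R0 + 1 <= s -> 0 <= Psi' s <= P1.
    move=> sR; have /andP[p1 ->] := Pb s sR; rewrite andbT (le_trans _ p1)// phi0//.
    by move: sR; lra.
  have := @star_ring R _ _ _ _ eta m i1 i2 i3 i4 etab b1 b2 b3 b4 Phi Psi Psi' R0 P1 C1 dl a c 2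
    R00 P10 C10 dl0 a0 ac aR dP cP P0 Pb' PB Phi_m Phi_p.
  case.
  - move=> z z1 z2; have zL : nrm z <= L by rewrite (le_trans z2)// lerDl.
    have [y1 y2] := ina z z1 zL; rewrite !trunc_in//.
    have [hh hu] := hrho (le_trans rho_le (ltW y1)).
    split => //; last first.
      move=> k k2; apply: trunc_me => //.
        by apply: le_trans z1; rewrite ea /W; have := normr_ge0 Q; lra.
      by apply: (le_trans z2); rewrite /L; lra.
    apply: (le_trans hh); have zR := le_trans aR z1.
    have zR0 : R0 <= nrm z by move: zR; lra.
    have /andP[p1 _] := Pb _ zR; have /andP[p2 _] := Pb' _ zR.
    rewrite ler_wpM2r ?addr_ge0 ?sqr_ge0// ler_sqr ?nnegrE ?mulr_ge0 ?phi0//.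
    by rewrite ler_wpM2l.
  - exact: cl.
  move=> e e01 he; exists e => //.
  have EQ : \int[mu2]_z (rw (a + 4) z * Lam e (trunc rho1 L u1 z) (trunc rho1 L u2 z)) =
     \int[mu2]_z (rw (a + 4) z * Lam e (u1 z) (u2 z)).
    apply: eq_Rintegral => z _; have [->|w0] := eqVneq (rw (a + 4) z) 0; first by rewrite !mul0r.
    have /andP[z1 z2] := rw_supp a4 w0.
    have zL : nrm z <= L.
      rewrite (le_trans (ltW z2))// /L; apply: (@le_trans _ _ (expR (c + 2))); last by rewrite lerDl.
      by rewrite ler_expR; move: ac; lra.
    have za : expR a <= nrm z by rewrite (le_trans _ (ltW z1))// ler_expR lerDl.
    by have [y1 y2] := ina z za zL; rewrite !trunc_in.
  rewrite EQ -K0d in he; move: he.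
  have /andP[l0 l1] := lam01 ac; set X := \int[mu2]_z _.
  have lE : lam a c / 2 * (1 - dl * Phi (expR c - 1)) <= - (K0 + 1 + 2 * K).
    have c4 : 0 < c - a - 4 by move: ac; lra.
    rewrite /lam (_ : _ * _ = - ((2 * (dl * Phi (expR c - 1) - 1)) / (c - a - 4))); last first.
      by field; rewrite gt_eqF.
    rewrite lerN2 ler_pdivlMr//.
    apply: (@le_trans _ _ ((K0 + 1 + 2 * K) * c)).
      rewrite ler_wpM2l ?addr_ge0 ?mulr_ge0//; move: a0; lra.
    have : (K0 + 2 + 2 * K) * (c - 1) * 2 = (K0 + 2 + 2 * K) * c + (K0 + 2 + 2 * K) * (c - 2) by ring.
    have : 0 <= (K0 + 2 + 2 * K) * (c - 2) by apply: mulr_ge0 => //; rewrite subr_ge0.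
    have : (K0 + 2 + 2 * K) * c = (K0 + 1 + 2 * K) * c + c by ring.
    move: dP1 c2; move: ((K0 + 2 + 2 * K) * (c - 1)) ((K0 + 2 + 2 * K) * (c - 2)) ((K0 + 2 + 2 * K) * c) ((K0 + 1 + 2 * K) * c) (dl * Phi (expR c - 1)) => x1 x2 x3 x4 x5; lra.
  move=> he; have {he lE} h3 : (1 + lam a c) * X <= - (2 * K) by move: he lE; lra.
  rewrite leNgt; apply/negP => XK.
  have : (1 + lam a c) * - K < (1 + lam a c) * X by rewrite ltr_pM2l// addr_gt0.
  have : lam a c * K <= 1 * K by rewrite ler_wpM2r.
  move: h3; rewrite mulrN !mulrDl !mul1r; move: (lam a c * K) (lam a c * X) => x y; lra.
(* From the ring weight to the indicator of V: Lam_e <= 1 and the weight is at most 1 on V, so the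
   exchange costs at most the area of V. *)
move=> K; pose Ar := \int[mu2]_z (\1_V z : R).
have Ar0 : 0 <= Ar by apply: Rint_ge0.
have [e e01 he] := main (`|K| + Ar) (addr_ge0 (normr_ge0 _) Ar0).
exists e => //; have /andP[e0 e1] := e01.
have [i1 i2] := good_inR mu1 mu2' u_le1 gV e0 e1.
have rV z : rw (a + 4) z != 0 -> V z.
  move=> w; have /andP[h1' h2'] := rw_supp a4 w; rewrite /V/= in_itv/= (ltW h1')/=.
  by rewrite (le_trans (ltW h2'))// ler_expR; lra.
have i3 : inR (fun z => rw (a + 4) z * Lam e (u1 z) (u2 z)).
  rewrite (_ : (fun z => _) = fun z => \1_V z * Lam e (u1 z) (u2 z) * rw (a + 4) z).
    by apply: inR_pairing => //; exact: bm_rw.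
  apply/funext => z; have [->|w] := eqVneq (rw (a + 4) z) 0; first by rewrite mul0r mulr0.
  by rewrite indicE mem_set ?mul1r; [rewrite mulrC|exact: rV].
apply: (@le_trans _ _ (\int[mu2]_z (rw (a + 4) z * Lam e (u1 z) (u2 z) + \1_V z))).
  apply: Rint_le => //; first exact: inRD.
  move=> z; rewrite indicE; have /andP[w0 w1] := rw_bounds z a4.
  case: (boolP (z \in V)) => [|nV]; last first.
    have -> : rw (a + 4) z = 0.
      by apply/eqP; apply: contraNT nV => /rV; rewrite inE.
    by rewrite !mul0r addr0.
  rewrite inE => Vz; have [_ _ /(_ z Vz)/u_le1 uz] := gV.
  have l1 := Lam_le1 e0 e1 uz; rewrite mul1r (_ : true%:R = 1 :> R)//.
  have : (1 - rw (a + 4) z) * (1 - Lam e (u1 z) (u2 z)) >= 0 by rewrite mulr_ge0 ?subr_ge0.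
  by move: (Lam e (u1 z) (u2 z)) => x; rewrite mulrBl mul1r mulrBr mulr1; move: (rw (a + 4) z * x) => y; move: w0; lra.
rewrite RintD// -/Ar; move: he; have := ler_norm K; lra.
Qed.

(** A concentration set of unit size near a far point a yields vanishing near (2 + 2i) a, then near
    all its further iterates; one of these is seen from any far enough b at an angle for which
    [far_dot] applies. Unit discs with rational centres then cover the far region. *)
Lemma far_vanish : exists R2 : R, {ae mu2, forall z : RR, R2 < nrm z -> u1 z ^+ 2 + u2 z ^+ 2 = 0}.
Proof.
have r10 : 0 < rho1 by move: R0_le R00; lra.
(* The margin required by [chainZ]; the distance 10 q is the one required by [far_dot]. *)
pose q := 6 + rho1; have q0 : 0 <= q by rewrite /q; move: r10; lra.
have [V0 [g0 c0 far0]] := ring_conc (10 * q).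
have [V [a [gV sV cV Va hV]]] := conc_small mu1 mu2' u_le1 g0 c0 ltr01.
have aq : 10 * q <= nrm a by exact: far0.
have aq2 : 2 * q <= nrm a by move: aq q0; lra.
have it n : Z (iter n.+1 mul22 a) /\ nrm a <= nrm (iter n.+1 mul22 a).
  elim: n => [|n [IH1 IH2]].
    have [f1 f2] := mul22_far aq2 q0; split => //.
    apply: (chainV gV cV ltr01 hV); rewrite (_ : 1 + 5 + rho1 = q)//; rewrite /q; ring.
  have [f1 f2] := mul22_far (le_trans aq2 IH2) q0; split; last exact: le_trans IH2 f2.
  by apply: (chainZ IH1) => //; move: IH2 aq q0; rewrite /q; lra.
pose R2 := 2 * (8 ^+ 4 * nrm a); exists (R2 + 1).
have Zb (b : R * R) : R2 <= nrm b -> Z b.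
  move=> hb; have [n [n0 n1 n2]] := iter_mul22_dot a b; case: n n0 n1 n2 => // n _ n1 n2.
  have [IH1 IH2] := it n.
  apply: (chainZ IH1); first by move: IH2 aq q0; rewrite /q; lra.
  apply: far_dot => //; first exact: le_trans aq IH2.
  by apply: le_trans hb; rewrite ler_wpM2l.
pose S (n : nat) (z : RR) := forall p : rat * rat, unpickle n = Some p ->
  R2 <= nrm (ratr p.1 : R, ratr p.2 : R) ->
  nrm ((z.1 : R) - ratr p.1, (z.2 : R) - ratr p.2) <= 1 -> u1 z ^+ 2 + u2 z ^+ 2 = 0.
have hS n : {ae mu2, forall z, S n z}.
  rewrite /S; case: (unpickle n) => [p|]; last by apply: aeW => z p.
  have [h|h] := leP R2 (nrm (ratr p.1 : R, ratr p.2 : R)); last first.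
    by apply: aeW => z p' [<-]; rewrite leNgt h.
  by apply: ae_imply (Zb _ h) => z hz p' [<-] _.
have : {ae mu2, forall z, forall n, S n z} by apply/ae_foralln.
apply: ae_imply => z hz zR.
have near_rat (x : R) : exists r : rat, `|x - ratr r| <= 1 / 2.
  have lt : x - 1 / 2 < x + 1 / 2 by lra.
  have [r] := rat_in_itvoo lt; rewrite in_itv/= => /andP[r1 r2]; exists r.
  by rewrite ler_norml; lra.
have [p hp] := near_rat z.1; have [p' hp'] := near_rat z.2.
have nz : nrm ((z.1 : R) - ratr p, (z.2 : R) - ratr p') <= 1.
  by apply: (le_trans (nrm_le_sum _)) => /=; move: hp hp'; lra.
apply: (hz (pickle (p, p')) (p, p')); first by rewrite pickleK.
  by have := nrm_sub_le z (ratr p, ratr p') => /=; move: zR nz; lra.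
exact: nz.
Qed.

(** Once u vanishes far out, so does h, and the truncated functions satisfy the equation on all of
    |z| > D: [uc_inward] brings the vanishing down to radius D. *)
Lemma slice_vanish : {ae mu2, forall z : RR, D < nrm z -> u1 z = 0 /\ u2 z = 0}.
Proof.
have [R2 hR2] := far_vanish.
pose L := R2 + 1.
have z0 z : u1 z ^+ 2 + u2 z ^+ 2 = 0 -> u1 z = 0 /\ u2 z = 0.
  by move/eqP; rewrite paddr_eq0 ?sqr_ge0// !sqrf_eq0 => /andP[/eqP -> /eqP ->].
have [i1 i2 i3 i4] := iu L.
have hM' z : D < nrm z -> `|trunc D L h1 z| + `|trunc D L h2 z| <= M * (`|trunc D L u1 z| + `|trunc D L u2 z|).
  move=> Dz; have [zL|zL] := leP (nrm z) L; first by rewrite !trunc_in// hM.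
  have no : ~ (D < nrm z /\ nrm z <= L) by move=> [_]; rewrite leNgt zL.
  by rewrite !trunc_out// normr0 addr0 mulr0.
have me' k z : D + 2 / k.+1%:R < nrm z ->
    moll_eq (eta k) (trunc D L u1) (trunc D L u2) (trunc D L h1) (trunc D L h2) z.
  move=> Dz; apply: (moll_eq_ae (etab k) (u1 := u1) (u2 := u2) (h1 := h1) (h2 := h2)) => //.
  - by split; exact: trunc_meas.
  - apply: ae_imply hR2 => xi hxi x1 x2; have /andP[y1 _] := nrm_box x1 x2.
    have Dx : D < nrm xi.
      apply: lt_le_trans y1; rewrite ltrBrDr; exact: Dz.
    have [xL|xL] := leP (nrm xi) L; first by rewrite !trunc_in.
    have no : ~ (D < nrm xi /\ nrm xi <= L) by move=> [_]; rewrite leNgt xL.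
    have [e1 e2] := z0 _ (hxi (lt_trans (ltr_pwDr ltr01 (lexx R2)) xL)).
    have := hM Dx; rewrite e1 e2 normr0 addr0 mulr0 => hh.
    have h10 : h1 xi = 0.
      by apply/eqP; rewrite -normr_le0 (le_trans _ hh)// lerDl.
    have h20 : h2 xi = 0.
      by apply/eqP; rewrite -normr_le0 (le_trans _ hh)// lerDr.
    by rewrite !trunc_out// h10 h20 e1 e2.
  - exact: hme.
have hs : {ae mu2, forall z : RR, L < nrm z -> `|trunc D L u1 z| + `|trunc D L u2 z| = 0}.
  apply: aeW => z zL; have no : ~ (D < nrm z /\ nrm z <= L) by move=> [_]; rewrite leNgt zL.
  by rewrite !trunc_out// normr0 addr0.
have hu := uc_inward i1 i2 i3 i4 etab D0 M0 hM' me' hs.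
apply: ae_imply2 _ hu hR2 => z hu hz Dz.
have [zL|zL] := leP (nrm z) L; last first.
  by apply: z0; apply: hz; apply: lt_trans zL; rewrite /L ltrDl.
have := hu Dz; rewrite !trunc_in// => /eqP; rewrite paddr_eq0// !normr_eq0.
by move=> /andP[/eqP -> /eqP ->].
Qed.

End slice.

(** * The primitive of a nonincreasing function *)

Section primitive_of_nonincreasing.
Context {R : realType}.
Variables (phi : R -> R) (R0 : R).
Hypothesis phi0 : forall s, R0 <= s -> 0 < phi s.
Hypothesis phim : forall s t, R0 <= s -> s <= t -> phi t <= phi s.
Local Notation mu := (@lebesgue_measure R).
Local Notation Phi := (fun t : R => \int[mu]_(s in `[R0, t]) phi s).

Lemma nonincreasing_integrable t : mu.-integrable `[R0, t] (EFin \o phi).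
Proof.
(* Composing with max(s, R0) extends phi to a monotone function on the whole line. *)
have m : measurable_fun `[R0, t] (fun s : R => phi (Num.max s R0)).
  apply: nonincreasing_measurable => // x y xy; apply: phim.
    by rewrite le_max lexx orbT.
  by rewrite ge_max !le_max xy lexx /= orbT.
apply: measurable_bounded_integrable => //.
- by rewrite /= lebesgue_measure_itv/=; case: ifP => // _; rewrite -EFinD ltry.
- apply: eq_measurable_fun m => x; rewrite inE/= in_itv/= => /andP[h _].
  by rewrite max_l.
- exists (phi R0); split; first exact: num_real.
  move=> M hM x /=; rewrite in_itv/= => /andP[h _].
  by rewrite ger0_norm ?(ltW (phi0 h))// (le_trans _ (ltW hM))// phim.
Qed.

Lemma primitive_bounds s t : R0 <= s -> s <= t ->
  (t - s) * phi t <= Phi t - Phi s <= (t - s) * phi s.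
Proof.
move=> Rs st; have it := nonincreasing_integrable t.
have mst : mu `]s, t] = (t - s)%:E.
  rewrite lebesgue_measure_itv/=; case: ifPn => [_|]; first by rewrite EFinB.
  rewrite lte_fin -leNgt => ts; have -> : t = s by apply/eqP; rewrite eq_le ts st.
  by rewrite subrr.
have Ic (c : R) : \int[mu]_(x in `]s, t]) c = (t - s) * c.
  by rewrite Rintegral_cst// [X in fine X]mst/= mulrC.
have icst (c : R) : mu.-integrable `]s, t] (EFin \o cst c).
  apply: measurable_bounded_integrable => //; first by rewrite /= [X in (X < _)%E]mst ltry.
  by exists `|c|; split; [exact: num_real|move=> M hM x _ /=; exact: ltW].
have sub : `]s, t] `<=` `[R0, t].
  move=> x /=; rewrite !in_itv/= => /andP[h ->]; by rewrite (le_trans Rs (ltW h)).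
have ist : mu.-integrable `]s, t] (EFin \o phi) by apply: integrableS it.
rewrite Rintegral_itvB//; apply/andP; split.
  rewrite -Ic; apply: le_Rintegral => //; first exact: (icst (phi t)).
  move=> x /=; rewrite in_itv/= => /andP[h1 h2].
  by apply: phim => //; rewrite (le_trans Rs (ltW h1)).
rewrite -Ic; apply: le_Rintegral => //; first exact: (icst (phi s)).
move=> x /=; rewrite in_itv/= => /andP[h1 h2].
by apply: phim => //; exact: ltW.
Qed.

Lemma primitive_mono s t : R0 <= s -> s <= t -> Phi s <= Phi t.
Proof.
move=> Rs st; have /andP[h _] := primitive_bounds Rs st.
rewrite -subr_ge0 (le_trans _ h)// mulr_ge0 ?subr_ge0//.
by apply: ltW; apply: phi0; exact: le_trans st.
Qed.

Lemma primitive_superlog : Phi t / ln t @[t --> +oo] --> +oo ->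
  forall A, exists r0, forall t, r0 <= t -> A * ln t <= Phi t.
Proof.
move=> /cvgryPge lim A; have [M [_ hM]] := lim A.
exists (Num.max (M + 1) 2) => t; rewrite ge_max => /andP[t1 t2].
have l0 : 0 < ln t by rewrite ln_gt0// (lt_le_trans _ t2)// ltr1n.
by rewrite -ler_pdivlMr//; apply: hM; rewrite (lt_le_trans _ t1)// ltrDl.
Qed.

End primitive_of_nonincreasing.

(** * Product measures and slices *)

Lemma integrableM_bounded d (T : measurableType d) (R : realType)
    (m : {measure set T -> \bar R}) (f k : T -> R) (C : R) :
  m.-integrable setT (EFin \o f) -> measurable_fun setT k -> (forall x, `|k x| <= C) ->
  m.-integrable setT (EFin \o (fun x => f x * k x)).
Proof.
move=> fi mk kC.
have H := @integrableMl _ _ _ m setT measurableT _ k fi mk.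
rewrite (_ : EFin \o (fun x => f x * k x) = ((EFin \o f) \* (EFin \o k))%E)//; apply: H.
by exists C; split; rewrite ?num_real// => x Cx y _ /=; rewrite (le_trans (kC y))// ltW.
Qed.

Section fubini.
Context d1 d2 (T1 : measurableType d1) (T2 : measurableType d2) (R : realType).
Variable m1 : {sigma_finite_measure set T1 -> \bar R}.
Variable m2 : {sigma_finite_measure set T2 -> \bar R}.
Local Notation M := (sf_product m1 m2).

Lemma Rintegral_fubini (f : T1 * T2 -> R) : M.-integrable setT (EFin \o f) ->
  m2.-integrable setT (EFin \o (fun y => \int[m1]_x f (x, y))) /\
  \int[M]_z f z = \int[m2]_y \int[m1]_x f (x, y).
Proof.
move=> fi.
have mG := measurable_fubini_G fi; have mf := measurable_int _ fi.
have iG : m2.-integrable setT (fubini_G m1 (EFin \o f)).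
  have fin := (@integrable21ltyP _ _ _ _ _ m1 m2 _ mf).1 fi.
  apply/integrableP; split => //; apply: le_lt_trans fin.
  have ma : measurable_fun setT (abse \o (EFin \o f)) by exact: measurableT_comp.
  apply: ge0_le_integral => //; first exact: measurableT_comp.
    have a0 (z : T1 * T2) : (0 <= `|(f z)%:E|)%E by exact: abse_ge0.
    exact: (@measurable_fun_fubini_tonelli_G _ _ _ _ _ m1 _ ma a0).
  move=> y _; apply: le_abse_integral => //.
  by apply: (measurableT_comp mf); exact: measurable_pair2.
have mI : measurable_fun [set: T2] (EFin \o (fun y => \int[m1]_x f (x, y))).
  apply/measurable_EFinP.
  exact: (measurableT_comp _ mG).
have ii : m2.-integrable setT (EFin \o (fun y => \int[m1]_x f (x, y))).
  apply: le_integrable iG => // y _.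
  rewrite /fubini_G /Rintegral/=; case: (\int[m1]_x (f (x, y))%:E)%E => [s| |]//=.
    by rewrite normr0 leey.
  by rewrite normr0 leey.
split=> //; rewrite /Rintegral; congr fine.
transitivity (\int[m2]_y fubini_G m1 (EFin \o f) y)%E.
  by rewrite (integral21_prod_meas1 fi).
(* The real-valued inner integral agrees with the extended one only where the slice is integrable,
   that is almost everywhere. *)
apply: ae_eq_integral => //.
apply: ae_imply (ae_integrable2 fi) => y iy _.
by rewrite /fubini_G /= fineK//; exact: integrable_fin_num.
Qed.

(** Measurability of f allows Tonelli: the integral of |f| is computed slice by slice and
    vanishes. *)
Lemma ae_sf_product (f : T1 * T2 -> R) : measurable_fun setT f ->
  {ae m2, forall y, {ae m1, forall x, f (x, y) = 0}} -> {ae M, forall z, f z = 0}.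
Proof.
move=> mf h.
have mE : measurable_fun setT (EFin \o f) by exact/measurable_EFinP.
have [/(_ _)H _] := ae_eq_integral_abs M measurableT mE.
have : ae_eq M setT (EFin \o f) (cst 0%E).
  apply: H.
  have ma : measurable_fun setT (abse \o (EFin \o f)) by exact: measurableT_comp.
  have a0 (z : T1 * T2) : (0 <= `|(f z)%:E|)%E by exact: abse_ge0.
  have e := fubini_tonelli2 (m1 := m1) (m2 := m2) _ ma a0; rewrite [LHS]e.
  rewrite -(integral0 m2 setT); apply: ae_eq_integral => //.
    exact: (@measurable_fun_fubini_tonelli_G _ _ _ _ _ m1 _ ma a0).
  apply: ae_imply h => y hy _; rewrite /fubini_G.
  rewrite -(integral0 m1 setT); apply: ae_eq_integral => //.
    by apply: (measurableT_comp ma); exact: measurable_pair2.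
  by apply: ae_imply hy => x /= -> _; rewrite normr0.
by apply: ae_imply => z /(_ I)[].
Qed.

End fubini.

Lemma ae_pushforward d1 d2 (T1 : measurableType d1) (T2 : measurableType d2) (R : realType)
    (m : {measure set T1 -> \bar R}) (f : T1 -> T2) (g : T2 -> T1) (P : T2 -> Prop)
    (m' : {measure set T2 -> \bar R}) :
  (forall A, measurable A -> m' A = pushforward m f A) ->
  measurable_fun setT g -> cancel f g -> cancel g f ->
  {ae m, forall x, P (f x)} -> {ae m', forall y, P y}.
Proof.
move=> m'E mg fK gK [N [mN N0 hN]]; exists (g @^-1` N).
have mgN : measurable (g @^-1` N) by rewrite -[X in measurable X]setTI; exact: mg.
split => //.
- rewrite m'E// /pushforward -comp_preimage (_ : g \o f = id) //.
  by apply/funext => x /=; rewrite fK.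
- by move=> y /= nP; apply: hN => /=; rewrite gK.
Qed.

Lemma ae_of_pushforward d1 d2 (T1 : measurableType d1) (T2 : measurableType d2) (R : realType)
    (m : {measure set T1 -> \bar R}) (f : T1 -> T2) (P : T2 -> Prop)
    (m' : {measure set T2 -> \bar R}) :
  (forall A, measurable A -> m' A = pushforward m f A) ->
  measurable_fun setT f ->
  {ae m', forall y, P y} -> {ae m, forall x, P (f x)}.
Proof.
move=> m'E mf [N [mN N0 hN]]; exists (f @^-1` N); split.
- by rewrite -[X in measurable X]setTI; exact: mf.
- by rewrite -N0 m'E.
- by move=> x /= nP; exact: hN.
Qed.

(** * The fundamental lemma for product kernels *)

Section peeling.
Context {R : realType}.
Local Notation RR := (plane R).
Local Notation lam m := (tuple_measure mu2 m).

Lemma dense_zero (F : R * R -> R) (O : set (R * R)) : continuous F -> open O ->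
  (forall p : rat * rat, O (ratr p.1, ratr p.2) -> F (ratr p.1, ratr p.2) = 0) ->
  forall p, O p -> F p = 0.
Proof.
move=> cF oO h p Op; apply/eqP/negPn/negP => Fp.
have : nbhs p (O `&` [set z | F z != 0]).
  apply: filterI; first exact: open_nbhs_nbhs.
  have : nbhs (F p) [set x : R | x != 0] by apply: open_nbhs_nbhs; split => //; exact: open_neq.
  exact: (cF p).
move=> /nbhs_ballP[e /= e0 he].
have near_rat (x : R) : exists r : rat, ball x e (ratr r : R).
  have lt : x - e < x + e by lra.
  have [r] := rat_in_itvoo lt; rewrite in_itv/= => /andP[r1 r2]; exists r.
  by rewrite /ball/= ltr_norml; lra.
have [r1 h1] := near_rat p.1; have [r2 h2] := near_rat p.2.
have [X12 F12] := he (ratr r1, ratr r2) (conj h1 h2).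
by move: F12 => /=; rewrite (h (r1, r2) X12) eqxx.
Qed.

Definition sbox (c : R * R) (d : R) : set RR :=
  [set z | `|z.1 - c.1| < d /\ `|z.2 - c.2| < d].

Lemma measurable_sbox c d : measurable (sbox c d).
Proof.
rewrite (_ : sbox c d = `]c.1 - d, c.1 + d[%classic `*` `]c.2 - d, c.2 + d[%classic).
  by apply: measurableX; exact: measurable_itv.
apply/seteqP; rewrite /sbox; split=> -[x y] /=; rewrite !in_itv/= !ltr_distl.
  by move=> [-> ->].
by move=> [-> ->].
Qed.

Lemma open_sbox c d : @open (R * R)%type (sbox c d).
Proof.
rewrite (_ : sbox c d = [set z | `|z.1 - c.1| < d] `&` [set z | `|z.2 - c.2| < d])//.
by apply: openI; apply: (@open_comp _ _ _ [set x : R | x < d]); 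
  [move=> z _|exact: open_lt|move=> z _|exact: open_lt];
  apply: cvg_norm; apply: cvgB; try (exact: cvg_cst); [exact: cvg_fst|exact: cvg_snd].
Qed.

Variable eta : nat -> R -> R.
Hypothesis etab : forall k, bump (k.+1%:R^-1) (eta k).

(** An index (k, p) whose mollifier is supported in the given square. *)
Definition inner (c : R * R) (d : R) (q : nat * (R * R)) :=
  sbox c (d - q.1.+1%:R^-1) q.2.

Definition ker (q : nat * (R * R)) : R * R -> R := kxy (eta q.1) (eta q.1) q.2.

Lemma bm_ker q : bm (ker q).
Proof. by apply: bm_kxy; exact: bump_kernel1 (etab _). Qed.

(** On each slightly smaller square f is the L^1 limit of mollifications that vanish there; the
    smaller squares exhaust the open one. *)
Lemma moll_zero (f : R * R -> R) (c : R * R) (d : R) : inR f ->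
  (forall q, inner c d q -> moll f (eta q.1) (eta q.1) q.2 = 0) ->
  {ae mu2, forall z : RR, sbox c d z -> f z = 0}.
Proof.
move=> fi h.
have S j : {ae mu2, forall z : RR, sbox c (d - j.+1%:R^-1) z -> f z = 0}.
  set A := sbox c _.
  have mI : mplane (\1_A : RR -> R) by apply: measurable_indic; exact: measurable_sbox.
  have Fi : inR (fun z => `|f z| * \1_A z).
    by apply: (inR_pairing (inR_norm fi)); apply: bm_indic; exact: measurable_sbox.
  have F0 (z : R * R) : 0 <= `|f z| * \1_A z by rewrite mulr_ge0.
  have : {ae mu2, forall z : RR, `|f z| * \1_A z = 0}.
    apply: Rint_le0_ae => //; apply/ler_addgt0Pr => e e0; rewrite add0r.
    have [N hN] := moll_L1_seq etab fi e0.
    have [b i] := hN (maxn N j) (leq_maxl _ _).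
    apply: le_trans b; apply: Rint_le => // z.
    have [zA|zA] := pselect (A z); last by rewrite indicE memNset// mulr0.
    rewrite indicE mem_set// mulr1 (h (maxn N j, z)) ?sub0r ?normrN//.
    have kj : (maxn N j).+1%:R^-1 <= j.+1%:R^-1 :> R.
      by rewrite lef_pV2 ?posrE ?ltr0n// ler_nat ltnS leq_maxr.
    move: zA; rewrite /A /inner /sbox /= => -[z1 z2].
    by split; [apply: lt_le_trans z1 _|apply: lt_le_trans z2 _]; rewrite lerD2l lerN2.
  apply: ae_imply => z hz Az; move: hz; rewrite indicE mem_set// mulr1.
  exact: normr0_eq0.
have : {ae mu2, forall z : RR, forall j, sbox c (d - j.+1%:R^-1) z -> f z = 0} by exact/ae_foralln.
apply: ae_imply => z hz [z1 z2].
have e0 : 0 < d - Num.max `|(z.1 : R) - c.1| `|(z.2 : R) - c.2| by rewrite subr_gt0 gt_max z1 z2.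
have [N _ hN] := near_infty_natSinv_lt (PosNum e0).
have := hN N (leqnn N); rewrite /= ltrBrDr => hh.
apply: (hz N); move: hh; move: (N.+1%:R^-1 : R) => t.
rewrite -ltrBrDl gt_max => /andP[h1 h2]; split; [exact: h1|exact: h2].
Qed.

Lemma bm_prod m (K : 'I_m -> R * R -> R) : (forall j, bm (K j)) ->
  measurable_fun [set: m.-tuple RR] (fun t => \prod_j K j (tnth t j)) /\
  exists C, forall t : m.-tuple RR, `|\prod_j K j (tnth t j)| <= C.
Proof.
move=> hK; split.
  apply: measurable_prod => j _.
  exact: (measurableT_comp (hK j).1 (measurable_tnth j)).
have /choice[C hC] : forall j, exists C, forall z, `|K j z| <= C by move=> j; exact: (hK j).2.
exists (\prod_j C j) => t; rewrite normr_prod; apply: ler_prod => j _.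
by rewrite normr_ge0 hC.
Qed.


Lemma integrable_tcons m (g : m.+1.-tuple RR -> R) :
  (lam m.+1).-integrable setT (EFin \o g) ->
  (sf_product mu2 (lam m)).-integrable setT (EFin \o (fun z : RR * m.-tuple RR => g (tcons z))).
Proof.
move=> gi; have mg := measurable_int _ gi.
have mt := @measurable_tcons _ RR m.
apply/integrableP; split; first by apply: (measurableT_comp mg mt).
have /integrableP[_] := gi; apply: le_lt_trans.
have mE : measurable_fun setT (abse \o (EFin \o g)) by exact: measurableT_comp.
by have -> := @ge0_integral_pushforward _ _ _ _ _ _ mt (sf_product mu2 (lam m)) setT _ measurableT mE (fun y _ => abse_ge0 _).
Qed.

Lemma integral_tcons m (g : m.+1.-tuple RR -> R) :
  (lam m.+1).-integrable setT (EFin \o g) ->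
  \int[lam m.+1]_t g t = \int[sf_product mu2 (lam m)]_z g (tcons z).
Proof.
move=> gi; have mg := measurable_int _ gi.
have mt := @measurable_tcons _ RR m.
by rewrite /Rintegral; congr fine; apply: (integral_pushforward mt mg (integrable_tcons gi)).
Qed.

(** Induction on the number of variables. For one fixed kernel in the first variable the induction
    hypothesis handles the pairing as a function of the others; [moll_zero] then treats the first
    variable on almost every slice. *)
Lemma peel m (g : m.-tuple RR -> R) (c : 'I_m -> R * R) (d : R) :
  (lam m).-integrable setT (EFin \o g) ->
  (forall q, (forall j, inner (c j) d (q j)) ->
    \int[lam m]_t (g t * \prod_j ker (q j) (tnth t j)) = 0) ->
  {ae lam m, forall t, (forall j, sbox (c j) d (tnth t j)) -> g t = 0}.
Proof.
elim: m g c => [|m IH] g c gi h.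
  apply: aeW => t _; rewrite (tuple0 t).
  have q0 : 'I_0 -> nat * (R * R) by case.
  have := h q0; rewrite /Rintegral [X in fine X](integral_dirac _ measurableT); last first.
    have mg := measurable_int _ gi; move: mg => /measurable_EFinP mg.
    apply/measurable_EFinP; apply: measurable_funM => //.
    by case: (bm_prod (fun j => bm_ker (q0 j))).
  by rewrite diracT mul1e /= big_ord0 mulr1; apply; case.
pose f (z : RR * m.-tuple RR) := g (tcons z).
have fi : (sf_product mu2 (lam m)).-integrable setT (EFin \o f) := integrable_tcons gi.
pose c' j := c (lift ord0 j).
pose G (q0 : nat * (R * R)) (t : m.-tuple RR) := \int[mu2]_z (f (z, t) * ker q0 z).
have fker (q0 : nat * (R * R)) : (sf_product mu2 (lam m)).-integrable setT (EFin \o (fun z => f z * ker q0 z.1)).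
  have [mk [C kC]] := bm_ker q0.
  apply: (integrableM_bounded fi (C := C)) => //.
  exact: (measurableT_comp mk measurable_fst).
have isec : {ae lam m, forall t, inR (fun z => f (z, t))} := ae_integrable2 fi.
have G0 (q0 : nat * (R * R)) : inner (c ord0) d q0 ->
    {ae lam m, forall t, (forall j, sbox (c' j) d (tnth t j)) -> G q0 t = 0}.
  move=> hq0; have [Gi _] := Rintegral_fubini (fker q0).
  apply: IH => // q' hq'.
  pose q j := if unlift ord0 j is Some j' then q' j' else q0.
  have hq j : inner (c j) d (q j).
    by rewrite /q; case: unliftP => [j' ->|->]; [exact: hq'|].
  have [mK [C KC]] := bm_prod (fun j => bm_ker (q j)).
  have gK := integrableM_bounded gi mK KC.
  have := h q hq; rewrite integral_tcons//.
  have [iK ->] := Rintegral_fubini (integrable_tcons gK).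
  move=> <-; rewrite /Rintegral; congr fine; apply: ae_eq_integral => //.
  - have [mK' _] := bm_prod (fun j => bm_ker (q' j)).
    apply/measurable_EFinP; apply: measurable_funM => //.
    by have := measurable_int _ Gi; move=> /measurable_EFinP.
  - exact: measurable_int iK.
  apply: ae_imply isec => t it _; congr EFin; rewrite /G mulrC -RintZ; last first.
    by apply: inR_pairing => //; exact: bm_ker.
  apply: eq_Rintegral => z _.
  rewrite big_ord_recl tnth0 /q unlift_none -/(f (z, t)).
  rewrite [X in _ = _ * (_ * X)](eq_bigr (fun j => ker (q' j) (tnth t j))); last first.
    by move=> j _; rewrite liftK tnthS.
  by rewrite /= mulrC mulrA.
(* Only countably many kernels, those with rational centres, may share an exceptional null set;
   continuity of mollifications recovers the others on each slice. *)
pose S n (t : m.-tuple RR) := forall p : nat * (rat * rat), unpickle n = Some p ->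
  inner (c ord0) d (p.1, (ratr p.2.1, ratr p.2.2)) -> (forall j, sbox (c' j) d (tnth t j)) ->
  G (p.1, (ratr p.2.1, ratr p.2.2)) t = 0.
have hS n : {ae lam m, forall t, S n t}.
  rewrite /S; case: (unpickle n) => [p|]; last by apply: aeW => z p.
  have [hp|hp] := pselect (inner (c ord0) d (p.1, (ratr p.2.1, ratr p.2.2))); last first.
    by apply: aeW => z p' [<-].
  by apply: ae_imply (G0 _ hp) => t ht p' [<-] _.
have hS' : {ae lam m, forall t, forall n, S n t} by exact/ae_foralln.
pose I j := (\1_(sbox (c j) d) : R * R -> R).
pose F (z : RR * m.-tuple RR) := f z * \prod_j I j (tnth (tcons z) j).
have mF : measurable_fun setT F.
  apply: measurable_funM; first by have := measurable_int _ fi; move=> /measurable_EFinP.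
  have [mI _] := bm_prod (fun j => bm_indic (measurable_sbox (c j) d)).
  exact: (measurableT_comp mI (@measurable_tcons _ RR m)).
have FF : {ae sf_product mu2 (lam m), forall z, F z = 0}.
  apply: ae_sf_product => //; apply: ae_imply2 _ hS' isec => t hS1 fti.
  have [tb|tb] := pselect (forall j, sbox (c' j) d (tnth t j)); last first.
    apply: aeW => x; rewrite /F.
    have /existsNP[j tj] := tb.
    by rewrite (bigD1 (lift ord0 j))//= /I indicE tnthS memNset//= mul0r mulr0.
  have : {ae mu2, forall z : RR, sbox (c ord0) d z -> f (z, t) = 0}.
    apply: moll_zero => // -[k p] hp /=.
    have ek := bump_kernel1 (etab k).
    apply: (dense_zero (moll_continuous fti ek ek) (@open_sbox (c ord0) (d - k.+1%:R^-1)) _ hp).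
    by move=> r hr; exact: (hS1 (pickle (k, r)) (k, r) (pickleK _) hr tb).
  apply: ae_imply => z hz; rewrite /F.
  have [zb|zb] := pselect (sbox (c ord0) d z); first by rewrite hz// mul0r.
  by rewrite big_ord_recl /I tnth0 indicE memNset//= mul0r mulr0.
have tunconsK : cancel (@tuncons _ RR m) (@tcons _ RR m).
  by move=> t; apply: val_inj; case: t => -[|x t].
have : {ae lam m.+1, forall t, F (tuncons t) = 0}.
  apply: (ae_pushforward (f := @tcons _ RR m) (g := @tuncons _ RR m) (m := sf_product mu2 (lam m))) => //.
  - exact: measurable_tuncons.
  - exact: tconsK.
  - by apply: ae_imply FF => z; rewrite tconsK.
apply: ae_imply => t; rewrite /F /f tunconsK => ht tb; move: ht.
by rewrite big1 ?mulr1// => j _; rewrite /I indicE mem_set.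
Qed.

End peeling.

Lemma RintegralM d (T : measurableType d) (R : realType) (m : {measure set T -> \bar R})
    (f g : T -> R) (s : R) : m.-integrable setT (EFin \o f) -> m.-integrable setT (EFin \o g) ->
  m.-integrable setT (EFin \o (fun x => f x + s * g x)) /\
  \int[m]_x (f x + s * g x) = \int[m]_x f x + s * \int[m]_x g x.
Proof.
move=> fi gi.
have si : m.-integrable setT (EFin \o (fun x => s * g x)).
  by have := integrableZl measurableT s gi.
split; last by rewrite RintegralD// RintegralZl.
by have := integrableD measurableT fi si.
Qed.

(** * From the weak equation to almost every slice *)

Section slicing.
Context {R : realType} (m : nat).
Local Notation RR := (plane R).
Local Notation lam := (tuple_measure mu2 m).
Local Notation M := (sf_product mu2 lam).
Local Notation X := (RR * m.-tuple RR)%type.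
Variable eta : nat -> R -> R.
Hypothesis etab : forall k, bump (k.+1%:R^-1) (eta k).

Definition tbox (c : 'I_m -> R * R) d (t : m.-tuple RR) := forall j, sbox (c j) d (tnth t j).

Definition cut (D L : R) (c : 'I_m -> R * R) (d : R) (z : X) : R :=
  \1_(ann D L) z.1 * \prod_j \1_(sbox (c j) d) (tnth z.2 j).

Lemma cut_in D L c d (z : X) : tbox c d z.2 -> cut D L c d z = \1_(ann D L) z.1.
Proof. by move=> h; rewrite /cut big1 ?mulr1// => j _; rewrite indicE mem_set. Qed.

Definition tker (q : 'I_m -> nat * (R * R)) (t : m.-tuple RR) : R := \prod_j ker eta (q j) (tnth t j).

Lemma ker_out c d q (z : R * R) : inner c d q -> ~ sbox c d z -> ker eta q z = 0.
Proof.
move=> [q1 q2] nz; have e0 x : q.1.+1%:R^-1 <= `|x| -> eta q.1 x = 0.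
  by case: (etab q.1) => _ _ h _ _ /h.
rewrite /ker /kxy.
have [h1|h1] := leP q.1.+1%:R^-1 `|q.2.1 - z.1|; first by rewrite e0// mul0r.
have [h2|h2] := leP q.1.+1%:R^-1 `|q.2.2 - z.2|; first by rewrite (e0 _ h2) mulr0.
case: nz; split.
  rewrite -(subrK q.2.1 z.1) -addrA (le_lt_trans (ler_normD _ _))// distrC.
  by move: h1 q1; move: (q.1.+1%:R^-1 : R) => e; lra.
rewrite -(subrK q.2.2 z.2) -addrA (le_lt_trans (ler_normD _ _))// distrC.
by move: h2 q2; move: (q.1.+1%:R^-1 : R) => e; lra.
Qed.

(** The kernels are supported where [cut] equals 1, so the factor can be inserted for free; it is
    what makes the integrals over the product finite. *)
Lemma tker_cut D L c d q (K : R * R -> R) (z : X) : (forall j, inner (c j) d (q j)) ->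
  (forall x, ~ ann D L x -> K x = 0) ->
  cut D L c d z * (K z.1 * tker q z.2) = K z.1 * tker q z.2.
Proof.
move=> hq hK.
have [z1|z1] := pselect (ann D L z.1); last by rewrite hK// mul0r mulr0.
have [z2|/existsNP[j zj]] := pselect (tbox c d z.2).
  by rewrite cut_in// indicE mem_set// mul1r.
by rewrite /tker (bigD1 j)//= (ker_out (hq j))// mul0r !mulr0.
Qed.

Section mixed.
Variables (f1 f2 f3 : X -> R) (K1 K2 K3 : R * R -> R) (s : R) (D L d : R) (c : 'I_m -> R * R).
Hypotheses (i1 : M.-integrable setT (EFin \o (fun z => f1 z * cut D L c d z)))
  (i2 : M.-integrable setT (EFin \o (fun z => f2 z * cut D L c d z)))
  (i3 : M.-integrable setT (EFin \o (fun z => f3 z * cut D L c d z))).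
Hypotheses (bK1 : bm K1) (bK2 : bm K2) (bK3 : bm K3).
Hypotheses (s1 : forall x, ~ ann D L x -> K1 x = 0) (s2 : forall x, ~ ann D L x -> K2 x = 0)
  (s3 : forall x, ~ ann D L x -> K3 x = 0).
Hypothesis weak : forall q, (forall j, inner (c j) d (q j)) ->
  \int[M]_z ((f1 z * K1 z.1 + s * (f2 z * K2 z.1)) * tker q z.2) =
  \int[M]_z (f3 z * K3 z.1 * tker q z.2).

Let H (z : X) := f1 z * cut D L c d z * K1 z.1 + s * (f2 z * cut D L c d z * K2 z.1)
  + (-1) * (f3 z * cut D L c d z * K3 z.1).

Let iK (f : X -> R) (K : R * R -> R) : M.-integrable setT (EFin \o f) -> bm K ->
  M.-integrable setT (EFin \o (fun z => f z * K z.1)).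
Proof.
move=> fi [mK [C KC]]; apply: (integrableM_bounded fi (C := C)) => //.
exact: (measurableT_comp mK measurable_fst).
Qed.

Let iH : M.-integrable setT (EFin \o H).
Proof.
have [h _] := RintegralM s (iK i1 bK1) (iK i2 bK2).
by have [] := RintegralM (-1) h (iK i3 bK3).
Qed.

(** The equation tested against a kernel in the first variable times product kernels in the others
    says that a function of t has zero pairing with all product kernels: [peel] makes it vanish
    almost everywhere. *)
Lemma mixed_zero : {ae lam, forall t, tbox c d t ->
  pairing (fun x => f1 (x, t)) K1 + s * pairing (fun x => f2 (x, t)) K2 =
  pairing (fun x => f3 (x, t)) K3}.
Proof.
have [iG _] := Rintegral_fubini iH.
have sec (f : X -> R) : M.-integrable setT (EFin \o f) -> {ae lam, forall t, inR (fun x => f (x, t))}.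
  by move=> fi; exact: (ae_integrable2 fi).
have G0 : {ae lam, forall t, tbox c d t -> \int[mu2]_x H (x, t) = 0}.
  apply: (peel etab iG) => q hq.
  have [mT [C TC]] := bm_prod (fun j => bm_ker etab (q j)).
  have iT (f : X -> R) : M.-integrable setT (EFin \o f) -> M.-integrable setT (EFin \o (fun z => f z * tker q z.2)).
    move=> fi; apply: (integrableM_bounded fi (C := C)); last by move=> z; exact: TC.
    exact: (measurableT_comp mT measurable_snd).
  have e3 z : f3 z * cut D L c d z * K3 z.1 * tker q z.2 = f3 z * K3 z.1 * tker q z.2.
    by rewrite -[RHS]mulrA -(tker_cut z hq s3); ring.
  have e12 z : (f1 z * cut D L c d z * K1 z.1 + s * (f2 z * cut D L c d z * K2 z.1)) * tker q z.2 =
      (f1 z * K1 z.1 + s * (f2 z * K2 z.1)) * tker q z.2.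
    transitivity (f1 z * (K1 z.1 * tker q z.2) + s * (f2 z * (K2 z.1 * tker q z.2))); last by ring.
    by rewrite -(tker_cut z hq s1) -(tker_cut z hq s2); ring.
  have [h12 _] := RintegralM s (iK i1 bK1) (iK i2 bK2).
  have Z : \int[M]_z (H z * tker q z.2) = 0.
    have [_ e] := RintegralM (-1) (iT _ h12) (iT _ (iK i3 bK3)).
    transitivity (\int[M]_z ((f1 z * K1 z.1 + s * (f2 z * K2 z.1)) * tker q z.2)
      + (-1) * \int[M]_z (f3 z * K3 z.1 * tker q z.2)); last by rewrite weak//; ring.
    rewrite -(funext e12) -(funext e3) -e.
    by apply: eq_Rintegral => z _; rewrite /H; ring.
  have [i e] := Rintegral_fubini (iT _ iH).
  rewrite e in Z; rewrite -Z /Rintegral; congr fine; apply: ae_eq_integral => //.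
  - have /measurable_EFinP mG := measurable_int _ iG.
    by apply/measurable_EFinP; apply: measurable_funM.
  - exact: measurable_int i.
  apply: ae_imply (sec _ iH) => t it _; congr EFin.
  rewrite -/(tker q t) mulrC -RintZ//.
  by apply: eq_Rintegral => x _; rewrite mulrC.
have := ae_imply2 (fun t a b => conj a b) (sec _ i1) (ae_imply2 (fun t a b => conj a b) (sec _ i2) (sec _ i3)).
move=> J; apply: ae_imply2 _ J G0 => t [j1 [j2 j3]] G0t tb.
have pE (f : X -> R) (K : R * R -> R) : (forall x, ~ ann D L x -> K x = 0) ->
    pairing (fun x => f (x, t)) K = \int[mu2]_x (f (x, t) * cut D L c d (x, t) * K x).
  move=> hK; apply: eq_Rintegral => x _; rewrite cut_in//=.
  have [z1|z1] := pselect (ann D L x); last by rewrite hK// !mulr0.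
  by rewrite indicE mem_set// mulr1.
have := G0t tb; rewrite /H.
have a1 := inR_pairing j1 bK1; have a2 := inR_pairing j2 bK2; have a3 := inR_pairing j3 bK3.
have [a12 e12] := RintegralM s a1 a2.
have [_ ->] := RintegralM (-1) a12 a3.
rewrite e12 !pE//; lra.
Qed.

End mixed.

Definition tsq (t : m.-tuple RR) : R := \sum_j sqn (tnth t j).

Variables (r : R) (w1 w2 h1 h2 : X -> R).

(** The region of points with |zeta| >= D over this closed box lies in the exterior of the ball of
    radius r. *)
Definition safe (D : R) (c : 'I_m -> R * R) (d : R) := forall t : m.-tuple RR,
  (forall j, `|(tnth t j).1 - (c j).1 : R| <= d /\ `|(tnth t j).2 - (c j).2 : R| <= d) ->
  r ^+ 2 < D ^+ 2 + tsq t.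

Definition loc (f : X -> R) := forall D L c d, 0 <= D -> safe D c d ->
  M.-integrable setT (EFin \o (fun z => f z * cut D L c d z)).

Hypotheses (mw1 : measurable_fun setT w1) (mw2 : measurable_fun setT w2)
  (mh1 : measurable_fun setT h1) (mh2 : measurable_fun setT h2).
Hypotheses (lw1 : loc w1) (lw2 : loc w2) (lh1 : loc h1) (lh2 : loc h2).
Hypothesis weak : forall D c d k p q eta', 0 <= D -> safe D c d ->
  (forall j, inner (c j) d (q j)) -> D + 2 / k.+1%:R < nrm p ->
  (forall x, der (eta k) x (eta' x)) ->
  \int[M]_z ((w1 z * kxy eta' (eta k) p z.1 + -1 * (w2 z * kxy (eta k) eta' p z.1)) * tker q z.2) =
  \int[M]_z (h1 z * kxy (eta k) (eta k) p z.1 * tker q z.2) /\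
  \int[M]_z ((w2 z * kxy eta' (eta k) p z.1 + 1 * (w1 z * kxy (eta k) eta' p z.1)) * tker q z.2) =
  \int[M]_z (h2 z * kxy (eta k) (eta k) p z.1 * tker q z.2).

Lemma kxy_ann (D L e : R) (a b : R -> R) (p : R * R) : (forall x, e < `|x| -> a x = 0) ->
  (forall x, e < `|x| -> b x = 0) -> D + 2 * e < nrm p -> nrm p + 2 * e <= L ->
  forall x, ~ ann D L x -> kxy a b p x = 0.
Proof.
move=> a0 b0 pD pL x nx; rewrite /kxy.
have [y1|y1] := leP `|p.1 - x.1| e; last by rewrite a0// mul0r.
have [y2|y2] := leP `|p.2 - x.2| e; last by rewrite (b0 _ y2) mulr0.
case: nx; rewrite /ann/= in_itv/=.
by have /andP[z1 z2] := nrm_box y1 y2; move: z1 z2 pD pL; lra.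
Qed.

Lemma ae_moll_eq D c d k (p : R * R) : 0 <= D -> safe D c d -> D + 2 / k.+1%:R < nrm p ->
  {ae lam, forall t, tbox c d t ->
    moll_eq (eta k) (fun x => w1 (x, t)) (fun x => w2 (x, t)) (fun x => h1 (x, t)) (fun x => h2 (x, t)) p}.
Proof.
move=> D0 sf pD; have ek := bump_kernel1 (etab k).
have [eta' de ke'] := kernel1_der ek.
have e0 (x : R) : k.+1%:R^-1 < `|x| -> eta k x = 0 by case: (etab k) => _ _ h _ _ /ltW/h.
have e0' := der_support e0 de.
pose L := nrm p + 2 * k.+1%:R^-1.
have bk a b : kernel1 a -> kernel1 b -> bm (kxy a b p) by exact: bm_kxy.
have s12 := kxy_ann e0' e0 pD (lexx L); have s21 := kxy_ann e0 e0' pD (lexx L).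
have s22 := kxy_ann e0 e0 pD (lexx L).
have W q hq := weak (q := q) D0 sf hq pD de.
have E1 := mixed_zero (lw1 L D0 sf) (lw2 L D0 sf) (lh1 L D0 sf) (bk _ _ ke' ek) (bk _ _ ek ke')
  (bk _ _ ek ek) s12 s21 s22 (fun q hq => (W q hq).1).
have E2 := mixed_zero (lw2 L D0 sf) (lw1 L D0 sf) (lh2 L D0 sf) (bk _ _ ke' ek) (bk _ _ ek ke')
  (bk _ _ ek ek) s12 s21 s22 (fun q hq => (W q hq).2).
apply: ae_imply2 _ E1 E2 => t f1 f2 tb eta'' de''.
have -> : eta'' = eta' by apply/funext => x; exact: der_uniq (de'' x) (de x).
have := f1 tb; have := f2 tb; rewrite mul1r mulN1r => -> g1; split => //.
Qed.

(** After truncation to an annulus both sides are continuous in p, so equality at rational points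
    extends to all; [moll_eq_ae] removes the truncation near p. *)
Lemma moll_eq_dense (u1 u2 g1 g2 : R * R -> R) D k :
  [/\ mplane u1, mplane u2, mplane g1 &
   mplane g2] ->
  (forall L, [/\ inR (trunc D L u1), inR (trunc D L u2), inR (trunc D L g1) & inR (trunc D L g2)]) ->
  (forall p : rat * rat, D + 2 / k.+1%:R < nrm (ratr p.1 : R, ratr p.2 : R) ->
    moll_eq (eta k) u1 u2 g1 g2 (ratr p.1, ratr p.2)) ->
  forall p, D + 2 / k.+1%:R < nrm p -> moll_eq (eta k) u1 u2 g1 g2 p.
Proof.
move=> ms iu h p pD; have ek := bump_kernel1 (etab k).
have [eta' de ke'] := kernel1_der ek.
pose L := nrm p + 1 + 2 / k.+1%:R.
have [j1 j2 j3 j4] := iu L; have [m1 m2 m3 m4] := ms.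
have tr (z : R * R) : D + 2 / k.+1%:R < nrm z -> nrm z < nrm p + 1 ->
    {ae mu2, forall xi : RR, `|z.1 - xi.1| <= k.+1%:R^-1 -> `|z.2 - xi.2| <= k.+1%:R^-1 ->
    [/\ u1 xi = trunc D L u1 xi, u2 xi = trunc D L u2 xi, g1 xi = trunc D L g1 xi &
     g2 xi = trunc D L g2 xi]}.
  move=> zD zL; apply: aeW => xi x1 x2; have /andP[y1 y2] := nrm_box x1 x2.
  have a1 : D < nrm xi by move: y1 zD; move: (nrm xi) (k.+1%:R^-1 : R) => n e; lra.
  have a2 : nrm xi <= L by move: y2 zL; rewrite /L; move: (nrm xi) (k.+1%:R^-1 : R) => n e; lra.
  by rewrite !trunc_in.
have mt : [/\ mplane (trunc D L u1), mplane (trunc D L u2),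
    mplane (trunc D L g1) & mplane (trunc D L g2)].
  by split; exact: trunc_meas.
pose B := [set z : R * R | D + 2 / k.+1%:R < nrm z] `&` [set z : R * R | nrm z < nrm p + 1].
have oB : @open (R * R)%type B.
  have cn : continuous (nrm : R * R -> R) by exact: ct_nrm.
  apply: openI.
    rewrite (_ : [set z : R * R | _] = nrm @^-1` [set x : R | D + 2 / k.+1%:R < x])//.
    by apply: open_comp; [move=> z _; exact: cn|exact: open_gt].
  rewrite (_ : [set z : R * R | _] = nrm @^-1` [set x : R | x < nrm p + 1])//.
  by apply: open_comp; [move=> z _; exact: cn|exact: open_lt].
have Bp : B p by split => //=; rewrite ltrDl.
pose F1 := fun z => moll (trunc D L u1) eta' (eta k) z - moll (trunc D L u2) (eta k) eta' z
  - moll (trunc D L g1) (eta k) (eta k) z.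
pose F2 := fun z => moll (trunc D L u2) eta' (eta k) z + moll (trunc D L u1) (eta k) eta' z
  - moll (trunc D L g2) (eta k) (eta k) z.
have cF1 : continuous F1 by move=> z; apply: cvgB; [apply: cvgB|]; exact: moll_continuous.
have cF2 : continuous F2 by move=> z; apply: cvgB; [apply: cvgD|]; exact: moll_continuous.
have R0 (q : rat * rat) : B (ratr q.1, ratr q.2) -> F1 (ratr q.1, ratr q.2) = 0 /\ F2 (ratr q.1, ratr q.2) = 0.
  move=> [q1 q2]; have := moll_eq_ae (etab k) ms mt (tr _ q1 q2) (h q q1).
  by move=> /(_ _ de)[f1 f2]; rewrite /F1 /F2 f1 f2 !subrr.
apply: (moll_eq_ae (etab k) mt ms).
  by apply: ae_imply (tr p Bp.1 Bp.2) => xi hx x1 x2; case: (hx x1 x2) => -> -> -> ->.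
move=> eta'' de''.
have -> : eta'' = eta' by apply/funext => x; exact: der_uniq (de'' x) (de x).
have /eqP := dense_zero cF1 oB (fun q hq => (R0 q hq).1) Bp.
have /eqP := dense_zero cF2 oB (fun q hq => (R0 q hq).2) Bp.
by rewrite !subr_eq0 => /eqP -> /eqP ->.
Qed.

Lemma loc_trunc (f : X -> R) D c d : loc f -> 0 <= D -> safe D c d ->
  {ae lam, forall t, tbox c d t -> forall L, inR (trunc D L (fun x => f (x, t)))}.
Proof.
move=> lf D0 sf.
have : {ae lam, forall t, forall n : nat, inR (fun x => f (x, t) * cut D n%:R c d (x, t))}.
  by apply/ae_foralln => n; exact: (ae_integrable2 (lf D n%:R c d D0 sf)).
apply: ae_imply => t h tb L; apply: (trunc_inR (lexx D) (L' := (Num.truncn L).+1%:R)).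
  by apply: ltW; exact: truncnS_gt.
have := h (Num.truncn L).+1; congr (is_true (inR _)); apply/funext => x.
by rewrite cut_in.
Qed.

Variables (Mc rho : R) (phi Phi : R -> R) (R1 C1 dl : R).
Hypotheses (r0 : 0 < r) (Mc0 : 0 <= Mc) (R10 : 0 < R1) (C10 : 0 <= C1) (dl0 : 0 < dl).
Hypothesis hM : forall z, `|h1 z| + `|h2 z| <= Mc * (`|w1 z| + `|w2 z|).
Hypothesis off : forall z, ~ (r ^+ 2 < sqn z.1 + tsq z.2) -> w1 z = 0 /\ w2 z = 0.
Hypotheses (phi0 : forall s, R1 <= s -> 0 <= phi s)
  (phim : forall s t, R1 <= s -> s <= t -> phi t <= phi s)
  (Phi0 : forall t, t <= R1 -> Phi t = 0)
  (Phib : forall s t, R1 <= s -> s <= t -> (t - s) * phi t <= Phi t - Phi s <= (t - s) * phi s)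
  (Phil : forall A, exists s0, forall s, s0 <= s -> A * ln s <= Phi s).
Hypothesis hrho : forall z, rho <= nrm z.1 ->
  h1 z ^+ 2 + h2 z ^+ 2 <= (C1 * phi (nrm z.1)) ^+ 2 * (w1 z ^+ 2 + w2 z ^+ 2) /\
  w1 z ^+ 2 + w2 z ^+ 2 <= expR (- (2 * ((C1 + dl) * Phi (nrm z.1)))).

(** Countably many rational p and indices k give one null set of bad t; on every other slice over
    the box the one-variable theorem applies. *)
Lemma box_vanish D c d : 0 <= D -> safe D c d ->
  {ae lam, forall t, tbox c d t ->
    {ae mu2, forall x : RR, D < nrm x -> w1 (x, t) = 0 /\ w2 (x, t) = 0}}.
Proof.
move=> D0 sf.
pose S n (t : m.-tuple RR) := forall p : nat * (rat * rat), unpickle n = Some p ->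
  D + 2 / p.1.+1%:R < nrm (ratr p.2.1 : R, ratr p.2.2 : R) -> tbox c d t ->
  moll_eq (eta p.1) (fun x => w1 (x, t)) (fun x => w2 (x, t)) (fun x => h1 (x, t))
    (fun x => h2 (x, t)) (ratr p.2.1, ratr p.2.2).
have hS n : {ae lam, forall t, S n t}.
  rewrite /S; case: (unpickle n) => [p|]; last by apply: aeW => z p.
  have [hp|hp] := ltP (D + 2 / p.1.+1%:R) (nrm (ratr p.2.1 : R, ratr p.2.2 : R)); last first.
    by apply: aeW => z p' [<-]; rewrite ltNge hp.
  by apply: ae_imply (ae_moll_eq D0 sf hp) => t ht p' [<-] _.
have hS' : {ae lam, forall t, forall n, S n t} by exact/ae_foralln.
have T1 := ae_imply2 (fun t a b => conj a b) (loc_trunc lw1 D0 sf) (loc_trunc lw2 D0 sf).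
have T2 := ae_imply2 (fun t a b => conj a b) (loc_trunc lh1 D0 sf) (loc_trunc lh2 D0 sf).
have T := ae_imply2 (fun t a b => conj a b) T1 T2.
apply: ae_imply2 _ hS' T => t hSt [[t1 t2] [t3 t4]] tb.
have mt (f : X -> R) : measurable_fun setT f -> mplane (fun x => f (x, t)).
  by move=> mf; apply: (measurableT_comp mf); exact: measurable_pair2.
have iu L : [/\ inR (trunc D L (fun x => w1 (x, t))), inR (trunc D L (fun x => w2 (x, t))),
  inR (trunc D L (fun x => h1 (x, t))) & inR (trunc D L (fun x => h2 (x, t)))].
  by split; [exact: t1|exact: t2|exact: t3|exact: t4].
apply: (slice_vanish etab (mt _ mw1) (mt _ mw2) (mt _ mh1) (mt _ mh2) iu D0 Mc0 R10 C10 dl0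
  _ _ phi0 phim Phi0 Phib Phil (rho := rho)) => [z _|k z|z zr].
- exact: hM.
- apply: moll_eq_dense => //; first by split; exact: mt.
  by move=> p hp; exact: (hSt (pickle (k, p)) (k, p) (pickleK _) hp tb).
- exact: hrho.
Qed.

Definition cgrid (c : m.-tuple (rat * rat)) (j : 'I_m) : R * R :=
  (ratr (tnth c j).1, ratr (tnth c j).2).

Lemma safe_exists (t : m.-tuple RR) (D : R) : 0 <= D -> r ^+ 2 < D ^+ 2 + tsq t ->
  exists N : nat, exists c : m.-tuple (rat * rat),
    safe D (cgrid c) N.+1%:R^-1 /\ tbox (cgrid c) N.+1%:R^-1 t.
Proof.
move=> D0 hD.
pose B := \sum_j (`|(tnth t j).1| + `|(tnth t j).2|).
have B0 : 0 <= B by apply: sumr_ge0 => j _; rewrite addr_ge0.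
have B1 : 0 < 4 * B + 1 by rewrite ltr_wpDl// mulr_ge0.
(* A box of half-side 1 / (N + 1) changes |t|^2 by at most 4 B / (N + 1), which must stay below the
   gap D^2 + |t|^2 - r^2. *)
have e0 : 0 < (D ^+ 2 + tsq t - r ^+ 2) / (4 * B + 1) by rewrite divr_gt0 ?subr_gt0.
have [N _ hN] := near_infty_natSinv_lt (PosNum e0); have {hN} := hN N (leqnn N) => /= hN.
exists N; have d0 : 0 < N.+1%:R^-1 :> R by rewrite invr_gt0.
have near_rat (x : R) : exists q : rat, `|x - ratr q| < N.+1%:R^-1.
  have lt : x - N.+1%:R^-1 < x + N.+1%:R^-1 by move: d0; move: (N.+1%:R^-1 : R) => e; lra.
  have [q] := rat_in_itvoo lt; rewrite in_itv/= => /andP[r1 r2]; exists q.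
  by rewrite ltr_norml; move: r1 r2; move: (N.+1%:R^-1 : R) => e; lra.
have /choice[C hC] : forall j, exists q : rat * rat, `|(tnth t j).1 - ratr q.1| < N.+1%:R^-1 /\
    `|(tnth t j).2 - ratr q.2| < N.+1%:R^-1.
  move=> j; have [q1 a1] := near_rat (tnth t j).1; have [q2 a2] := near_rat (tnth t j).2.
  by exists (q1, q2).
exists [tuple C j | j < m].
have c'E j : cgrid [tuple C j | j < m] j = (ratr (C j).1, ratr (C j).2).
  by rewrite /cgrid tnth_mktuple.
split; last by move=> j; rewrite c'E.
move=> t' ht'; move: hN; rewrite (ltr_pdivlMr _ _ B1) => hN.
set e := (N.+1%:R^-1 : R) in d0 hN hC ht' *.
have sq (x y : R) : `|y - x| <= 2 * e -> x ^+ 2 - 4 * e * `|x| <= y ^+ 2.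
  move=> xy; have h1' : 0 <= (y - x) ^+ 2 by exact: sqr_ge0.
  have h2' : - (2 * x * (y - x)) <= 2 * `|x| * (2 * e).
    rewrite (le_trans (ler_norm _))// normrN !normrM ger0_norm// ler_wpM2l// mulr_ge0//.
  by move: h1' h2'; rewrite !expr2; lra.
have tri (a b q : R) : `|a - q| < e -> `|b - q| <= e -> `|b - a| <= 2 * e.
  move=> aq bq; have := ler_normD (b - q) (q - a); rewrite (distrC q) addrA subrK.
  by move: aq bq; lra.
have : tsq t - 4 * e * B <= tsq t'.
  rewrite /tsq /B mulr_sumr -sumrB; apply: ler_sum => j _; rewrite /sqn.
  have [b1 b2] := ht' j; have [a1 a2] := hC j; rewrite c'E/= in b1 b2.
  have := sq _ _ (tri _ _ _ a1 b1); have := sq _ _ (tri _ _ _ a2 b2); rewrite mulrDr; lra.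
by move: hN d0; nra.
Qed.

(** The exterior region is covered by countably many products, of |zeta| > D with D rational and
    boxes with rational centres; on each of them [box_vanish] applies. *)
Theorem product_vanish : {ae M, forall z, w1 z = 0 /\ w2 z = 0}.
Proof.
pose Q n (t : m.-tuple RR) (x : RR) := forall p : rat * (m.-tuple (rat * rat) * nat), unpickle n = Some p ->
  0 <= ratr p.1 :> R -> safe (ratr p.1) (cgrid p.2.1) p.2.2.+1%:R^-1 -> tbox (cgrid p.2.1) p.2.2.+1%:R^-1 t ->
  ratr p.1 < nrm x -> w1 (x, t) = 0 /\ w2 (x, t) = 0.
have hQ n : {ae lam, forall t, {ae mu2, forall x, Q n t x}}.
  rewrite /Q; case: (unpickle n) => [p|]; last by apply: aeW => t; apply: aeW => x p.
  have [D0|D0] := leP 0 (ratr p.1 : R); last first.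
    by apply: aeW => t; apply: aeW => x p' [<-] ; rewrite leNgt D0.
  have [sf|sf] := pselect (safe (ratr p.1) (cgrid p.2.1) p.2.2.+1%:R^-1); last first.
    by apply: aeW => t; apply: aeW => x p' [<-].
  apply: ae_imply (box_vanish D0 sf) => t ht.
  have [tb|tb] := pselect (tbox (cgrid p.2.1) p.2.2.+1%:R^-1 t); last by apply: aeW => x p' [<-].
  by apply: ae_imply (ht tb) => x hx p' [<-] _ _ _.
have : {ae M, forall z, `|w1 z| + `|w2 z| = 0}.
  apply: (ae_sf_product (f := fun z => `|w1 z| + `|w2 z|)).
    by apply: measurable_funD; exact: measurableT_comp.
  have : {ae lam, forall t, forall n, {ae mu2, forall x, Q n t x}} by exact/ae_foralln.
  apply: ae_imply => t /ae_foralln ht.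
  (* The covering needs 0 <= D < |zeta|, hence zeta nonzero; the origin is a null set of each
     slice. *)
  have nz : {ae mu2, forall x : RR, nrm x <> 0}.
    exists [set z | nrm z = 0]; split; first by have := @measurable_nrm_itv R `[0, 0]; rewrite (_ : [set z : R * R | nrm z \in `[0, 0]] = [set z | nrm z = 0])//; apply/seteqP; split=> z /=; rewrite in_itv/= -eq_le eq_sym => /eqP.
      exact: mu2_circle.
    by move=> x /= /contrapT.
  apply: ae_imply2 _ ht nz => x hx xn.
  suff [-> ->] : w1 (x, t) = 0 /\ w2 (x, t) = 0 by rewrite normr0 addr0.
  have [xe|] := ltP (r ^+ 2) (sqn x + tsq t); last first.
    by rewrite leNgt => /negP; exact: (off (z := (x, t))).
  have n0 : 0 < nrm x by rewrite lt_neqAle nrm_ge0 andbT eq_sym; apply/eqP.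
  have lt : Num.sqrt (Num.max 0 (r ^+ 2 - tsq t)) < nrm x.
    rewrite /nrm ltr_sqrt; last by rewrite -nrm_sq exprn_gt0.
    by rewrite gt_max -nrm_sq exprn_gt0//= nrm_sq ltrBlDr.
  have [q] := rat_in_itvoo lt; rewrite in_itv/= => /andP[q1 q2].
  have q0 : 0 <= ratr q :> R by apply: le_trans (ltW q1); exact: sqrtr_ge0.
  have qr : r ^+ 2 < ratr q ^+ 2 + tsq t.
    rewrite -ltrBlDr (le_lt_trans (_ : _ <= Num.max 0 (r ^+ 2 - tsq t)))//.
      by rewrite le_max lexx orbT.
    rewrite -[X in X < _]sqr_sqrtr ?le_max ?lexx// ltr_sqr// nnegrE ?sqrtr_ge0//.
  have [N [c [sf tb]]] := safe_exists q0 qr.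
  exact: (hx (pickle (q, (c, N))) (q, (c, N)) (pickleK _) q0 sf tb q2).
by apply: ae_imply => z /eqP; rewrite paddr_eq0// !normr_eq0 => /andP[/eqP -> /eqP ->].
Qed.

End slicing.

(** * Test functions on C^n *)

From mathcomp Require Import complex.
Local Open Scope complex_scope.
Section complex_topology.
Context {R : realType}.

Lemma normc_le_sum (x y : R) : `|x +i* y| <= (`|x| + `|y|)%:C :> R[i].
Proof.
have -> := complexE (x +i* y); rewrite /=; apply: (le_trans (ler_normD _ _)); rewrite normrM.
have nR (a : R) : `|a%:C| = `|a|%:C :> R[i] by rewrite normc_def /= expr0n addr0 sqrtr_sqr.
have ni : `|'i%C| = 1 :> R[i] by rewrite normc_def /= expr0n add0r expr1n sqrtr1.
by rewrite ni mul1r !nR -rmorphD.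
Qed.

Lemma continuous_Re : continuous (@complex.Re R : R[i] -> R).
Proof.
move=> x A /nbhs_ballP[e /= e0 he]; apply/nbhs_ballP; exists (e%:C) => /=; first by rewrite ltcR.
move=> y; rewrite -ball_normE /= => xy; apply: he; rewrite -ball_normE /=.
rewrite -ltcR (le_lt_trans _ xy)// (le_trans _ (normc_ge_Re (x - y)))//.
by case: x {xy} => ? ?; case: y.
Qed.

Lemma continuous_Im : continuous (@complex.Im R : R[i] -> R).
Proof.
move=> x A /nbhs_ballP[e /= e0 he]; apply/nbhs_ballP; exists (e%:C) => /=; first by rewrite ltcR.
move=> y; rewrite -ball_normE /= => xy; apply: he; rewrite -ball_normE /=.
rewrite -ltcR (le_lt_trans _ xy)// -(normrN (x - y)) -normcJ.
have -> : complex.Im x - complex.Im y = complex.Re ((x - y) * - 'i%C).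
  by case: x {xy} => a b; case: y => c d; simpc => /=.
rewrite (le_trans (normc_ge_Re _))// normrM normcJ !normrN.
have -> : `|'i%C| = 1 :> R[i] by rewrite normc_def /= expr0n add0r expr1n sqrtr1.
by rewrite mulr1.
Qed.

Lemma continuous_Complex (T : topologicalType) (f g : T -> R) :
  continuous f -> continuous g -> continuous (fun t => f t +i* g t : R[i]).
Proof.
move=> cf cg t; apply/(@cvgrPdist_lt R[i] R[i]) => -[e e']; rewrite ltcE /= => /andP[/eqP -> e0].
have e2 : 0 < e / 2 by rewrite divr_gt0.
have /cvgrPdist_lt/(_ _ e2) nf := cf t; have /cvgrPdist_lt/(_ _ e2) ng := cg t.
near=> s.
have -> : (f t +i* g t) - (f s +i* g s) = (f t - f s) +i* (g t - g s) :> R[i] by [].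
rewrite (le_lt_trans (normc_le_sum _ _))// ltcR [ltRHS]splitr ltrD//.
  by near: s.
by near: s.
Unshelve. all: by end_near. Qed.

End complex_topology.

(** * Product test functions *)

Section test_functions.
Context {R : realType} {n : nat}.
Local Notation Cn := 'rV[R[i]]_n.

(** Real coordinates are indexed by a complex coordinate and a boolean, true for the imaginary
    part. *)
Definition coord (i : 'I_n * bool) (z : Cn) : R :=
  if i.2 then complex.Im (z 0 i.1) else complex.Re (z 0 i.1).

Definition dir (i : 'I_n * bool) : Cn := if i.2 then ey i.1 else ex i.1.

Lemma continuous_coord i : continuous (coord i).
Proof.
move=> z; rewrite /coord; case: i.2.
  by apply: (@continuous_comp _ _ _ (fun z : Cn => z 0 i.1) (@complex.Im R));
    [exact: coord_continuous|exact: continuous_Im].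
by apply: (@continuous_comp _ _ _ (fun z : Cn => z 0 i.1) (@complex.Re R));
    [exact: coord_continuous|exact: continuous_Re].
Qed.

Lemma coord_dir l i (z : Cn) (t : R) : coord l (z + t%:C *: dir i) = coord l z + t * (l == i)%:R.
Proof.
case: l i => l bl [i bi]; rewrite /coord /dir /ex /ey -complexiE /= xpair_eqE.
case: bi; case: bl; rewrite !mxE eqxx /=; case: (l == i); case: (z 0 l) => x y;
  simpc => /=; rewrite ?mulr1 ?mulr0 ?addr0 ?mul0r ?subr0 ?oppr0 ?addr0 //.
Qed.

(** Products of functions of one real coordinate: a partial derivative replaces one factor ([upd])
    and stays in the class, so smoothness reduces to the factors. *)
Definition prodf (s : 'I_n * bool -> R -> R) (z : Cn) : R := \prod_i s i (coord i z).

Definition upd (s : 'I_n * bool -> R -> R) i (g : R -> R) l := if l == i then g else s l.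

Lemma continuous_prodf s : (forall i, continuous (s i)) -> continuous (prodf s).
Proof.
move=> cs; apply: (@continuous_big R _ *%R 1 xpredT _ _ _ (fun i z => s i (coord i z))) => [|i _ z].
  by move=> p; apply: cvgM; [exact: cvg_fst|exact: cvg_snd].
by apply: (@continuous_comp _ _ _ (coord i) (s i)); [exact: continuous_coord|exact: cs].
Qed.

Lemma continuous_prodfC s : (forall i, continuous (s i)) -> continuous (fun z => (prodf s z)%:C).
Proof.
by move=> cs; apply: continuous_Complex; [exact: continuous_prodf|exact: cst_continuous].
Qed.

Lemma rderive_prodf s i g z : (forall x, der (s i) x (g x)) ->
  rderivable (fun z => (prodf s z)%:C) z (dir i) /\
  rderive (dir i) (fun z => (prodf s z)%:C) z = (prodf (upd s i g) z)%:C.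
Proof.
move=> dg; pose c := \prod_(l | l != i) s l (coord l z).
have fE (t : R) : prodf s (z + t%:C *: dir i) = c * s i (1 * t + coord i z).
  rewrite /prodf (bigD1 i)//= coord_dir eqxx mulr1 mul1r mulrC; congr (_ * _); last by rewrite addrC.
  by apply: eq_bigr => l /negbTE li; rewrite coord_dir li mulr0 addr0.
have gE : prodf (upd s i g) z = c * g (coord i z).
  rewrite /prodf (bigD1 i)//= /upd eqxx mulrC; congr (_ * _).
  by apply: eq_bigr => l /negbTE ->.
have d1 : der (fun t : R => complex.Re (prodf s (z + t%:C *: dir i))%:C) 0 (c * g (coord i z)).
  rewrite (_ : (fun t => _) = fun t => c * s i (1 * t + coord i z)); last by apply/funext => t; rewrite /= fE.
  have h : der (fun t : R => s i (1 * t + coord i z)) 0 (g (coord i z)).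
    have d0 : der (fun t : R => 1 * t + coord i z) 0 1.
      apply: der_eq; first by apply: derD; [apply: derM; [exact: der_cst|exact: der_id]|exact: der_cst].
      by rewrite mul0r add0r mulr1 addr0.
    apply: der_eq; first by apply: (der_comp (f := s i)); [exact: dg|exact: d0].
    by rewrite mulr0 add0r mulr1.
  apply: der_eq; first by apply: derM; [exact: der_cst|exact: h].
  by rewrite mul0r add0r.
have d2 : der (fun t : R => complex.Im (prodf s (z + t%:C *: dir i))%:C) 0 0 by exact: der_cst.
case: d1 => e1 v1; case: d2 => e2 v2; split; first by split.
rewrite /rderive !derive1E v1 v2.
by rewrite gE.
Qed.

Lemma Ck_prodf k s : (forall i, smooth1 (s i)) -> Ck k (fun z => (prodf s z)%:C).
Proof.
elim: k s => [|k IH] s hs; have cs i : continuous (s i) by exact: smooth1_continuous.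
  by split => //; exact: continuous_prodfC.
split; first exact: continuous_prodfC.
move=> j v hv.
have [i ->] : exists i, v = dir i by case: hv => ->; [exists (j, false)|exists (j, true)].
have [g dg sg] := smooth1_der (hs i).
split; first by move=> z; case: (rderive_prodf z dg).
rewrite (_ : rderive _ _ = fun z => (prodf (upd s i g) z)%:C).
  by apply: IH => l; rewrite /upd; case: ifP.
by apply/funext => z; case: (rderive_prodf z dg).
Qed.

Lemma compact_cbox_Cn (l h : 'I_n * bool -> R) :
  compact [set z : Cn | forall i, coord i z \in `[l i, h i]].
Proof.
pose A j := [set w : R[i] | complex.Re w \in `[l (j, false), h (j, false)] /\
  complex.Im w \in `[l (j, true), h (j, true)]].
rewrite (_ : [set z | _] = [set z : Cn | forall j, A j (z ord0 j)]).
  apply: rV_compact => j.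
  rewrite (_ : A j = (fun p : R * R => p.1 +i* p.2 : R[i]) @`
    (`[l (j, false), h (j, false)]%classic `*` `[l (j, true), h (j, true)]%classic)).
    apply: continuous_compact.
      apply: continuous_subspaceT; apply: continuous_Complex; move=> p; [exact: cvg_fst|exact: cvg_snd].
    by apply: compact_setX; exact: segment_compact.
  apply/seteqP; split=> [[x y] [/= h1 h2]|_ [[x y] /= [h1 h2] <-]]; last by split.
  by exists (x, y).
apply/seteqP; split=> z /= h0.
  by move=> j; split; [exact: (h0 (j, false))|exact: (h0 (j, true))].
by case=> j [] /=; have [] := h0 j.
Qed.

Lemma closed_cbox_Cn (l h : 'I_n * bool -> R) :
  closed [set z : Cn | forall i, coord i z \in `[l i, h i]].
Proof. by apply: compact_closed; [exact: norm_hausdorff|exact: compact_cbox_Cn]. Qed.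

Lemma test_function_prodf s (l h : 'I_n * bool -> R) D : (forall i, smooth1 (s i)) ->
  (forall i x, x \notin `[l i, h i] -> s i x = 0) ->
  [set z : Cn | forall i, coord i z \in `[l i, h i]] `<=` D ->
  test_function D (fun z => (prodf s z)%:C).
Proof.
move=> hs s0 KD.
have sub : closure [set z : Cn | (prodf s z)%:C != 0] `<=` [set z : Cn | forall i, coord i z \in `[l i, h i]].
  rewrite closureE; apply: smallest_sub; first exact: closed_cbox_Cn.
  move=> z /= fz i; apply/negPn/negP => ni; move: fz.
  by rewrite /prodf (bigD1 i)//= s0// mul0r eqxx.
split.
- by move=> k; exact: Ck_prodf.
- by apply: subclosed_compact sub; [exact: closed_closure|exact: compact_cbox_Cn].
- exact: subset_trans KD.
Qed.

End test_functions.

(** * Reduction to slices *)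

Section coordinates.
Context {R : realType} {m : nat}.
Local Notation RR := (plane R).
Local Notation lam := (tuple_measure mu2 m).
Local Notation M := (sf_product mu2 lam).
Local Notation X := (RR * m.-tuple RR)%type.
Local Notation Cn := 'rV[R[i]]_m.+1.
Local Notation mu := (@lebesgue_Cn R m.+1).

(** The coordinates of C^(m+1) as a first plane, which carries the slices, times the remaining m
    planes; the Lebesgue measure is by construction the image of the product measure. *)
Definition psi (x : X) : Cn := Cn_of_tuple (tcons x).
Definition psi_inv (z : Cn) : X := tuncons (tuple_of_Cn z).

Lemma psiK : cancel psi psi_inv.
Proof. by move=> x; rewrite /psi /psi_inv Cn_of_tupleK tconsK. Qed.

Lemma psi_invK : cancel psi_inv psi.
Proof.
move=> z; rewrite /psi /psi_inv; have -> : tcons (tuncons (tuple_of_Cn z)) = tuple_of_Cn z.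
  by case: (tuple_of_Cn z) => -[|x t] h; apply: val_inj.
exact: tuple_of_CnK.
Qed.

Lemma measurable_psi : measurable_fun setT psi.
Proof. exact: (measurableT_comp (@measurable_Cn_of_tuple R m.+1) (@measurable_tcons _ RR m)). Qed.

Lemma measurable_psi_inv : measurable_fun setT psi_inv.
Proof. exact: (measurableT_comp (@measurable_tuncons _ RR m) (@measurable_tuple_of_Cn R m.+1)). Qed.

Lemma lebesgue_CnE A : mu A = pushforward M psi A.
Proof. by []. Qed.

Lemma integral_psi (D : set Cn) (g : Cn -> \bar R) : measurable D -> measurable_fun D g ->
  (\int[mu]_(z in D) g z = \int[M]_(x in psi @^-1` D) g (psi x))%E.
Proof.
move=> mD mg; rewrite integralE [RHS]integralE.
have e (f : Cn -> \bar R) : measurable_fun D f -> (forall z, 0 <= f z)%E ->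
    (\int[mu]_(z in D) f z = \int[M]_(x in psi @^-1` D) f (psi x))%E.
  move=> mf f0.
  have h := @ge0_integral_pushforward _ _ _ _ _ psi measurable_psi M D f mD mf (fun z _ => f0 z).
  exact: h.
rewrite (e _ (measurable_funepos mg) (fun z => funepos_ge0 g z)).
rewrite (e _ (measurable_funeneg mg) (fun z => funeneg_ge0 g z)).
by congr (_ - _)%E; apply: eq_integral => x _; rewrite ?funeposE ?funenegE.
Qed.

Lemma psi_coord0 (x : X) b : coord (ord0, b) (psi x) = if b then x.1.2 else x.1.1.
Proof. by rewrite /coord /psi mxE tnth0; case: b. Qed.

Lemma psi_coordS (x : X) j b :
  coord (lift ord0 j, b) (psi x) = if b then (tnth x.2 j).2 else (tnth x.2 j).1.
Proof. by rewrite /coord /psi mxE tnthS; case: b. Qed.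

Lemma cmod_sq (w : R[i]) : cmod w ^+ 2 = complex.Re w ^+ 2 + complex.Im w ^+ 2.
Proof. by rewrite /cmod normc_def /= sqr_sqrtr// addr_ge0 ?sqr_ge0. Qed.

Lemma cmod_ge0 (w : R[i]) : 0 <= cmod w.
Proof. by rewrite /cmod normc_def /= sqrtr_ge0. Qed.

Lemma enorm_psi (x : X) : enorm (psi x) ^+ 2 = sqn x.1 + tsq x.2.
Proof.
rewrite /enorm sqr_sqrtr; last by apply: sumr_ge0 => j _; exact: sqr_ge0.
rewrite big_ord_recl cmod_sq /psi mxE tnth0 /=; congr (_ + _).
by apply: eq_bigr => j _; rewrite cmod_sq mxE tnthS.
Qed.

Lemma enorm_ge0 n (z : 'rV[R[i]]_n) : 0 <= enorm z.
Proof. exact: sqrtr_ge0. Qed.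

Lemma tsq_ge0 (t : m.-tuple RR) : 0 <= tsq t.
Proof. by apply: sumr_ge0 => j _; rewrite addr_ge0 ?sqr_ge0. Qed.

Lemma nrm_le_enorm (x : X) : nrm x.1 <= enorm (psi x).
Proof. by rewrite nrm_le ?enorm_ge0// enorm_psi lerDl tsq_ge0. Qed.

Lemma exterior_psi (r : R) (x : X) : 0 < r -> exterior r (psi x) <-> r ^+ 2 < sqn x.1 + tsq x.2.
Proof. by move=> r0; rewrite /exterior /= -enorm_psi ltr_sqr// nnegrE ?(ltW r0)// enorm_ge0. Qed.

Lemma measurable_coord i : measurable_fun setT (coord i : Cn -> R).
Proof.
rewrite (_ : coord i = (fun p : RR => if i.2 then p.2 else p.1) \o (@tnth _ _ ^~ i.1) \o @tuple_of_Cn R m.+1).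
  apply: measurableT_comp; last exact: measurable_tuple_of_Cn.
  apply: measurableT_comp; last exact: measurable_tnth.
  by case: i.2; [exact: measurable_snd|exact: measurable_fst].
by apply/funext => z; rewrite /coord /= tnth_mktuple; case: i.2.
Qed.

Lemma measurable_prodf s : (forall i, continuous (s i)) -> measurable_fun setT (prodf s : Cn -> R).
Proof.
move=> cs; apply: measurable_prod => i _.
apply: (measurableT_comp (f := s i)); last exact: measurable_coord.
by apply: continuous_measurable_fun; exact: cs.
Qed.

Lemma measurable_enorm_psi : measurable_fun setT (fun x : X => sqn x.1 + tsq x.2).
Proof.
apply: measurable_funD.
  apply: (measurableT_comp (f := sqn)); last exact: measurable_fst.
  exact: (continuous_measurable2 ct_sqn).
apply: (measurableT_comp (f := @tsq R m)); last exact: measurable_snd.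
apply: measurable_sum => j; apply: (measurableT_comp (f := sqn)); last exact: measurable_tnth.
exact: (continuous_measurable2 ct_sqn).
Qed.

Lemma measurable_exteriorX r : measurable [set x : X | r ^+ 2 < sqn x.1 + tsq x.2].
Proof.
rewrite (_ : [set x | _] = (fun x : X => sqn x.1 + tsq x.2) @^-1` `]r ^+ 2, +oo[).
  have := measurable_enorm_psi measurableT (measurable_itv `]r ^+ 2, +oo[); rewrite setTI; exact.
by apply/seteqP; split=> x /=; rewrite in_itv/= andbT.
Qed.

Lemma measurable_exterior (r : R) : 0 < r -> measurable (exterior r : set Cn).
Proof.
move=> r0; rewrite (_ : exterior r = psi_inv @^-1` [set x : X | r ^+ 2 < sqn x.1 + tsq x.2]).
  by have := measurable_psi_inv measurableT (measurable_exteriorX r); rewrite setTI.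
by apply/seteqP; split=> z /=; have := exterior_psi (psi_inv z) r0; rewrite psi_invK => -[e1 e2]; [exact: e1|exact: e2].
Qed.

Lemma prodf_psi (s : 'I_m.+1 * bool -> R -> R) (x : X) : prodf s (psi x) =
  s (ord0, false) x.1.1 * s (ord0, true) x.1.2 *
  \prod_j (s (lift ord0 j, false) (tnth x.2 j).1 * s (lift ord0 j, true) (tnth x.2 j).2).
Proof.
transitivity (\prod_j \prod_(b : bool) s (j, b) (coord (j, b) (psi x))).
  by rewrite pair_bigA; apply: eq_bigr => -[].
rewrite big_ord_recl big_bool !psi_coord0 [X in X * _]mulrC; congr (_ * _).
by apply: eq_bigr => j _; rewrite big_bool !psi_coordS mulrC.
Qed.

Lemma dbar_prodf (j : 'I_m.+1) (s : 'I_m.+1 * bool -> R -> R) gx gy z : (forall x, der (s (j, false)) x (gx x)) ->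
  (forall x, der (s (j, true)) x (gy x)) ->
  dbar j (fun z => (prodf s z)%:C) z =
  (prodf (upd s (j, false) gx) z / 2) +i* (prodf (upd s (j, true) gy) z / 2).
Proof.
move=> dx dy; have [_ ex] := rderive_prodf z dx; have [_ ey] := rderive_prodf z dy.
rewrite /dbar -[Defs.ex j]/(dir (j, false)) -[Defs.ey j]/(dir (j, true)) ex ey -complexiE.
move: (prodf _ z) (prodf (upd s (j, true) gy) z) => a b.
have n2 : (2%:R : R[i]) != 0 by rewrite pnatr_eq0.
apply: (mulIf n2); rewrite divfK//.
have -> : 2%:R = 2%:R%:C :> R[i] by rewrite rmorph_nat.
by simpc; congr (_ +i* _); rewrite divfK// pnatr_eq0.
Qed.

Variables (r : R) (u : Cn -> R[i]) (V : Cn -> Cn) (Mb : R) (N : set X).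
Hypotheses (r0 : 0 < r) (ul : L1loc (exterior r) u) (Vm : forall j, cmeasurable (exterior r) (fun z => V z 0 j)).
Hypotheses (wk : weak_dbar_eq (exterior r) u V).
Hypotheses (mN : measurable N) (N0 : M N = 0%E).
Hypothesis VM : forall x : X, ~ N x -> exterior r (psi x) -> enorm (V (psi x)) <= Mb.

Let E : set X := psi @^-1` exterior r.
Let A := E `\` N.

Let mE : measurable E.
Proof. rewrite -[E]setTI; exact: (measurable_psi measurableT (measurable_exterior r0)). Qed.
Let mA : measurable A. Proof. by apply: measurableD. Qed.

Lemma measurable_psi_on (D : set Cn) (f : Cn -> R) : measurable D -> measurable_fun D f ->
  measurable_fun (psi @^-1` D) (fun x : X => f (psi x)).
Proof.
move=> mD mf; apply: (measurable_comp (F := D)) => //; first by move=> _ [x h <-].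
by apply: measurable_funTS; exact: measurable_psi.
Qed.

(** Extension by 0 outside the domain and on the null set [N] where the almost-everywhere bounds may
    fail: all pointwise estimates then hold everywhere. *)
Definition restr (f : Cn -> R) : X -> R := (fun x => f (psi x)) \_ (psi @^-1` exterior r `\` N).

Lemma restr_in f x : exterior r (psi x) -> ~ N x -> restr f x = f (psi x).
Proof. by move=> h1 h2; rewrite /restr patchE mem_set. Qed.

Lemma restr_out f x : ~ (exterior r (psi x) /\ ~ N x) -> restr f x = 0.
Proof. by move=> h; rewrite /restr patchE memNset. Qed.

Lemma measurable_restr (f : Cn -> R) : measurable_fun (exterior r) f -> measurable_fun setT (restr f).
Proof.
move=> mf; apply/(measurable_restrictT _ mA).
have h := measurable_psi_on (measurable_exterior r0) mf.
by apply: measurable_funS h => // x [].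
Qed.

Lemma Rintegral_restr (f : Cn -> R) : measurable_fun (exterior r) f ->
  \int[mu]_(z in exterior r) f z = \int[M]_x restr f x.
Proof.
move=> mf; rewrite /Rintegral; congr fine.
rewrite integral_psi//; [|exact: measurable_exterior|exact/measurable_EFinP].
rewrite [LHS]integral_mkcond; apply: ae_eq_integral => //.
- apply/(measurable_restrictT _ mE).
  by apply/measurable_EFinP; apply: (measurable_psi_on (measurable_exterior r0)).
- by apply/measurable_EFinP; exact: measurable_restr.
exists N; split=> // x /=; apply: contra_notP => nN _.
rewrite patchE; case: (boolP (x \in E)) => [/set_mem h|/negP h].
  by rewrite restr_in.
by rewrite restr_out// => -[h' _]; apply: h; exact: mem_set.
Qed.

Let V0 z := V z 0 ord0.
Let w1 := restr (fun z => complex.Re (u z)).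
Let w2 := restr (fun z => complex.Im (u z)).
(** The factor 2 matches the convention 2 dbar u = h of [moll_eq], and becomes the 2 of 2 C0. *)
Let h1 := restr (fun z => 2 * complex.Re (V0 z * u z)).
Let h2 := restr (fun z => 2 * complex.Im (V0 z * u z)).

Let mu1 : measurable_fun (exterior r) (fun z => complex.Re (u z)). Proof. exact: ul.1.1. Qed.
Let mu2' : measurable_fun (exterior r) (fun z => complex.Im (u z)). Proof. exact: ul.1.2. Qed.
Let mv1 : measurable_fun (exterior r) (fun z => complex.Re (V0 z)). Proof. exact: (Vm ord0).1. Qed.
Let mv2 : measurable_fun (exterior r) (fun z => complex.Im (V0 z)). Proof. exact: (Vm ord0).2. Qed.

Let ReM (a b : R[i]) : complex.Re (a * b) = complex.Re a * complex.Re b - complex.Im a * complex.Im b.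
Proof. by case: a; case: b. Qed.
Let ImM (a b : R[i]) : complex.Im (a * b) = complex.Re a * complex.Im b + complex.Im a * complex.Re b.
Proof. by case: a; case: b. Qed.

Let ReMC (a : R[i]) (x : R) : complex.Re (a * x%:C) = complex.Re a * x.
Proof. by rewrite ReM /= mulr0 subr0. Qed.
Let ImMC (a : R[i]) (x : R) : complex.Im (a * x%:C) = complex.Im a * x.
Proof. by rewrite ImM /= mulr0 add0r. Qed.

Let mg1 : measurable_fun (exterior r) (fun z => complex.Re (V0 z * u z)).
Proof.
under eq_fun do rewrite ReM.
by apply: measurable_funB; apply: measurable_funM.
Qed.
Let mg2 : measurable_fun (exterior r) (fun z => complex.Im (V0 z * u z)).
Proof.
under eq_fun do rewrite ImM.
by apply: measurable_funD; apply: measurable_funM.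
Qed.

Let mw1 : measurable_fun setT w1. Proof. exact: measurable_restr. Qed.
Let mw2 : measurable_fun setT w2. Proof. exact: measurable_restr. Qed.
Let mh1 : measurable_fun setT h1. Proof. by apply: measurable_restr; exact: measurable_funM. Qed.
Let mh2 : measurable_fun setT h2. Proof. by apply: measurable_restr; exact: measurable_funM. Qed.

Lemma restr_cases x : (exterior r (psi x) /\ ~ N x) \/ (forall f, restr f x = 0).
Proof.
by have [h|h] := pselect (exterior r (psi x) /\ ~ N x); [left|right=> f; exact: restr_out].
Qed.

Lemma cmod_le_enorm (z : Cn) j : cmod (z 0 j) <= enorm z.
Proof.
rewrite -(ler_sqr (x := cmod _)) ?nnegrE ?cmod_ge0 ?enorm_ge0// /enorm sqr_sqrtr; last first.
  by apply: sumr_ge0 => l _; exact: sqr_ge0.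
by rewrite (bigD1 j)//= lerDl; apply: sumr_ge0 => l _; exact: sqr_ge0.
Qed.

Lemma h_sq x : h1 x ^+ 2 + h2 x ^+ 2 =
  4 * restr (fun z => cmod (V0 z) ^+ 2) x * (w1 x ^+ 2 + w2 x ^+ 2).
Proof.
have [[e n]|z] := restr_cases x; last by rewrite /h1 /h2 /w1 /w2 !z expr0n !addr0 mulr0.
by rewrite /h1 /h2 /w1 /w2 !restr_in// cmod_sq ReM ImM; ring.
Qed.

Lemma h_le x : `|h1 x| + `|h2 x| <= 4 * `|Mb| * (`|w1 x| + `|w2 x|).
Proof.
have [[e n]|z] := restr_cases x; last by rewrite /h1 /h2 /w1 /w2 !z normr0 !addr0 mulr0.
have vb : cmod (V0 (psi x)) <= `|Mb|.
  by rewrite (le_trans (cmod_le_enorm _ _))// (le_trans (VM n e))// ler_norm.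
have sb (a b : R) : a ^+ 2 <= a ^+ 2 + b ^+ 2 by rewrite lerDl sqr_ge0.
have nb (a : R) : a ^+ 2 <= cmod (V0 (psi x)) ^+ 2 -> `|a| <= `|Mb|.
  move=> ha; rewrite (le_trans _ vb)// -(ler_sqr (x := `|a|)) ?nnegrE ?cmod_ge0//.
  by rewrite real_normK// num_real.
have b1 : `|complex.Re (V0 (psi x))| <= `|Mb| by apply: nb; rewrite cmod_sq.
have b2 : `|complex.Im (V0 (psi x))| <= `|Mb| by apply: nb; rewrite cmod_sq addrC.
rewrite /h1 /h2 /w1 /w2 !restr_in// ReM ImM !normrM ger0_norm//.
have t1 := ler_normB (complex.Re (V0 (psi x)) * complex.Re (u (psi x))) (complex.Im (V0 (psi x)) * complex.Im (u (psi x))).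
have t2 := ler_normD (complex.Re (V0 (psi x)) * complex.Im (u (psi x))) (complex.Im (V0 (psi x)) * complex.Re (u (psi x))).
rewrite !normrM in t1 t2.
have p (a b : R) : `|a| <= `|Mb| -> `|a| * `|b| <= `|Mb| * `|b| by move=> ab; rewrite ler_wpM2r.
have := p _ (complex.Re (u (psi x))) b1; have := p _ (complex.Im (u (psi x))) b1.
have := p _ (complex.Re (u (psi x))) b2; have := p _ (complex.Im (u (psi x))) b2.
by move: t1 t2; lra.
Qed.

(** A compact subset of the domain over a safe box, on which local integrability of u gives a finite
    integral. *)
Definition shell (D L : R) (c : 'I_m -> R * R) (d : R) : set X :=
  [set x | [/\ D <= nrm x.1, `|x.1.1| <= L /\ `|x.1.2| <= L &
    forall j, `|(tnth x.2 j).1 - (c j).1 : R| <= d /\ `|(tnth x.2 j).2 - (c j).2 : R| <= d]].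

Lemma compact_shell D L c d : compact (psi_inv @^-1` shell D L c d : set Cn).
Proof.
pose lo (i : 'I_m.+1 * bool) := if unlift ord0 i.1 is Some j then (if i.2 then (c j).2 else (c j).1) - d else - L.
pose hi (i : 'I_m.+1 * bool) := if unlift ord0 i.1 is Some j then (if i.2 then (c j).2 else (c j).1) + d else L.
pose nr (z : Cn) := nrm (coord (ord0, false) z, coord (ord0, true) z).
have cnr : continuous nr.
  move=> z; apply: (@continuous_comp _ _ _ (fun z : Cn => (coord (ord0, false) z, coord (ord0, true) z)) nrm).
    exact: (cvg_pair (@continuous_coord _ _ (ord0, false) z) (@continuous_coord _ _ (ord0, true) z)).
  exact: ct_nrm.
have K x : shell D L c d x <-> (forall i, coord i (psi x) \in `[lo i, hi i]) /\ D <= nr (psi x).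
  rewrite /nr !psi_coord0 -surjective_pairing; split=> [[h0 [a1 a2] hj]|[hb hn]].
    split=> // -[j b]; rewrite /lo /hi /=; case: unliftP => [l ->|->].
      by rewrite psi_coordS in_itv/= -ler_distl; have [] := hj l; case: b.
    by rewrite psi_coord0 in_itv/= -ler_norml; case: b.
  split=> //.
    have := hb (ord0, false); have := hb (ord0, true).
    by rewrite /lo /hi /= unlift_none !psi_coord0 !in_itv/= -!ler_norml.
  move=> j; have := hb (lift ord0 j, false); have := hb (lift ord0 j, true).
  by rewrite /lo /hi /= liftK !psi_coordS !in_itv/= -!ler_distl.
rewrite (_ : _ @^-1` _ = [set z : Cn | forall i, coord i z \in `[lo i, hi i]] `&` nr @^-1` [set s : R | D <= s]).
  apply: (subclosed_compact _ (@compact_cbox_Cn R m.+1 lo hi)) => [|z []//].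
  apply: closedI; first exact: (@closed_cbox_Cn R m.+1 lo hi).
  by apply: closed_comp; [move=> z _; exact: cnr|exact: closed_ge].
by apply/seteqP; split=> z h; have [k1 k2] := K (psi_inv z); rewrite psi_invK in k1 k2; [exact: k1|exact: k2].
Qed.

Lemma measurable_shell D L c d : measurable (shell D L c d).
Proof.
pose B j : set RR := `[(c j).1 - d, (c j).1 + d]%classic `*` `[(c j).2 - d, (c j).2 + d]%classic.
pose pr j (x : X) : RR := tnth x.2 j.
rewrite (_ : shell D L c d = fst @^-1` [set y : RR | nrm y \in `[D, +oo[] `&`
  (fst @^-1` (`[- L, L]%classic `*` `[- L, L]%classic) `&`
   \bigcap_(j in [set: 'I_m]) (pr j @^-1` B j))).
  apply: measurableI.
    have := @measurable_fst _ _ RR (m.-tuple RR) measurableT _ (@measurable_nrm_itv R `[D, +oo[).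
    by rewrite setTI.
  apply: measurableI.
    have := @measurable_fst _ _ RR (m.-tuple RR) measurableT _
      (measurableX (measurable_itv `[- L, L]) (measurable_itv `[- L, L])).
    by rewrite setTI.
  apply: fin_bigcap_measurable => [|j _]; first exact: finite_finset.
  have mt := measurableT_comp (@measurable_tnth _ RR m j) (@measurable_snd _ _ RR (m.-tuple RR)).
  have := mt measurableT _ (measurableX (measurable_itv `[(c j).1 - d, (c j).1 + d])
     (measurable_itv `[(c j).2 - d, (c j).2 + d])).
  by rewrite setTI.
apply/seteqP; split=> -[[x1 x2] t] /=.
  move=> [hD [hL1 hL2] hj]; split; first by rewrite in_itv/= hD.
  split; first by rewrite !in_itv/= -!ler_norml.
  by move=> j _; rewrite /preimage /B /pr /= !in_itv/= -!ler_distl.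
rewrite !in_itv/= -!ler_norml => -[/andP[hD _] [hL hj]]; split => // j.
by have := hj j I; rewrite /preimage /B /pr /= !in_itv/= -!ler_distl.
Qed.

Lemma cut_le1 (D L d : R) c (x : X) : `|cut D L c d x| <= 1.
Proof.
have i1 (T : Type) (B : set T) (y : T) : `|\1_B y : R| <= 1.
  by rewrite indicE; case: (_ \in _); rewrite ?normr1 ?normr0.
rewrite /cut normrM mulr_ile1// normr_prod.
suff /andP[] : 0 <= \prod_j `|\1_(sbox (c j) d) (tnth x.2 j) : R| <= 1 by [].
by elim/big_ind: _ => [|a b /andP[a0 a1] /andP[b0 b1]|j _]; rewrite ?ler01 ?lexx ?mulr_ge0 ?mulr_ile1 ?normr_ge0 ?i1.
Qed.

Lemma cut_shell D L c d (x : X) : ~ shell D L c d x -> cut D L c d x = 0.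
Proof.
move=> ns; rewrite /cut.
have [a|na] := pselect (ann D L x.1); last by rewrite indicE memNset// mul0r.
have [tb|/existsNP[j nj]] := pselect (tbox c d x.2); last first.
  by rewrite (bigD1 j)//= [X in _ * (X * _)]indicE memNset// mul0r mulr0.
case: ns; move: a; rewrite /ann /= in_itv/= => /andP[a1 a2].
split; first exact: ltW.
  have n2 (a : R) : a ^+ 2 <= sqn x.1 -> `|a| <= L.
    move=> ha; apply: le_trans a2; rewrite -(ler_sqr (x := `|a|)) ?nnegrE ?nrm_ge0//.
    by rewrite nrm_sq real_normK// num_real.
  by split; apply: n2; rewrite /sqn ?lerDl ?lerDr sqr_ge0.
by move=> j; have [t1 t2] := tb j; split; exact: ltW.
Qed.

Lemma measurable_cut (D L d : R) (c : 'I_m -> R * R) : measurable_fun setT (cut D L c d).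
Proof.
apply: measurable_funM.
  apply: (measurableT_comp (f := (\1_(ann D L) : RR -> R))); last exact: measurable_fst.
  by apply: measurable_indic; exact: measurable_ann.
have [mp _] := bm_prod (fun j => bm_indic (measurable_sbox (c j) d)).
exact: (measurableT_comp mp measurable_snd).
Qed.

Lemma shell_exterior D L c d (x : X) : 0 <= D -> safe r D c d -> shell D L c d x -> exterior r (psi x).
Proof.
move=> D0 sf [hD _ hj]; apply/(exterior_psi _ r0); apply: lt_le_trans (sf x.2 hj) _.
by rewrite lerD2r -nrm_sq ler_sqr// nnegrE nrm_ge0.
Qed.

(** The factor [cut] is at most 1 in modulus and vanishes off a compact shell contained in the
    domain. *)
Lemma loc_restr (f : Cn -> R) : measurable_fun (exterior r) f -> (forall z, `|f z| <= cmod (u z)) ->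
  loc r (restr f).
Proof.
move=> mf fu D L c d D0 sf.
have mc : measurable_fun (exterior r) (fun z => cmod (u z)).
  rewrite (_ : (fun z => _) = fun z => Num.sqrt (complex.Re (u z) ^+ 2 + complex.Im (u z) ^+ 2)).
    apply: (measurableT_comp (f := @Num.sqrt R)).
      exact: (continuous_measurable_fun (@sqrt_continuous R)).
    by apply: measurable_funD; exact: measurable_funX.
  by apply/funext => z; rewrite -cmod_sq sqrtr_sqr ger0_norm// cmod_ge0.
pose K : set Cn := psi_inv @^-1` shell D L c d.
have KE : K `<=` exterior r.
  by move=> z /(shell_exterior D0 sf); rewrite psi_invK.
have mK : measurable K.
  by have := measurable_psi_inv measurableT (measurable_shell D L c d); rewrite setTI.
have fin := ul.2 K (@compact_shell D L c d) KE.
have Kp : psi @^-1` K = shell D L c d by apply/seteqP; split=> x; rewrite /K /= psiK.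
have ms := measurable_shell D L c d.
have mcu : measurable_fun K (fun z => cmod (u z)).
  by apply: measurable_funS mc => //; exact: measurable_exterior.
have mcK : measurable_fun K (EFin \o (fun z => cmod (u z))) by exact/measurable_EFinP.
rewrite integral_psi// Kp integral_mkcond in fin.
have mwc : measurable_fun setT (EFin \o (fun x => restr f x * cut D L c d x)).
  apply/measurable_EFinP; apply: measurable_funM; last exact: measurable_cut.
  exact: measurable_restr.
apply/integrableP; split=> //; apply: le_lt_trans fin.
apply: ge0_le_integral => //.
- exact: measurableT_comp.
- apply/(measurable_restrictT _ ms); rewrite -Kp.
  have mp := measurable_psi_on mK mcu; apply/measurable_EFinP; exact: mp.
- move=> x _; rewrite patchE; case: (boolP (x \in shell D L c d)) => [/set_mem sx|/negP nsx].
    rewrite lee_fin normrM; apply: (@le_trans _ _ (`|restr f x| * 1)).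
      by rewrite ler_wpM2l// cut_le1.
    rewrite mulr1; have [[e n]|->] := restr_cases x; first by rewrite restr_in.
    by rewrite normr0 cmod_ge0.
  by rewrite /= cut_shell ?mulr0 ?normr0// => sx; apply: nsx; exact: mem_set.
Qed.

Lemma Re_le_cmod (w : R[i]) : `|complex.Re w| <= cmod w.
Proof.
rewrite -(ler_sqr (x := `|_|)) ?nnegrE ?cmod_ge0// real_normK ?num_real//.
by rewrite cmod_sq lerDl sqr_ge0.
Qed.

Lemma Im_le_cmod (w : R[i]) : `|complex.Im w| <= cmod w.
Proof.
rewrite -(ler_sqr (x := `|_|)) ?nnegrE ?cmod_ge0// real_normK ?num_real//.
by rewrite cmod_sq lerDr sqr_ge0.
Qed.

Lemma loc_w1 : loc r w1.
Proof. by apply: loc_restr => // z; exact: Re_le_cmod. Qed.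
Lemma loc_w2 : loc r w2.
Proof. by apply: loc_restr => // z; exact: Im_le_cmod. Qed.

Lemma loc_dominated (h : X -> R) : measurable_fun setT h ->
  (forall x, `|h x| <= 4 * `|Mb| * (`|w1 x| + `|w2 x|)) -> loc r h.
Proof.
move=> mh hle D L c d D0 sf.
have a1 := integrable_abse (loc_w1 L D0 sf); have a2 := integrable_abse (loc_w2 L D0 sf).
have b := integrableZl measurableT (4 * `|Mb|) (integrableD measurableT a1 a2).
apply: le_integrable b => //.
  by apply/measurable_EFinP; apply: measurable_funM => //; exact: measurable_cut.
move=> x _; rewrite /= lee_fin [leRHS]ger0_norm; last first.
  by rewrite mulr_ge0 ?mulr_ge0// addr_ge0.
by rewrite !(normrM _ (cut D L c d x)) -mulrDl mulrA ler_wpM2r.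
Qed.

Lemma loc_h1 : loc r h1.
Proof.
by apply: loc_dominated => // x; apply: le_trans (h_le x); rewrite lerDl.
Qed.
Lemma loc_h2 : loc r h2.
Proof.
by apply: loc_dominated => // x; apply: le_trans (h_le x); rewrite lerDr.
Qed.


Variable eta : nat -> R -> R.
Hypothesis etab : forall k, bump (k.+1%:R^-1) (eta k).

Lemma integrable_loc f (K : R * R -> R) (D L d : R) c q : loc r f -> 0 <= D -> safe r D c d ->
  (forall j, inner (c j) d (q j)) -> bm K -> (forall x, ~ ann D L x -> K x = 0) ->
  M.-integrable setT (EFin \o (fun x => f x * K x.1 * tker eta q x.2)).
Proof.
move=> lf D0 sf hq [mK [C KC]] hK; have fi := lf D L c d D0 sf.
have [mT [C' TC]] := bm_prod (fun j => bm_ker etab (q j)).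
rewrite (_ : (fun x => _) = fun x => f x * cut D L c d x * (K x.1 * tker eta q x.2)); last first.
  by apply/funext => x; rewrite -mulrA -[in LHS](tker_cut etab x hq hK) mulrA.
apply: (integrableM_bounded fi (C := C * C')).
  apply: measurable_funM; first exact: (measurableT_comp mK measurable_fst).
  exact: (measurableT_comp mT measurable_snd).
by move=> x; rewrite normrM ler_pM//; exact: TC.
Qed.

(** The distributional equation in the first coordinate, tested against a product of mollifiers. The
    kernels are functions of p - x, so differentiating in x produces a sign that cancels the one in
    the definition of weak solutions. *)
Lemma weak_restr D c d k p q eta' : 0 <= D -> safe r D c d ->
  (forall j, inner (c j) d (q j)) -> D + 2 / k.+1%:R < nrm p ->
  (forall x, der (eta k) x (eta' x)) ->
  \int[M]_z ((w1 z * kxy eta' (eta k) p z.1 + -1 * (w2 z * kxy (eta k) eta' p z.1)) * tker eta q z.2) =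
  \int[M]_z (h1 z * kxy (eta k) (eta k) p z.1 * tker eta q z.2) /\
  \int[M]_z ((w2 z * kxy eta' (eta k) p z.1 + 1 * (w1 z * kxy (eta k) eta' p z.1)) * tker eta q z.2) =
  \int[M]_z (h2 z * kxy (eta k) (eta k) p z.1 * tker eta q z.2).
Proof.
move=> D0 sf hq pD de; have ek := bump_kernel1 (etab k).
have ke' : kernel1 eta'.
  have [eta'' de'' ?] := kernel1_der ek.
  by have -> : eta' = eta'' by apply/funext => x; exact: der_uniq (de x) (de'' x).
have e0 (x : R) : k.+1%:R^-1 < `|x| -> eta k x = 0 by case: (etab k) => _ _ h _ _ /ltW/h.
have e0' := der_support e0 de.
(* The kernel indices for all coordinates: (k, p) on the slice, [q] on the others. *)
pose q' (j : 'I_m.+1) : nat * (R * R) := if unlift ord0 j is Some l then q l else (k, p).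
pose pt (i : 'I_m.+1 * bool) : R := if i.2 then (q' i.1).2.2 else (q' i.1).2.1.
pose s i (x : R) := eta (q' i.1).1 (-1 * x + pt i).
have ss i : smooth1 (s i).
  by move=> n; apply: dk_affine; case: (etab (q' i.1).1) => /(_ n).
pose lo i := pt i - (q' i.1).1.+1%:R^-1; pose hi i := pt i + (q' i.1).1.+1%:R^-1.
have s0 i x : x \notin `[lo i, hi i] -> s i x = 0.
  rewrite in_itv/= -ler_distl -ltNge => hx; case: (etab (q' i.1).1) => _ _ h _ _; apply: h.
  by rewrite mulN1r addrC distrC ltW.
have KE : [set z : Cn | forall i, coord i z \in `[lo i, hi i]] `<=` exterior r.
  (* The support of the test function stays over the safe box and at |zeta| >= D, hence inside the
     domain. *)
  move=> z; rewrite -(psi_invK z); move: (psi_inv z) => x hx /=.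
  have x0 b := hx (ord0, b); have xS j b := hx (lift ord0 j, b).
  have h1' : `|p.1 - x.1.1| <= k.+1%:R^-1.
    have := x0 false; rewrite psi_coord0 in_itv/= -ler_distl /pt /q' /= unlift_none /=.
    by rewrite distrC.
  have h2' : `|p.2 - x.1.2| <= k.+1%:R^-1.
    have := x0 true; rewrite psi_coord0 in_itv/= -ler_distl /pt /q' /= unlift_none /=.
    by rewrite distrC.
  apply/(exterior_psi _ r0); apply: (@lt_le_trans _ _ (D ^+ 2 + tsq x.2)).
    apply: sf => j; have [i1 i2] := hq j.
    have := xS j false; rewrite psi_coordS in_itv/= -ler_distl /pt /q' /= liftK /= => g1.
    have := xS j true; rewrite psi_coordS in_itv/= -ler_distl /pt /q' /= liftK /= => g2.
    split.
      rewrite -(subrK (q j).2.1 (tnth x.2 j).1) -addrA (le_trans (ler_normD _ _))//.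
      by move: g1 i1; move: ((q j).1.+1%:R^-1 : R) => e; lra.
    rewrite -(subrK (q j).2.2 (tnth x.2 j).2) -addrA (le_trans (ler_normD _ _))//.
    by move: g2 i2; move: ((q j).1.+1%:R^-1 : R) => e; lra.
  rewrite lerD2r -nrm_sq ler_sqr ?nnegrE ?nrm_ge0//.
  have /andP[n1 _] := nrm_box h1' h2'.
  by move: n1 pD; move: (nrm x.1) (k.+1%:R^-1 : R) => a e; lra.
have tf := test_function_prodf ss s0 KE.
pose g (c : R) x := - eta' (-1 * x + c).
have dg (a : R) x : der (fun x => eta k (-1 * x + a)) x (g a x).
  have d0 : der (fun t : R => -1 * t + a) x (-1).
    apply: der_eq; first by apply: derD; [apply: derM; [exact: der_cst|exact: der_id]|exact: der_cst].
    by rewrite mul0r add0r mulr1 addr0.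
  apply: der_eq; first by apply: (der_comp (f := eta k)); [exact: de|exact: d0].
  by rewrite mulrN1.
have dx x : der (s (ord0, false)) x (g p.1 x) by rewrite /s /pt /q' /= unlift_none.
have dy x : der (s (ord0, true)) x (g p.2 x) by rewrite /s /pt /q' /= unlift_none.
pose fx := prodf (upd s (ord0, false) (g p.1)); pose fy := prodf (upd s (ord0, true) (g p.2)).
have cs i : continuous (s i) by exact: smooth1_continuous.
have cg a : continuous (g a).
  move=> x; apply: cvgN; apply: (@continuous_comp _ _ _ (fun x : R => -1 * x + a) eta').
    by apply: cvgD; [apply: cvgM; [exact: cvg_cst|exact: cvg_id]|exact: cvg_cst].
  by apply: smooth1_continuous; case: ke'.
have mfx : measurable_fun setT fx.
  by apply: measurable_prodf => i; rewrite /upd; case: ifP => _; [exact: cg|exact: cs].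
have mfy : measurable_fun setT fy.
  by apply: measurable_prodf => i; rewrite /upd; case: ifP => _; [exact: cg|exact: cs].
have mf := measurable_prodf cs.
have tkE (x : X) : \prod_j (s (lift ord0 j, false) (tnth x.2 j).1 * s (lift ord0 j, true) (tnth x.2 j).2) = tker eta q x.2.
  by apply: eq_bigr => j _; rewrite /s /pt /q' /= liftK !mulN1r !(addrC (- _)).
have fE (x : X) : prodf s (psi x) = kxy (eta k) (eta k) p x.1 * tker eta q x.2.
  by rewrite prodf_psi tkE /s /pt /q' /= unlift_none !mulN1r !(addrC (- _)).
have updE (b : bool) (c0 : R -> R) (x : X) : prodf (upd s (ord0, b) c0) (psi x) =
    (if b then s (ord0, false) x.1.1 * c0 x.1.2 else c0 x.1.1 * s (ord0, true) x.1.2) * tker eta q x.2.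
  rewrite prodf_psi -tkE /upd; congr (_ * _).
  by rewrite !xpair_eqE eqxx /=; case: b.
have fxE x : fx (psi x) = - (kxy eta' (eta k) p x.1 * tker eta q x.2).
  rewrite /fx updE /s /g /pt /q' /= unlift_none /kxy /= !mulN1r !(addrC (- _)); ring.
have fyE x : fy (psi x) = - (kxy (eta k) eta' p x.1 * tker eta q x.2).
  rewrite /fy updE /s /g /pt /q' /= unlift_none /kxy /= !mulN1r !(addrC (- _)); ring.
have dE z : dbar ord0 (fun z => (prodf s z)%:C) z = (fx z / 2) +i* (fy z / 2) := dbar_prodf z dx dy.
have mE0 (f0 : Cn -> R) : measurable_fun setT f0 -> measurable_fun (exterior r) f0 by exact: measurable_funTS.
have := wk tf ord0; rewrite /cintegral => /eqP; rewrite eq_complex /= => /andP[/eqP e1 /eqP e2].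
pose L := nrm p + 2 * k.+1%:R^-1.
have s12 := kxy_ann e0' e0 pD (lexx L); have s21 := kxy_ann e0 e0' pD (lexx L).
have s22 := kxy_ann e0 e0 pD (lexx L).
have j11 := integrable_loc loc_w1 D0 sf hq (bm_kxy p ke' ek) s12.
have j12 := integrable_loc loc_w1 D0 sf hq (bm_kxy p ek ke') s21.
have j21 := integrable_loc loc_w2 D0 sf hq (bm_kxy p ke' ek) s12.
have j22 := integrable_loc loc_w2 D0 sf hq (bm_kxy p ek ke') s21.
have j3 := integrable_loc loc_h1 D0 sf hq (bm_kxy p ek ek) s22.
have j4 := integrable_loc loc_h2 D0 sf hq (bm_kxy p ek ek) s22.
(* Both sides carry a factor 1/2: on the left from the definition of dbar, on the right from h = 2 V
   u. *)
have fin (G1 G2 : Cn -> R) (E1 E2 : X -> R) : measurable_fun (exterior r) G1 -> measurable_fun (exterior r) G2 ->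
    (forall x, restr G1 x = - (1 / 2) * E1 x) -> (forall x, restr G2 x = 1 / 2 * E2 x) ->
    M.-integrable setT (EFin \o E1) -> M.-integrable setT (EFin \o E2) ->
    - (\int[mu]_(z in exterior r) G1 z) = (\int[mu]_(z in exterior r) G2 z) ->
    (\int[M]_x E1 x) = (\int[M]_x E2 x).
  move=> m1 m2 r1 r2 i1 i2; rewrite !Rintegral_restr// (funext r1) (funext r2) !RintegralZl//.
  by rewrite mulNr opprK; apply: mulfI; rewrite mul1r invr_eq0 pnatr_eq0.
split.
- have [i _] := RintegralM (-1) j11 j22.
  apply: (fin _ _ _ _ _ _ _ _ _ j3 e1) => [||x|x|].
  + rewrite (_ : (fun z => _) = fun z => (complex.Re (u z) * fx z - complex.Im (u z) * fy z) / 2).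
      apply: measurable_funM => //; apply: measurable_funB; apply: measurable_funM => //; exact: mE0.
    by apply/funext => z; rewrite dE ReM /=; ring.
  + rewrite (_ : (fun z => _) = fun z => complex.Re (V0 z * u z) * prodf s z).
      by apply: measurable_funM => //; exact: mE0.
    by apply/funext => z; rewrite ReMC.
  + have [[ex nx]|zx] := restr_cases x; last by rewrite /w1 /w2 !zx; ring.
    by rewrite /w1 /w2 !restr_in// dE ReM /= fxE fyE; field.
  + have [[ex nx]|zx] := restr_cases x; last by rewrite /h1 !zx; ring.
    by rewrite /h1 !restr_in// ReMC fE; field.
  + rewrite (_ : (fun x => _) = fun x => w1 x * kxy eta' (eta k) p x.1 * tker eta q x.2 +
      -1 * (w2 x * kxy (eta k) eta' p x.1 * tker eta q x.2)) //.
    by apply/funext => x; ring.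
- have [i _] := RintegralM 1 j21 j12.
  apply: (fin _ _ _ _ _ _ _ _ _ j4 e2) => [||x|x|].
  + rewrite (_ : (fun z => _) = fun z => (complex.Re (u z) * fy z + complex.Im (u z) * fx z) / 2).
      apply: measurable_funM => //; apply: measurable_funD; apply: measurable_funM => //; exact: mE0.
    by apply/funext => z; rewrite dE ImM /=; ring.
  + rewrite (_ : (fun z => _) = fun z => complex.Im (V0 z * u z) * prodf s z).
      by apply: measurable_funM => //; exact: mE0.
    by apply/funext => z; rewrite ImMC.
  + have [[ex nx]|zx] := restr_cases x; last by rewrite /w1 /w2 !zx; ring.
    by rewrite /w1 /w2 !restr_in// dE ImM /= fxE fyE; field.
  + have [[ex nx]|zx] := restr_cases x; last by rewrite /h2 !zx; ring.
    by rewrite /h2 !restr_in// ImMC fE; field.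
  + rewrite (_ : (fun x => _) = fun x => w2 x * kxy eta' (eta k) p x.1 * tker eta q x.2 +
      1 * (w1 x * kxy (eta k) eta' p x.1 * tker eta q x.2)) //.
    by apply/funext => x; ring.
Qed.

Variables (R0 rho C0 C : R) (phi : R -> R).
Local Notation Phi := (fun t : R => \int[@lebesgue_measure R]_(s in `[R0, t]) phi s).
Hypotheses (R00 : 0 <= R0) (phi0 : forall s, R0 <= s -> 0 < phi s)
  (phim : forall s t, R0 <= s -> s <= t -> phi t <= phi s)
  (lim : Phi t / ln t @[t --> +oo] --> +oo) (C00 : 0 < C0) (C0C : 2 * C0 < C).
Hypothesis hV : forall x : X, ~ N x -> rho <= enorm (psi x) ->
  enorm (V (psi x)) <= C0 * phi (enorm (psi x)).
Hypothesis hu : forall x : X, ~ N x -> rho <= enorm (psi x) ->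
  cmod (u (psi x)) <= expR (- (C * Phi (enorm (psi x)))).

Lemma restr_vanish : {ae M, forall x, w1 x = 0 /\ w2 x = 0}.
Proof.
(* The slice theorem wants a positive starting point. Restarting the primitive at R1 only lowers it,
   so the decay of u persists. *)
pose R1 := R0 + 1; have R01 : R0 <= R1 by rewrite /R1 lerDl.
have R10 : 0 < R1 by rewrite /R1 ltr_wpDl.
pose Phi1 t : R := if t <= R1 then 0 else Phi t - Phi R1.
have Phi1E t : R1 <= t -> Phi1 t = Phi t - Phi R1.
  rewrite /Phi1; case: (leP t R1) => // tR Rt.
  by have -> : t = R1 by [apply/le_anti/andP]; rewrite subrr.
have PhiR1 : 0 <= Phi R1.
  by apply: Rintegral_ge0 => s /=; rewrite in_itv/= => /andP[h _]; exact/ltW/phi0.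
have mono := primitive_mono phi0 phim.
apply: (product_vanish etab mw1 mw2 mh1 mh2 loc_w1 loc_w2 loc_h1 loc_h2 weak_restr (Mc := 4 * `|Mb|)
  (rho := Num.max rho R1) (phi := phi) (Phi := Phi1) (R1 := R1) (C1 := 2 * C0) (dl := C - 2 * C0)) => //.
- by rewrite mulr_ge0// ltW.
- by rewrite subr_gt0.
- exact: h_le.
- move=> x /(exterior_psi _ r0) nx; have [[e _]|z] := restr_cases x; last by rewrite /w1 /w2 !z.
  by case: (nx e).
- by move=> s Rs; apply/ltW/phi0; exact: le_trans Rs.
- by move=> s t Rs st; apply: phim => //; exact: le_trans Rs.
- by move=> t tR; rewrite /Phi1 tR.
- move=> s t Rs st; rewrite !Phi1E ?(le_trans Rs)// opprB addrA subrK.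
  by apply: primitive_bounds => //; exact: le_trans Rs.
(* The slope B + 1 leaves room for the constant Phi(R1), which is at most ln s once s >= exp (Phi
   R1). *)
- move=> B; have [s0 hs0] := primitive_superlog lim (B + 1).
  exists (Num.max (Num.max s0 (expR (Phi R1))) R1) => s; rewrite !ge_max => /andP[/andP[ss0 sP] sR].
  rewrite Phi1E//; have := hs0 _ ss0; have : Phi R1 <= ln s.
    by rewrite -[leLHS]expRK ler_ln// posrE ?expR_gt0// (lt_le_trans R10).
  by move=> a1 a2; rewrite lerBrDr (le_trans _ a2)// mulrDl mul1r lerD2l.
move=> x; rewrite ge_max => /andP[xr xR].
have [[e nx]|z] := restr_cases x; last first.
  by rewrite /w1 /w2 /h1 /h2 !z expr0n !addr0 mulr0; split; [|exact: expR_ge0].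
(* As |z| >= |zeta|, monotonicity of phi and Phi turns the bounds at |z| into bounds at |zeta|. *)
have ab := nrm_le_enorm x.
have xr' := le_trans xr ab; have Ra := le_trans R01 xR.
split.
  rewrite h_sq restr_in// ler_wpM2r ?addr_ge0 ?sqr_ge0//.
  have vb : cmod (V0 (psi x)) <= C0 * phi (nrm x.1).
    rewrite (le_trans (cmod_le_enorm _ _))// (le_trans (hV nx xr'))// ler_wpM2l ?(ltW C00)//.
    exact: phim.
  have : cmod (V0 (psi x)) ^+ 2 <= (C0 * phi (nrm x.1)) ^+ 2.
    by rewrite ler_sqr// nnegrE ?cmod_ge0// mulr_ge0 ?(ltW C00)// ltW// phi0.
  move=> h; rewrite -mulrA [leRHS]exprMn (_ : 2 ^+ 2 = 4 :> R); first by rewrite ler_wpM2l.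
  by rewrite -natrX.
rewrite /w1 /w2 !restr_in// -cmod_sq addrC subrK.
apply: (@le_trans _ _ (expR (- (C * Phi (enorm (psi x)))) ^+ 2)).
  by rewrite ler_sqr ?nnegrE ?cmod_ge0 ?expR_ge0// hu.
rewrite -expRM_natl ler_expR mulrN lerN2 !mulrA ler_wpM2l//.
  by rewrite mulr_ge0// ltW// (lt_trans _ C0C)// mulr_gt0.
rewrite Phi1E// (le_trans _ (mono _ _ Ra ab))// gerBl//.
Qed.

End coordinates.

Theorem theorem4p1 (R : realType) (n : nat) (r : R) (R0 : R) (phi : R -> R)
    (u : 'rV[R[i]]_n -> R[i]) (V : 'rV[R[i]]_n -> 'rV[R[i]]_n) (C0 C : R) :
  let Phi := fun t : R => \int[@lebesgue_measure R]_(s in `[R0, t]) phi s in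
  (1 <= n)%N ->
  0 < r ->
  0 <= R0 ->
  (forall s, R0 <= s -> 0 < phi s) ->
  (forall s t, R0 <= s -> s <= t -> phi t <= phi s) ->
  Phi t / ln t @[t --> +oo] --> +oo ->
  L1loc (exterior r) u ->
  Linfty (exterior r) V ->
  weak_dbar_eq (exterior r) u V ->
  0 < C0 ->
  (exists rho : R, {ae lebesgue_Cn, forall z, rho <= enorm z ->
     enorm (V z) <= C0 * phi (enorm z)}) ->
  2%:R * C0 < C ->
  (exists rho : R, {ae lebesgue_Cn, forall z, rho <= enorm z ->
     cmod (u z) <= expR (- (C * Phi (enorm z)))}) ->
  {ae lebesgue_Cn, forall z, exterior r z -> u z = 0}.
Proof.
move=> Phi n1 r0 R00 phi0 phim lim ul [Vm [Mb VMb]] wk C00 [rho1 hV] C0C [rho2 hu].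
case: n n1 u V ul Vm VMb wk hV hu => // m _ u V ul Vm VMb wk hV hu.
have psi_ae (P : 'rV[R[i]]_m.+1 -> Prop) : {ae lebesgue_Cn, forall z, P z} ->
    {ae sf_product mu2 (tuple_measure mu2 m), forall x, P (psi x)}.
  exact: (ae_of_pushforward (fun A _ => lebesgue_CnE A) measurable_psi).
(* The three almost-everywhere bounds are pulled back together, so that a single null set [N] serves
   all of them. *)
have := psi_ae _ (ae_imply2 (fun z a b => conj a b) VMb (ae_imply2 (fun z a b => conj a b) hV hu)).
move=> [N [mN N0 hN]].
have good x : ~ N x -> (exterior r (psi x) -> enorm (V (psi x)) <= Mb) /\
    (rho1 <= enorm (psi x) -> enorm (V (psi x)) <= C0 * phi (enorm (psi x))) /\
    (rho2 <= enorm (psi x) -> cmod (u (psi x)) <= expR (- (C * Phi (enorm (psi x))))).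
  by move=> nx; apply: contrapT => h; apply: nx; exact: hN.
have /choice[eta etab] : forall k, exists eta : R -> R, bump (k.+1%:R^-1) eta.
  by move=> k; apply: bump_exists; rewrite invr_gt0.
have van := restr_vanish r0 ul Vm wk mN N0 (fun x nx => (good x nx).1) etab (rho := Num.max rho1 rho2)
  R00 phi0 phim lim C00 C0C.
have {}van : {ae sf_product mu2 (tuple_measure mu2 m), forall x,
    restr r N (fun z => complex.Re (u z)) x = 0 /\ restr r N (fun z => complex.Im (u z)) x = 0}.
  by apply: van => x nx; rewrite ge_max => /andP[x1 x2]; have [_ [gV gu]] := good x nx; [exact: gV|exact: gu].
(* On [N] the restricted functions are 0 by definition and say nothing about u, so this null set is
   discarded at the end. *)
have nN : {ae sf_product mu2 (tuple_measure mu2 m), forall x, ~ N x}.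
  by exists N; split=> // x /contrapT.
apply: (ae_pushforward (fun A _ => lebesgue_CnE A) measurable_psi_inv (@psiK R m) (@psi_invK R m)).
apply: ae_imply2 _ van nN => x [w1 w2] nx ex.
rewrite restr_in// in w1; rewrite restr_in// in w2.
by move: w1 w2; case: (u (psi x)) => a b /= -> ->.
Qed.
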